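(* Let $T>0$, $x\in\mathbb{R}$, and let $b:[0,T]\times\mathbb{R}\times\mathcal{P}_1(\mathbb{R})\to\mathbb{R}$ and $\sigma:[0,T]\times\mathbb{R}\to\mathbb{R}$ be bounded continuous functions such that: (a) there exists $C>0$ such that for every $t\in[0,T]$, $y\in\mathbb{R}$ and $\mu,\nu\in\mathcal{P}_1(\mathbb{R})$, $|b(t,y,\mu)-b(t,y,\nu)|\le C\,W_1(\mu,\nu)$; (b) there exists a strictly increasing function $\rho$ on $[0,+\infty)$ with $\rho(0)=0$, $\rho^2$ convex and $\int_{0^+}\rho^{-2}(u)\,du=+\infty$, such that for every $t\in[0,T]$ and $y,z\in\mathbb{R}$, $|\sigma(t,y)-\sigma(t,z)|\le\rho(|y-z|)$; (c) there exists a strictly increasing function $\kappa$ on $[0,+\infty)$ with $\kappa(0)=0$, $\kappa$ concave and $\int_{0^+}\kappa^{-1}(u)\,du=+\infty$, such that for every $t\in[0,T]$, $y,z\in\mathbb{R}$ and $\mu\in\mathcal{P}_2(\mathbb{R})$, $|b(t,y,\mu)-b(t,z,\mu)|\le\kappa(|y-z|)$. Then the McKean-Vlasov stochastic differential equation $$dX_t=b(t,X_t,\mathbb{P}_{X_t})\,dt+\sigma(t,X_t)\,dB_t,\qquad X_0=x,\quad t\in[0,T],$$ has a unique strong solution.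
   Context: $\mathbb{P}_{X_t}$ denotes the law of the random variable $X_t$. $\mathcal{P}_p(\mathbb{R})$ is the set of probability measures on $\mathbb{R}$ with finite moment of order $p$, and $W_p(\mu,\nu)=\inf_{\pi\in\Pi(\mu,\nu)}\left[\int|x-y|^p\,d\pi(x,y)\right]^{1/p}$ is the $p$-Wasserstein distance, where $\Pi(\mu,\nu)$ is the set of couplings of $\mu$ and $\nu$; $\mathcal{P}_1(\mathbb{R})$ carries the $W_1$ topology. $B$ is a one-dimensional $(\mathcal{F}_t)$-Brownian motion on a filtered probability space satisfying the usual conditions; solutions are continuous adapted processes. The notation $\int_{0^+}f(u)\,du=+\infty$ means $\int_0^\varepsilon f(u)\,du=+\infty$ for every small $\varepsilon>0$; here $\rho^{-2}(u)=1/\rho(u)^2$ and $\kappa^{-1}(u)=1/\kappa(u)$. *)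

(* Defs.v *)
From HB Require Import structures.
From mathcomp Require Import all_boot all_order all_algebra.
From mathcomp Require Import all_classical all_reals all_analysis.

Set Implicit Arguments.
Unset Strict Implicit.
Unset Printing Implicit Defensive.

Import Order.TTheory GRing.Theory Num.Theory.
Import numFieldNormedType.Exports.

Local Open Scope classical_set_scope.
Local Open Scope ring_scope.

(* [borel_prob R] is the set P(R) of Borel probability measures on the line. *)
Notation borel_prob R := (probability R R).

Definition finite_moment (R : realType) (p : R) (mu : borel_prob R) : Prop :=
  (\int[mu]_x (`|x| `^ p)%:E < +oo)%E.

Definition coupling (R : realType) (mu nu : borel_prob R)
    (pi : probability (R * R)%type R) : Prop :=
  forall A : set R, measurable A ->
    pi (fst @^-1` A) = mu A /\ pi (snd @^-1` A) = nu A.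

Definition wasserstein (R : realType) (p : R) (mu nu : borel_prob R) : \bar R :=
  ereal_inf
    [set ((\int[pi]_z (`|z.1 - z.2| `^ p)%:E) `^ p^-1)%E
      | pi in [set pi | coupling mu nu pi]].

(* Continuity on [0, T] x R x P_1(R), where P_1(R) carries the W_1 topology.
   The value of [b] off this domain is irrelevant. *)
Definition continuous_drift (R : realType) (T : R)
    (b : R -> R -> borel_prob R -> R) : Prop :=
  forall t y mu, 0 <= t <= T -> finite_moment 1 mu ->
  forall e, 0 < e -> exists2 dlt : R, 0 < dlt &
    forall s z nu, 0 <= s <= T -> finite_moment 1 nu ->
      `|t - s| < dlt -> `|y - z| < dlt -> (wasserstein 1 mu nu < dlt%:E)%E ->
      `|b t y mu - b s z nu| < e.

(* [\int_(0+) f = +oo]: the integral over ]0, e] is infinite for all small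
   e > 0. *)
Definition diverges_at_0 (R : realType) (f : R -> R) : Prop :=
  \forall e \near (0 : R)^'+,
    (\int[lebesgue_measure]_(u in `]0%R, e]) (f u)%:E)%E = +oo%E.

Definition concave_function (R : realType) (D : set R) (f : R -> R) : Prop :=
  convex_function D (fun u => - f u).

Definition filtration (R : realType) (d : measure_display)
    (Omega : measurableType d) (T : R) (F : R -> set (set Omega)) : Prop :=
  (forall t, 0 <= t <= T ->
     sigma_algebra setT (F t) /\ F t `<=` measurable) /\
  (forall s t, 0 <= s -> s <= t -> t <= T -> F s `<=` F t).

Definition usual_conditions (R : realType) (d : measure_display)
    (Omega : measurableType d) (P : probability Omega R) (T : R)
    (F : R -> set (set Omega)) : Prop :=
  [/\ filtration T F,
      forall N, P.-negligible N -> F 0 N &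
      forall t, 0 <= t < T -> \bigcap_(s in `]t, T]) F s `<=` F t].

Definition measurable_wrt (R : realType) (Omega : Type)
    (G : set (set Omega)) (f : Omega -> R) : Prop :=
  forall U : set R, measurable U -> G (f @^-1` U).

Definition adapted (R : realType) (Omega : Type) (T : R)
    (F : R -> set (set Omega)) (X : R -> Omega -> R) : Prop :=
  forall t, 0 <= t <= T -> measurable_wrt (F t) (X t).

Definition continuous_paths (R : realType) (Omega : Type) (T : R)
    (X : R -> Omega -> R) : Prop :=
  forall w, {within `[0, T], continuous (X ^~ w)}.

Definition brownian_motion (R : realType) (d : measure_display)
    (Omega : measurableType d) (P : probability Omega R) (T : R)
    (F : R -> set (set Omega)) (B : R -> {RV P >-> R}) : Prop :=
  [/\ adapted T F B,
      continuous_paths T B,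
      {ae P, forall w, B 0 w = 0} &
      forall s t, 0 <= s -> s < t -> t <= T ->
        let incr := fun w => B t w - B s w in
        (forall U : set R, measurable U ->
           P (incr @^-1` U) = normal_prob 0 (Num.sqrt (t - s)) U) /\
        (forall A (U : set R), F s A -> measurable U ->
           P (A `&` incr @^-1` U) = (P A * P (incr @^-1` U))%E)].

Definition completed_natural_filtration (R : realType) (d : measure_display)
    (Omega : measurableType d) (P : probability Omega R)
    (B : R -> {RV P >-> R}) (t : R) : set (set Omega) :=
  <<s [set A | (exists s (U : set R),
                  [/\ 0 <= s <= t, measurable U & A = B s @^-1` U]) \/
               P.-negligible A] >>.

(* The process \sum_(i < n) xi_i 1_]t_i, t_(i+1)]. *)
Record simple_process (R : realType) (Omega : Type) := SimpleProcess {
  sp_size : nat;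
  sp_time : nat -> R;
  sp_coef : nat -> Omega -> R }.

Definition is_simple_process (R : realType) (Omega : Type) (T : R)
    (F : R -> set (set Omega)) (S : simple_process R Omega) : Prop :=
  [/\ 0 <= sp_time S 0, sp_time S (sp_size S) <= T &
      forall i, (i < sp_size S)%N ->
        [/\ sp_time S i <= sp_time S i.+1,
            measurable_wrt (F (sp_time S i)) (sp_coef S i) &
            exists M, forall w, `|sp_coef S i w| <= M]].

Definition sp_val (R : realType) (Omega : Type) (S : simple_process R Omega)
    (s : R) (w : Omega) : R :=
  \sum_(i < sp_size S)
    sp_coef S i w * \1_(`]sp_time S i, sp_time S i.+1]) s.

Definition sp_int (R : realType) (Omega : Type) (B : R -> Omega -> R)
    (S : simple_process R Omega) (t : R) (w : Omega) : R :=
  \sum_(i < sp_size S) sp_coef S i w *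
    (B (Num.min (sp_time S i.+1) t) w - B (Num.min (sp_time S i) t) w).

Definition L2_integrand (R : realType) (d : measure_display)
    (Omega : measurableType d) (P : probability Omega R) (T : R)
    (F : R -> set (set Omega)) (H : R -> Omega -> R) : Prop :=
  [/\ measurable_fun (`[0, T] `*` setT)
        (fun z : R * Omega => H z.1 z.2),
      adapted T F H &
      (\int[P]_w \int[lebesgue_measure]_(s in `[0%R, T])
         (H s w ^+ 2)%:E < +oo)%E].

(* [J] is a continuous version of the Ito integral of [H] against [B] on
   [0, T], i.e. of the extension of [sp_int] by L^2-isometry. *)
Definition is_ito_integral (R : realType) (d : measure_display)
    (Omega : measurableType d) (P : probability Omega R) (T : R)
    (F : R -> set (set Omega)) (B : R -> {RV P >-> R})
    (H : R -> Omega -> R) (J : R -> {RV P >-> R}) : Prop :=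
  [/\ L2_integrand P T F H,
      continuous_paths T J &
      exists S : nat -> simple_process R Omega,
        [/\ forall k, is_simple_process T F (S k),
            (\int[P]_w \int[lebesgue_measure]_(s in `[0%R, T])
               ((H s w - sp_val (S k) s w) ^+ 2)%:E)%E @[k --> \oo] --> 0%E &
            forall t, 0 <= t <= T ->
              (\int[P]_w ((J t w - sp_int B (S k) t w) ^+ 2)%:E)%E
                @[k --> \oo] --> 0%E]].

(* The third clause places every law in the domain P_1(R) of the drift. *)
Definition mckean_vlasov_solution (R : realType) (d : measure_display)
    (Omega : measurableType d) (P : probability Omega R) (T : R)
    (F : R -> set (set Omega)) (B : R -> {RV P >-> R})
    (x : R) (b : R -> R -> borel_prob R -> R) (sigma : R -> R -> R)
    (X : R -> {RV P >-> R}) : Prop :=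
  [/\ adapted T F X,
      continuous_paths T X,
      forall t, 0 <= t <= T -> finite_moment 1 (distribution P (X t)) &
      exists J : R -> {RV P >-> R},
        is_ito_integral T F B (fun t w => sigma t (X t w)) J /\
        {ae P, forall w, forall t, 0 <= t <= T ->
          X t w = x
            + \int[lebesgue_measure]_(s in `[0, t])
                b s (X s w) (distribution P (X s))
            + J t w}].

(* Existence is of a solution adapted to the completed filtration of [B];
   uniqueness holds, up to indistinguishability, among all F-adapted
   solutions. *)
Definition unique_strong_solution (R : realType) (d : measure_display)
    (Omega : measurableType d) (P : probability Omega R) (T : R)
    (F : R -> set (set Omega)) (B : R -> {RV P >-> R})
    (x : R) (b : R -> R -> borel_prob R -> R) (sigma : R -> R -> R) : Prop :=
  exists X : R -> {RV P >-> R},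
    [/\ mckean_vlasov_solution T F B x b sigma X,
        adapted T (completed_natural_filtration B) X &
        forall Y : R -> {RV P >-> R},
          mckean_vlasov_solution T F B x b sigma Y ->
          {ae P, forall w, forall t, 0 <= t <= T -> X t w = Y t w}].

(* Main.v *)
Require Import Defs.
From HB Require Import structures.
From mathcomp Require Import all_boot all_order all_algebra.
From mathcomp Require Import all_classical all_reals all_analysis.
From mathcomp Require Import measurable_realfun ring lra.

Set Implicit Arguments.
Unset Strict Implicit.
Unset Printing Implicit Defensive.

Import Order.TTheory GRing.Theory Num.Theory.
Import numFieldNormedType.Exports.

Local Open Scope classical_set_scope.
Local Open Scope ring_scope.

(* Existence and uniqueness both come from one stability estimate for
   approximate solutions on fine partitions of [0, T]. A convex rho^2 vanishing
   at 0 grows at most linearly near 0, so with boundedness (b) makes sigma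
   1/2-Hoelder in space, uniformly in time. Following Yamada and Watanabe, the
   distance Z of two approximate solutions is tested against smoothed absolute
   values, averaged over the dyadic scales a, a/2, a/4, ...: the second-order
   terms of sum_j sqrt(Z^2 + a_j^2) sum up to a bounded quantity, so that after
   averaging E|Z| grows at most by E[kappa(|Z|) + C E|Z|] dt up to small errors.
   Concavity of kappa and Osgood's criterion then keep E|Z| small; the bound is
   discrete, and Kolmogorov's maximal inequality makes it uniform in time.
   The dyadic Euler schemes are approximate solutions adapted to the completed
   filtration of B, hence converge along a subsequence, almost surely uniformly,
   to a strong solution. Any solution is itself an approximate solution, its Ito
   integral being approximated by integrals of simple processes, so two solutions
   coincide. *)

(** * The smoothed absolute value *)

(** Ito's formula is replaced by Taylor expansions of [sabs] between consecutive points of a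
    partition, so that only moments, independence and orthogonality of Brownian increments enter.
    Two obstacles shape the notion of approximate solution. The law enters the drift through E|Z|,
    so the estimate has to be closed on the unconditional mean. And the Ito integral of a solution
    is only an L^2 limit of simple integrals, so its increments over a cell are read on a simple
    process. What remains after freezing the coefficients is split in two: martingale differences,
    of L^2 norm at most [eps] times the square root of the step, and an L^1 remainder, at most [eps]
    times the step. Both rates are those that sum up over the partition to a multiple of [eps]. The
    diffusion coefficient is frozen in time, space and law; the drift only in space and law, because
    no uniform modulus in time is available for it. The numbers 8, 36 and 64 that recur come from
    crude bounds on Gaussian moments. *)

Section SmoothAbs.
Variable R : realType.
Implicit Types a z h m : R.

Definition sabs a z : R := Num.sqrt (z ^+ 2 + a ^+ 2).

Lemma sabs_sqr a z : sabs a z ^+ 2 = z ^+ 2 + a ^+ 2.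
Proof. by rewrite sqr_sqrtr// addr_ge0// sqr_ge0. Qed.

Lemma sabs_ge0 a z : 0 <= sabs a z.
Proof. exact: sqrtr_ge0. Qed.

Lemma sabs_ge a z : 0 <= a -> a <= sabs a z.
Proof.
move=> a0; rewrite -(@ler_pXn2r _ 2)// ?nnegrE ?sabs_ge0//.
by rewrite sabs_sqr lerDr sqr_ge0.
Qed.

Lemma sabs_gt0 a z : 0 < a -> 0 < sabs a z.
Proof. by move=> a0; apply: lt_le_trans (sabs_ge _ (ltW a0)). Qed.

Lemma normr_le_sabs a z : `|z| <= sabs a z.
Proof.
rewrite -(@ler_pXn2r _ 2)// ?nnegrE ?sabs_ge0//.
by rewrite sabs_sqr real_normK ?num_real// lerDl sqr_ge0.
Qed.

Lemma sabs_le a z : 0 <= a -> sabs a z <= `|z| + a.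
Proof.
move=> a0; rewrite -(@ler_pXn2r _ 2)// ?nnegrE ?sabs_ge0 ?addr_ge0//.
rewrite sabs_sqr sqrrD real_normK ?num_real// lerD2r lerDl.
by rewrite mulrn_wge0// mulr_ge0.
Qed.

Lemma sabs_lipschitz a z h : 0 < a -> `|sabs a (z + h) - sabs a z| <= `|h|.
Proof.
move=> a0.
have s1 := sabs_gt0 z a0; have s2 := sabs_gt0 (z + h) a0.
have n1 := normr_le_sabs a z; have n2 := normr_le_sabs a (z + h).
have e1 := sabs_sqr a z; have e2 := sabs_sqr a (z + h).
set s := sabs a z in s1 n1 e1 *; set t := sabs a (z + h) in s2 n2 e2 *.
have E : (t - s) * (t + s) = h * (z + h + z).
  have -> : (t - s) * (t + s) = t ^+ 2 - s ^+ 2 by ring.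
  by rewrite e1 e2; ring.
rewrite -(@ler_pM2r _ (t + s)) ?addr_gt0//.
have ts0 : 0 < t + s by rewrite addr_gt0.
rewrite -{1}(gtr0_norm ts0) -normrM E normrM.
rewrite ler_wpM2l// (le_trans (ler_normD _ _))// lerD//.
Qed.

(** First derivative of [sabs a]. *)
Definition dsabs a z : R := z / sabs a z.

(** Second derivative of [sabs a]: a bump of height [1 / a] at 0, decaying at distances larger than
    [a]. This localisation is what makes the sum over dyadic scales bounded. *)
Definition ddsabs a z : R := a ^+ 2 / sabs a z ^+ 3.

Lemma dsabs_le1 a z : 0 < a -> `|dsabs a z| <= 1.
Proof.
move=> a0; have s0 := sabs_gt0 z a0.
rewrite normrM normfV (gtr0_norm s0) ler_pdivrMr// mul1r.
exact: normr_le_sabs.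
Qed.

Lemma ddsabs_ge0 a z : 0 <= ddsabs a z.
Proof. by rewrite divr_ge0// ?sqr_ge0// exprn_ge0// sabs_ge0. Qed.

Lemma ddsabs_le a z : 0 < a -> ddsabs a z <= a^-1.
Proof.
move=> a0; have s0 := sabs_gt0 z a0; have sa := sabs_ge z (ltW a0).
rewrite ler_pdivrMr ?exprn_gt0// ler_pdivlMl//.
have -> : a * a ^+ 2 = a ^+ 3 by ring.
by rewrite ler_pXn2r// nnegrE ltW.
Qed.

Lemma dsabs_lipschitz a z h : 0 < a ->
  `|dsabs a (z + h) - dsabs a z| <= 2 * `|h| / a.
Proof.
move=> a0.
have s1 := sabs_gt0 z a0; have s2 := sabs_gt0 (z + h) a0.
have n1 := normr_le_sabs a z.
have a2 := sabs_ge (z + h) (ltW a0).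
have L := sabs_lipschitz z h a0.
rewrite /dsabs; set s := sabs a z in s1 n1 L *.
set t := sabs a (z + h) in s2 a2 L *.
have -> : (z + h) / t - z / s = (h - (z / s) * (t - s)) / t.
  by field; rewrite ?gt_eqF.
rewrite normrM normfV (gtr0_norm s2).
apply: ler_pM; rewrite ?normr_ge0 ?invr_ge0 ?(ltW s2)//; last first.
  by rewrite lef_pV2 ?posrE.
apply: (le_trans (ler_normB _ _)).
rewrite normrM; have : `|z / s| <= 1.
  by rewrite normrM normfV (gtr0_norm s1) ler_pdivrMr// mul1r.
move: L; set u := `|t - s|; set v := `|h|; set w := `|z / s| => L W.
have := @ler_pM _ w 1 u v (normr_ge0 _) (normr_ge0 _) W L.
lra.
Qed.

(* The increment beyond first order is [(h^2 s - z h (t - s)) / (s (t + s))]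
   with [s = sabs a z] and [t = sabs a (z + h)]; substituting this identity into
   itself once isolates the second-order term. *)
Lemma sabs_taylor2 a z h : 0 < a ->
  sabs a (z + h) <=
  sabs a z + dsabs a z * h + ddsabs a z * h ^+ 2 / 2 + 3 * `|h| ^+ 3 / a ^+ 2.
Proof.
move=> a0.
have s1 := sabs_gt0 z a0; have s2 := sabs_gt0 (z + h) a0.
have n1 := normr_le_sabs a z.
have a1 := sabs_ge z (ltW a0).
have L := sabs_lipschitz z h a0.
have e1 := sabs_sqr a z; have e2 := sabs_sqr a (z + h).
rewrite /dsabs /ddsabs; set s := sabs a z in s1 n1 a1 L e1 *.
set t := sabs a (z + h) in s2 L e2 *.
have ts : 0 < t + s by rewrite addr_gt0.
set v := `|h|; have v0 : 0 <= v by exact: normr_ge0.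
have h2 : h ^+ 2 = v ^+ 2 by rewrite real_normK ?num_real.
have [e eE] : exists e, e = (h ^+ 2 * s - z * h * (t - s)) / (s * (t + s)).
  by eexists.
have E : t = s + z / s * h + e.
  have D : (t - s) * (t + s) = 2 * z * h + h ^+ 2.
    have -> : (t - s) * (t + s) = t ^+ 2 - s ^+ 2 by ring.
    by rewrite e1 e2; ring.
  have D' : h ^+ 2 = (t - s) * (t + s) - 2 * z * h by rewrite D; ring.
  by rewrite eE D'; field; rewrite ?gt_eqF.
have Be : `|e| <= 2 * v ^+ 2 / s.
  rewrite eE normrM normfV (gtr0_norm (mulr_gt0 s1 ts)).
  rewrite ler_pdivrMr ?mulr_gt0//.
  apply: (le_trans (ler_normB _ _)).
  rewrite h2 (ger0_norm (mulr_ge0 (sqr_ge0 v) (ltW s1))) !normrM -/v.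
  have -> : 2 * v ^+ 2 / s * (s * (t + s)) = 2 * v ^+ 2 * (t + s).
    by field; rewrite gt_eqF.
  have A : `|z| * v * `|t - s| <= s * v * v.
    by apply: ler_pM => //; rewrite ?mulr_ge0// ler_wpM2r.
  have B : 0 <= v ^+ 2 * t by rewrite mulr_ge0 ?sqr_ge0// ltW.
  rewrite -/v in A.
  have -> : 2 * v ^+ 2 * (t + s) = v ^+ 2 * s + s * v * v + 2 * (v ^+ 2 * t).
    by ring.
  lra.
have E2 : e = (h ^+ 2 * a ^+ 2 / s - z * h * e) / (s * (t + s)).
  rewrite {1}eE; congr (_ / _).
  have -> : t - s = z / s * h + e by rewrite {1}E; ring.
  have -> : a ^+ 2 = s ^+ 2 - z ^+ 2 by rewrite e1; ring.
  by field; rewrite gt_eqF.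
(* Replacing [t + s] by [2 * s] in the denominator produces the quadratic term; the exchange costs a
   factor [s - t], at most [|h|], hence only a cubic error. *)
have T1 : h ^+ 2 * a ^+ 2 / s / (s * (t + s)) <=
    a ^+ 2 / s ^+ 3 * h ^+ 2 / 2 + v ^+ 3 / (2 * a ^+ 2).
  have -> : h ^+ 2 * a ^+ 2 / s / (s * (t + s)) = a ^+ 2 / s ^+ 3 * h ^+ 2 / 2
      + h ^+ 2 * a ^+ 2 * (s - t) / (2 * s ^+ 3 * (t + s)).
    by field; rewrite ?gt_eqF.
  rewrite lerD2l h2.
  have Lst : s - t <= v by apply: le_trans L; rewrite distrC ler_norm.
  apply: (@le_trans _ _ (v ^+ 2 * a ^+ 2 * v / (2 * s ^+ 3 * (t + s)))).
    rewrite ler_pM2r ?invr_gt0 ?mulr_gt0 ?exprn_gt0//.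
    by rewrite ler_wpM2l// mulr_ge0// sqr_ge0.
  have -> : v ^+ 2 * a ^+ 2 * v / (2 * s ^+ 3 * (t + s)) =
     v ^+ 3 / 2 * (a ^+ 2 / (s ^+ 3 * (t + s))) by field; rewrite ?gt_eqF.
  have -> : v ^+ 3 / (2 * a ^+ 2) = v ^+ 3 / 2 * (a ^+ 2)^-1.
    by field; rewrite ?gt_eqF.
  rewrite ler_wpM2l ?mulr_ge0 ?exprn_ge0//.
  rewrite ler_pdivrMr ?mulr_gt0 ?exprn_gt0// ler_pdivlMl ?exprn_gt0//.
  have -> : a ^+ 2 * a ^+ 2 = a ^+ 3 * a by ring.
  apply: ler_pM; rewrite ?exprn_ge0 ?(ltW a0)//.
    by rewrite ler_pXn2r// nnegrE ltW.
  by rewrite (le_trans a1)// lerDr ltW.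
have T2 : - (z * h * e) / (s * (t + s)) <= 2 * v ^+ 3 / a ^+ 2.
  apply: (le_trans (ler_norm _)).
  rewrite normrM normrN normfV (gtr0_norm (mulr_gt0 s1 ts)).
  rewrite ler_pdivrMr ?mulr_gt0// !normrM -/v.
  apply: (@le_trans _ _ (s * v * (2 * v ^+ 2 / s))).
    by apply: ler_pM => //; rewrite ?mulr_ge0// ler_wpM2r.
  have -> : s * v * (2 * v ^+ 2 / s) = 2 * v ^+ 3 by field; rewrite gt_eqF.
  rewrite mulrAC ler_pdivlMr ?exprn_gt0// ler_wpM2l ?mulr_ge0 ?exprn_ge0//.
  rewrite expr2; apply: ler_pM; rewrite ?(ltW a0)//.
  by rewrite (le_trans a1)// lerDr ltW.
have T3 : 0 <= v ^+ 3 / a ^+ 2 by rewrite divr_ge0// ?exprn_ge0// ltW.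
rewrite {1}E {1}E2 mulrBl -mulNr.
have Q : v ^+ 3 / (2 * a ^+ 2) = v ^+ 3 / a ^+ 2 / 2.
  by field; rewrite gt_eqF.
have Q2 : 3 * v ^+ 3 / a ^+ 2 = 3 * (v ^+ 3 / a ^+ 2) by rewrite mulrA.
have Q3 : 2 * v ^+ 3 / a ^+ 2 = 2 * (v ^+ 3 / a ^+ 2) by rewrite mulrA.
rewrite Q in T1; rewrite Q3 in T2; rewrite Q2; lra.
Qed.

(** With [s = sabs a z] in place of [a] in the last denominator, the gap between the two sides is
    exactly [(t - s)^2 / (2 s)], where [t = sabs a (z + m)]. *)
Lemma sabs_taylor1 a z m : 0 < a ->
  sabs a (z + m) <= sabs a z + dsabs a z * m + m ^+ 2 / (2 * a).
Proof.
move=> a0.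
have s1 := sabs_gt0 z a0; have s2 := sabs_gt0 (z + m) a0.
have a1 := sabs_ge z (ltW a0).
have e1 := sabs_sqr a z; have e2 := sabs_sqr a (z + m).
rewrite /dsabs; set s := sabs a z in s1 a1 e1 *.
set t := sabs a (z + m) in s2 e2 *.
apply: (@le_trans _ _ (s + z / s * m + m ^+ 2 / (2 * s))).
  rewrite -subr_ge0.
  have -> : s + z / s * m + m ^+ 2 / (2 * s) - t = (t - s) ^+ 2 / (2 * s).
    have -> : m ^+ 2 = t ^+ 2 - s ^+ 2 - 2 * z * m by rewrite e1 e2; ring.
    by field; rewrite gt_eqF.
  by rewrite mulr_ge0 ?sqr_ge0// invr_ge0 mulr_ge0// ltW.
rewrite lerD2l ler_wpM2l ?sqr_ge0// lef_pV2 ?posrE ?mulr_gt0//.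
by rewrite ler_wpM2l.
Qed.

(** Each part of the increment gets the expansion it can afford: Lipschitz for the drift [r], second
    order for the Brownian term [h], first order for the martingale remainder [m]. Moving the
    derivative from [z + h] back to [z] leaves a cross term in [h] and [m], treated by Young's
    inequality with weight [l]. *)
Lemma sabs_step a l z h m r : 0 < a -> 0 < l ->
  sabs a (z + r + h + m) <= sabs a z + `|r| + dsabs a z * h
    + ddsabs a z * h ^+ 2 / 2 + 3 * `|h| ^+ 3 / a ^+ 2
    + dsabs a z * m + (l * h ^+ 2 + m ^+ 2 / l) / a + m ^+ 2 / (2 * a).
Proof.
move=> a0 l0.
have -> : z + r + h + m = (z + h + m) + r by ring.
have A := sabs_lipschitz (z + h + m) r a0.
have B := sabs_taylor1 (z + h) m a0.
have C := sabs_taylor2 z h a0.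
have D := dsabs_lipschitz z h a0.
have {}A := le_trans (ler_norm _) A.
have E : (dsabs a (z + h) - dsabs a z) * m <= (l * h ^+ 2 + m ^+ 2 / l) / a.
  apply: (le_trans (ler_norm _)); rewrite normrM.
  apply: (@le_trans _ _ (2 * `|h| / a * `|m|)); first by rewrite ler_wpM2r.
  rewrite mulrAC ler_pM2r ?invr_gt0//.
  rewrite -(@real_normK _ h) ?num_real// -(@real_normK _ m) ?num_real//.
  rewrite -subr_ge0.
  have -> : l * `|h| ^+ 2 + `|m| ^+ 2 / l - 2 * `|h| * `|m| =
    (l * `|h| - `|m|) ^+ 2 / l by field; rewrite gt_eqF.
  by rewrite mulr_ge0 ?sqr_ge0// invr_ge0 ltW.
lra.
Qed.

(* With [u = |z| / a], each term is at most [4 (g u - g (u / 2))] for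
   [g u = u / (1 + u)], so the sum telescopes. *)
Lemma sum_ddsabs_le a z k : 0 < a ->
  \sum_(j < k) `|z| * ddsabs (a / 2 ^+ j) z <= 4.
Proof.
move=> a0.
pose g j : R := `|z| / (2 * a / 2 ^+ j + `|z|).
suff H : \sum_(j < k) `|z| * ddsabs (a / 2 ^+ j) z <= 4 * (g k - g 0%N).
  apply: (le_trans H).
  have g1 j : 0 <= g j <= 1.
    have d0 : 0 < 2 * a / 2 ^+ j + `|z|.
      by rewrite ltr_wpDr// !mulr_gt0// invr_gt0 exprn_gt0.
    rewrite /g divr_ge0//= ?(ltW d0)// ler_pdivrMr// mul1r lerDr ltW//.
    by rewrite !mulr_gt0// invr_gt0 exprn_gt0.
  by have /andP[_] := g1 k; have /andP[] := g1 0%N; lra.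
rewrite -(telescope_sumr _ (leq0n k)) mulr_sumr big_mkord.
apply: ler_sum => i _; rewrite /g exprS.
set b := a / 2 ^+ i.
have b0 : 0 < b by rewrite divr_gt0// exprn_gt0.
have -> : 2 * a / (2 * 2 ^+ i) = b.
  by rewrite /b; field; rewrite gt_eqF// exprn_gt0.
have -> : 2 * a / 2 ^+ i = 2 * b by rewrite mulrA.
have s1 := sabs_gt0 z b0; have e1 := sabs_sqr b z.
have sb := sabs_ge z (ltW b0).
rewrite /ddsabs; set s := sabs b z in s1 e1 sb *.
have z2 : z ^+ 2 = `|z| ^+ 2 by rewrite real_normK ?num_real.
have u0 : 0 <= `|z| by [].
move: u0 z2; set u := `|z| => u0 z2; rewrite z2 in e1.
have -> : 4 * (u / (b + u) - u / (2 * b + u)) =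
  u * (4 * b / ((b + u) * (2 * b + u))).
  by field; rewrite !gt_eqF//= ltr_pwDl// mulr_gt0.
rewrite ler_wpM2l//.
apply: (@le_trans _ _ (b / s ^+ 2)).
  rewrite ler_pdivrMr ?exprn_gt0//.
  have -> : b / s ^+ 2 * s ^+ 3 = b * s by field; rewrite gt_eqF.
  by rewrite expr2 ler_pM2l.
have bu : 0 < b + u by rewrite ltr_pwDl.
have bu2 : 0 < 2 * b + u by rewrite ltr_pwDl// mulr_gt0.
rewrite ler_pdivlMr ?mulr_gt0// mulrAC ler_pdivrMr ?exprn_gt0// e1.
have -> : 4 * b * (u ^+ 2 + b ^+ 2) = b * (4 * (u ^+ 2 + b ^+ 2)) by ring.
rewrite ler_pM2l//.
have := sqr_ge0 (b - u); have := sqr_ge0 u; have := sqr_ge0 b.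
nra.
Qed.

End SmoothAbs.

(** * Osgood's criterion *)

Lemma convex_functionE (R : realType) (f : R -> R) :
  convex_function (`[0, +oo[%classic : set R) f ->
  forall t u v, 0 <= t <= 1 -> 0 <= u -> 0 <= v ->
    f (t * u + (1 - t) * v) <= t * f u + (1 - t) * f v.
Proof.
move=> cf t u v /andP[t0 t1] u0 v0.
have := cf (Itv01 t0 t1) u v; rewrite !inE/= !in_itv/= !andbT.
by move=> /(_ u0 v0).
Qed.

Lemma convex_scale_le (R : realType) (f : R -> R) :
  convex_function (`[0, +oo[%classic : set R) f -> f 0 = 0 ->
  forall t u, 0 <= t <= 1 -> 0 <= u -> f (t * u) <= t * f u.
Proof.
move=> cf f0 t u t01 u0.
by have := convex_functionE cf t01 u0 (lexx 0); rewrite f0 !mulr0 !addr0.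
Qed.

Lemma ler_sum_prefix (R : realType) (D : nat -> R) (i N : nat) :
  (forall j, (j < N)%N -> 0 <= D j) -> (i <= N)%N ->
  \sum_(j < i) D j <= \sum_(j < N) D j.
Proof.
elim: N => [|N IH] D0; first by rewrite leqn0 => /eqP->.
rewrite leq_eqVlt => /orP[/eqP->//|]; rewrite ltnS => iN.
rewrite [leRHS]big_ord_recr/= (le_trans (IH _ iN))//; last first.
  by rewrite lerDl D0.
by move=> j jN; apply: D0; exact: leqW.
Qed.

Section Osgood.
Variables (R : realType) (kappa : R -> R).
Hypothesis kappa_incr : {in `[0, +oo[ &, {homo kappa : u v / u < v}}.
Hypothesis kappa0 : kappa 0 = 0.
Hypothesis kappa_concave : concave_function `[0, +oo[ kappa.
Hypothesis kappa_div : diverges_at_0 (fun u => (kappa u)^-1).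
Implicit Types u v c eta : R.

Lemma kappa_gt0 u : 0 < u -> 0 < kappa u.
Proof.
by move=> u0; rewrite -kappa0 kappa_incr// in_itv/= ?lexx ?(ltW u0).
Qed.

Lemma kappa_le u v : 0 <= u -> u <= v -> kappa u <= kappa v.
Proof.
move=> u0; rewrite le_eqVlt => /orP[/eqP->//|uv].
by rewrite ltW// kappa_incr// in_itv/= andbT// (le_trans u0)// ltW.
Qed.

Lemma kappa_ge0 u : 0 <= u -> 0 <= kappa u.
Proof. by move=> u0; rewrite -{1}kappa0 kappa_le. Qed.

Lemma kappa_scale t u : 0 <= t <= 1 -> 0 <= u -> t * kappa u <= kappa (t * u).
Proof.
move=> t01 u0; have := convex_scale_le kappa_concave _ t01 u0.
by rewrite kappa0 oppr0 mulrN lerN2; apply.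
Qed.

(* Serves as Jensen's inequality up to a factor 2, with [c] the mean of [u]. *)
Lemma kappa_affine u c : 0 <= u -> 0 < c -> kappa u <= kappa c * (1 + u / c).
Proof.
move=> u0 c0; have kc := kappa_gt0 c0.
have [uc|cu] := leP u c.
  apply: (le_trans (kappa_le u0 uc)).
  by rewrite -{1}(mulr1 (kappa c)) ler_pM2l// lerDl divr_ge0// ltW.
have u1 : 0 < u by exact: lt_trans cu.
have t01 : 0 <= c / u <= 1.
  by rewrite divr_ge0 ?(ltW c0) ?(ltW u1)// ler_pdivrMr// mul1r ltW.
have := kappa_scale t01 u0.
rewrite divfK ?gt_eqF// mulrAC ler_pdivrMr// => H.
have -> : kappa c * (1 + u / c) = kappa c + (kappa c * u) / c by ring.
rewrite -[leLHS]add0r lerD ?(ltW kc)//.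
by rewrite ler_pdivlMr// mulrC.
Qed.

Let mu := @lebesgue_measure R.

Lemma measurable_kappaV u v : 0 < u ->
  measurable_fun `]u, v] (fun s => (kappa s)^-1).
Proof.
move=> u0.
(* [kappa] is monotone on nonnegative reals only; raising the argument to at least [u] gives a
   function that is nonincreasing on the whole line and agrees with the original on the interval. *)
have H : measurable_fun (`]u, v] : set R) (fun s => (kappa (Num.max s u))^-1).
  apply: nonincreasing_measurable => // s t st.
  have m0 r : 0 < Num.max r u by rewrite lt_max u0 orbT.
  rewrite lef_pV2 ?posrE ?kappa_gt0// kappa_le//; first exact: ltW.
  by rewrite ge_max !le_max st/= lexx orbT.
apply: eq_measurable_fun H => s; rewrite inE/= in_itv/= => /andP[us _].
by rewrite max_l// ltW.
Qed.

Lemma integrable_kappaV u v : 0 < u ->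
  mu.-integrable `]u, v] (EFin \o (fun s => (kappa s)^-1)).
Proof.
move=> u0; apply: measurable_bounded_integrable => //.
- by rewrite /= lebesgue_measure_itv/=; case: ifP => _; rewrite ?ltry.
- exact: measurable_kappaV.
exists (kappa u)^-1; split; first exact: num_real.
move=> M uM s /=; rewrite in_itv/= => /andP[us _].
have s0 : 0 < s := lt_trans u0 us.
rewrite (le_trans _ (ltW uM))// ger0_norm ?invr_ge0 ?kappa_ge0 ?(ltW s0)//.
by rewrite lef_pV2 ?posrE ?kappa_gt0// kappa_le// ltW.
Qed.

Lemma kappaV_integral_le u v : 0 < u -> u <= v ->
  \int[mu]_(s in `]u, v]) (kappa s)^-1 <= (v - u) / kappa u.
Proof.
move=> u0 uv.
apply: (@le_trans _ _ (\int[mu]_(s in `]u, v]) (kappa u)^-1)).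
  apply: le_Rintegral => //; first exact: integrable_kappaV.
    apply: measurable_bounded_integrable => //.
      by rewrite /= lebesgue_measure_itv/=; case: ifP => _; rewrite ?ltry.
    exists `|(kappa u)^-1|; split; first exact: num_real.
    by move=> M uM s _ /=; rewrite ltW.
  move=> s /=; rewrite in_itv/= => /andP[us _].
  have s0 : 0 < s := lt_trans u0 us.
  by rewrite lef_pV2 ?posrE ?kappa_gt0// kappa_le// ltW.
rewrite Rintegral_cst//= mulrC lebesgue_measure_itv/= lte_fin.
case: ltP => //= vu; rewrite mul0r mulr_ge0 ?subr_ge0//.
by rewrite invr_ge0 kappa_ge0 ?ltW.
Qed.

(** Monotone convergence: were all the integrals with positive lower endpoint at most [L], so would
    be the integral from 0, which is infinite. *)
Lemma kappaV_integral_unbounded L eta : 0 < eta ->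
  exists2 e, 0 < e < eta & L < \int[mu]_(s in `]e, eta]) (kappa s)^-1.
Proof.
move=> eta0; case: kappa_div => e0 /= e00 H.
pose z := Num.min eta (e0 / 2).
have z0 : 0 < z by rewrite lt_min eta0 divr_gt0.
have ze : z <= eta by rewrite ge_min lexx.
have {}H : (\int[mu]_(s in `]0%R, z]) (kappa s)^-1%:E)%E = +oo%E.
  apply: H => //=; rewrite sub0r normrN gtr0_norm// gt_min; apply/orP; right.
  by rewrite ltr_pdivrMr// ltr_pMr// ltrDl.
apply: contrapT => /forall2NP K.
(* The shift by 2 keeps the lower endpoint strictly below [z], as required of the witness, already
   for [n = 0]. *)
pose E n : set R := `]z / n.+2%:R, z]%classic.
have En n : 0 < z / n.+2%:R by rewrite divr_gt0.
have Ez n : z / n.+2%:R < z.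
  by rewrite ltr_pdivrMr// ltr_pMr// ltr1n.
have B n : (\int[mu]_(s in E n) (kappa s)^-1%:E <= L%:E)%E.
  have /integrable_fin_num/= fn := integrable_kappaV z (En n).
  rewrite -(fineK (fn (measurable_itv _))) lee_fin.
  have [|] := K (z / n.+2%:R).
    by move=> /negP; rewrite En/= (lt_le_trans (Ez n) ze).
  move=> /negP; rewrite -leNgt; apply: le_trans.
  rewrite -[X in X <= _]/(\int[mu]_(s in `]z / n.+2%:R, z]) (kappa s)^-1).
  have I := integrable_kappaV eta (En n).
  rewrite -subr_ge0 Rintegral_itvB//.
    apply: Rintegral_ge0 => s /=; rewrite in_itv/= => /andP[zs _].
    by rewrite invr_ge0 kappa_ge0// ltW// (lt_trans z0).
  by rewrite bnd_simp ltW.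
have bigE : \bigcup_n E n = `]0%R, z]%classic.
  apply/seteqP; split=> s /=.
    by move=> [n _]; rewrite /E/= !in_itv/= => /andP[h ->]; rewrite (lt_trans _ h).
  rewrite in_itv/= => /andP[s0 sz].
  have [n hn] : exists n : nat, z / s < n%:R.
    by exists (Num.truncn (z / s)).+1; exact: truncnS_gt.
  exists n => //; rewrite /E/= in_itv/= sz andbT.
  rewrite ltr_pdivrMr// mulrC -ltr_pdivrMr// (lt_le_trans hn)// ler_nat.
  by rewrite -addn2 leq_addr.
have := @ge0_nondecreasing_set_cvg_integral _ (measurableTypeR R) R E
  (fun s => (kappa s)^-1%:E) mu.
rewrite bigE H => C.
have {}C : (\int[mu]_(s in E n) (kappa s)^-1%:E)%E @[n --> \oo] --> +oo%E.
  apply: C.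
  - apply/nondecreasing_seqP => n; rewrite subsetEset => s /=.
    rewrite /E/= !in_itv/= => /andP[h ->]; rewrite andbT (le_lt_trans _ h)//.
    by rewrite ler_pM2l// lef_pV2 ?posrE// ler_nat.
  - by move=> n; exact: measurable_itv.
  - by move=> n; apply/measurable_EFinP; exact: measurable_kappaV.
  - move=> n s; rewrite /E/= in_itv/= => /andP[h _].
    by rewrite lee_fin invr_ge0 kappa_ge0// ltW// (lt_trans (En n)).
have : (+oo <= L%:E)%E.
  rewrite -(cvg_lim _ C)//; apply: lime_le; first by apply/cvg_ex; exists +oo%E.
  by apply: nearW.
by rewrite leye_eq.
Qed.

(** Right-continuity of [kappa] at 0, drawn from Osgood's condition: if [kappa] stayed above [eta],
    the integrals of its reciprocal over []e, 1]] would stay below [1 / eta]. *)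
Lemma kappa_small eta : 0 < eta ->
  exists2 c, 0 < c & kappa c <= eta.
Proof.
move=> eta0; apply: contrapT => /forall2NP K.
have [e /andP[e0 e1]] := kappaV_integral_unbounded eta^-1 ltr01.
apply/negP; rewrite -leNgt.
have ek : eta < kappa e.
  by have [//|/negP] := K e; rewrite -ltNge.
apply: (le_trans (kappaV_integral_le e0 (ltW e1))).
apply: (@le_trans _ _ (kappa e)^-1).
  rewrite ler_piMl ?invr_ge0 ?kappa_ge0 ?(ltW e0)//.
  by rewrite lerBlDr lerDl ltW.
by rewrite lef_pV2 ?posrE ?kappa_gt0// ltW.
Qed.

(* [\int_(u_i, eta] 1 / kappa] decreases by at most a multiple of the step
   length, so [u] cannot reach [eta] when started where it is large. *)
Lemma discrete_osgood (C T eta : R) : 0 <= C -> 0 < eta ->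
  exists2 e, 0 < e & forall (N : nat) (D u : nat -> R),
    (forall i, (i < N)%N -> 0 <= D i) -> \sum_(i < N) D i <= T ->
    u 0%N = e ->
    (forall i, (i < N)%N -> u i.+1 = u i + D i * (2 * kappa (u i) + C * u i)) ->
    forall i, (i <= N)%N -> 0 < u i <= eta.
Proof.
move=> C0 eta0.
pose z := Num.min eta 1.
have z0 : 0 < z by rewrite lt_min eta0 ltr01.
have ze : z <= eta by rewrite ge_min lexx.
have z1 : z <= 1 by rewrite ge_min lexx orbT.
have k1 := kappa_gt0 ltr01.
(* On []0, 1]] concavity gives [v * kappa 1 <= kappa v], so the linear term [C * v] is absorbed into
   a multiple of [kappa v]. This is why [z] is capped at 1. *)
pose A := 2 + C / kappa 1.
have A0 : 0 < A by rewrite ltr_pwDl// divr_ge0// ltW.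
(* Each step consumes at most [A] times its length of the integral of [1 / kappa] up to [z]; the
   initial reserve is chosen larger than the total [A * T]. *)
have [e /andP[e0 ez] He] := kappaV_integral_unbounded (A * T) z0.
exists e => // N D u D0 DT u0 uS.
pose Phi v := \int[mu]_(s in `]v, z]) (kappa s)^-1.
have G v : 0 < v -> v <= 1 -> 2 * kappa v + C * v <= A * kappa v.
  move=> v0 v1; rewrite [leRHS]mulrDl lerD2l -mulrA ler_wpM2l//.
  rewrite ler_pdivlMl// mulrC.
  by have := @kappa_scale v 1; rewrite mulr1; apply; rewrite ?(ltW v0).
have key i : (i <= N)%N ->
    0 < u i <= z /\ Phi e - A * \sum_(j < i) D j <= Phi (u i).
  elim: i => [_|i IH iN].
    by rewrite u0 e0 (ltW ez)/= big_ord0 mulr0 subr0.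
  have [/andP[ui0 uiz] P] := IH (ltnW iN).
  have Di := D0 _ iN.
  have g1 := G _ ui0 (le_trans uiz z1).
  have g0 : 0 <= 2 * kappa (u i) + C * u i.
    by rewrite addr_ge0// mulr_ge0// ?kappa_ge0// ltW.
  have uu : u i <= u i.+1 by rewrite uS// lerDl mulr_ge0.
  have uu2 : (u i.+1 - u i) / kappa (u i) <= A * D i.
    rewrite ler_pdivrMr ?kappa_gt0// uS// addrC addKr.
    by rewrite [A * _]mulrC -mulrA ler_wpM2l.
  have sumle : \sum_(j < i.+1) D j <= T.
    by apply: le_trans DT; exact: ler_sum_prefix.
  have P2 : A * D i < Phi (u i).
    apply: lt_le_trans P; rewrite ltrBrDr.
    rewrite -mulrDr; apply: le_lt_trans He; rewrite ler_pM2l//.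
    by move: sumle; rewrite big_ord_recr/= addrC.
  have uz : u i.+1 <= z.
    (* A jump beyond [z] is longer than [z - u i]. As [1 / kappa] is largest at the left endpoint,
       it would use up all of [Phi (u i)], which exceeds [A * D i]. *)
    rewrite leNgt; apply/negP => zu.
    have := kappaV_integral_le ui0 uiz; rewrite -/(Phi (u i)) => P3.
    have := lt_le_trans P2 P3; apply/negP; rewrite -leNgt.
    apply: le_trans uu2; rewrite ler_pM2r ?invr_gt0 ?kappa_gt0//.
    by rewrite lerD2r ltW.
  split; first by rewrite uz andbT (lt_le_trans ui0).
  have : Phi (u i) - Phi (u i.+1) <= A * D i.
    apply: le_trans uu2.
    rewrite -(_ : \int[mu]_(s in `]u i, u i.+1]) (kappa s)^-1 =
      Phi (u i) - Phi (u i.+1)); first exact: kappaV_integral_le.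
    have I := integrable_kappaV z ui0.
    rewrite /Phi -(@Rintegral_itvB _ _ (BRight (u i)) (BRight z) (u i.+1))//.
    by rewrite opprB addrC subrK.
  rewrite big_ord_recr/= mulrDr; move: P.
  by set a := Phi e; set b := Phi (u i); set c := Phi (u i.+1); lra.
move=> i iN; have [/andP[-> h] _] := key i iN.
by rewrite (le_trans h).
Qed.

End Osgood.

(** * Modulus of continuity of the diffusion coefficient *)

Lemma within_continuousE (R : realType) (X : pseudoMetricType R) (D : set X)
    (f : X -> R) :
  {within D, continuous f} <->
  forall x, D x -> forall e, 0 < e -> exists2 dlt : R, 0 < dlt &
    forall y, D y -> ball x dlt y -> `|f x - f y| < e.
Proof.
split.
  move=> /subspace_continuousP cf x Dx e e0.
  have /cvgrPdist_lt/(_ e e0) := cf x Dx.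
  rewrite near_withinE => /nbhs_ballP[dl /= dl0 H].
  by exists dl => // y Dy xy; exact: H.
move=> H; apply/subspace_continuousP => x Dx.
apply/cvgrPdist_lt => e e0; rewrite near_withinE.
have [dl dl0 K] := H x Dx e e0.
by apply/nbhs_ballP; exists dl => //= y xy Dy; exact: K.
Qed.

Section Diffusion.
Variables (R : realType) (T : R) (sigma : R -> R -> R) (M : R).
Implicit Types s t u v y z eta : R.
Hypothesis sigma_le : forall t y, 0 <= t <= T -> `|sigma t y| <= M.

Let sq_le (a b : R) : `|a| <= M -> `|b| <= M -> (a - b) ^+ 2 <= 4 * M ^+ 2.
Proof.
move=> aM bM; have := ler_normB a b => h.
rewrite -real_normK ?num_real//.
have -> : 4 * M ^+ 2 = (2 * M) ^+ 2 by ring.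
have M0 : 0 <= M := le_trans (normr_ge0 a) aM.
by rewrite ler_pXn2r ?nnegrE ?mulr_ge0//; lra.
Qed.

Lemma sigma_half_holder (rho : R -> R) :
  {in `[0, +oo[ &, {homo rho : u v / u < v}} -> rho 0 = 0 ->
  convex_function (`[0, +oo[%classic : set R) (fun u => rho u ^+ 2) ->
  (forall t y z, 0 <= t <= T -> `|sigma t y - sigma t z| <= rho `|y - z|) ->
  exists2 K, 0 <= K & forall t y z, 0 <= t <= T ->
    (sigma t y - sigma t z) ^+ 2 <= K * `|y - z|.
Proof.
move=> rho_incr rho0 rho_cvx H.
exists (rho 1 ^+ 2 + 4 * M ^+ 2) => [|t y z tT].
  by rewrite addr_ge0 ?sqr_ge0// mulr_ge0// sqr_ge0.
have n0 := normr_ge0 (y - z).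
have [yz|yz] := leP `|y - z| 1.
  apply: (@le_trans _ _ (rho `|y - z| ^+ 2)).
    rewrite -real_normK ?num_real// ler_pXn2r ?nnegrE//; first exact: H.
    exact: le_trans (H t y z tT).
  have := @convex_scale_le _ _ rho_cvx _ `|y - z| 1.
  rewrite rho0 expr0n mulr1 n0 yz => /(_ erefl erefl ler01) h.
  apply: (le_trans h); rewrite mulrC ler_wpM2r// lerDl.
  by rewrite mulr_ge0// sqr_ge0.
apply: (le_trans (sq_le (sigma_le y tT) (sigma_le z tT))).
rewrite -[leLHS]mulr1; apply: ler_pM => //.
- by rewrite mulr_ge0// sqr_ge0.
- by rewrite lerDr sqr_ge0.
- exact: ltW.
Qed.

Hypothesis sigma_continuous :
  {within `[0, T] `*` setT, continuous (fun z : R * R => sigma z.1 z.2)}.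

(** Continuity is uniform only for bounded [v]. Beyond the radius [r = 4 M^2 / eta] the crude bound
    [4 M^2] on the square is at most [eta * |v|], which accounts for the factor [1 + |v|]. *)
Lemma sigma_time_modulus eta : 0 < eta -> exists2 dlt, 0 < dlt &
  forall s t v, 0 <= s <= T -> 0 <= t <= T -> `|s - t| <= dlt ->
    (sigma s v - sigma t v) ^+ 2 <= eta * (1 + `|v|).
Proof.
move=> eta0.
pose r := 4 * M ^+ 2 / eta.
have r0 : 0 <= r by rewrite divr_ge0 ?(ltW eta0)// mulr_ge0// sqr_ge0.
pose e := Num.sqrt eta; have e0 : 0 < e by rewrite sqrtr_gt0.
have ee : e ^+ 2 = eta by rewrite sqr_sqrtr// ltW.
have cK : compact (`[0, T] `*` `[- r, r] : set (R * R)).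
  by apply: compact_setX; exact: segment_compact.
pose Q (dl : R) (z : R * R) := forall t, 0 <= t <= T -> `|z.1 - t| <= dl ->
  `|sigma z.1 z.2 - sigma t z.2| <= e.
(* Compactness in its near-covering form: a time threshold valid near each point of the rectangle
   can be chosen valid on all of it. *)
have : near_covering_within (`[0, T] `*` `[- r, r] : set (R * R)).
  by apply/near_covering_withinP; apply/compact_near_coveringP.
move=> /(_ R (0^'+) Q _) nc.
have : \forall dl \near 0^'+, `[0, T] `*` `[- r, r] `<=` Q dl.
  apply: nc => -[s0 v0]/= [s0T v0r].
  have e2 : 0 < e / 2 by rewrite divr_gt0.
  have [//|dl dl0 H] :=
    (within_continuousE _ _).1 sigma_continuous (s0, v0) _ (e / 2) e2.
  have dl2 : 0 < dl / 2 by rewrite divr_gt0.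
  exists (ball (s0, v0) (dl / 2), [set d : R | d < dl / 2]).
    split=> /=; first exact: nbhsx_ballx.
    by apply: nbhs_right_lt.
  move=> [[s v] d] /= [[b1 b2] dd] [/=]; rewrite in_itv/= => sT _ t tT std.
  have h1 : `|sigma s0 v0 - sigma s v| < e / 2.
    apply: (H (s, v)); first by split => //=; rewrite in_itv.
    by split => /=; [apply: lt_trans b1 _|apply: lt_trans b2 _];
      rewrite gtr_pMr// invf_lt1// ltr1n.
  have h2 : `|sigma s0 v0 - sigma t v| < e / 2.
    apply: (H (t, v)); first by split => //=; rewrite in_itv.
    split => /=; last by apply: lt_trans b2 _;
      rewrite gtr_pMr// invf_lt1// ltr1n.
    move: b1; rewrite /ball/= => b1.
    have := ler_distD s s0 t; lra.
  have := ler_distD (sigma s0 v0) (sigma s v) (sigma t v).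
  by rewrite (distrC _ (sigma s0 v0)) /=; lra.
move=> [dl /= dl0 H]; exists (dl / 2); first by rewrite divr_gt0.
move=> s t v sT tT st.
have dl2 : 0 < dl / 2 by rewrite divr_gt0.
have [vr|vr] := leP `|v| r.
  have := H (dl / 2); rewrite /= sub0r normrN gtr0_norm// gtr_pMr// invf_lt1//.
  rewrite ltr1n => /(_ erefl dl2 (s, v)) /=.
  rewrite !in_itv/= -ler_norml => /(_ (conj sT vr) t tT st) h.
  apply: (@le_trans _ _ eta); last by rewrite ler_peMr ?(ltW eta0)// lerDl.
  by rewrite -ee -real_normK ?num_real// ler_pXn2r ?nnegrE// ltW.
apply: (le_trans (sq_le (sigma_le v sT) (sigma_le v tT))).
have -> : 4 * M ^+ 2 = eta * r by rewrite /r; field; rewrite gt_eqF.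
rewrite ler_pM2l// (le_trans (ltW vr))// lerDr//.
Qed.

Lemma sigma_modulus K eta : 0 <= K ->
  (forall t y z, 0 <= t <= T -> (sigma t y - sigma t z) ^+ 2 <= K * `|y - z|) ->
  0 < eta -> exists2 dlt, 0 < dlt &
  forall s t u v, 0 <= s <= T -> 0 <= t <= T -> `|s - t| <= dlt ->
    (sigma s u - sigma t v) ^+ 2 <= 2 * K * `|u - v| + eta * (1 + `|v|).
Proof.
move=> K0 HK eta0.
have e2 : 0 < eta / 2 by rewrite divr_gt0.
have [dl dl0 H] := sigma_time_modulus e2.
exists dl => // s t u v sT tT st.
have := H s t v sT tT st; have := HK s u v sT.
have := sqr_ge0 ((sigma s u - sigma s v) - (sigma s v - sigma t v)).
set a := sigma s u; set b := sigma s v; set c := sigma t v.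
set w := `|u - v|; set z := `|v|.
nra.
Qed.

End Diffusion.

(** * Moments, adaptedness and independence *)

Section GaussianMoments.
Variable R : realType.
Implicit Types s x : R.
Let mu := @lebesgue_measure R.

(** The change of variables is known for the Radon-Nikodym derivative of the normal law; it agrees
    almost everywhere with [normal_pdf], as both have the same integral over every measurable
    set. *)
Lemma ge0_integral_normal_prob s (f : R -> \bar R) :
  measurable_fun setT f -> (forall x, (0 <= f x)%E) ->
  (\int[normal_prob 0 s]_x f x = \int[mu]_x (f x * (normal_pdf 0 s x)%:E))%E.
Proof.
move=> mf f0.
pose nu : {finite_measure set (measurableTypeR R) -> \bar R} := normal_prob 0 s.
have dom : nu `<< mu := normal_prob_dominates 0 s.
rewrite -[LHS](@Radon_Nikodym_SigmaFinite.change_of_variables _ _ _ nu mu)//.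
have mpdf : measurable_fun setT (EFin \o normal_pdf (0 : R) s).
  by apply/measurable_EFinP; exact: measurable_normal_pdf.
have ir := @Radon_Nikodym_SigmaFinite.f_integrable _ _ _ nu mu dom.
have ae : ae_eq mu setT (Radon_Nikodym_SigmaFinite.f nu mu)
    (EFin \o normal_pdf (0 : R) s).
  apply: integral_ae_eq => //.
  by move=> A _ mA; rewrite -Radon_Nikodym_SigmaFinite.f_integral.
apply: ae_eq_integral => //.
- by apply: emeasurable_funM => //; exact: measurable_int ir.
- exact: emeasurable_funM.
- exact: ae_eqe_mul2l.
Qed.

(** The exponential halves the exponent of the density of standard deviation [s], which becomes
    [sqrt 2] times the density of standard deviation [s * sqrt 2]. The factor [sqrt 2] is rounded up
    to 2. *)
Lemma normal_prob_integral_le s (K : R) (g : R -> R) : 0 < s -> 0 <= K ->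
  measurable_fun setT g -> (forall x, 0 <= g x) ->
  (forall x, g x <= K * expR (x ^+ 2 / (4 * s ^+ 2))) ->
  (\int[normal_prob 0 s]_x (g x)%:E <= (2 * K)%:E)%E.
Proof.
move=> s0 K0 mg g0 gK.
have s2 : 0 < s * Num.sqrt 2 by rewrite mulr_gt0// sqrtr_gt0.
have ss2 : (s * Num.sqrt 2) ^+ 2 = 2 * s ^+ 2.
  by rewrite exprMn sqr_sqrtr// mulrC.
rewrite ge0_integral_normal_prob//; last first.
  exact/measurable_EFinP.
have <- : ((2 * K)%:E * \int[mu]_x (normal_pdf 0 (s * Num.sqrt 2) x)%:E =
    (2 * K)%:E)%E.
  by rewrite integral_normal_pdf ?gt_eqF// mule1.
rewrite -ge0_integralZl//; last 3 first.
- by apply/measurable_EFinP; exact: measurable_normal_pdf.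
- by move=> x _; rewrite lee_fin normal_pdf_ge0.
- by rewrite lee_fin mulr_ge0.
apply: ge0_le_integral => //.
- by move=> x _; rewrite mule_ge0// lee_fin// normal_pdf_ge0.
- apply: emeasurable_funM; apply/measurable_EFinP => //.
  exact: measurable_normal_pdf.
- by apply: emeasurable_funM => //; apply/measurable_EFinP => //;
    exact: measurable_normal_pdf.
move=> x _; rewrite -!EFinM lee_fin.
rewrite !normal_pdfE ?gt_eqF//.
apply: (@le_trans _ _ (K * expR (x ^+ 2 / (4 * s ^+ 2)) *
   (normal_peak s * normal_fun 0 s x))).
  by rewrite ler_wpM2r// mulr_ge0 ?normal_peak_ge0 ?normal_fun_ge0.
have -> : K * expR (x ^+ 2 / (4 * s ^+ 2)) * (normal_peak s * normal_fun 0 s x)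
  = K * normal_peak s * normal_fun 0 (s * Num.sqrt 2) x.
  rewrite -!mulrA; congr (_ * _); rewrite mulrCA; congr (_ * _).
  rewrite /normal_fun ss2 -expRD subr0; congr expR.
  by field; rewrite gt_eqF.
rewrite mulrA ler_wpM2r ?normal_fun_ge0// -mulrA mulrCA ler_wpM2l//.
rewrite /normal_peak ss2.
have p0 : 0 < s ^+ 2 * pi *+ 2 by rewrite mulrn_wgt0// mulr_gt0 ?exprn_gt0 ?pi_gt0.
have -> : 2 * s ^+ 2 * pi *+ 2 = 2 * (s ^+ 2 * pi *+ 2) by rewrite -mulrA mulrnAr.
rewrite sqrtrM// invfM mulrA -[leLHS]mul1r ler_wpM2r ?invr_ge0 ?sqrtr_ge0//.
rewrite ler_pdivlMr ?sqrtr_gt0// mul1r.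
rewrite -(@ler_pXn2r _ 2)// ?nnegrE ?sqrtr_ge0// sqr_sqrtr//.
by rewrite -natrX ler_nat.
Qed.

Lemma expR_ge_sqr_half x : 0 <= x -> x ^+ 2 / 2 <= expR x.
Proof.
move=> x0; have := expR_ge1Dxn 1 x0.
rewrite (_ : 2`! = 2%N)//.
by move=> h; rewrite (le_trans _ h)// lerDr.
Qed.

(** With [y = x^2 / (4 s^2)], the inequality [y <= exp y] serves here and [y^2 / 2 <= exp y] for the
    fourth moment. The constants 8 and 64 are not sharp. *)
Lemma normal_prob_moment2 s : 0 < s ->
  (\int[normal_prob 0 s]_x (x ^+ 2)%:E <= (8 * s ^+ 2)%:E)%E.
Proof.
move=> s0; have -> : 8 * s ^+ 2 = 2 * (4 * s ^+ 2) by ring.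
have s20 : 0 < 4 * s ^+ 2 by rewrite mulr_gt0// exprn_gt0.
apply: normal_prob_integral_le => //; first exact: ltW.
- by move=> x; rewrite sqr_ge0.
- move=> x; rewrite -ler_pdivrMl// mulrC.
  by apply: le_trans (expR_ge1Dx _); rewrite lerDr.
Qed.

Lemma normal_prob_moment4 s : 0 < s ->
  (\int[normal_prob 0 s]_x (x ^+ 4)%:E <= (64 * s ^+ 4)%:E)%E.
Proof.
move=> s0; have -> : 64 * s ^+ 4 = 2 * (32 * s ^+ 4) by ring.
have s20 : 0 < 32 * s ^+ 4 by rewrite mulr_gt0// exprn_gt0.
apply: normal_prob_integral_le => //; first exact: ltW.
- by move=> x; rewrite (exprM x 2 2) sqr_ge0.
- move=> x; rewrite -ler_pdivrMl// mulrC.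
  have -> : x ^+ 4 / (32 * s ^+ 4) = (x ^+ 2 / (4 * s ^+ 2)) ^+ 2 / 2.
    by field; rewrite gt_eqF.
  apply: expR_ge_sqr_half; rewrite divr_ge0// ?sqr_ge0//.
  by rewrite mulr_ge0// sqr_ge0.
Qed.

Lemma ge0_integral_lebesgueN (f : R -> \bar R) :
  measurable_fun setT f -> (forall x, (0 <= f x)%E) ->
  (\int[mu]_x f (- x)%R = \int[mu]_x f x)%E.
Proof.
move=> mf f0.
have mN : measurable_fun setT (-%R : R -> measurableTypeR R).
  exact: oppr_measurable.
have := @ge0_integral_pushforward _ _ (measurableTypeR R) (measurableTypeR R) R
  -%R mN mu setT f measurableT mf (fun x _ => f0 x).
rewrite preimage_setT /= => <-.
by apply: eq_measure_integral => A mA _; exact: lebesgue_measureN.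
Qed.

(** By reflection the positive and the negative part of [x] have the same integral; it is finite
    because both are at most [1 + x^2]. *)
Lemma normal_prob_mean s : 0 < s ->
  (\int[normal_prob 0 s]_x x%:E = 0)%E.
Proof.
move=> s0.
have mid : measurable_fun setT (EFin : R -> \bar R) by exact/measurable_EFinP.
have mp : measurable_fun setT (fun x : R => (Num.max x 0)%:E).
  by apply/measurable_EFinP; exact: measurable_maxr.
have mn : measurable_fun setT (fun x : R => (Num.max (- x) 0)%:E).
  by apply/measurable_EFinP; apply: measurable_maxr => //; exact: oppr_measurable.
have E : (\int[normal_prob 0 s]_x (Num.max x 0)%:E =
          \int[normal_prob 0 s]_x (Num.max (- x) 0)%:E)%E.
  rewrite !ge0_integral_normal_prob//.
  - rewrite -[LHS]ge0_integral_lebesgueN.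
    + apply: eq_integral => x _; congr (_ * _%:E)%E.
      by rewrite !normal_pdfE ?gt_eqF// /normal_fun !subr0 sqrrN.
    + apply: emeasurable_funM => //; apply/measurable_EFinP.
      exact: measurable_normal_pdf.
    + by move=> x; rewrite mule_ge0// lee_fin ?le_max ?lexx ?orbT ?normal_pdf_ge0.
  - by move=> x; rewrite lee_fin le_max lexx orbT.
  - by move=> x; rewrite lee_fin le_max lexx orbT.
rewrite integralE.
have -> : (EFin^\+)%E = (fun x : R => (Num.max x 0)%:E).
  by apply/funext => x; rewrite funeposE -EFin_max.
have -> : (EFin^\-)%E = (fun x : R => (Num.max (- x) 0)%:E).
  by apply/funext => x; rewrite funenegE -EFinN -EFin_max.
rewrite E subee// ge0_fin_numE; last first.
  by apply: integral_ge0 => x _; rewrite lee_fin le_max lexx orbT.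
apply: (@le_lt_trans _ _ (\int[normal_prob 0 s]_x (1 + x ^+ 2)%:E)%E).
  apply: ge0_le_integral => //.
  - by move=> x _; rewrite lee_fin le_max lexx orbT.
  - apply/measurable_EFinP; apply: measurable_funD => //.
  - move=> x _; rewrite lee_fin ge_max addr_ge0 ?sqr_ge0// andbT.
    have := sqr_ge0 (x + 1); have := sqr_ge0 x; nra.
under eq_integral do rewrite EFinD.
rewrite ge0_integralD//; last 2 first.
  by move=> x _; rewrite lee_fin sqr_ge0.
  by apply/measurable_EFinP.
rewrite lte_add_pinfty//.
  rewrite integral_cst// mul1e.
  exact: le_lt_trans (probability_le1 (normal_prob 0 s) measurableT) (ltry _).
exact: le_lt_trans (normal_prob_moment2 s0) (ltry _).
Qed.

End GaussianMoments.

(** * Means, integrable and square-integrable variables *)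

Section Mean.
Context (R : realType) (d : measure_display) (Omega : measurableType d).
Variable P : probability Omega R.
Implicit Types f g : Omega -> R.

Definition intg f := P.-integrable setT (EFin \o f).

Definition mean f : R := \int[P]_w f w.

Definition sqint f := measurable_fun setT f /\ intg (fun w => f w ^+ 2).

Lemma intg_measurable f : intg f -> measurable_fun setT f.
Proof. by move=> /measurable_int /measurable_EFinP. Qed.

Lemma intgD f g : intg f -> intg g -> intg (fun w => f w + g w).
Proof. by move=> /integrableD h /h; apply. Qed.

Lemma intgN f : intg f -> intg (fun w => - f w).
Proof. by move=> /integrableN h; exact: h. Qed.

Lemma intgB f g : intg f -> intg g -> intg (fun w => f w - g w).
Proof. by move=> h /intgN; exact: intgD. Qed.

Lemma intgZ k f : intg f -> intg (fun w => k * f w).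
Proof. by move=> h; exact: (integrableZl measurableT k h). Qed.

Lemma intg_cst k : intg (fun=> k).
Proof. exact: finite_measure_integrable_cst. Qed.

Lemma intg_sum (n : nat) (f : nat -> Omega -> R) :
  (forall i, (i < n)%N -> intg (f i)) -> intg (fun w => \sum_(i < n) f i w).
Proof.
elim: n => [|n IH] h.
  by under [X in intg X]eq_fun do rewrite big_ord0; exact: intg_cst.
under [X in intg X]eq_fun do rewrite big_ord_recr/=.
by apply: intgD; [apply: IH => i /leqW; exact: h|exact: h].
Qed.

Lemma intg_le f g : measurable_fun setT f -> intg g ->
  (forall w, `|f w| <= g w) -> intg f.
Proof.
move=> mf ig fg; apply: (le_integrable measurableT _ _ ig).
  exact/measurable_EFinP.
by move=> w _ /=; rewrite lee_fin (le_trans (fg w))// ler_norm.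
Qed.

Lemma intg_norm f : intg f -> intg (fun w => `|f w|).
Proof.
move=> h; have mf := intg_measurable h; exact: (integrable_norm h).
Qed.

Lemma meanE f : intg f -> (mean f)%:E = (\int[P]_w (f w)%:E)%E.
Proof. by move=> h; rewrite fineK//; exact: integrable_fin_num h. Qed.

Lemma meanD f g : intg f -> intg g ->
  mean (fun w => f w + g w) = mean f + mean g.
Proof. exact: RintegralD. Qed.

Lemma meanB f g : intg f -> intg g ->
  mean (fun w => f w - g w) = mean f - mean g.
Proof. exact: RintegralB. Qed.

Lemma meanZ k f : intg f -> mean (fun w => k * f w) = k * mean f.
Proof. exact: RintegralZl. Qed.

Lemma mean_cst k : mean (fun=> k) = k.
Proof. by rewrite /mean Rintegral_cst//= probability_setT mulr1. Qed.

Lemma mean_sum (n : nat) (f : nat -> Omega -> R) :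
  (forall i, (i < n)%N -> intg (f i)) ->
  mean (fun w => \sum_(i < n) f i w) = \sum_(i < n) mean (f i).
Proof.
elim: n => [|n IH] h.
  by under [X in mean X]eq_fun do rewrite big_ord0; rewrite big_ord0 mean_cst.
under [X in mean X]eq_fun do rewrite big_ord_recr/=.
rewrite meanD ?big_ord_recr/= ?IH//; first by move=> i /leqW; exact: h.
- by apply: intg_sum => i /leqW; exact: h.
- exact: h.
Qed.

Lemma mean_le f g : intg f -> intg g -> (forall w, f w <= g w) ->
  mean f <= mean g.
Proof. by move=> fi gi fg; apply: le_Rintegral. Qed.

Lemma mean_ge0 f : (forall w, 0 <= f w) -> 0 <= mean f.
Proof. by move=> f0; apply: Rintegral_ge0. Qed.

Lemma ae_mean_eq f g : measurable_fun setT f -> measurable_fun setT g ->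
  {ae P, forall w, f w = g w} -> mean f = mean g.
Proof.
move=> mf mg fg; congr fine; apply: ae_eq_integral => //.
- exact/measurable_EFinP.
- exact/measurable_EFinP.
- by apply: filterS fg => w /= -> _.
Qed.

Lemma sqint_measurable f : sqint f -> measurable_fun setT f.
Proof. by case. Qed.

Lemma sqint_cst k : sqint (fun=> k).
Proof. by split => //; exact: intg_cst. Qed.

Lemma sqint_intg_sqr f : sqint f -> intg (fun w => f w ^+ 2).
Proof. by case. Qed.

Lemma sqint_le f g : measurable_fun setT f -> sqint g ->
  (forall w, `|f w| <= `|g w|) -> sqint f.
Proof.
move=> mf [mg ig] fg; split=> //.
apply: intg_le ig _; first exact: measurable_funX.
move=> w; rewrite ger0_norm ?sqr_ge0//.
by rewrite -[leLHS]real_normK ?num_real// -[leRHS]real_normK ?num_real//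
  ler_pXn2r ?nnegrE.
Qed.

Lemma sqint_intgM f g : sqint f -> sqint g -> intg (fun w => f w * g w).
Proof.
move=> [mf fi] [mg gi]; apply: intg_le (intgD fi gi) _.
  exact: measurable_funM.
move=> w; rewrite normrM -(@real_normK _ (f w)) ?num_real//.
rewrite -(@real_normK _ (g w)) ?num_real//.
have := sqr_ge0 (`|f w| - `|g w|); have := sqr_ge0 (`|f w| + `|g w|); nra.
Qed.

Lemma sqint_intg f : sqint f -> intg f.
Proof.
move=> h; have := sqint_intgM h (sqint_cst 1).
by under [X in intg X]eq_fun do rewrite mulr1.
Qed.

Lemma sqintD f g : sqint f -> sqint g -> sqint (fun w => f w + g w).
Proof.
move=> [mf fi] [mg gi]; split; first exact: measurable_funD.
apply: intg_le (intgZ 2 (intgD fi gi)) _.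
  exact/measurable_funX/measurable_funD.
move=> w; rewrite ger0_norm ?sqr_ge0//.
have := sqr_ge0 (f w - g w); nra.
Qed.

Lemma sqintZ k f : sqint f -> sqint (fun w => k * f w).
Proof.
move=> [mf fi]; split; first exact: measurable_funM.
by under [X in intg X]eq_fun do rewrite exprMn; exact: intgZ.
Qed.

Lemma sqintN f : sqint f -> sqint (fun w => - f w).
Proof.
move=> /(sqintZ (-1)).
by under [X in sqint X -> _]eq_fun do rewrite mulN1r.
Qed.

Lemma sqintB f g : sqint f -> sqint g -> sqint (fun w => f w - g w).
Proof. by move=> h /sqintN; exact: sqintD. Qed.

Lemma sqint_norm f : sqint f -> sqint (fun w => `|f w|).
Proof.
move=> h; apply: (sqint_le _ h) => [|w]; last by rewrite normr_id.
by apply: measurableT_comp => //; exact: sqint_measurable.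
Qed.

Lemma sqint_sum (n : nat) (f : nat -> Omega -> R) :
  (forall i, (i < n)%N -> sqint (f i)) -> sqint (fun w => \sum_(i < n) f i w).
Proof.
elim: n => [|n IH] h.
  by under [X in sqint X]eq_fun do rewrite big_ord0; exact: sqint_cst.
under [X in sqint X]eq_fun do rewrite big_ord_recr/=.
by apply: sqintD; [apply: IH => i /leqW; exact: h|exact: h].
Qed.

Lemma sqint_bounded f k : measurable_fun setT f -> (forall w, `|f w| <= k) ->
  sqint f.
Proof.
move=> mf fk; apply: (sqint_le mf (sqint_cst k)) => w.
by rewrite (le_trans (fk w))// ler_norm.
Qed.

Lemma sqint_boundedM k f g : measurable_fun setT f -> (forall w, `|f w| <= k) ->
  sqint g -> sqint (fun w => f w * g w).
Proof.
move=> mf fk ig; apply: (sqint_le _ (sqintZ k ig)) => [|w].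
  by apply: measurable_funM => //; exact: sqint_measurable.
by rewrite !normrM ler_wpM2r// (le_trans (fk w))// ler_norm.
Qed.

Lemma intg_boundedM k f g : measurable_fun setT f -> (forall w, `|f w| <= k) ->
  intg g -> intg (fun w => f w * g w).
Proof.
move=> mf fk ig; apply: (intg_le _ (intgZ k (intg_norm ig))) => [|w].
  by apply: measurable_funM => //; exact: intg_measurable.
by rewrite !normrM ler_wpM2r.
Qed.

(** The variance of [|f|] is nonnegative. *)
Lemma sqr_mean_le f : sqint f -> mean (fun w => `|f w|) ^+ 2 <=
  mean (fun w => f w ^+ 2).
Proof.
move=> sf; set m := mean (fun w => `|f w|).
have ni := sqint_intg (sqint_norm sf).
have : 0 <= mean (fun w => (`|f w| - m) ^+ 2) by apply: mean_ge0 => w; exact: sqr_ge0.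
have -> : (fun w => (`|f w| - m) ^+ 2) =
    (fun w => (f w ^+ 2 + (- (2 * m)) * `|f w|) + m ^+ 2).
  by apply/funext => w; rewrite -(@real_normK _ (f w)) ?num_real//; ring.
have i2 := intgZ (- (2 * m)) ni.
have i1 := sqint_intg_sqr sf.
rewrite (meanD (intgD i1 i2) (intg_cst _)) (meanD i1 i2) meanZ// mean_cst.
by rewrite -/m; lra.
Qed.

Lemma mean_norm_le_sqrt f k : 0 <= k -> sqint f ->
  mean (fun w => f w ^+ 2) <= k ^+ 2 -> mean (fun w => `|f w|) <= k.
Proof.
move=> k0 sf fk; rewrite -(@ler_pXn2r _ 2)// ?nnegrE//.
  exact: le_trans (sqr_mean_le sf) fk.
by apply: mean_ge0 => w; exact: normr_ge0.
Qed.

Lemma mean_sqrD_le f g : sqint f -> sqint g ->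
  mean (fun w => (f w + g w) ^+ 2) <=
  2 * mean (fun w => f w ^+ 2) + 2 * mean (fun w => g w ^+ 2).
Proof.
move=> sf sg; have [_ if2] := sf; have [_ ig2] := sg.
rewrite -mulrDr -meanD// -meanZ; last exact: intgD.
apply: mean_le; [by have [] := sqintD sf sg|exact/intgZ/intgD|move=> w].
have := sqr_ge0 (f w - g w); nra.
Qed.

Lemma markov_mean f (l : R) : intg f -> 0 < l ->
  (P [set w | (l <= `|f w|)%R] <= (mean (fun w => `|f w|) / l)%:E)%E.
Proof.
move=> fi l0; have mf := intg_measurable fi.
have mA : measurable [set w | l <= `|f w|].
  rewrite -[X in measurable X]setTI.
  apply: (@measurable_fun_le _ _ _ setT (fun=> l) (fun w => `|f w|)) => //.
  exact: measurableT_comp.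
rewrite mulrC EFinM lee_pdivlMl// meanE; last exact: intg_norm.
rewrite -(setIT [set w | _]) -integral_indic// -ge0_integralZl//; last 2 first.
- by apply/measurable_EFinP; exact: measurable_indic.
- by rewrite lee_fin ltW.
apply: ge0_le_integral => //.
- by move=> w _; rewrite -EFinM lee_fin mulr_ge0// ltW.
- apply/measurable_EFinP; apply: measurable_funM => //; exact: measurable_indic.
- by apply/measurable_EFinP; exact: measurableT_comp.
move=> w _; rewrite -EFinM lee_fin indicE.
case: (boolP (w \in _)) => [|_]; last by rewrite mulr0.
by rewrite inE/= mulr1.
Qed.

End Mean.
Arguments intg {R d Omega} P f.
Arguments sqint {R d Omega} P f.

(** * Measurability with respect to a sub-sigma-algebra *)

Section MeasurableWrt.
Context (R : realType) (Omega : pointedType) (G : set (set Omega)).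
Hypothesis sG : sigma_algebra setT G.
Implicit Types f g : Omega -> R.

(** Equips [Omega] with the sigma-algebra [G] as its measurable structure, so that the closure
    properties below are those of ordinary measurable functions. *)
Lemma measurable_wrtE f :
  measurable_wrt G f <-> measurable_fun setT (f : g_sigma_algebraType G -> R).
Proof.
split=> [h _ U mU|h U mU].
  by rewrite setTI; apply: sub_sigma_algebra; exact: h.
have := h measurableT U mU; rewrite setTI.
by change (<<s G >> (f @^-1` U) -> G (f @^-1` U)); rewrite (sigma_algebra_id sG).
Qed.

Lemma measurable_wrt_cst (k : R) : measurable_wrt G (fun=> k).
Proof. by apply/measurable_wrtE. Qed.

Lemma measurable_wrtD f g : measurable_wrt G f -> measurable_wrt G g ->
  measurable_wrt G (fun w => f w + g w).
Proof.
by move=> /measurable_wrtE mf /measurable_wrtE mg; apply/measurable_wrtE;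
  exact: measurable_funD.
Qed.

Lemma measurable_wrtB f g : measurable_wrt G f -> measurable_wrt G g ->
  measurable_wrt G (fun w => f w - g w).
Proof.
by move=> /measurable_wrtE mf /measurable_wrtE mg; apply/measurable_wrtE;
  exact: measurable_funB.
Qed.

Lemma measurable_wrtM f g : measurable_wrt G f -> measurable_wrt G g ->
  measurable_wrt G (fun w => f w * g w).
Proof.
by move=> /measurable_wrtE mf /measurable_wrtE mg; apply/measurable_wrtE;
  exact: measurable_funM.
Qed.

Lemma measurable_wrt_sum n (f : nat -> Omega -> R) :
  (forall i, (i < n)%N -> measurable_wrt G (f i)) ->
  measurable_wrt G (fun w => \sum_(i < n) f i w).
Proof.
elim: n => [|n IH] h.
  by under [X in measurable_wrt _ X]eq_fun do rewrite big_ord0;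
    exact: measurable_wrt_cst.
under [X in measurable_wrt _ X]eq_fun do rewrite big_ord_recr/=.
by apply: measurable_wrtD; [apply: IH => i /leqW; exact: h|exact: h].
Qed.

Lemma measurable_wrt_cvg (f : nat -> Omega -> R) g :
  (forall n, measurable_wrt G (f n)) ->
  (forall w, f n w @[n --> \oo] --> g w) -> measurable_wrt G g.
Proof.
move=> mf fg; apply/measurable_wrtE.
apply: (@measurable_fun_cvg _ (g_sigma_algebraType G) _ setT f) => // n.
exact/measurable_wrtE.
Qed.

End MeasurableWrt.

Lemma measurable_wrt_comp (R : realType) (Omega : Type) (G : set (set Omega))
    (h : R -> R) (f : Omega -> R) :
  measurable_fun setT h -> measurable_wrt G f -> measurable_wrt G (fun w => h (f w)).
Proof.
move=> mh mf U mU; have := mh measurableT U mU; rewrite setTI => mV.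
exact: mf _ mV.
Qed.

Lemma measurable_wrtS (R : realType) (Omega : Type) (G H : set (set Omega))
    (f : Omega -> R) :
  G `<=` H -> measurable_wrt G f -> measurable_wrt H f.
Proof. by move=> GH mf U /mf /GH. Qed.

Lemma measurable_wrt_fun (R : realType) d (Omega : measurableType d)
    (G : set (set Omega)) (f : Omega -> R) :
  G `<=` measurable -> measurable_wrt G f -> measurable_fun setT f.
Proof. by move=> GH mf _ U /mf /GH; rewrite setTI. Qed.

(** * Independence and couplings *)

Section Independence.
Context (R : realType) (d : measure_display) (Omega : measurableType d).
Variable P : probability Omega R.

Definition mkRV (f : Omega -> R) (mf : measurable_fun setT f) : {RV P >-> R} :=
  HB.pack f (isMeasurableFun.Build _ _ _ _ f mf).

(** The joint law agrees with the product of the marginal laws on rectangles, hence everywhere, and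
    Fubini's theorem applies to the function [x * y]. *)
Lemma independent_mean_mul (X Y : Omega -> R) :
  (forall U V : set R, measurable U -> measurable V ->
    P (X @^-1` U `&` Y @^-1` V) = (P (X @^-1` U) * P (Y @^-1` V))%E) ->
  intg P X -> intg P Y ->
  intg P (fun w => X w * Y w) /\
  mean P (fun w => X w * Y w) = mean P X * mean P Y.
Proof.
move=> ind iX iY.
have mX := intg_measurable iX; have mY := intg_measurable iY.
have mXY : measurable_fun setT (fun w => (X w, Y w)) by exact: measurable_fun_pair.
pose XY : {mfun Omega >-> (R * R)%type} :=
  HB.pack (fun w => (X w, Y w)) (isMeasurableFun.Build _ _ _ _ _ mXY).
pose mx : probability R R := distribution P (mkRV mX).
pose my : probability R R := distribution P (mkRV mY).
have eqm (A : set (R * R)) : measurable A -> (mx \x my)%E A = distribution P XY A.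
  move=> mA; apply: product_measure_unique => //.
pose f (z : R * R) : \bar R := (z.1 * z.2)%:E.
have mf : measurable_fun setT f.
  by apply/measurable_EFinP; apply: measurable_funM.
have eqint (g : R * R -> \bar R) :
    (\int[mx \x my]_z g z = \int[distribution P XY]_z g z)%E.
  by apply: eq_measure_integral => A mA _; first [exact: eqm|exact/esym/eqm].
have mn : measurable_fun setT (fun y : R => `|y|%:E).
  by apply/measurable_EFinP; exact: normr_measurable.
have absE (Z : Omega -> R) (mZ : measurable_fun setT Z) : intg P Z ->
    (\int[distribution P (mkRV mZ)]_x `|x|%:E < +oo)%E.
  move=> /integrableP[_ h]; by rewrite ge0_integral_distribution.
have iprod : (mx \x my)%E.-integrable setT f.
  apply/integrable12ltyP => //.
  rewrite (_ : (\int[mx]_x \int[my]_y `|f (x, y)| =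
    \int[mx]_x (`|x|%:E * \int[my]_y `|y|%:E))%E); last first.
    apply: eq_integral => x _; rewrite -ge0_integralZl//.
    - by apply: eq_integral => y _; rewrite /f/= normrM EFinM.
  rewrite ge0_integralZr//; last exact: integral_ge0.
  apply: lte_mul_pinfty; rewrite ?integral_ge0// ?absE//.
  rewrite ge0_fin_numE ?absE// integral_ge0//.
have ic : intg P (fun w => X w * Y w).
  apply/integrableP; split.
    by apply/measurable_EFinP; exact: measurable_funM.
  case/integrableP: iprod => _.
  rewrite eqint ge0_integral_distribution//.
  exact: measurableT_comp.
split => //.
apply: EFin_inj; rewrite EFinM !meanE//.
rewrite (_ : (\int[P]_w (X w * Y w)%:E = \int[distribution P XY]_z f z)%E); last first.
  by rewrite integral_distribution.
rewrite -eqint -integral12_prod_meas1//.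
rewrite /fubini_F/= /f/=.
have fY : (\int[my]_y y%:E = \int[P]_w (Y w)%:E)%E.
  by rewrite integral_distribution//; exact/measurable_EFinP.
have fX : (\int[mx]_y y%:E = \int[P]_w (X w)%:E)%E.
  by rewrite integral_distribution//; exact/measurable_EFinP.
rewrite -fX -fY.
have iy : my.-integrable setT EFin.
  apply/integrableP; split; first exact/measurable_EFinP.
  exact: absE.
have ix : mx.-integrable setT EFin.
  apply/integrableP; split; first exact/measurable_EFinP.
  exact: absE.
rewrite (eq_integral (fun x : R => (\int[my]_y y%:E) * x%:E)%E); last first.
  move=> x _; under eq_integral do rewrite EFinM.
  by rewrite integralZl// muleC.
have /fineK <- := integrable_fin_num measurableT iy.
by rewrite integralZl// muleC.
Qed.

(** The joint law of [X] and [Y] is a coupling of their laws. *)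
Lemma wasserstein1_le (X Y : {RV P >-> R}) : intg P (fun w => X w - Y w) ->
  (wasserstein 1 (distribution P X) (distribution P Y) <=
   (mean P (fun w => `|X w - Y w|))%:E)%E.
Proof.
move=> iXY; rewrite meanE; last exact: intg_norm.
have mXY : measurable_fun setT (fun w => (X w, Y w)) by exact: measurable_fun_pair.
pose XY : {mfun Omega >-> (R * R)%type} :=
  HB.pack (fun w => (X w, Y w)) (isMeasurableFun.Build _ _ _ _ _ mXY).
apply: ereal_inf_lbound; exists (distribution P XY).
  by move=> A mA.
rewrite ge0_integral_distribution//.
  rewrite invr1 poweRe1; last first.
    by apply: integral_ge0 => w _; rewrite lee_fin powR_ge0.
  by apply: eq_integral => w _ /=; rewrite powRr1.
apply/measurable_EFinP.
apply: (@measurableT_comp _ _ _ _ _ _ (fun x : R => x `^ 1)).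
    exact: measurable_powR.
by apply: measurableT_comp => //; exact: measurable_funB.
Qed.

End Independence.

(** * Martingale differences and Brownian increments *)

Section MartingaleDifferences.
Context (R : realType) (d : measure_display) (Omega : measurableType d).
Variables (P : probability Omega R) (N : nat) (G : nat -> set (set Omega)).
Hypothesis G_sigma : forall i, (i <= N)%N -> sigma_algebra setT (G i).
Hypothesis G_meas : forall i, (i <= N)%N -> G i `<=` measurable.
Hypothesis G_mono : forall i, (i < N)%N -> G i `<=` G i.+1.

(** Martingale differences without conditional expectations: [D i] has zero mean against every
    square-integrable variable known at index [i]. *)
Definition mdiff (D : nat -> Omega -> R) := forall i, (i < N)%N ->
  [/\ sqint P (D i), measurable_wrt (G i.+1) (D i) &
      forall xi, measurable_wrt (G i) xi -> sqint P xi ->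
        mean P (fun w => xi w * D i w) = 0].

Lemma G_le i j : (i <= j)%N -> (j <= N)%N -> G i `<=` G j.
Proof.
elim: j => [|j IH]; first by rewrite leqn0 => /eqP-> _ ?.
rewrite leq_eqVlt => /orP[/eqP-> _ ?//|]; rewrite ltnS => ij jN.
by apply: subset_trans (IH ij (ltnW jN)) _; exact: G_mono.
Qed.

Lemma mdiff_partial_sum D n : mdiff D -> (n <= N)%N ->
  measurable_wrt (G n) (fun w => \sum_(i < n) D i w) /\
  sqint P (fun w => \sum_(i < n) D i w).
Proof.
move=> mD nN; split; last first.
  by apply: sqint_sum => i iN; have [] := mD i (leq_trans iN nN).
apply: measurable_wrt_sum; first exact: G_sigma.
move=> i iN; have [_ h _] := mD i (leq_trans iN nN).
by apply: measurable_wrtS h; exact: G_le.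
Qed.

Lemma mdiff_sum_sqr D n : mdiff D -> (n <= N)%N ->
  mean P (fun w => (\sum_(i < n) D i w) ^+ 2) =
  \sum_(i < n) mean P (fun w => D i w ^+ 2).
Proof.
move=> mD; elim: n => [|n IH] nN.
  under [X in mean P X]eq_fun do rewrite big_ord0 expr0n.
  by rewrite mean_cst big_ord0.
have [sD _ oD] := mD n nN.
have [mS sS] := mdiff_partial_sum mD (ltnW nN).
rewrite big_ord_recr/= -IH ?(ltnW nN)//.
have -> : (fun w => (\sum_(i < n.+1) D i w) ^+ 2) = (fun w =>
   ((\sum_(i < n) D i w) ^+ 2 + 2 * ((\sum_(i < n) D i w) * D n w)) + D n w ^+ 2).
  by apply/funext => w; rewrite big_ord_recr/=; ring.
have i1 := sqint_intg_sqr sS; have i3 := sqint_intg_sqr sD.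
have i2 := intgZ 2 (sqint_intgM sS sD).
rewrite (meanD (intgD i1 i2) i3) (meanD i1 i2) meanZ; last exact: sqint_intgM.
by rewrite oD// mulr0 addr0.
Qed.

(** A bounded predictable factor moves to the side of the test variable. The maximal inequality uses
    it to stop the partial sums. *)
Lemma mdiff_transform D (theta : nat -> Omega -> R) (k : R) : mdiff D ->
  (forall i, (i < N)%N -> measurable_wrt (G i) (theta i) /\
     forall w, `|theta i w| <= k) ->
  mdiff (fun i w => theta i w * D i w).
Proof.
move=> mD th i iN; have [sD wD oD] := mD i iN; have [mt tk] := th i iN.
have mt' : measurable_fun setT (theta i).
  by apply: measurable_wrt_fun mt; exact/G_meas/ltnW.
split.
- exact: sqint_boundedM sD.
- apply: measurable_wrtM => //; first exact: G_sigma.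
  by apply: measurable_wrtS mt; exact: G_mono.
- move=> xi mxi sxi.
  under [X in mean P X]eq_fun do rewrite mulrA; apply: oD.
    by apply: measurable_wrtM => //; exact/G_sigma/ltnW.
  have := sqint_boundedM mt' tk sxi.
  by under [X in sqint P X -> _]eq_fun do rewrite mulrC.
Qed.

(* Kolmogorov's maximal inequality, by stopping the partial sums at the first
   passage over [l]: [|M'_N|] is then at least [l] on the event considered. *)
Lemma mdiff_maximal D (l : R) : mdiff D -> 0 < l ->
  (P [set w | exists2 i, (i <= N)%N & (l <= `|\sum_(j < i) D j w|)%R] <=
   ((\sum_(i < N) mean P (fun w => (D i w ^+ 2)%R))%R / l ^+ 2)%:E)%E.
Proof.
move=> mD l0; pose M i w : R := \sum_(j < i) D j w.
(* [theta j] will be the indicator that the sums up to index [j] included are all below [l]. It is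
   known at index [j], and multiplying the differences by it stops the sums at the first passage. *)
pose low : R -> R := \1_(~` [set x : R | l <= `|x|]).
pose theta j w : R := \prod_(k < j.+1) low (M k w).
have mlow : measurable_fun setT low.
  apply: measurable_indic; apply: measurableC; rewrite -[X in measurable X]setTI.
  apply: (@measurable_fun_le _ _ _ setT (fun=> l) (fun x : R => `|x|)) => //.
have lowE x : low x = (if `|x| < l then 1 else 0).
  rewrite /low indicE in_setC ltNge; case: (boolP (l <= `|x|)) => h.
    by rewrite mem_set.
  by rewrite memNset//; exact/negP.
have low01 x : 0 <= low x <= 1 by rewrite lowE; case: ifP; rewrite ?ler01 lexx.
have th j w : 0 <= theta j w <= 1.
  rewrite /theta; elim/big_rec: _ => [|i x _ /andP[x0 x1]].
    by rewrite ler01 lexx.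
  have /andP[y0 y1] := low01 (M i w).
  by rewrite mulr_ge0//= mulr_ile1.
have mth i : (i < N)%N -> measurable_wrt (G i) (theta i) /\
    forall w, `|theta i w| <= 1.
  move=> iN; split; last first.
    by move=> w; have /andP[t0 t1] := th i w; rewrite ger0_norm.
  have sG := G_sigma (ltnW iN).
  suff H n : (n <= i.+1)%N ->
    measurable_wrt (G i) (fun w => \prod_(k < n) low (M k w)) by exact: H.
  elim: n => [|n IH] ni.
    under [X in measurable_wrt _ X]eq_fun do rewrite big_ord0.
    exact: measurable_wrt_cst.
  under [X in measurable_wrt _ X]eq_fun do rewrite big_ord_recr/=.
  apply: measurable_wrtM => //; first exact/IH/ltnW.
  apply: (measurable_wrt_comp mlow).
  apply: (measurable_wrtS (@G_le n i ni (ltnW iN))).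
  by have [] := mdiff_partial_sum mD (leq_trans (ltnSE ni) (ltnW iN)).
have mD' := mdiff_transform mD mth.
pose M' n w : R := \sum_(j < n) theta j w * D j w.
(* Until the passage the stopped sum equals the original one; from then on it keeps the value
   reached, of modulus at least [l]. *)
have key n w : ((forall k, (k < n)%N -> `|M k w| < l) /\ M' n w = M n w) \/
    (l <= `|M' n w| /\ exists2 k, (k < n)%N & l <= `|M k w|).
  elim: n => [|n [[IH1 IH2]|[IH1 [k kn kl]]]].
  - by left; split => //; rewrite /M' /M !big_ord0.
  - have [Ml|Ml] := ltP `|M n w| l.
      have A k : (k < n.+1)%N -> `|M k w| < l.
        by rewrite ltnS leq_eqVlt => /orP[/eqP->//|]; exact: IH1.
      left; split => //.
      rewrite /M' /M !big_ord_recr/= -/(M' n w) -/(M n w) IH2; congr (_ + _).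
      by rewrite /theta big1 ?mul1r// => i _; rewrite lowE A.
    right; split; last by exists n.
    rewrite /M' big_ord_recr/= -/(M' n w) IH2.
    rewrite [theta n w](_ : _ = 0) ?mul0r ?addr0//.
    by rewrite /theta big_ord_recr/= lowE ltNge Ml mulr0.
  - right; split; last by exists k => //; exact: leqW.
    rewrite /M' big_ord_recr/= -/(M' n w).
    rewrite [theta n w](_ : _ = 0) ?mul0r ?addr0//.
    have kn1 : (k < n.+1)%N by exact: leqW.
    by rewrite /theta (bigD1 (Ordinal kn1))//= lowE ltNge kl mul0r.
have [mN sN] := mdiff_partial_sum mD' (leqnn N).
have i2 := sqint_intg_sqr sN.
have l2 : 0 < l ^+ 2 by rewrite exprn_gt0.
have := markov_mean i2 l2.
have -> : (fun w => `|(\sum_(i < N) theta i w * D i w) ^+ 2|) =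
          (fun w => (\sum_(i < N) theta i w * D i w) ^+ 2).
  by apply/funext => w; rewrite ger0_norm// sqr_ge0.
rewrite (mdiff_sum_sqr mD' (leqnn N)) => mk.
apply: (le_trans (le_trans _ mk)); last first.
  rewrite lee_fin ler_pM2r ?invr_gt0//; apply: ler_sum => i _.
  have [sD' _ _] := mD' i (ltn_ord i); have [sD _ _] := mD i (ltn_ord i).
  apply: mean_le; [exact: sqint_intg_sqr|exact: sqint_intg_sqr|move=> w].
  rewrite exprMn ler_piMl ?sqr_ge0//.
  by have /andP[t0 t1] := th i w; rewrite exprn_ile1.
apply: le_measure; rewrite ?inE.
- rewrite [X in measurable X](_ : _ =
    \bigcup_(i in [set i | (i <= N)%N]) (M i @^-1` [set x | l <= `|x|])).
    apply: bigcup_measurable => i iN; rewrite -[X in measurable X]setTI.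
    have [_ /sqint_measurable mM] := mdiff_partial_sum mD iN.
    apply: mM => //; rewrite -[X in measurable X]setTI.
    apply: (@measurable_fun_le _ _ _ setT (fun=> l) (fun x : R => `|x|)) => //.
  by apply/seteqP; split=> w /= [i iN h]; exists i.
- rewrite -[X in measurable X]setTI.
  apply: (@measurable_fun_le _ _ _ setT (fun=> l ^+ 2)) => //.
  apply: measurableT_comp; first exact: normr_measurable.
  exact: intg_measurable i2.
- move=> w /= [i iN il]; rewrite ger0_norm ?sqr_ge0//.
  rewrite -[leRHS]real_normK ?num_real// ler_pXn2r ?nnegrE ?(ltW l0)//.
  rewrite -/(M' N w).
  have [[A ->]|[//]] := key N w.
  move: iN; rewrite leq_eqVlt => /orP[/eqP <-//|iN].
  by have := A i iN; rewrite ltNge il.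
Qed.

End MartingaleDifferences.

Lemma integral_normal_law (R : realType) (m : probability R R) (v : R)
    (f : R -> \bar R) :
  (forall A : set R, measurable A -> m A = normal_prob 0 v A) ->
  measurable_fun setT f ->
  (\int[m]_x f x = \int[normal_prob 0 v]_x f x)%E.
Proof.
move=> law mf.
have mid : measurable_fun setT (id : measurableTypeR R -> R).
  by move=> _ A mA; rewrite setTI.
have ge0 (g : R -> \bar R) : measurable_fun setT g -> (forall x, 0 <= g x)%E ->
    (\int[m]_x g x = \int[normal_prob 0 v]_x g x)%E.
  move=> mg g0.
  have := @ge0_integral_pushforward _ _ (measurableTypeR R) R R id mid
    (normal_prob 0 v) setT g measurableT mg (fun x _ => g0 x).
  rewrite preimage_setT => <-.
  by apply: eq_measure_integral => A mA _; exact: law.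
rewrite [LHS]integralE [RHS]integralE !ge0//.
- exact: measurable_funeneg.
- exact: measurable_funepos.
Qed.

(** * Moments and orthogonality of Brownian increments *)

Section BrownianIncrements.
Context (R : realType) (d : measure_display) (Omega : measurableType d).
Variables (P : probability Omega R) (T : R) (F : R -> set (set Omega)).
Variable B : R -> {RV P >-> R}.
Hypothesis F_filtration : filtration T F.
Hypothesis B_brownian : brownian_motion T F B.
Implicit Types (s t : R) (xi : Omega -> R).

Lemma filtration_sigma t : 0 <= t <= T -> sigma_algebra setT (F t).
Proof. by move=> tT; have [/(_ t tT)[]] := F_filtration. Qed.

Lemma filtration_meas t : 0 <= t <= T -> F t `<=` measurable.
Proof. by move=> tT; have [/(_ t tT)[]] := F_filtration. Qed.

Lemma filtration_le s t : 0 <= s -> s <= t -> t <= T -> F s `<=` F t.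
Proof. by have [_] := F_filtration; exact. Qed.

Definition incr s t (w : Omega) : R := B t w - B s w.

Lemma incr_measurable s t : measurable_fun setT (incr s t).
Proof. by apply: measurable_funB; exact: measurable_funP. Qed.

Lemma incr_wrt s t : 0 <= s -> s <= t -> t <= T -> measurable_wrt (F t) (incr s t).
Proof.
move=> s0 st tT; have [adB _ _ _] := B_brownian.
apply: measurable_wrtB; first by apply: filtration_sigma; rewrite (le_trans s0)/=.
  by apply: adB; rewrite (le_trans s0)/=.
apply: (measurable_wrtS (filtration_le s0 st tT)).
by apply: adB; rewrite s0 (le_trans st).
Qed.

Lemma incr_self s : incr s s = (fun=> 0).
Proof. by apply/funext => w; rewrite /incr subrr. Qed.

Lemma ge0_integral_incr s t (g : R -> R) : 0 <= s -> s < t -> t <= T ->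
  measurable_fun setT g -> (forall x, 0 <= g x) ->
  (\int[P]_w (g (incr s t w))%:E =
   \int[normal_prob 0 (Num.sqrt (t - s))]_x (g x)%:E)%E.
Proof.
move=> s0 st tT mg g0; have [_ _ _ /(_ s t s0 st tT)[law _]] := B_brownian.
rewrite -(@ge0_integral_distribution _ _ _ _ _ P (mkRV P (incr_measurable s t))
   (fun x => (g x)%:E))//; last exact/measurable_EFinP.
apply: integral_normal_law; last exact/measurable_EFinP.
by move=> A mA; rewrite -law.
Qed.

Let sd_gt0 s t : s < t -> 0 < Num.sqrt (t - s).
Proof. by move=> st; rewrite sqrtr_gt0 subr_gt0. Qed.

Let ge0_intg (f : Omega -> R) (k : R) : measurable_fun setT f ->
  (forall w, 0 <= f w) -> (\int[P]_w (f w)%:E <= k%:E)%E ->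
  intg P f /\ mean P f <= k.
Proof.
move=> mf f0 fk.
have fi : intg P f.
  apply/integrableP; split; first exact/measurable_EFinP.
  rewrite (eq_integral (EFin \o f)) => [|w _].
    exact: le_lt_trans fk (ltry _).
  by rewrite /= ger0_norm.
by split => //; rewrite -lee_fin meanE.
Qed.

Lemma incr_moment2 s t : 0 <= s -> s <= t -> t <= T ->
  intg P (fun w => incr s t w ^+ 2) /\
  mean P (fun w => incr s t w ^+ 2) <= 8 * (t - s).
Proof.
move=> s0; rewrite le_eqVlt => /orP[/eqP<- tT|st tT].
  rewrite incr_self; under [X in intg P X]eq_fun do rewrite expr0n.
  under [X in mean P X]eq_fun do rewrite expr0n.
  by rewrite mean_cst subrr mulr0; split=> //; exact: intg_cst.
apply: ge0_intg.
- by apply: measurable_funX; exact: incr_measurable.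
- by move=> w; exact: sqr_ge0.
rewrite (@ge0_integral_incr _ _ (fun x => x ^+ 2))//; last by move=> x; exact: sqr_ge0.
apply: (le_trans (normal_prob_moment2 (sd_gt0 st))).
by rewrite sqr_sqrtr// subr_ge0 ltW.
Qed.

Lemma incr_moment4 s t : 0 <= s -> s <= t -> t <= T ->
  intg P (fun w => incr s t w ^+ 4) /\
  mean P (fun w => incr s t w ^+ 4) <= 64 * (t - s) ^+ 2.
Proof.
move=> s0; rewrite le_eqVlt => /orP[/eqP<- tT|st tT].
  rewrite incr_self; under [X in intg P X]eq_fun do rewrite expr0n.
  under [X in mean P X]eq_fun do rewrite expr0n.
  by rewrite mean_cst subrr expr0n mulr0; split=> //; exact: intg_cst.
have f4 (x : R) : 0 <= x ^+ 4 by rewrite (exprM x 2 2) sqr_ge0.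
apply: ge0_intg => //.
- by apply: measurable_funX; exact: incr_measurable.
rewrite (@ge0_integral_incr _ _ (fun x => x ^+ 4))//.
apply: (le_trans (normal_prob_moment4 (sd_gt0 st))).
by rewrite (exprM _ 2 2) sqr_sqrtr// subr_ge0 ltW.
Qed.

(** Interpolation between the second and fourth moments: [y^3 <= (r / 2) y^2 + y^4 / (2 r)] with [r]
    the standard deviation, whence [36 = 8 / 2 + 64 / 2]. *)
Lemma incr_moment3 s t : 0 <= s -> s <= t -> t <= T ->
  intg P (fun w => `|incr s t w| ^+ 3) /\
  mean P (fun w => `|incr s t w| ^+ 3) <= 36 * ((t - s) * Num.sqrt (t - s)).
Proof.
move=> s0; rewrite le_eqVlt => /orP[/eqP<- tT|st tT].
  rewrite incr_self; under [X in intg P X]eq_fun do rewrite normr0 expr0n.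
  under [X in mean P X]eq_fun do rewrite normr0 expr0n.
  by rewrite mean_cst subrr mul0r mulr0; split=> //; exact: intg_cst.
have [i2 m2] := incr_moment2 s0 (ltW st) tT.
have [i4 m4] := incr_moment4 s0 (ltW st) tT.
set r := Num.sqrt (t - s); have r0 : 0 < r := sd_gt0 st.
have rr : t - s = r ^+ 2 by rewrite sqr_sqrtr// subr_ge0 ltW.
have bnd w : `|incr s t w| ^+ 3 <=
    r / 2 * incr s t w ^+ 2 + (2 * r)^-1 * incr s t w ^+ 4.
  set x := incr s t w; rewrite -(@real_normK _ x) ?num_real//.
  rewrite (_ : x ^+ 4 = `|x| ^+ 4); last first.
    by rewrite (exprM x 2 2) -(@real_normK _ x) ?num_real// -exprM.
  set y := `|x|; have y0 : 0 <= y := normr_ge0 x.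
  rewrite -subr_ge0.
  have -> : r / 2 * y ^+ 2 + (2 * r)^-1 * y ^+ 4 - y ^+ 3 =
     (2 * r)^-1 * (y * (y - r)) ^+ 2 by field; rewrite gt_eqF.
  by rewrite mulr_ge0 ?sqr_ge0// invr_ge0 mulr_ge0// ltW.
have iU := intgD (intgZ (r / 2) i2) (intgZ (2 * r)^-1 i4).
have i3 : intg P (fun w => `|incr s t w| ^+ 3).
  apply: intg_le iU _.
    apply: measurable_funX; apply: measurableT_comp => //.
    exact: incr_measurable.
  by move=> w; rewrite ger0_norm ?exprn_ge0//; exact: bnd.
split => //; apply: le_trans (mean_le i3 iU bnd) _.
rewrite meanD; [|exact: intgZ|exact: intgZ].
rewrite !meanZ// rr.
have -> : 36 * (r ^+ 2 * r) = r / 2 * (8 * r ^+ 2) + (2 * r)^-1 * (64 * (r ^+ 2) ^+ 2).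
  by field; rewrite gt_eqF.
rewrite -rr; apply: lerD; apply: ler_wpM2l => //.
  by rewrite divr_ge0// ltW.
by rewrite invr_ge0 mulr_ge0// ltW.
Qed.

Lemma incr_sqint s t : 0 <= s -> s <= t -> t <= T -> sqint P (incr s t).
Proof.
by move=> s0 st tT; split; [exact: incr_measurable|have [] := incr_moment2 s0 st tT].
Qed.

Lemma incr_mean s t : 0 <= s -> s <= t -> t <= T -> mean P (incr s t) = 0.
Proof.
move=> s0; rewrite le_eqVlt => /orP[/eqP<- tT|st tT].
  by rewrite incr_self mean_cst.
have fi := sqint_intg (incr_sqint s0 (ltW st) tT).
have [_ _ _ /(_ s t s0 st tT)[law _]] := B_brownian.
apply: EFin_inj; rewrite meanE//; apply: etrans (normal_prob_mean (sd_gt0 st)).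
rewrite -(@integral_distribution _ _ _ _ _ P (mkRV P (incr_measurable s t)) EFin)//.
apply: integral_normal_law; last exact/measurable_EFinP.
by move=> A mA; rewrite -law.
Qed.

Lemma incr_independent s t xi (g : R -> R) : 0 <= s -> s <= t -> t <= T ->
  measurable_wrt (F s) xi -> intg P xi ->
  measurable_fun setT g -> intg P (fun w => g (incr s t w)) ->
  intg P (fun w => xi w * g (incr s t w)) /\
  mean P (fun w => xi w * g (incr s t w)) =
    mean P xi * mean P (fun w => g (incr s t w)).
Proof.
move=> s0; rewrite le_eqVlt => /orP[/eqP<- tT|st tT] mxi ixi mg ig.
  rewrite incr_self mean_cst mulrC.
  under [X in intg P X]eq_fun do rewrite mulrC.
  under [X in mean P X]eq_fun do rewrite mulrC.
  by rewrite meanZ//; split=> //; exact: intgZ.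
have [_ _ _ /(_ s t s0 st tT)[_ ind]] := B_brownian.
apply: independent_mean_mul => // U V mU mV.
have mgV : measurable (g @^-1` V) by rewrite -[X in measurable X]setTI; exact: mg.
exact: (ind _ _ (mxi U mU) mgV).
Qed.

Lemma incr_orth s t xi : 0 <= s -> s <= t -> t <= T ->
  measurable_wrt (F s) xi -> intg P xi -> mean P (fun w => xi w * incr s t w) = 0.
Proof.
move=> s0 st tT mxi ixi.
have [_ ->] := @incr_independent s t xi id s0 st tT mxi ixi (@measurable_id _ _ _)
  (sqint_intg (incr_sqint s0 st tT)).
by rewrite (incr_mean s0 st tT) mulr0.
Qed.

Lemma incr_mul_sqr s t xi : 0 <= s -> s <= t -> t <= T ->
  measurable_wrt (F s) xi -> (forall w, 0 <= xi w) -> intg P xi ->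
  intg P (fun w => xi w * incr s t w ^+ 2) /\
  mean P (fun w => xi w * incr s t w ^+ 2) <= 8 * (t - s) * mean P xi.
Proof.
move=> s0 st tT mxi xi0 ixi; have [i2 m2] := incr_moment2 s0 st tT.
have [ii ->] := @incr_independent s t xi (fun x => x ^+ 2) s0 st tT mxi ixi
  (@exprn_measurable R setT 2) i2.
by split => //; rewrite [leRHS]mulrC ler_wpM2l//; exact: mean_ge0.
Qed.

(** Measurability of [xi] is asked for on proper steps only. Partitions stopped at a given time have
    flat steps, on which the coefficient may not be known yet but the increment vanishes. *)
Lemma incr_mul_sqint s t xi : 0 <= s -> s <= t -> t <= T ->
  (s < t -> measurable_wrt (F s) xi) -> sqint P xi ->
  sqint P (fun w => xi w * incr s t w) /\
  mean P (fun w => (xi w * incr s t w) ^+ 2) <=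
    8 * (t - s) * mean P (fun w => xi w ^+ 2).
Proof.
move=> s0; rewrite le_eqVlt => /orP[/eqP<- tT _ sxi|st tT /(_ st) mxi sxi].
  rewrite incr_self; under [X in sqint P X]eq_fun do rewrite mulr0.
  under [X in mean P X]eq_fun do rewrite mulr0 expr0n.
  by rewrite subrr mulr0 mul0r mean_cst; split => //; exact: sqint_cst.
have mx2 : measurable_wrt (F s) (fun w => xi w ^+ 2).
  exact: (measurable_wrt_comp (@exprn_measurable R setT 2) mxi).
have [i m] := incr_mul_sqr s0 (ltW st) tT mx2 (fun w => sqr_ge0 _) (sqint_intg_sqr sxi).
split; last by under [X in mean P X]eq_fun do rewrite exprMn.
split; last by under [X in intg P X]eq_fun do rewrite exprMn.
by apply: measurable_funM; [have [] := sxi|exact: incr_measurable].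
Qed.

Section Chain.
Variables (N : nat) (c : nat -> R) (a : nat -> Omega -> R).
Hypothesis c_ge0 : 0 <= c 0%N.
Hypothesis c_le : forall i, (i < N)%N -> c i <= c i.+1.
Hypothesis c_T : c N <= T.
Hypothesis a_wrt : forall i, (i < N)%N -> c i < c i.+1 ->
  measurable_wrt (F (c i)) (a i).
Hypothesis a_sqint : forall i, (i < N)%N -> sqint P (a i).

Lemma chain_le i j : (i <= j)%N -> (j <= N)%N -> c i <= c j.
Proof.
elim: j => [|j IH]; first by rewrite leqn0 => /eqP->.
rewrite leq_eqVlt => /orP[/eqP->//|]; rewrite ltnS => ij jN.
by apply: le_trans (IH ij (ltnW jN)) _; exact: c_le.
Qed.

Lemma chain_itv i : (i <= N)%N -> 0 <= c i <= T.
Proof.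
move=> iN; apply/andP; split; first exact: le_trans c_ge0 (chain_le _ iN).
exact: le_trans (chain_le iN _) c_T.
Qed.

Lemma chain_sigma i : (i <= N)%N -> sigma_algebra setT (F (c i)).
Proof. by move=> iN; exact/filtration_sigma/chain_itv. Qed.

Lemma chain_meas i : (i <= N)%N -> F (c i) `<=` measurable.
Proof. by move=> iN; exact/filtration_meas/chain_itv. Qed.

Lemma chain_mono i : (i < N)%N -> F (c i) `<=` F (c i.+1).
Proof.
move=> iN; have /andP[? _] := chain_itv (ltnW iN).
by have /andP[_ ?] := chain_itv iN; apply: filtration_le => //; exact: c_le.
Qed.

Lemma chain_mdiff :
  mdiff P N (fun i => F (c i)) (fun i w => a i w * incr (c i) (c i.+1) w).
Proof.
move=> i iN; have /andP[ci0 _] := chain_itv (ltnW iN).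
have /andP[_ ciT] := chain_itv iN; have cc := c_le iN.
have [sq _] := incr_mul_sqint ci0 cc ciT (a_wrt iN) (a_sqint iN).
split => //.
  move: cc; rewrite le_eqVlt => /orP[/eqP E|cc].
    rewrite -E incr_self.
    under [X in measurable_wrt _ X]eq_fun do rewrite mulr0.
    by apply: measurable_wrt_cst; exact/chain_sigma/ltnW.
  apply: measurable_wrtM; first exact: chain_sigma.
    by apply: (measurable_wrtS (chain_mono iN)); exact: a_wrt.
  by apply: incr_wrt => //; exact: ltW.
move=> xi mxi sxi; move: cc; rewrite le_eqVlt => /orP[/eqP E|cc].
  by rewrite -E incr_self; under [X in mean P X]eq_fun do rewrite !mulr0;
    rewrite mean_cst.
under [X in mean P X]eq_fun do rewrite mulrA.
apply: incr_orth => //; first exact: ltW.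
  apply: measurable_wrtM => //; first exact/chain_sigma/ltnW.
  exact: a_wrt.
by apply: sqint_intgM => //; exact: a_sqint.
Qed.

(** Ito's isometry as an inequality, with the constant 8 of the second moment bound: orthogonality
    of the differences makes the mean square of the sum additive. *)
Lemma chain_isometry_le :
  sqint P (fun w => \sum_(i < N) a i w * incr (c i) (c i.+1) w) /\
  mean P (fun w => (\sum_(i < N) a i w * incr (c i) (c i.+1) w) ^+ 2) <=
  \sum_(i < N) 8 * (c i.+1 - c i) * mean P (fun w => a i w ^+ 2).
Proof.
have [_ sq] := mdiff_partial_sum chain_sigma chain_mono chain_mdiff (leqnn N).
split => //.
rewrite (mdiff_sum_sqr chain_sigma chain_mono chain_mdiff (leqnn N)).
apply: ler_sum => i _; have iN := ltn_ord i.
have /andP[ci0 _] := chain_itv (ltnW iN).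
have /andP[_ ciT] := chain_itv iN; have cc := c_le iN.
by have [_] := incr_mul_sqint ci0 cc ciT (a_wrt iN) (a_sqint iN).
Qed.

End Chain.

End BrownianIncrements.

(** * Growth of the mean distance *)

Section MeasurableSabs.
Variables (R : realType) (a : R).
Hypothesis a0 : 0 < a.

Lemma measurable_sabs : measurable_fun setT (@sabs R a).
Proof.
apply: continuous_measurable_fun => z; apply/cvgrPdist_le => e e0.
near=> y; rewrite distrC.
have := sabs_lipschitz z (y - z) a0; rewrite (_ : z + (y - z) = y); last by ring.
move=> /le_trans; apply.
near: y; apply/nbhs_ballP; exists e => //= y; rewrite /ball/= distrC.
exact: ltW.
Unshelve. all: by end_near. Qed.

Lemma measurable_dsabs : measurable_fun setT (@dsabs R a).
Proof.
apply: continuous_measurable_fun => z; apply/cvgrPdist_le => e e0.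
near=> y; rewrite distrC.
have := dsabs_lipschitz z (y - z) a0; rewrite (_ : z + (y - z) = y); last by ring.
move=> /le_trans; apply.
rewrite ler_pdivrMr// -ler_pdivlMl//.
near: y; apply/nbhs_ballP; exists (2^-1 * (e * a)) => /=.
  by rewrite !mulr_gt0.
by move=> y; rewrite /ball/= distrC => /ltW.
Unshelve. all: by end_near. Qed.

Lemma measurable_ddsabs : measurable_fun setT (@ddsabs R a).
Proof.
rewrite /ddsabs; apply: measurable_funM => //.
apply: (@measurable_comp _ _ _ _ _ _ [set x : R | x != 0] (fun x : R => x^-1)).
- rewrite (_ : [set x : R | x != 0] = ~` [set 0]); last first.
    by apply/seteqP; split => x /=; [move/eqP|move=> h; apply/eqP].
  exact: measurableC.
- move=> _ [z _ <-] /=; rewrite expf_neq0// gt_eqF// sabs_gt0//.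
- apply: open_continuous_measurable_fun.
    exact: open_neq.
  by move=> x; rewrite inE/= => x0; exact: inv_continuous.
- by apply: measurable_funX; exact: measurable_sabs.
Qed.

End MeasurableSabs.

Section ErrorEstimate.
Context (R : realType) (d : measure_display) (Omega : measurableType d).
Variables (P : probability Omega R) (T : R) (F : R -> set (set Omega)).
Variable B : R -> {RV P >-> R}.
Hypothesis F_filtration : filtration T F.
Hypothesis B_brownian : brownian_motion T F B.
Variables (N : nat) (c : nat -> R) (delta eps H K : R).
Hypothesis c_ge0 : 0 <= c 0%N.
Hypothesis c_le : forall i, (i < N)%N -> c i <= c i.+1.
Hypothesis c_T : c N <= T.
Hypothesis c_step : forall i, (i < N)%N -> c i.+1 - c i <= delta.
Hypothesis eps_gt0 : 0 < eps.
Hypothesis H_ge0 : 0 <= H.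
Hypothesis K_ge0 : 0 <= K.
Variables Z beta h m : nat -> Omega -> R.
Hypothesis Z_wrt : forall i, (i <= N)%N -> measurable_wrt (F (c i)) (Z i).
Hypothesis Z_sqint : forall i, (i <= N)%N -> sqint P (Z i).
Hypothesis beta_intg : forall i, (i < N)%N -> intg P (beta i).
Hypothesis h_wrt : forall i, (i < N)%N -> measurable_wrt (F (c i)) (h i).
Hypothesis h_le : forall i w, (i < N)%N -> `|h i w| <= H.
Hypothesis h_Z : forall i w, (i < N)%N -> h i w ^+ 2 <= K * `|Z i w|.
Hypothesis m_mdiff : mdiff P N (fun i => F (c i)) m.
Hypothesis m_small : forall i, (i < N)%N ->
  mean P (fun w => m i w ^+ 2) <= eps ^+ 2 * (c i.+1 - c i).
Hypothesis Z_step : forall i w, (i < N)%N ->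
  Z i.+1 w = Z i w + beta i w + h i w * incr B (c i) (c i.+1) w + m i w.

(** Error per unit of time at scale [a]. The first term is the cubic Taylor remainder, with
    [108 = 3 * 36] from the third moment; the second is Young's cross term with weight [eps]; the
    third is the square of the martingale remainder. *)
Definition step_error (a : R) : R :=
  108 * H ^+ 3 * Num.sqrt delta / a ^+ 2 + eps * (8 * H ^+ 2 + 1) / a
  + eps ^+ 2 / (2 * a).

Lemma sabs_comp_intg a (f : Omega -> R) : 0 < a -> sqint P f ->
  intg P (fun w => sabs a (f w)).
Proof.
move=> a0 sf; apply: (intg_le _ (intgD (intg_norm (sqint_intg sf)) (intg_cst P a))).
  exact: (measurableT_comp (measurable_sabs a0) (sqint_measurable sf)).
by move=> w; rewrite ger0_norm ?sabs_ge0// sabs_le// ltW.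
Qed.

(** The terms of first order in the Brownian increment and in [m] have zero mean, being multiplied
    by variables known at the start of the step. The factor 4 is half of the second moment constant
    8. *)
Lemma sabs_mean_step a i : 0 < a -> (i < N)%N ->
  mean P (fun w => sabs a (Z i.+1 w)) <=
  mean P (fun w => sabs a (Z i w)) + mean P (fun w => `|beta i w|)
  + 4 * (c i.+1 - c i) * mean P (fun w => ddsabs a (Z i w) * h i w ^+ 2)
  + (c i.+1 - c i) * step_error a.
Proof.
move=> a0 iN.
have /andP[ci0 _] := chain_itv c_ge0 c_le c_T (ltnW iN).
have /andP[_ ciT] := chain_itv c_ge0 c_le c_T iN.
have cc := c_le iN; set D := c i.+1 - c i; set I := incr B (c i) (c i.+1).
have D0 : 0 <= D by rewrite subr_ge0.
have sG : sigma_algebra setT (F (c i)).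
  by apply: (filtration_sigma F_filtration); rewrite ci0 (le_trans cc).
have mF : F (c i) `<=` measurable.
  by apply: (filtration_meas F_filtration); rewrite ci0 (le_trans cc).
have Zw := Z_wrt (ltnW iN); have Zs := Z_sqint (ltnW iN).
have hw := h_wrt iN; have hm := measurable_wrt_fun mF hw.
have [ms _ mo] := m_mdiff iN.
have dZw : measurable_wrt (F (c i)) (fun w => dsabs a (Z i w)).
  exact: measurable_wrt_comp (measurable_dsabs a0) Zw.
have dZm := measurable_wrt_fun mF dZw.
have dZ1 w : `|dsabs a (Z i w)| <= 1 by exact: dsabs_le1.
have ddZw : measurable_wrt (F (c i)) (fun w => ddsabs a (Z i w)).
  exact: measurable_wrt_comp (measurable_ddsabs a0) Zw.
have h2w : measurable_wrt (F (c i)) (fun w => h i w ^+ 2).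
  exact: measurable_wrt_comp (@exprn_measurable R setT 2) hw.
have hs : sqint P (h i) by exact: (sqint_bounded P hm (fun w => h_le w iN)).
have h2i : intg P (fun w => h i w ^+ 2) by case: hs.
have ddh_i : intg P (fun w => ddsabs a (Z i w) * h i w ^+ 2).
  apply: (@intg_boundedM _ _ _ _ a^-1) => //.
    exact: measurable_wrt_fun ddZw.
  by move=> w; rewrite ger0_norm ?ddsabs_ge0 ?ddsabs_le.
have [ddhI_i ddhI_m] : intg P (fun w => (ddsabs a (Z i w) * h i w ^+ 2) * I w ^+ 2) /\
    mean P (fun w => (ddsabs a (Z i w) * h i w ^+ 2) * I w ^+ 2) <=
    8 * D * mean P (fun w => ddsabs a (Z i w) * h i w ^+ 2).
  apply: (incr_mul_sqr B_brownian) => //.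
    exact: measurable_wrtM.
  by move=> w; rewrite mulr_ge0 ?ddsabs_ge0 ?sqr_ge0.
have [hI_s hI_m] := incr_mul_sqint B_brownian ci0 cc ciT (fun _ => hw) hs.
have h2H : mean P (fun w => h i w ^+ 2) <= H ^+ 2.
  rewrite -[leRHS](mean_cst P); apply: mean_le => //; first exact: intg_cst.
  move=> w; rewrite -[leLHS]real_normK ?num_real// ler_pXn2r ?nnegrE//.
  exact: h_le.
have {hI_m} hI_m : mean P (fun w => (h i w * I w) ^+ 2) <= 8 * D * H ^+ 2.
  by apply: (le_trans hI_m); rewrite ler_wpM2l// mulr_ge0.
have [I3_i I3_m] := incr_moment3 B_brownian ci0 cc ciT.
have hI3_i : intg P (fun w => `|h i w * I w| ^+ 3).
  apply: (intg_le _ (intgZ (H ^+ 3) I3_i)).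
    apply: measurable_funX; apply: measurableT_comp; first exact: normr_measurable.
    by case: hI_s.
  move=> w; rewrite ger0_norm ?exprn_ge0// normrM exprMn ler_wpM2r ?exprn_ge0//.
  by rewrite ler_pXn2r ?nnegrE// h_le.
have hI3_m : mean P (fun w => `|h i w * I w| ^+ 3) <=
    H ^+ 3 * (36 * (D * Num.sqrt delta)).
  apply: (@le_trans _ _ (mean P (fun w => H ^+ 3 * `|I w| ^+ 3))).
    apply: mean_le => //; first exact: intgZ.
    move=> w; rewrite normrM exprMn ler_wpM2r ?exprn_ge0//.
    by rewrite ler_pXn2r ?nnegrE// h_le.
  rewrite meanZ// ler_wpM2l ?exprn_ge0//; apply: (le_trans I3_m).
  by rewrite ler_pM2l// ler_wpM2l// ler_wsqrtr// c_step.
have dhI_i : intg P (fun w => dsabs a (Z i w) * (h i w * I w)).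
  exact: intg_boundedM dZm dZ1 (sqint_intg hI_s).
have dhI_m : mean P (fun w => dsabs a (Z i w) * (h i w * I w)) = 0.
  under [X in mean P X]eq_fun do rewrite mulrA.
  apply: (incr_orth B_brownian) => //; first exact: measurable_wrtM.
  exact: intg_boundedM dZm dZ1 (sqint_intg hs).
have dm_i : intg P (fun w => dsabs a (Z i w) * m i w).
  exact: intg_boundedM dZm dZ1 (sqint_intg ms).
have dm_m : mean P (fun w => dsabs a (Z i w) * m i w) = 0.
  by apply: mo => //; exact: sqint_bounded dZm dZ1.
have m2_i : intg P (fun w => m i w ^+ 2) by case: ms.
have hI2_i : intg P (fun w => (h i w * I w) ^+ 2) by case: hI_s.
have beta_i := intg_norm (beta_intg iN).
have sZ_i := sabs_comp_intg a0 Zs.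
have sZ1_i := sabs_comp_intg a0 (Z_sqint iN).
(* The right-hand side of [sabs_step], taken with [l = eps], is rebuilt one term at a time so that
   each mean can be split off. *)
pose t1 w := sabs a (Z i w) + `|beta i w|.
pose t2 w := t1 w + dsabs a (Z i w) * (h i w * I w).
pose t3 w := t2 w + 2^-1 * ((ddsabs a (Z i w) * h i w ^+ 2) * I w ^+ 2).
pose t4 w := t3 w + 3 / a ^+ 2 * `|h i w * I w| ^+ 3.
pose t5 w := t4 w + dsabs a (Z i w) * m i w.
pose t6 w := t5 w + eps / a * (h i w * I w) ^+ 2.
pose t7 w := t6 w + ((eps * a)^-1 + (2 * a)^-1) * m i w ^+ 2.
have i1 : intg P t1 by exact: intgD.
have i2 : intg P t2 by exact: intgD.
have i3 : intg P t3 by apply: intgD => //; exact: intgZ.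
have i4 : intg P t4 by apply: intgD => //; exact: intgZ.
have i5 : intg P t5 by exact: intgD.
have i6 : intg P t6 by apply: intgD => //; exact: intgZ.
have i7 : intg P t7 by apply: intgD => //; exact: intgZ.
have le7 : mean P (fun w => sabs a (Z i.+1 w)) <= mean P t7.
  apply: mean_le => // w; rewrite Z_step//.
  apply: (le_trans (sabs_step _ _ _ _ a0 eps_gt0)).
  rewrite le_eqVlt; apply/orP; left; apply/eqP.
  rewrite /t7 /t6 /t5 /t4 /t3 /t2 /t1 -/I.
  by field; rewrite !gt_eqF.
apply: (le_trans le7).
rewrite /t7 meanD//; last exact: intgZ.
rewrite meanZ// /t6 meanD//; last exact: intgZ.
rewrite meanZ// /t5 meanD// dm_m addr0 /t4 meanD//; last exact: intgZ.
rewrite meanZ// /t3 meanD//; last exact: intgZ.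
rewrite meanZ// /t2 meanD// dhI_m addr0 /t1 meanD//.
have b1 : 2^-1 * mean P (fun w => (ddsabs a (Z i w) * h i w ^+ 2) * I w ^+ 2) <=
    4 * D * mean P (fun w => ddsabs a (Z i w) * h i w ^+ 2).
  have -> : 4 * D * mean P (fun w => ddsabs a (Z i w) * h i w ^+ 2) =
    2^-1 * (8 * D * mean P (fun w => ddsabs a (Z i w) * h i w ^+ 2)) by field.
  by rewrite ler_wpM2l.
have b2 : 3 / a ^+ 2 * mean P (fun w => `|h i w * I w| ^+ 3) <=
   D * (108 * H ^+ 3 * Num.sqrt delta / a ^+ 2).
  have -> : D * (108 * H ^+ 3 * Num.sqrt delta / a ^+ 2) =
    3 / a ^+ 2 * (H ^+ 3 * (36 * (D * Num.sqrt delta))).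
    by field; rewrite gt_eqF.
  by rewrite ler_wpM2l// divr_ge0// sqr_ge0.
have b3 : eps / a * mean P (fun w => (h i w * I w) ^+ 2) <= eps / a * (8 * D * H ^+ 2).
  by rewrite ler_wpM2l// divr_ge0// ltW.
have b4 : ((eps * a)^-1 + (2 * a)^-1) * mean P (fun w => m i w ^+ 2) <=
   ((eps * a)^-1 + (2 * a)^-1) * (eps ^+ 2 * D).
  rewrite ler_wpM2l//; last exact: m_small.
  by rewrite addr_ge0// invr_ge0 mulr_ge0// ltW.
have E : D * step_error a = D * (108 * H ^+ 3 * Num.sqrt delta / a ^+ 2) +
  eps / a * (8 * D * H ^+ 2) + ((eps * a)^-1 + (2 * a)^-1) * (eps ^+ 2 * D).
  by rewrite /step_error; field; rewrite !gt_eqF.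
rewrite E; move: b1 b2 b3 b4.
set x1 := 2^-1 * _; set x2 := 3 / _ * _; set x3 := eps / a * mean _ _.
set x4 := _ * mean P (fun w => m i w ^+ 2).
set y1 := 4 * D * _; set y2 := D * _; set y3 := eps / a * _; set y4 := _ * (eps ^+ 2 * D).
set u := mean P (fun w => sabs a (Z i w)); set v := mean P _.
by lra.
Qed.

Lemma step_error_antimono a a' : 0 < a -> a <= a' -> step_error a' <= step_error a.
Proof.
move=> a0 aa'; have a'0 := lt_le_trans a0 aa'.
have q : a'^-1 <= a^-1 by rewrite lef_pV2.
rewrite /step_error; apply: lerD; first apply: lerD.
- rewrite ler_wpM2l// ?mulr_ge0 ?exprn_ge0 ?sqrtr_ge0//.
  by rewrite lef_pV2 ?posrE ?exprn_gt0// ler_pXn2r// nnegrE ltW.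
- by rewrite ler_wpM2l// mulr_ge0 ?(ltW eps_gt0)// addr_ge0// mulr_ge0// sqr_ge0.
- rewrite ler_wpM2l ?sqr_ge0// lef_pV2 ?posrE ?mulr_gt0//.
  by rewrite ler_wpM2l.
Qed.

(** Since [h^2 <= K |Z|], the second-order terms of all [k] scales together contribute at most
    [4 * 4K] per unit of time, where a single scale would already cost a fixed amount; division by
    [k] leaves [16 K / k]. The step error is taken at the smallest scale, where it is largest. *)
Lemma mean_error_le a k n : 0 < a -> (0 < k)%N -> (n <= N)%N ->
  mean P (fun w => `|Z n w|) <= mean P (fun w => `|Z 0%N w|) + a
  + (c n - c 0%N) * (16 * K / k%:R + step_error (a / 2 ^+ k))
  + \sum_(i < n) mean P (fun w => `|beta i w|).
Proof.
move=> a0 k0 nN.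
pose aj j : R := a / 2 ^+ j.
have aj0 j : 0 < aj j by rewrite divr_gt0// exprn_gt0.
have kR : 0 < k%:R :> R by rewrite ltr0n.
pose phi i := \sum_(j < k) mean P (fun w => sabs (aj j) (Z i w)).
have phi_ge i : (i <= N)%N -> k%:R * mean P (fun w => `|Z i w|) <= phi i.
  move=> iN; rewrite mulr_natl -[k in X in X <= _]card_ord -sumr_const.
  apply: ler_sum => j _; apply: mean_le.
  - exact/intg_norm/sqint_intg/Z_sqint.
  - exact/sabs_comp_intg/Z_sqint.
  - by move=> w; exact: normr_le_sabs.
have phi0 : phi 0%N <= k%:R * (mean P (fun w => `|Z 0%N w|) + a).
  rewrite mulr_natl -[k in X in _ <= X]card_ord -sumr_const.
  have iZ := intg_norm (sqint_intg (Z_sqint (leq0n N))).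
  apply: ler_sum => j _; rewrite -[X in _ <= _ + X](mean_cst P) -meanD//; last exact: intg_cst.
  apply: mean_le; [exact/sabs_comp_intg/Z_sqint|by apply: intgD => //; exact: intg_cst|].
  move=> w; apply: (le_trans (sabs_le _ (ltW (aj0 j)))); rewrite lerD2l.
  by rewrite ler_pdivrMr ?exprn_gt0// ler_peMr ?(ltW a0)// exprn_ege1// ler1n.
have stepk i : (i < N)%N -> phi i.+1 <= phi i + k%:R * (mean P (fun w => `|beta i w|)
    + (c i.+1 - c i) * (16 * K / k%:R + step_error (a / 2 ^+ k))).
  move=> iN; have D0 : 0 <= c i.+1 - c i by rewrite subr_ge0 c_le.
  set D := c i.+1 - c i.
  have ddh : \sum_(j < k) mean P (fun w => ddsabs (aj j) (Z i w) * h i w ^+ 2) <= 4 * K.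
    have ii j : (j < k)%N -> intg P (fun w => ddsabs (aj j) (Z i w) * h i w ^+ 2).
      move=> _.
      have cT : 0 <= c i <= T by apply: (chain_itv c_ge0 c_le c_T); exact: ltnW.
      have mF := filtration_meas F_filtration cT.
      apply: (@intg_boundedM _ _ _ _ (aj j)^-1).
      - apply: measurable_wrt_fun mF _.
        apply: measurable_wrt_comp (measurable_ddsabs (aj0 j)) _.
        exact/Z_wrt/ltnW.
      - by move=> w; rewrite ger0_norm ?ddsabs_ge0 ?ddsabs_le.
      - apply: sqint_intg_sqr.
        exact: (sqint_bounded P (measurable_wrt_fun mF (h_wrt iN))
          (fun w => h_le w iN)).
    rewrite -(@mean_sum _ _ _ P k (fun j w => ddsabs (aj j) (Z i w) * h i w ^+ 2))//.
    rewrite -[leRHS](mean_cst P); apply: mean_le.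
    - exact: (@intg_sum _ _ _ P k (fun j w => ddsabs (aj j) (Z i w) * h i w ^+ 2)).
    - exact: intg_cst.
    move=> w; apply: (@le_trans _ _ (\sum_(j < k) K * (`|Z i w| * ddsabs (aj j) (Z i w)))).
      apply: ler_sum => j _; rewrite mulrC [leRHS]mulrA ler_wpM2r ?ddsabs_ge0//.
      exact: h_Z.
    by rewrite -mulr_sumr mulrC ler_wpM2r// sum_ddsabs_le.
  apply: (@le_trans _ _ (\sum_(j < k) (mean P (fun w => sabs (aj j) (Z i w))
     + mean P (fun w => `|beta i w|)
     + 4 * D * mean P (fun w => ddsabs (aj j) (Z i w) * h i w ^+ 2)
     + D * step_error (a / 2 ^+ k)))).
    apply: ler_sum => j _; apply: (le_trans (sabs_mean_step (aj0 j) iN)).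
    rewrite lerD2l ler_wpM2l//; apply: step_error_antimono; first exact: aj0.
    rewrite ler_pM2l// lef_pV2 ?posrE ?exprn_gt0//.
    by rewrite ler_weXn2l ?ler1n// ltnW.
  rewrite !big_split/= !sumr_const card_ord -/(phi i) -mulr_sumr.
  set S := \sum_(j < k) _; set b := mean P (fun w => `|beta i w|).
  set e := step_error (a / 2 ^+ k).
  rewrite -(mulr_natl b k) -(mulr_natl (D * e) k).
  have : 4 * D * S <= 4 * D * (4 * K) by rewrite ler_wpM2l// mulr_ge0.
  have -> : k%:R * (b + D * (16 * K / k%:R + e)) =
    k%:R * b + 4 * D * (4 * K) + k%:R * (D * e) by field; rewrite gt_eqF.
  by move=> h4; lra.
have : phi n <= k%:R * (mean P (fun w => `|Z 0%N w|) + a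
  + (c n - c 0%N) * (16 * K / k%:R + step_error (a / 2 ^+ k))
  + \sum_(i < n) mean P (fun w => `|beta i w|)).
  elim: n nN => [|n IH] nN.
    by rewrite subrr mul0r big_ord0 !addr0.
  apply: (le_trans (stepk n nN)); have := IH (ltnW nN).
  rewrite big_ord_recr/=; set e := 16 * K / _ + _; set S := \sum_(i < n) _.
  set b := mean P (fun w => `|beta n w|); set z := mean P _ + a.
  have -> : k%:R * (z + (c n.+1 - c 0%N) * e + (S + b)) =
    k%:R * (z + (c n - c 0%N) * e + S) + k%:R * (b + (c n.+1 - c n) * e) by ring.
  by rewrite lerD2r.
move=> /(le_trans (phi_ge n nN)); rewrite ler_pM2l//.
Qed.

End ErrorEstimate.

(** The order of choice matters: [a] bounds the smoothing error, then [k] the averaged second-order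
    term, and only then [eps], since the step error at scale [a / 2 ^ k] deteriorates with [k]. *)
Lemma step_error_small (R : realType) (T H K theta : R) :
  0 < T -> 0 <= H -> 0 <= K -> 0 < theta ->
  exists (a : R) (k : nat) (eps : R), [/\ 0 < a, (0 < k)%N, 0 < eps &
    a + T * (16 * K / k%:R + step_error eps eps H (a / 2 ^+ k)) <= theta].
Proof.
move=> T0 H0 K0 t0.
pose a := theta / 3.
have a0 : 0 < a by rewrite divr_gt0.
pose k := (Num.truncn (T * (16 * K) / a)).+1.
have kR : 0 < k%:R :> R by rewrite ltr0n.
have kK : T * (16 * K / k%:R) <= a.
  rewrite mulrA ler_pdivrMr// [leRHS]mulrC -ler_pdivrMr//.
  by rewrite ltW// truncnS_gt.
pose A := a / 2 ^+ k; have A0 : 0 < A by rewrite divr_gt0// exprn_gt0.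
pose Q := 108 * H ^+ 3 / A ^+ 2 + (8 * H ^+ 2 + 1) / A + (2 * A)^-1.
have Q0 : 0 < Q.
  rewrite ltr_wpDl// ?invr_gt0 ?mulr_gt0// addr_ge0//.
    by rewrite divr_ge0 ?sqr_ge0// mulr_ge0// exprn_ge0.
  by rewrite divr_ge0 ?(ltW A0)// addr_ge0// mulr_ge0// sqr_ge0.
(* The witness is [eps = q^2], with the mesh bound [delta] equal to [eps]: the square root of
   [delta] is then [q], and [q <= 1] bounds the other powers by [q]. *)
pose q := Num.min 1 (a / (T * Q)).
have q0 : 0 < q by rewrite lt_min ltr01 divr_gt0// mulr_gt0.
have q1 : q <= 1 by rewrite ge_min lexx.
have qQ : T * (q * Q) <= a.
  rewrite mulrCA -ler_pdivlMr ?mulr_gt0//.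
  by rewrite ge_min lexx orbT.
exists a, k, (q ^+ 2); split => //; first by rewrite exprn_gt0.
suff h : step_error (q ^+ 2) (q ^+ 2) H A <= q * Q.
  have h2 : T * step_error (q ^+ 2) (q ^+ 2) H A <= T * (q * Q).
    by rewrite ler_wpM2l// ltW.
  rewrite -/A [T * (_ + _)]mulrDr (_ : theta = a + a + a); last by rewrite /a; field.
  move: (le_trans h2 qQ) kK; set u := T * _; set v := T * _; lra.
rewrite /step_error sqrtr_sqr (gtr0_norm q0).
have q2 : q ^+ 2 <= q by rewrite expr2 ler_piMr// ltW.
have q4 : (q ^+ 2) ^+ 2 <= q.
  have q21 := le_trans q2 q1.
  by apply: le_trans q2; rewrite expr2 ler_piMl ?sqr_ge0.
have -> : q * Q = q * (108 * H ^+ 3 / A ^+ 2) + q * ((8 * H ^+ 2 + 1) / A)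
  + q / (2 * A) by rewrite /Q; ring.
apply: lerD; first apply: lerD.
- by rewrite mulrAC mulrC mulrA.
- by rewrite -mulrA ler_wpM2r// divr_ge0 ?(ltW A0)// addr_ge0// mulr_ge0// sqr_ge0.
- by rewrite ler_wpM2r// invr_ge0 mulr_ge0// ltW.
Qed.

(** * The drift *)

Section IntervalIntegral.
Context (R : realType) (T M : R) (f : R -> R).
Implicit Types s t u : R.
Let mu := @lebesgue_measure R.
Hypothesis f_meas : measurable_fun `[0, T] f.
Hypothesis f_le : forall u, 0 <= u <= T -> `|f u| <= M.

Lemma integrable_itv s t : 0 <= s -> t <= T ->
  mu.-integrable `]s, t] (EFin \o f).
Proof.
move=> s0 tT; apply: measurable_bounded_integrable => //.
- by rewrite /= lebesgue_measure_itv/=; case: ifP => _; rewrite ?ltry.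
- apply: measurable_funS f_meas => // u /=; rewrite !in_itv/= => /andP[su ut].
  by rewrite (le_trans s0 (ltW su)) (le_trans ut tT).
- exists M; split; first exact: num_real.
  move=> K MK u /=; rewrite in_itv/= => /andP[su ut].
  apply: le_trans (ltW MK); apply: f_le.
  by rewrite (le_trans s0 (ltW su)) (le_trans ut tT).
Qed.

Lemma norm_integral_itv_le s t : 0 <= s -> s <= t -> t <= T ->
  `|\int[mu]_(u in `]s, t]) f u| <= M * (t - s).
Proof.
move=> s0 st tT.
have fi := integrable_itv s0 tT.
apply: le_trans; first by apply: le_normr_Rintegral fi.
apply: (@le_trans _ _ (\int[mu]_(u in `]s, t]) M)).
  apply: le_Rintegral => //; first exact: integrable_norm.
    apply: measurable_bounded_integrable => //.
      by rewrite /= lebesgue_measure_itv/=; case: ifP => _; rewrite ?ltry.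
    exists `|M|; split; first exact: num_real.
    by move=> K MK u _ /=; rewrite ltW.
  move=> u /=; rewrite in_itv/= => /andP[su ut]; apply: f_le.
  by rewrite (le_trans s0 (ltW su)) (le_trans ut tT).
rewrite Rintegral_cst//= lebesgue_measure_itv/= lte_fin.
case: ltP => //= ts; rewrite mulr0.
by rewrite (_ : t = s) ?subrr ?mulr0//; apply/eqP; rewrite eq_le ts.
Qed.

Lemma integral_itv_cat s t u : 0 <= s -> s <= t -> t <= u -> u <= T ->
  \int[mu]_(v in `]s, t]) f v + \int[mu]_(v in `]t, u]) f v =
  \int[mu]_(v in `]s, u]) f v.
Proof.
move=> s0 st tu uT.
rewrite -(@Rintegral_itvB _ _ (BRight s) (BRight u) t)//; last exact: integrable_itv.
by rewrite addrC subrK.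
Qed.

Lemma integral_itv_self s : \int[mu]_(v in `]s, s]) f v = 0.
Proof. by rewrite set_itv_ge ?bnd_simp ?ltxx// Rintegral_set0. Qed.

Lemma integral_itv_closed t : t <= T ->
  \int[mu]_(v in `[0, t]) f v = \int[mu]_(v in `]0, t]) f v.
Proof.
by move=> tT; rewrite -Rintegral_itv_obnd_cbnd//; exact: integrable_itv.
Qed.

End IntervalIntegral.

Lemma norm_integral_itvB_le (R : realType) (T M M' k : R) (f g : R -> R) (s t : R) :
  measurable_fun `[0, T] f -> measurable_fun `[0, T] g ->
  (forall u, 0 <= u <= T -> `|f u| <= M) ->
  (forall u, 0 <= u <= T -> `|g u| <= M') ->
  0 <= s -> s <= t -> t <= T ->
  (forall u, s <= u <= t -> `|f u - g u| <= k) ->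
  `|\int[lebesgue_measure]_(u in `]s, t]) f u -
    \int[lebesgue_measure]_(u in `]s, t]) g u| <= k * (t - s).
Proof.
move=> mf mg fM gM s0 st tT fgk.
rewrite -RintegralB//; [|exact: (integrable_itv mf fM)|exact: (integrable_itv mg gM)].
have mfg : measurable_fun `[0, T] (fun u => f u - g u) by exact: measurable_funB.
have k0 : 0 <= k by apply: le_trans (fgk s _); rewrite ?normr_ge0 ?lexx.
(* The bound [k] is known on [[s, t]] only, whereas the estimate to be applied asks for it on all of
   [[0, T]]. *)
pose h u := if s <= u <= t then f u - g u else 0.
have -> : \int[lebesgue_measure]_(u in `]s, t]) (f u - g u) =
    \int[lebesgue_measure]_(u in `]s, t]) h u.
  apply: eq_Rintegral => u; rewrite inE/= in_itv/= => /andP[su ut].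
  by rewrite /h (ltW su) ut.
apply: (@norm_integral_itv_le _ T) => //.
  rewrite (_ : h = fun u => (f u - g u) * \1_(`[s, t] : set R) u); last first.
    apply/funext => u; rewrite /h indicE.
    case: ifPn => h1; first by rewrite mem_set ?mulr1//= in_itv.
    by rewrite memNset ?mulr0//= in_itv/=; exact/negP.
  by apply: measurable_funM => //; apply: measurable_funTS; exact: measurable_indic.
move=> u _; rewrite /h; case: ifP => // su; first exact: fgk.
by rewrite normr0.
Qed.

Section Moments.
Context (R : realType) (d : measure_display) (Omega : measurableType d).
Variable P : probability Omega R.

Lemma finite_moment1_law (X : {RV P >-> R}) : intg P X ->
  finite_moment 1 (distribution P X).
Proof.
move=> /integrableP[_ iX]; rewrite /finite_moment ge0_integral_distribution//.
  rewrite (eq_integral (fun w => `|(X w)%:E|%E))// => w _ /=.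
  by rewrite powRr1.
apply/measurable_EFinP; apply: (@measurableT_comp _ _ _ _ _ _ (fun x : R => x `^ 1)).
  exact: measurable_powR.
exact: normr_measurable.
Qed.

Lemma finite_moment2_law (X : {RV P >-> R}) : sqint P X ->
  finite_moment 2 (distribution P X).
Proof.
move=> [_ /integrableP[_ iX]]; rewrite /finite_moment ge0_integral_distribution//.
  rewrite (eq_integral (fun w => `|(X w ^+ 2)%:E|%E))// => w _ /=.
  by rewrite powR_mulrn// normrX.
apply/measurable_EFinP; apply: (@measurableT_comp _ _ _ _ _ _ (fun x : R => x `^ 2)).
  exact: measurable_powR.
exact: normr_measurable.
Qed.

End Moments.

Section Drift.
Context (R : realType) (d : measure_display) (Omega : measurableType d).
Variables (P : probability Omega R) (T M C : R).
Variables (b : R -> R -> borel_prob R -> R) (kappa : R -> R).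
Implicit Types (s t u y z : R).
Hypothesis T_gt0 : 0 < T.
Hypothesis C_ge0 : 0 <= C.
Hypothesis b_le : forall t y mu, 0 <= t <= T -> finite_moment 1 mu -> `|b t y mu| <= M.
Hypothesis b_continuous : continuous_drift T b.
Hypothesis b_lip : forall t y mu nu, 0 <= t <= T ->
  finite_moment 1 mu -> finite_moment 1 nu ->
  (`|b t y mu - b t y nu|%:E <= C%:E * wasserstein 1 mu nu)%E.
Hypothesis b_kappa : forall t y z mu, 0 <= t <= T -> finite_moment 2 mu ->
  `|b t y mu - b t z mu| <= kappa `|y - z|.
Hypothesis kappa_incr : {in `[0, +oo[ &, {homo kappa : u v / u < v}}.
Hypothesis kappa0 : kappa 0 = 0.
Hypothesis kappa_small : forall eta : R, 0 < eta -> exists2 c, 0 < c & kappa c <= eta.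
Implicit Types (X Y : {RV P >-> R}).

Definition law X : borel_prob R := distribution P X.

(** First the point moves under the law of [X], then the law moves at the point [z]. Square
    integrability is what gives access to the modulus [kappa], available for laws with second
    moment. *)
Lemma drift_diff t y z X Y : 0 <= t <= T -> sqint P X -> sqint P Y ->
  `|b t y (law X) - b t z (law Y)| <=
  kappa `|y - z| + C * mean P (fun w => `|X w - Y w|).
Proof.
move=> tT sX sY.
have -> : b t y (law X) - b t z (law Y) =
  (b t y (law X) - b t z (law X)) + (b t z (law X) - b t z (law Y)) by ring.
apply: (le_trans (ler_normD _ _)); apply: lerD.
  by apply: b_kappa => //; exact: finite_moment2_law.
rewrite -lee_fin; apply: (le_trans (b_lip _ tT _ _)).
- exact/finite_moment1_law/sqint_intg.
- exact/finite_moment1_law/sqint_intg.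
rewrite EFinM; apply: lee_wpmul2l; first by rewrite lee_fin.
by apply: wasserstein1_le; exact/sqint_intg/sqintB.
Qed.

(** Continuity of [X] in mean makes its law continuous for the Wasserstein distance, so that the
    joint continuity of [b] can be composed with the path and the law. *)
Lemma drift_path_continuous (y : R -> R) (X : R -> {RV P >-> R}) :
  {within `[0, T], continuous y} ->
  (forall u, 0 <= u <= T -> intg P (X u)) ->
  (forall u, 0 <= u <= T -> forall e, 0 < e -> exists2 dl, 0 < dl &
    forall v, 0 <= v <= T -> `|u - v| < dl ->
      mean P (fun w => `|X u w - X v w|) < e) ->
  {within `[0, T], continuous (fun u => b u (y u) (law (X u)))}.
Proof.
move=> /within_continuousE cy iX cX; apply/within_continuousE => u /=.
rewrite in_itv/= => uT e e0.
have [dl dl0 H] := b_continuous (y u) uT (finite_moment1_law (iX u uT)) e0.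
have uI : `[0, T]%classic u by rewrite /= in_itv.
have [d1 d10 H1] := cy u uI dl dl0.
have [d2 d20 H2] := cX u uT dl dl0.
exists (Num.min dl (Num.min d1 d2)); first by rewrite !lt_min dl0 d10 d20.
move=> v; rewrite /= in_itv/= => vT; rewrite /ball/= !lt_min => /and3P[v0 v1 v2].
apply: H => //.
- exact/finite_moment1_law/iX.
- by apply: H1 => //=; rewrite in_itv.
- have iXuv : intg P (fun w => X u w - X v w) by apply: intgB; exact: iX.
  by apply: (le_lt_trans (wasserstein1_le iXuv)); rewrite lte_fin H2.
Qed.

Lemma drift_path_measurable (y : R -> R) (X : R -> {RV P >-> R}) :
  {within `[0, T], continuous (fun u => b u (y u) (law (X u)))} ->
  measurable_fun `[0, T] (fun u => b u (y u) (law (X u))).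
Proof. by move=> h; apply: subspace_continuous_measurable_fun. Qed.

Lemma drift_time_measurable y X : intg P X ->
  measurable_fun `[0, T] (fun u => b u y (law X)).
Proof.
move=> iX; apply: (@drift_path_measurable (fun=> y) (fun=> X)).
apply: drift_path_continuous => //.
  apply/within_continuousE => u _ e e0; exists 1 => // v _ _.
  by rewrite subrr normr0.
move=> u _ e e0; exists 1 => // v _ _.
by under eq_fun do rewrite subrr normr0; rewrite mean_cst.
Qed.

Lemma drift_time_le y X : intg P X ->
  forall u, 0 <= u <= T -> `|b u y (law X)| <= M.
Proof. by move=> iX u uT; apply: b_le => //; exact: finite_moment1_law. Qed.

(** Position and law are frozen, time is not: [b] is continuous in time without any modulus uniform
    in position and law, so the time integral is kept exact. *)
Definition drift s t X y : R :=
  \int[lebesgue_measure]_(u in `]s, t]) b u y (law X).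

Lemma drift_le s t X y : 0 <= s -> s <= t -> t <= T -> intg P X ->
  `|drift s t X y| <= M * (t - s).
Proof.
move=> s0 st tT iX.
exact (norm_integral_itv_le (drift_time_measurable y iX)
  (drift_time_le y iX) s0 st tT).
Qed.

Lemma driftB_le s t X Y y z : 0 <= s -> s <= t -> t <= T ->
  sqint P X -> sqint P Y ->
  `|drift s t X y - drift s t Y z| <=
  (kappa `|y - z| + C * mean P (fun w => `|X w - Y w|)) * (t - s).
Proof.
move=> s0 st tT sX sY.
have iX := sqint_intg sX; have iY := sqint_intg sY.
apply: (norm_integral_itvB_le (drift_time_measurable y iX)
  (drift_time_measurable z iY) (drift_time_le y iX) (drift_time_le z iY)) => //.
move=> u /andP[su ut]; apply: drift_diff => //.
by rewrite (le_trans s0 su) (le_trans ut).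
Qed.

Lemma drift_cat s t u X y : 0 <= s -> s <= t -> t <= u -> u <= T -> intg P X ->
  drift s t X y + drift t u X y = drift s u X y.
Proof.
move=> s0 st tu uT iX.
exact (integral_itv_cat (drift_time_measurable y iX) (drift_time_le y iX)
  s0 st tu uT).
Qed.

Lemma drift_self s X y : drift s s X y = 0.
Proof. exact: integral_itv_self. Qed.

Lemma drift_measurable s t X : 0 <= s -> s <= t -> t <= T -> sqint P X ->
  measurable_fun setT (drift s t X).
Proof.
move=> s0 st tT sX.
apply: continuous_measurable_fun => y; apply/cvgrPdist_le => e e0.
have ts0 : 0 < t - s + 1 by rewrite ltr_wpDl// subr_ge0.
have e1 : 0 < e / (t - s + 1) by rewrite divr_gt0.
have [c c0 kc] := kappa_small e1.
have nc : \forall z \near y, `|y - z| <= c.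
  by apply/nbhs_ballP; exists c => //= z; rewrite /ball/= => /ltW.
apply: filterS nc => z yz.
apply: (le_trans (driftB_le y z s0 st tT sX sX)).
under eq_fun do rewrite subrr normr0; rewrite mean_cst mulr0 addr0.
apply: (@le_trans _ _ (kappa c * (t - s))).
  rewrite ler_wpM2r ?subr_ge0//; apply: (kappa_le kappa_incr) => //.
apply: (@le_trans _ _ (e / (t - s + 1) * (t - s))).
  by rewrite ler_wpM2r ?subr_ge0.
by rewrite mulrAC ler_pdivrMr// ler_wpM2l ?(ltW e0)// lerDl.
Qed.

End Drift.

(** * Stability of approximate solutions *)

(** Working form of the hypotheses: a single [M] bounds both coefficients, and condition (b) is
    encoded by the 1/2-Hoelder constant [K]. *)
Record regular_coef (R : realType) (T M C K : R) (b : R -> R -> borel_prob R -> R)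
    (sigma : R -> R -> R) (kappa : R -> R) : Prop := RegularCoef {
  rc_T : 0 < T;
  rc_C : 0 <= C;
  rc_K : 0 <= K;
  rc_b_le : forall (t y : R) mu, 0 <= t <= T -> finite_moment 1 mu ->
    `|b t y mu| <= M;
  rc_b_cont : continuous_drift T b;
  rc_b_lip : forall (t y : R) mu nu, 0 <= t <= T ->
    finite_moment 1 mu -> finite_moment 1 nu ->
    (`|b t y mu - b t y nu|%:E <= C%:E * wasserstein 1 mu nu)%E;
  rc_b_kappa : forall (t y z : R) mu, 0 <= t <= T -> finite_moment 2 mu ->
    `|b t y mu - b t z mu| <= kappa `|y - z|;
  rc_sigma_le : forall t y : R, 0 <= t <= T -> `|sigma t y| <= M;
  rc_sigma_half : forall t y z : R, 0 <= t <= T ->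
    (sigma t y - sigma t z) ^+ 2 <= K * `|y - z|;
  rc_sigma_cont :
    {within `[0, T] `*` setT, continuous (fun z : R * R => sigma z.1 z.2)};
  rc_kappa_incr : {in `[0, +oo[ &, {homo kappa : u v / u < v}};
  rc_kappa0 : kappa 0 = 0;
  rc_kappa_concave : concave_function `[0, +oo[ kappa;
  rc_kappa_div : diverges_at_0 (fun u => (kappa u)^-1) }.

Section Stability.
Context (R : realType) (d : measure_display) (Omega : measurableType d).
Variables (P : probability Omega R) (T M C K x : R).
Variables (b : R -> R -> borel_prob R -> R) (sigma : R -> R -> R) (kappa : R -> R).
Hypothesis RC : regular_coef T M C K b sigma kappa.
Variables (F : R -> set (set Omega)) (B : R -> {RV P >-> R}).
Hypothesis F_filtration : filtration T F.
Hypothesis B_brownian : brownian_motion T F B.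
Implicit Types (eps eta s t : R) (c : nat -> R) (V U : nat -> {RV P >-> R}).

Let T0 := rc_T RC.

Lemma rc_M_ge0 : 0 <= M.
Proof.
by apply: le_trans (rc_sigma_le RC 0 (_ : 0 <= 0 <= T)) => //; rewrite lexx ltW.
Qed.

Lemma rc_kappa_small eta : 0 < eta -> exists2 e : R, 0 < e & kappa e <= eta.
Proof.
exact: (kappa_small (rc_kappa_incr RC) (rc_kappa0 RC) (rc_kappa_div RC)).
Qed.

Definition rc_drift_le := drift_le (P := P) (rc_b_le RC) (rc_b_cont RC).

Definition rc_driftB_le :=
  driftB_le (P := P) (rc_C RC) (rc_b_le RC) (rc_b_cont RC) (rc_b_lip RC) (rc_b_kappa RC).

Definition rc_drift_measurable :=
  drift_measurable (P := P) (rc_C RC) (rc_b_le RC) (rc_b_cont RC) (rc_b_lip RC)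
    (rc_b_kappa RC) (rc_kappa_incr RC) rc_kappa_small.

Lemma sigma_measurable t : 0 <= t <= T -> measurable_fun setT (sigma t).
Proof.
move=> tT; apply: continuous_measurable_fun => y; apply/cvgrPdist_le => e e0.
have K1 : 0 < K + 1 by rewrite ltr_wpDl// (rc_K RC).
have nc : \forall z \near y, `|y - z| <= e ^+ 2 / (K + 1).
  apply/nbhs_ballP; exists (e ^+ 2 / (K + 1)) => //=.
    by rewrite divr_gt0// exprn_gt0.
  by move=> z; rewrite /ball/= => /ltW.
apply: filterS nc => z yz.
rewrite -(@ler_pXn2r _ 2)// ?nnegrE ?(ltW e0)// real_normK ?num_real//.
apply: (le_trans (rc_sigma_half RC y z tT)).
apply: (@le_trans _ _ (K * (e ^+ 2 / (K + 1)))).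
  by rewrite ler_wpM2l// (rc_K RC).
by rewrite mulrCA ler_piMr ?sqr_ge0// ler_pdivrMr// mul1r lerDl.
Qed.

Definition good_chain N c eps :=
  [/\ 0 <= c 0%N, forall i, (i < N)%N -> c i <= c i.+1, c N <= T &
      forall i, (i < N)%N -> c i.+1 - c i <= eps].

(* [Q] is the martingale part of [V]; the remainders [r] and [m] are small in
   L^1 and L^2, and [m] consists of martingale differences. *)
Definition approx_sol N c eps V (Q : nat -> Omega -> R) :=
  exists r m : nat -> Omega -> R,
  [/\ (forall i, (i <= N)%N -> measurable_wrt (F (c i)) (V i) /\ sqint P (V i)) /\
        mean P (fun w => `|V 0%N w - x|) <= eps,
      forall i, (i < N)%N -> intg P (r i) /\
        mean P (fun w => `|r i w|) <= eps * (c i.+1 - c i),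
      mdiff P N (fun i => F (c i)) m,
      forall i, (i < N)%N ->
        mean P (fun w => m i w ^+ 2) <= eps ^+ 2 * (c i.+1 - c i) &
      forall i w, (i < N)%N -> V i.+1 w = V i w
        + drift b (c i) (c i.+1) (V i) (V i w) + r i w
        + sigma (c i) (V i w) * incr B (c i) (c i.+1) w + m i w /\
        Q i.+1 w = Q i w + sigma (c i) (V i w) * incr B (c i) (c i.+1) w + m i w].

Lemma mdiffD N (G : nat -> set (set Omega)) D D' :
  (forall i, (i <= N)%N -> sigma_algebra setT (G i)) ->
  mdiff P N G D -> mdiff P N G D' ->
  mdiff P N G (fun i w => D i w + D' i w).
Proof.
move=> sG mD mD' i iN; have [s1 w1 o1] := mD i iN; have [s2 w2 o2] := mD' i iN.
split; [exact: sqintD|by apply: measurable_wrtD => //; exact: sG|].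
move=> xi mxi sxi; under [X in mean P X]eq_fun do rewrite mulrDr.
by rewrite meanD ?o1 ?o2 ?addr0//; exact: sqint_intgM.
Qed.

Lemma mdiffN N (G : nat -> set (set Omega)) D :
  (forall i, (i <= N)%N -> sigma_algebra setT (G i)) ->
  mdiff P N G D -> mdiff P N G (fun i w => - D i w).
Proof.
move=> sG mD i iN; have [s1 w1 o1] := mD i iN.
split; first exact: sqintN.
  under [X in measurable_wrt _ X]eq_fun do rewrite -mulN1r.
  apply: measurable_wrtM => //; first exact: sG.
  by apply: measurable_wrt_cst; exact: sG.
move=> xi mxi sxi; under [X in mean P X]eq_fun do rewrite mulrN -mulN1r.
by rewrite meanZ ?o1 ?mulr0//; exact: sqint_intgM.
Qed.

(* [u] is the explicit Euler scheme of [u' = 2 kappa(u) + C u], which dominates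
   the mean distance and stays small by Osgood's criterion. *)
Theorem stability eta : 0 < eta -> exists2 eps, 0 < eps &
  forall N c U V QU QV, good_chain N c eps ->
    approx_sol N c eps U QU -> approx_sol N c eps V QV ->
    [/\ forall i, (i <= N)%N -> mean P (fun w => `|U i w - V i w|) <= eta,
      (P [set w | exists2 i, (i <= N)%N & (eta <= `|U i w - V i w|)%R] <= eta%:E)%E &
      sqint P (fun w => (QU N w - QU 0%N w) - (QV N w - QV 0%N w)) /\
      mean P (fun w => ((QU N w - QU 0%N w) - (QV N w - QV 0%N w)) ^+ 2) <= eta].
Proof.
move=> eta0; have M0 := rc_M_ge0; have C0 := rc_C RC; have K0 := rc_K RC.
have T0' := ltW T0.
(* A deviation of size [eta] is shared between the initial error, the total drift and the martingale
   part. *)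
pose l := eta / 3; have l0 : 0 < l by rewrite divr_gt0.
(* [A'] and [A2'] gather the coefficients of [q] and [eps] in the bound on the probability; [A] and
   [A2] add those of the second moment bound. [q] and [eps] are chosen so that each contributes at
   most [eta / 2]. *)
pose A' := T * (2 + C) / l + 16 * K * T / l ^+ 2.
have A'0 : 0 <= A'.
  by rewrite addr_ge0// divr_ge0 ?(ltW l0) ?sqr_ge0// !mulr_ge0// addr_ge0.
pose A := A' + 16 * K * T.
have A0 : 0 <= A by rewrite addr_ge0// !mulr_ge0.
pose q := eta / (2 * (A + 1)).
have A1 : 0 < 2 * (A + 1) by rewrite mulr_gt0// ltr_wpDl.
have q0 : 0 < q by rewrite divr_gt0.
have qA : A * q <= eta / 2.
  rewrite /q mulrA ler_pdivrMr// (_ : eta / 2 * (2 * (A + 1)) = eta * (A + 1)).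
    by rewrite mulrC ler_pM2l// lerDl.
  by field.
have [c0 c00 kc0] := rc_kappa_small q0.
(* Target for the mean distance: at most [eta] for the first conclusion, at most [q] and with
   [kappa eta1 <= q] for the other two. *)
pose eta1 := Num.min c0 (Num.min eta q).
have eta10 : 0 < eta1 by rewrite !lt_min c00 eta0 q0.
have e1c : eta1 <= c0 by rewrite ge_min lexx.
have e1e : eta1 <= eta by rewrite !ge_min lexx orbT.
have e1q : eta1 <= q by rewrite !ge_min lexx !orbT.
(* [e] is the starting value from which the comparison scheme stays below [eta1]. Half of it pays
   for the smoothing, the other half for the initial error and the L^1 remainders. *)
have [e e0 osg] := discrete_osgood (rc_kappa_incr RC) (rc_kappa0 RC)
  (rc_kappa_concave RC) (rc_kappa_div RC) T C0 eta10.
have e20 : 0 < e / 2 by rewrite divr_gt0.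
have M20 : 0 <= 2 * M by rewrite mulr_ge0.
have [a [k [eps1 [a0 k0 eps10 seps1]]]] := step_error_small T0 M20 K0 e20.
pose A2' := 2 / l + 2 * T / l + 8 * T / l ^+ 2.
have A2'0 : 0 <= A2'.
  by rewrite addr_ge0 ?addr_ge0// divr_ge0 ?(ltW l0) ?sqr_ge0// mulr_ge0.
pose A2 := A2' + 8 * T.
have A20 : 0 <= A2 by rewrite addr_ge0// mulr_ge0.
(* The bound 1 gives [eps^2 <= eps]. Halving [eps1] compensates the factor 4 in the mean square of a
   difference of two martingale remainders. [2 + 2 * T] counts the two initial errors and the two
   remainders accumulated up to [T]. *)
pose eps := Num.min 1 (Num.min (eps1 / 2) (Num.min (e / (2 * (2 + 2 * T)))
  (eta / (2 * (A2 + 1))))).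
have A21 : 0 < 2 * (A2 + 1) by rewrite mulr_gt0// ltr_wpDl.
have T2 : 0 < 2 * (2 + 2 * T) by rewrite mulr_gt0// ltr_wpDr// mulr_ge0.
have eps0 : 0 < eps by rewrite !lt_min ltr01 !divr_gt0.
have eps_1 : eps <= 1 by rewrite ge_min lexx.
have eps_2 : eps <= eps1 / 2 by rewrite !ge_min lexx orbT.
have eps_3 : (2 + 2 * T) * eps <= e / 2.
  have : eps <= e / (2 * (2 + 2 * T)) by rewrite !ge_min lexx !orbT.
  by rewrite ler_pdivlMr// => h; rewrite ler_pdivlMr//; apply: le_trans h; rewrite le_eqVlt;
    apply/orP; left; apply/eqP; ring.
have eps_4 : A2 * eps <= eta / 2.
  have h : eps <= eta / (2 * (A2 + 1)) by rewrite !ge_min lexx !orbT.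
  apply: (le_trans (ler_wpM2l A20 h)).
  rewrite mulrA ler_pdivrMr// (_ : eta / 2 * (2 * (A2 + 1)) = eta * (A2 + 1)).
    by rewrite mulrC ler_pM2l// lerDl.
  by field.
exists eps => // N c U V QU QV [c_ge0 c_le c_T c_step].
move=> [rU [mU [[UF U0] rUs mUd mUs Ustep]]] [rV [mV [[VF V0] rVs mVd mVs Vstep]]].
have cT i : (i <= N)%N -> 0 <= c i <= T by exact: chain_itv.
have csig := chain_sigma F_filtration c_ge0 c_le c_T.
have cmeas := chain_meas F_filtration c_ge0 c_le c_T.
have cmono := chain_mono F_filtration c_ge0 c_le c_T.
have D0 i : (i < N)%N -> 0 <= c i.+1 - c i by move=> iN; rewrite subr_ge0 c_le.

(* The difference of the two approximate solutions *)
pose Z i w := U i w - V i w.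
pose dr i w := drift b (c i) (c i.+1) (U i) (U i w) - drift b (c i) (c i.+1) (V i) (V i w).
pose beta i w := dr i w + (rU i w - rV i w).
pose h i w := sigma (c i) (U i w) - sigma (c i) (V i w).
pose m i w := mU i w + - mV i w.
have Zs i : (i <= N)%N -> sqint P (Z i).
  by move=> iN; apply: sqintB; [have [] := UF i iN|have [] := VF i iN].
have Zw i : (i <= N)%N -> measurable_wrt (F (c i)) (Z i).
  move=> iN; apply: measurable_wrtB; [exact: csig|by have [] := UF i iN|by have [] := VF i iN].
have hw i : (i < N)%N -> measurable_wrt (F (c i)) (h i).
  move=> iN; have iN' := ltnW iN.
  apply: measurable_wrtB; first exact: csig.
    by apply: (measurable_wrt_comp (sigma_measurable (cT i iN'))); have [] := UF i iN'.
  by apply: (measurable_wrt_comp (sigma_measurable (cT i iN'))); have [] := VF i iN'.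
have hM i w : (i < N)%N -> `|h i w| <= 2 * M.
  move=> iN; have iN' := ltnW iN; apply: (le_trans (ler_normB _ _)).
  have := rc_sigma_le RC (U i w) (cT i iN'); have := rc_sigma_le RC (V i w) (cT i iN'); lra.
have hZ i w : (i < N)%N -> h i w ^+ 2 <= K * `|Z i w|.
  by move=> iN; exact/(rc_sigma_half RC)/cT/ltnW.
have mD : mdiff P N (fun i => F (c i)) m by apply: mdiffD => //; exact: mdiffN.
have m2 i : (i < N)%N -> mean P (fun w => m i w ^+ 2) <= 4 * eps ^+ 2 * (c i.+1 - c i).
  move=> iN; have [s1 _ _] := mUd i iN; have [s2 _ _] := mVd i iN.
  apply: (le_trans (mean_sqrD_le s1 (sqintN s2))).
  under [X in _ + 2 * mean P X]eq_fun do rewrite sqrrN.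
  have := mUs i iN; have := mVs i iN; lra.
have m1 i : (i < N)%N -> mean P (fun w => m i w ^+ 2) <= eps1 ^+ 2 * (c i.+1 - c i).
  move=> iN; apply: (le_trans (m2 i iN)); rewrite ler_wpM2r ?D0//.
  have -> : 4 * eps ^+ 2 = (2 * eps) ^+ 2 by ring.
  by rewrite ler_pXn2r ?nnegrE ?mulr_ge0 ?(ltW eps0) ?(ltW eps10)//; lra.
have dr_le i w : (i < N)%N -> `|dr i w| <=
    (kappa `|Z i w| + C * mean P (fun w => `|Z i w|)) * (c i.+1 - c i).
  move=> iN; have iN' := ltnW iN.
  have /andP[ci0 _] := cT i iN'; have /andP[_ ciT] := cT _ iN.
  by apply: rc_driftB_le; rewrite ?c_le//; [have [] := UF i iN'|have [] := VF i iN'].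
have mdrift i (W : {RV P >-> R}) : (i < N)%N -> sqint P W ->
    measurable_fun setT (fun w => drift b (c i) (c i.+1) W (W w)).
  move=> iN sW.
  have /andP[ci0 _] := cT i (ltnW iN); have /andP[_ ciT] := cT _ iN.
  apply: (measurableT_comp _ (sqint_measurable sW)).
  by apply: rc_drift_measurable; rewrite ?c_le.
have dr_i i : (i < N)%N -> intg P (dr i).
  move=> iN; have iN' := ltnW iN; have [_ sU] := UF i iN'; have [_ sV] := VF i iN'.
  apply: (@intg_le _ _ _ _ _ (fun=> 2 * M * (c i.+1 - c i))).
  - by apply: measurable_funB; exact: mdrift.
  - exact: intg_cst.
  move=> w; apply: (le_trans (ler_normB _ _)).
  have /andP[ci0 _] := cT i iN'; have /andP[_ ciT] := cT _ iN.
  have := rc_drift_le (U i w) ci0 (c_le i iN) ciT (sqint_intg sU).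
  have := rc_drift_le (V i w) ci0 (c_le i iN) ciT (sqint_intg sV).
  lra.
have beta_i i : (i < N)%N -> intg P (beta i).
  move=> iN; apply: intgD; first exact: dr_i.
  by apply: intgB; [have [] := rUs i iN|have [] := rVs i iN].
(* [kappa_affine] at [v] has mean at most [2 * kappa v] as soon as the mean distance is at most [v];
   this is where the factor 2 of the Osgood scheme comes from. *)
have beta_m i v : (i < N)%N -> 0 < v -> mean P (fun w => `|Z i w|) <= v ->
    mean P (fun w => `|beta i w|) <=
    (c i.+1 - c i) * (2 * kappa v + C * v) + 2 * eps * (c i.+1 - c i).
  move=> iN v0 Zv; have [iU mrU] := rUs i iN; have [iV mrV] := rVs i iN.
  have iZ := intg_norm (sqint_intg (Zs i (ltnW iN))).
  set D := c i.+1 - c i; have Di : 0 <= D := D0 i iN.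
  have kv := kappa_ge0 (rc_kappa_incr RC) (rc_kappa0 RC) (ltW v0).
  have ib := intgD (intgZ (D * kappa v / v) iZ) (intg_cst P (D * (kappa v + C * v))).
  have ir := intgD (intg_norm iU) (intg_norm iV).
  apply: (@le_trans _ _ (mean P (fun w => (D * kappa v / v * `|Z i w|
      + D * (kappa v + C * v)) + (`|rU i w| + `|rV i w|)))).
    apply: mean_le; [exact/intg_norm/beta_i|exact: intgD|move=> w].
    apply: (le_trans (ler_normD _ _)); apply: lerD; last exact: ler_normB.
    apply: (le_trans (dr_le i w iN)); rewrite -/D mulrC.
    have -> : D * kappa v / v * `|Z i w| + D * (kappa v + C * v) =
      D * (kappa v * (1 + `|Z i w| / v) + C * v) by field; rewrite gt_eqF.
    rewrite ler_wpM2l//; apply: lerD; last by rewrite ler_wpM2l.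
    exact: (kappa_affine (rc_kappa_incr RC) (rc_kappa0 RC) (rc_kappa_concave RC)).
  rewrite meanD// meanD ?mean_cst; [|exact: intgZ|exact: intg_cst].
  rewrite meanZ// meanD//; [|exact: intg_norm|exact: intg_norm].
  have h1 : D * kappa v / v * mean P (fun w => `|Z i w|) <= D * kappa v.
    rewrite [leRHS](_ : _ = D * kappa v / v * v); last by field; rewrite gt_eqF.
    by rewrite ler_wpM2l// divr_ge0 ?(ltW v0)// mulr_ge0.
  move: mrU mrV; rewrite -/D => mrU mrV.
  have -> : D * (2 * kappa v + C * v) + 2 * eps * D =
    D * kappa v + D * (kappa v + C * v) + (eps * D + eps * D) by ring.
  by rewrite lerD// ?lerD.
have Zstep i w : (i < N)%N ->
    Z i.+1 w = Z i w + beta i w + h i w * incr B (c i) (c i.+1) w + m i w.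
  by move=> iN; rewrite /Z /beta /dr /h /m (Ustep i w iN).1 (Vstep i w iN).1; ring.
have Z0 : mean P (fun w => `|Z 0%N w|) <= 2 * eps.
  have iU : intg P (fun w => U 0%N w - x).
    by apply: intgB; [have [_ /sqint_intg] := UF 0%N (leq0n _)|exact: intg_cst].
  have iV : intg P (fun w => V 0%N w - x).
    by apply: intgB; [have [_ /sqint_intg] := VF 0%N (leq0n _)|exact: intg_cst].
  apply: (@le_trans _ _ (mean P (fun w => `|U 0%N w - x| + `|V 0%N w - x|))).
    apply: mean_le; [exact/intg_norm/sqint_intg/Zs|by apply: intgD; exact: intg_norm|].
    move=> w; rewrite /Z (_ : U 0%N w - V 0%N w = (U 0%N w - x) - (V 0%N w - x)).
      exact: ler_normB.
    by ring.
  rewrite meanD; [|exact: intg_norm|exact: intg_norm].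
  lra.
have err n : (n <= N)%N -> mean P (fun w => `|Z n w|) <=
    2 * eps + e / 2 + \sum_(i < n) mean P (fun w => `|beta i w|).
  move=> nN.
  have c_step1 i : (i < N)%N -> c i.+1 - c i <= eps1.
    by move=> iN; apply: (le_trans (c_step i iN)); lra.
  have := mean_error_le F_filtration B_brownian c_ge0 c_le c_T c_step1 eps10 M20 K0
    Zw Zs beta_i hw hM hZ mD m1 Zstep a0 k0 nN.
  move=> /le_trans; apply; rewrite lerD2r -addrA; apply: lerD => //.
  apply: le_trans seps1; rewrite lerD2l ler_wpM2r//.
    rewrite addr_ge0// ?divr_ge0 ?mulr_ge0//.
    rewrite /step_error addr_ge0 ?addr_ge0// divr_ge0 ?mulr_ge0 ?exprn_ge0 ?sqrtr_ge0 ?sqr_ge0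
      ?(ltW eps10) ?divr_ge0 ?exprn_ge0 ?(ltW a0)//.
    by rewrite addr_ge0// mulr_ge0// sqr_ge0.
  by have /andP[_ cnT] := cT n nN; rewrite lerBlDr (le_trans cnT)// lerDl.

(* Comparison with the Osgood scheme *)
pose u := fix u i := if i is j.+1 then
  u j + (c j.+1 - c j) * (2 * kappa (u j) + C * u j) else e.
have sumD : \sum_(i < N) (c i.+1 - c i) <= T.
  rewrite -(big_mkord xpredT (fun i => c i.+1 - c i)) telescope_sumr//.
  by rewrite lerBlDr (le_trans c_T)// lerDl.
have sumDn n : (n <= N)%N -> \sum_(i < n) (c i.+1 - c i) <= T.
  by move=> nN; apply: le_trans sumD; exact: (@ler_sum_prefix _ (fun i => c i.+1 - c i)).
have uP := osg N (fun i => c i.+1 - c i) u D0 sumD erefl (fun i _ => erefl).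
(* The growth bound [err] sums the drift terms from the very beginning, so the induction carries all
   earlier indices. It matches [u], which is [e] plus the sum of its own increments. *)
have Zu n : (n <= N)%N -> forall j, (j <= n)%N -> mean P (fun w => `|Z j w|) <= u j.
  elim: n => [|n IH] nN j.
    rewrite leqn0 => /eqP->; apply: (le_trans Z0) => /=.
    apply: (@le_trans _ _ ((2 + 2 * T) * eps)); last by lra.
    by rewrite ler_wpM2r ?(ltW eps0)// lerDl mulr_ge0.
  rewrite leq_eqVlt => /orP[/eqP->|]; last by rewrite ltnS; exact/IH/ltnW.
  have {}IH := IH (ltnW nN).
  apply: (le_trans (err n.+1 nN)).
  have uE i : u i = e + \sum_(j < i) (c j.+1 - c j) * (2 * kappa (u j) + C * u j).
    by elim: i => [|i IHi]; rewrite ?big_ord0 ?addr0// big_ord_recr/= addrA -IHi.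
  have S1 : \sum_(i < n.+1) mean P (fun w => `|beta i w|) <=
      \sum_(i < n.+1) ((c i.+1 - c i) * (2 * kappa (u i) + C * u i)
        + 2 * eps * (c i.+1 - c i)).
    apply: ler_sum => i _; have iN : (i < N)%N := leq_trans (ltn_ord i) nN.
    apply: beta_m => //; first by have /andP[] := uP i (ltnW iN).
    by apply: IH; rewrite -ltnS.
  have S2 : \sum_(i < n.+1) 2 * eps * (c i.+1 - c i) <= 2 * eps * T.
    rewrite -mulr_sumr ler_wpM2l//; first by rewrite mulr_ge0// ltW.
    exact: sumDn.
  rewrite big_split/= in S1; rewrite uE; move: S1 S2 eps_3.
  set s1 := \sum_(i < _) mean _ _; set s2 := \sum_(i < _) _ * (_ + _).
  set s3 := \sum_(i < _) _ * (_ - _); nra.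
have Zeta1 i : (i <= N)%N -> mean P (fun w => `|Z i w|) <= eta1.
  move=> iN; apply: (le_trans (Zu i iN i (leqnn i))).
  by have /andP[] := uP i iN.
have keta : kappa eta1 <= q.
  apply: le_trans kc0; exact: (kappa_le (rc_kappa_incr RC) (ltW eta10)).
have kge := kappa_ge0 (rc_kappa_incr RC) (rc_kappa0 RC) (ltW eta10).

(* Martingale part, total drift and the three conclusions *)
pose X i w := h i w * incr B (c i) (c i.+1) w + m i w.
have hs i : (i < N)%N -> sqint P (h i).
  move=> iN; apply: sqint_bounded (fun w => hM i w iN).
  by apply: measurable_wrt_fun (hw i iN); exact/cmeas/ltnW.
have XD : mdiff P N (fun i => F (c i)) X.
  apply: mdiffD => //; apply: (chain_mdiff F_filtration B_brownian) => //.
  by move=> i iN _; exact: hw.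
(* [16 = 2 * 8] and [8 = 2 * 4]: the square of a sum costs 2, on top of the isometry constant for
   [h] and of the bound [m2] for [m]. *)
have X2 : \sum_(i < N) mean P (fun w => X i w ^+ 2) <=
    T * (16 * K * eta1 + 8 * eps ^+ 2).
  apply: (@le_trans _ _ (\sum_(i < N) (c i.+1 - c i) * (16 * K * eta1 + 8 * eps ^+ 2))).
    apply: ler_sum => i _; have iN := ltn_ord i.
    have /andP[ci0 _] := cT i (ltnW iN); have /andP[_ ciT] := cT _ iN.
    have [s1 n1] := incr_mul_sqint B_brownian ci0 (c_le i iN) ciT (fun _ => hw i iN) (hs i iN).
    have [s2 _ _] := mD i iN.
    apply: (le_trans (mean_sqrD_le s1 s2)).
    have h2 : mean P (fun w => h i w ^+ 2) <= K * eta1.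
      apply: (@le_trans _ _ (mean P (fun w => K * `|Z i w|))).
        apply: mean_le; [exact/sqint_intg_sqr/hs|exact/intgZ/intg_norm/sqint_intg/Zs/ltnW|].
        by move=> w; exact: hZ.
      rewrite meanZ; last exact/intg_norm/sqint_intg/Zs/ltnW.
      by rewrite ler_wpM2l// Zeta1// ltnW.
    have := m2 i iN; have := ler_wpM2l (D0 i iN) h2; move: n1.
    set p1 := mean P _; set p2 := mean P _; set p3 := mean P _; set D := c i.+1 - c i.
    nra.
  by rewrite -mulr_suml ler_wpM2r// addr_ge0 ?mulr_ge0 ?sqr_ge0 ?(ltW eta10) ?(ltW eps0).
have Sb : \sum_(i < N) mean P (fun w => `|beta i w|) <=
    T * (2 * kappa eta1 + C * eta1) + 2 * eps * T.
  apply: (@le_trans _ _ (\sum_(i < N) (c i.+1 - c i) *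
      (2 * kappa eta1 + C * eta1 + 2 * eps))).
    apply: ler_sum => i _; have iN := ltn_ord i.
    have := beta_m i eta1 iN eta10 (Zeta1 i (ltnW iN)); lra.
  rewrite -mulr_suml.
  have -> : T * (2 * kappa eta1 + C * eta1) + 2 * eps * T =
    T * (2 * kappa eta1 + C * eta1 + 2 * eps) by ring.
  by rewrite ler_wpM2r// !addr_ge0// !mulr_ge0// ltW.
have Zsum n w : (n <= N)%N ->
    Z n w = Z 0%N w + \sum_(i < n) beta i w + \sum_(i < n) X i w.
  elim: n => [|n IH] nN; first by rewrite !big_ord0 !addr0.
  by rewrite Zstep// IH ?(ltnW nN)// !big_ord_recr/= /X; ring.
have eps2 : eps ^+ 2 <= eps by rewrite expr2 ler_piMr// ltW.
have Qsum n w : (n <= N)%N ->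
    (QU n w - QU 0%N w) - (QV n w - QV 0%N w) = \sum_(i < n) X i w.
  elim: n => [|n IH] nN; first by rewrite big_ord0 !subrr.
  rewrite big_ord_recr/= -IH ?(ltnW nN)// (Ustep n w nN).2 (Vstep n w nN).2 /X /h /m.
  by ring.
split; [by move=> i iN; apply: (le_trans (Zeta1 i iN))| |]; last first.
  have -> : (fun w => (QU N w - QU 0%N w) - (QV N w - QV 0%N w)) =
      (fun w => \sum_(i < N) X i w) by apply/funext => w; exact: Qsum.
  have -> : (fun w => ((QU N w - QU 0%N w) - (QV N w - QV 0%N w)) ^+ 2) =
      (fun w => (\sum_(i < N) X i w) ^+ 2) by apply/funext => w; rewrite Qsum.
  have [_ sX] := mdiff_partial_sum csig cmono XD (leqnn N).
  split => //; rewrite (mdiff_sum_sqr csig cmono XD (leqnn N)).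
  apply: (le_trans X2); apply: (@le_trans _ _ (A * q + A2 * eps)); last by lra.
  have b1 : 16 * K * T * eta1 <= 16 * K * T * q by rewrite ler_wpM2l// !mulr_ge0.
  have b2 : 8 * T * eps ^+ 2 <= 8 * T * eps by rewrite ler_wpM2l// mulr_ge0.
  have b3 : 0 <= A' * q + A2' * eps by rewrite addr_ge0// mulr_ge0// ltW.
  rewrite /A /A2; lra.
have i0 : intg P (Z 0%N) by exact/sqint_intg/Zs.
have isb : intg P (fun w => \sum_(i < N) `|beta i w|).
  by apply: (@intg_sum _ _ _ P N (fun i w => `|beta i w|)) => i iN; exact/intg_norm/beta_i.
have p1 := markov_mean i0 l0.
have p2 := markov_mean isb l0.
have p3 := mdiff_maximal csig cmeas cmono XD l0.
set E1 := [set w | _] in p1; set E2 := [set w | _] in p2; set E3 := [set w | _] in p3.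
have mE1 : measurable E1.
  rewrite -[X in measurable X]setTI.
  apply: (@measurable_fun_le _ _ _ setT (fun=> l) (fun w => `|Z 0%N w|)) => //.
  by apply: measurableT_comp; [exact: normr_measurable|exact: intg_measurable i0].
have mE2 : measurable E2.
  rewrite -[X in measurable X]setTI.
  apply: (@measurable_fun_le _ _ _ setT (fun=> l) (fun w => `|\sum_(i < N) `|beta i w| |)) => //.
  by apply: measurableT_comp; [exact: normr_measurable|exact: intg_measurable isb].
have bigm (Y : nat -> Omega -> R) (l' : R) : (forall i, (i <= N)%N -> measurable_fun setT (Y i)) ->
    measurable [set w | exists2 i, (i <= N)%N & (l' <= `|Y i w|)%R].
  move=> mY; rewrite [X in measurable X](_ : _ =
      \bigcup_(i in [set i | (i <= N)%N]) (Y i @^-1` [set z | l' <= `|z|])).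
    apply: bigcup_measurable => i iN; rewrite -[X in measurable X]setTI.
    apply: (mY i iN) => //; rewrite -[X in measurable X]setTI.
    by apply: (@measurable_fun_le _ _ _ setT (fun=> l') (fun z : R => `|z|)).
  by apply/seteqP; split=> w /= [i iN hh]; exists i.
have mE3 : measurable E3.
  apply: (bigm (fun i w => \sum_(j < i) X j w)) => i iN.
  by have [_ /sqint_measurable] := mdiff_partial_sum csig cmono XD iN.
(* If neither the initial error nor the sum of the [|beta i|] reaches [l], a deviation of [3 * l] at
   some index must come from the partial sum of [X] there. The three events fall to Markov, Markov
   and the maximal inequality. *)
have sub : [set w | exists2 i, (i <= N)%N & (eta <= `|U i w - V i w|)%R] `<=`
    E1 `|` E2 `|` E3.
  move=> w [i iN hi]; rewrite -/(Z i w) Zsum// in hi.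
  have [g1|g1] := leP l `|Z 0%N w|; first by left; left.
  have [g2|g2] := leP l `|\sum_(i < N) `|beta i w| |; first by left; right.
  right; exists i => //; rewrite leNgt; apply/negP => g3.
  have g2' : `|\sum_(i < i) beta i w| < l.
    apply: le_lt_trans g2; apply: (le_trans (ler_norm_sum _ _ _)).
    apply: le_trans (ler_norm _).
    exact: (@ler_sum_prefix _ (fun i => `|beta i w|)).
  move: hi; apply/negP; rewrite -ltNge.
  apply: (le_lt_trans (ler_normD _ _)).
  apply: (le_lt_trans (lerD (ler_normD _ _) (lexx _))).
  by rewrite (_ : eta = l + l + l); [lra|rewrite /l; field].
have mE : measurable [set w | exists2 i, (i <= N)%N & (eta <= `|U i w - V i w|)%R].
  by apply: (bigm Z) => i iN; exact/sqint_measurable/Zs.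
apply: (@le_trans _ _ (P (E1 `|` E2 `|` E3))).
  apply: le_measure => //; rewrite inE//.
  by apply: measurableU => //; exact: measurableU.
apply: (le_trans (measureU2 _ (measurableU _ _ mE1 mE2) mE3)).
apply: (le_trans (leeD (measureU2 _ mE1 mE2) p3)).
apply: (le_trans (leeD (leeD p1 p2) (lexx _))).
rewrite -!EFinD lee_fin.
have -> : mean P (fun w => `|\sum_(i < N) `|beta i w| |) =
    \sum_(i < N) mean P (fun w => `|beta i w|).
  rewrite -(@mean_sum _ _ _ P N (fun i w => `|beta i w|)); last first.
    by move=> i iN; exact/intg_norm/beta_i.
  by congr mean; apply/funext => w; rewrite ger0_norm// sumr_ge0.
have b1 : mean P (fun w => `|Z 0%N w|) / l <= 2 * eps / l.
  by rewrite ler_pM2r ?invr_gt0.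
have b2 : (\sum_(i < N) mean P (fun w => `|beta i w|)) / l <=
    (T * (2 * kappa eta1 + C * eta1) + 2 * eps * T) / l.
  by rewrite ler_pM2r ?invr_gt0.
have b3 : (\sum_(i < N) mean P (fun w => X i w ^+ 2)) / l ^+ 2 <=
    T * (16 * K * eta1 + 8 * eps ^+ 2) / l ^+ 2.
  by rewrite ler_pM2r ?invr_gt0 ?exprn_gt0.
apply: (le_trans (lerD (lerD b1 b2) b3)).
apply: (@le_trans _ _ (A' * q + A2' * eps)); last first.
  apply: (@le_trans _ _ (A * q + A2 * eps)); last by lra.
  by rewrite lerD// ler_wpM2r ?(ltW q0) ?(ltW eps0)// lerDl ?mulr_ge0.
have -> : A' * q + A2' * eps =
   2 * eps / l + (T * (2 * q + C * q) + 2 * eps * T) / l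
   + T * (16 * K * q + 8 * eps) / l ^+ 2 by rewrite /A' /A2'; field; rewrite gt_eqF.
apply: lerD; first rewrite lerD2l.
  rewrite ler_pM2r ?invr_gt0// lerD2r ler_wpM2l// lerD// ?ler_wpM2l//.
rewrite ler_pM2r ?invr_gt0 ?exprn_gt0// ler_wpM2l// lerD// ler_wpM2l//.
by rewrite mulr_ge0.
Qed.

End Stability.

(** * The Euler scheme *)

Section Grid.
Context (R : realType) (T : R).
Hypothesis T0' : 0 <= T.
Implicit Types (t eps : R) (n i L : nat).

Definition grid n i : R := T * i%:R / 2 ^+ n.

Lemma grid0 n : grid n 0 = 0. Proof. by rewrite /grid mulr0 mul0r. Qed.

Lemma gridN n : grid n (2 ^ n) = T.
Proof. by rewrite /grid natrX -mulrA mulfV ?mulr1// expf_neq0. Qed.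

Lemma grid_le n i j : (i <= j)%N -> grid n i <= grid n j.
Proof.
move=> ij; rewrite /grid ler_pM2r ?invr_gt0 ?exprn_gt0//.
by rewrite ler_wpM2l// ler_nat.
Qed.

Lemma grid_ge0 n i : 0 <= grid n i.
Proof. by rewrite -(grid0 n) grid_le. Qed.

Lemma grid_leT n i : (i <= 2 ^ n)%N -> grid n i <= T.
Proof. by move=> iN; rewrite -(gridN n) grid_le. Qed.

Lemma gridS n i : grid n i.+1 = grid n i + T / 2 ^+ n.
Proof. by rewrite /grid -natr1; ring. Qed.

Lemma grid_refine n L i : (n <= L)%N -> grid n i = grid L (i * 2 ^ (L - n)).
Proof.
move=> nL; rewrite /grid natrM natrX.
have -> : (2 : R) ^+ L = 2 ^+ n * 2 ^+ (L - n) by rewrite -exprD subnKC.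
by field; rewrite !expf_neq0.
Qed.

Lemma grid_mesh_small eps : 0 < eps ->
  exists n0, forall n, (n0 <= n)%N -> T / 2 ^+ n <= eps.
Proof.
move=> eps0; exists (Num.truncn (T / eps)).+1 => n hn.
rewrite ler_pdivrMr ?exprn_gt0// mulrC -ler_pdivrMr//.
have h1 : T / eps < (Num.truncn (T / eps)).+1%:R by exact: truncnS_gt.
apply: (le_trans (ltW h1)); rewrite -natrX ler_nat (leq_trans hn)//.
exact/ltnW/ltn_expl.
Qed.

(** Stopping the grid at [t] gives a partition whose last point is [t] exactly, so that terminal
    estimates can be read at any time. Its steps beyond [t] are flat. *)
Definition dyadic_chain L t i : R := Num.min (grid L i) t.

Lemma dyadic_chain0 L t : 0 <= t -> dyadic_chain L t 0 = 0.
Proof. by move=> t0; rewrite /dyadic_chain grid0 min_l. Qed.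

Lemma dyadic_chainN L t : t <= T -> dyadic_chain L t (2 ^ L) = t.
Proof. by move=> tT; rewrite /dyadic_chain gridN min_r. Qed.

Lemma dyadic_chain_le L t i : dyadic_chain L t i <= dyadic_chain L t i.+1.
Proof. by rewrite le_min !ge_min lexx orbT grid_le. Qed.

Lemma dyadic_chain_step L t i : dyadic_chain L t i.+1 - dyadic_chain L t i <= T / 2 ^+ L.
Proof.
rewrite /dyadic_chain gridS; have h : 0 <= T / 2 ^+ L by rewrite divr_ge0 ?exprn_ge0.
by case: (leP (grid L i) t) => h1; case: (leP (grid L i + T / 2 ^+ L) t) => h2; lra.
Qed.

Lemma dyadic_chain_good L t eps : 0 <= t -> t <= T -> T / 2 ^+ L <= eps ->
  good_chain T (2 ^ L) (dyadic_chain L t) eps.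
Proof.
move=> t0 tT h; split.
- by rewrite dyadic_chain0.
- by move=> i _; exact: dyadic_chain_le.
- by rewrite dyadic_chainN.
- by move=> i _; apply: le_trans (dyadic_chain_step L t i) h.
Qed.

Lemma dyadic_chain_lt L t i : dyadic_chain L t i < dyadic_chain L t i.+1 ->
  dyadic_chain L t i = grid L i /\ grid L i < t.
Proof.
rewrite /dyadic_chain; case: (ltP (grid L i) t) => // ti.
by rewrite lt_min ltxx andbF.
Qed.

End Grid.

Section Euler.
Context (R : realType) (d : measure_display) (Omega : measurableType d).
Variables (P : probability Omega R) (T M C K x : R).
Variables (b : R -> R -> borel_prob R -> R) (sigma : R -> R -> R) (kappa : R -> R).
Hypothesis RC : regular_coef T M C K b sigma kappa.
Variable B : R -> {RV P >-> R}.
Implicit Types (s t eps : R) (n i L : nat) (w : Omega).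

Let T0 := rc_T RC.
Let T0' : 0 <= T := ltW T0.
Let M0 := rc_M_ge0 RC.
Local Notation grid := (grid T).
Local Notation dyadic_chain := (dyadic_chain T).
Let grid_le := @grid_le _ _ T0'.
Let grid_ge0 := @grid_ge0 _ _ T0'.
Let grid_leT := @grid_leT _ _ T0'.
Let dyadic_chain_le := @dyadic_chain_le _ _ T0'.
Let dyadic_chain_step := @dyadic_chain_step _ _ T0'.
Let dyadic_chain_good := @dyadic_chain_good _ _ T0'.

(** The default value lets the Euler scheme be defined before its measurability is proved, which
    itself goes by recursion along the scheme. *)
Definition toRV (f : Omega -> R) : {RV P >-> R} :=
  match pselect (measurable_fun setT f) with
  | left mf => mkRV P mf
  | right _ => cst 0
  end.

Lemma toRVE (f : Omega -> R) : measurable_fun setT f -> toRV f = f :> (Omega -> R).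
Proof. by move=> mf; rewrite /toRV; case: pselect. Qed.

(** The drift of each step depends on the law of the current value, so the recursion runs on random
    variables rather than sample by sample. *)
Fixpoint euler n i : {RV P >-> R} :=
  if i is j.+1 then
    toRV (fun w => euler n j w
      + drift b (grid n j) (grid n j.+1) (euler n j) (euler n j w)
      + sigma (grid n j) (euler n j w) * incr B (grid n j) (grid n j.+1) w)
  else cst x.

Definition euler_sp n : simple_process R Omega :=
  SimpleProcess (2 ^ n) (grid n) (fun i w => sigma (grid n i) (euler n i w)).

Definition euler_drift n t w : R := \sum_(i < 2 ^ n)
  drift b (Num.min (grid n i) t) (Num.min (grid n i.+1) t) (euler n i) (euler n i w).

Definition euler_path n t w : R := x + euler_drift n t w + sp_int B (euler_sp n) t w.

Definition eulerX n t : {RV P >-> R} := toRV (euler_path n t).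

Lemma euler_path_step_sp n i s t w : (i < 2 ^ n)%N -> grid n i <= s -> s <= t ->
  t <= grid n i.+1 ->
  euler_drift n t w = euler_drift n s w +
    (drift b (grid n i) t (euler n i) (euler n i w) -
     drift b (grid n i) s (euler n i) (euler n i w)) /\
  sp_int B (euler_sp n) t w = sp_int B (euler_sp n) s w +
    sigma (grid n i) (euler n i w) * incr B s t w.
Proof.
move=> iN is_ st ti.
have lo j r : (j <= i)%N -> s <= r -> Num.min (grid n j) r = grid n j.
  by move=> ji sr; rewrite min_l// (le_trans _ sr)// (le_trans _ is_)// grid_le.
have hi j r : (i < j)%N -> r <= t -> Num.min (grid n j) r = r.
  by move=> ji sr; rewrite min_r// (le_trans sr)// (le_trans ti)// grid_le.
(* Between [s] and [t] only cell [i] changes: earlier cells are complete and later ones empty at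
   both times. [g] stands for the drift as well as for the stochastic sum. *)
have key (g : nat -> R -> R -> R) : (forall j r, g j r r = 0) ->
    \sum_(j < 2 ^ n) g j (Num.min (grid n j) t) (Num.min (grid n j.+1) t) =
    \sum_(j < 2 ^ n) g j (Num.min (grid n j) s) (Num.min (grid n j.+1) s)
    + (g i (grid n i) t - g i (grid n i) s).
  move=> g0; rewrite (bigD1 (Ordinal iN))//= [in RHS](bigD1 (Ordinal iN))//=.
  rewrite (lo i t)// (lo i s)// (hi i.+1 t)// (hi i.+1 s)//.
  rewrite (eq_bigr (fun j : 'I_(2 ^ n) =>
    g j (Num.min (grid n j) s) (Num.min (grid n j.+1) s))); last first.
    move=> j; rewrite -val_eqE/= neq_ltn => /orP[ji|ij].
      by rewrite (lo j t) ?(lo j s) ?(lo j.+1 t) ?(lo j.+1 s)// ltnW.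
    by rewrite (hi j t) ?(hi j s) ?(hi j.+1 t) ?(hi j.+1 s) ?g0// ltnW.
  by ring.
rewrite /euler_drift /sp_int/=; split.
  rewrite (key (fun j r r' => drift b r r' (euler n j) (euler n j w)))//.
  by move=> j r; exact: drift_self.
rewrite (key (fun j r r' => sigma (grid n j) (euler n j w) * (B r' w - B r w))).
  by rewrite /incr; ring.
by move=> j r; rewrite subrr mulr0.
Qed.

Lemma euler_path_step n i s t w : (i < 2 ^ n)%N -> grid n i <= s -> s <= t ->
  t <= grid n i.+1 ->
  euler_path n t w = euler_path n s w +
    (drift b (grid n i) t (euler n i) (euler n i w) -
     drift b (grid n i) s (euler n i) (euler n i w))
    + sigma (grid n i) (euler n i w) * incr B s t w.
Proof.
move=> iN si st ti; have [h1 h2] := euler_path_step_sp w iN si st ti.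
by rewrite /euler_path h1 h2; ring.
Qed.

Lemma euler_path0 n w : euler_path n 0 w = x.
Proof.
have m0 i : Num.min (grid n i) 0 = 0 by rewrite min_r// grid_ge0.
rewrite /euler_path /euler_drift /sp_int !big1 ?addr0// => i _ /=.
  by rewrite !m0 subrr mulr0.
by rewrite !m0 drift_self.
Qed.

Section Filtered.
Variable F : R -> set (set Omega).
Hypothesis F_filtration : filtration T F.
Hypothesis B_brownian : brownian_motion T F B.

Lemma euler_wrt n i : (i <= 2 ^ n)%N ->
  measurable_wrt (F (grid n i)) (euler n i) /\ sqint P (euler n i).
Proof.
elim: i => [|i IH] iN.
  split; last exact: sqint_cst.
  apply: measurable_wrt_cst; apply: (filtration_sigma F_filtration).
  by rewrite grid0 lexx.
have [mE sE] := IH (ltnW iN).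
have i0 := grid_ge0 n i; have iT := grid_leT iN; have ii := grid_le n (leqnSn i).
have iT' : grid n i <= T := le_trans ii iT.
have sG : sigma_algebra setT (F (grid n i.+1)).
  by apply: (filtration_sigma F_filtration); rewrite (le_trans i0 ii).
have FG := filtration_le F_filtration i0 ii iT.
have md : measurable_fun setT (drift b (grid n i) (grid n i.+1) (euler n i)).
  exact: (rc_drift_measurable RC i0 ii iT sE).
have mdE : measurable_wrt (F (grid n i.+1))
    (fun w => drift b (grid n i) (grid n i.+1) (euler n i) (euler n i w)).
  exact: (measurable_wrt_comp md (measurable_wrtS FG mE)).
have msE : measurable_wrt (F (grid n i)) (fun w => sigma (grid n i) (euler n i w)).
  by apply: (measurable_wrt_comp _ mE); apply: (sigma_measurable RC); rewrite i0.
pose f w := euler n i w + drift b (grid n i) (grid n i.+1) (euler n i) (euler n i w)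
      + sigma (grid n i) (euler n i w) * incr B (grid n i) (grid n i.+1) w.
have mf : measurable_wrt (F (grid n i.+1)) f.
  apply: measurable_wrtD => //.
    by apply: measurable_wrtD => //; exact: measurable_wrtS mE.
  apply: measurable_wrtM => //; first exact: measurable_wrtS msE.
  exact: (incr_wrt F_filtration B_brownian).
have mf' : measurable_fun setT f.
  apply: measurable_wrt_fun mf; apply: (filtration_meas F_filtration).
  by rewrite (le_trans i0 ii).
have mF := filtration_meas F_filtration (_ : 0 <= grid n i <= T).
have sS : sqint P (fun w => sigma (grid n i) (euler n i w)).
  apply: (@sqint_bounded _ _ _ P _ M).
    by apply: measurable_wrt_fun msE; apply: mF; rewrite i0.
  by move=> w; apply: (rc_sigma_le RC); rewrite i0.
have -> : euler n i.+1 = f :> (Omega -> R) by rewrite /= toRVE.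
split => //; apply: sqintD.
  apply: sqintD => //; apply: (@sqint_bounded _ _ _ P _ (M * (grid n i.+1 - grid n i))).
    exact: (measurableT_comp md (sqint_measurable sE)).
  by move=> w; exact: (rc_drift_le RC _ i0 ii iT (sqint_intg sE)).
by have [] := incr_mul_sqint B_brownian i0 ii iT (fun _ => msE) sS.
Qed.

Lemma euler_path_grid n i w : (i <= 2 ^ n)%N -> euler_path n (grid n i) w = euler n i w.
Proof.
elim: i => [|i IH] iN; first by rewrite grid0 euler_path0.
have ii := grid_le n (leqnSn i).
rewrite (euler_path_step w iN (lexx _) ii (lexx _)) IH ?(ltnW iN)//.
rewrite drift_self subr0 /= toRVE//.
have [mE _] := euler_wrt iN.
have i0 := grid_ge0 n i; have iT := grid_leT iN.
have [mEi sEi] := euler_wrt (ltnW iN).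
have md : measurable_fun setT (drift b (grid n i) (grid n i.+1) (euler n i)).
  exact: (rc_drift_measurable RC i0 ii iT sEi).
apply: measurable_funD.
  apply: measurable_funD; first exact: sqint_measurable sEi.
  exact: (measurableT_comp md (sqint_measurable sEi)).
apply: measurable_funM; last exact: incr_measurable.
apply: (measurableT_comp _ (sqint_measurable sEi)).
by apply: (sigma_measurable RC); rewrite i0 (le_trans ii).
Qed.

(** A coarse cell consists of [2 ^ (L - n)] fine ones, so the coarse index is the quotient of the
    fine one by this number. *)
Lemma grid_cell n L i : (i < 2 ^ L)%N -> (n <= L)%N ->
  exists j, [/\ (j < 2 ^ n)%N, grid n j <= grid L i & grid L i.+1 <= grid n j.+1].
Proof.
move=> iN nL; exists (i %/ 2 ^ (L - n))%N.
have p0 : (0 < 2 ^ (L - n))%N by rewrite expn_gt0.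
split.
- by rewrite ltn_divLR// -expnD subnKC.
- by rewrite (grid_refine T _ nL) grid_le// leq_trunc_div.
- by rewrite (grid_refine T _ nL) grid_le// ltn_ceil.
Qed.

Lemma euler_drift_le n t w : 0 <= t -> t <= T -> `|euler_drift n t w| <= M * T.
Proof.
move=> t0 tT.
have [c0 cl cN _] := dyadic_chain_good t0 tT (lexx (T / 2 ^+ n)).
have cT := chain_itv c0 cl cN.
apply: (le_trans (ler_norm_sum _ _ _)).
apply: (@le_trans _ _ (\sum_(i < 2 ^ n)
    (dyadic_chain n t i.+1 - dyadic_chain n t i) * M)).
  apply: ler_sum => i _; have iN := ltn_ord i.
  have [_ sE] := euler_wrt (ltnW iN).
  have /andP[h1 _] := cT i (ltnW iN); have /andP[_ h2] := cT i.+1 iN.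
  rewrite mulrC.
  exact: (rc_drift_le RC (euler n i w) h1 (cl i iN) h2 (sqint_intg sE)).
rewrite -mulr_suml -(big_mkord xpredT (fun i => dyadic_chain n t i.+1 - dyadic_chain n t i)).
by rewrite telescope_sumr// dyadic_chainN// dyadic_chain0// subr0 mulrC ler_wpM2l.
Qed.

(** Along the grid stopped at [t], the stochastic part is a sum over a partition ending at [t]. Its
    second moment is at most [8 M^2 T], and [|y| <= 1 + y^2] turns this into a bound on the mean,
    independent of [n]. *)
Lemma euler_path_wrt n t : 0 <= t -> t <= T ->
  [/\ measurable_wrt (F t) (euler_path n t), sqint P (euler_path n t),
      mean P (fun w => `|euler_path n t w|) <= `|x| + M * T + 1 + 8 * M ^+ 2 * T,
      measurable_wrt (F t) (sp_int B (euler_sp n) t) & sqint P (sp_int B (euler_sp n) t)].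
Proof.
move=> t0 tT.
have [c0 cl cN _] := dyadic_chain_good t0 tT (lexx (T / 2 ^+ n)).
have sF : sigma_algebra setT (F t) by apply: (filtration_sigma F_filtration); rewrite t0.
have mF : F t `<=` measurable by apply: (filtration_meas F_filtration); rewrite t0.
have cT := chain_itv c0 cl cN.
have aw i : (i < 2 ^ n)%N -> dyadic_chain n t i < dyadic_chain n t i.+1 ->
    measurable_wrt (F (dyadic_chain n t i)) (fun w => sigma (grid n i) (euler n i w)).
  move=> iN /dyadic_chain_lt[-> _].
  have [mE _] := euler_wrt (ltnW iN); apply: (measurable_wrt_comp _ mE).
  by apply: (sigma_measurable RC); rewrite grid_ge0 grid_leT// ltnW.
have gT i : (i < 2 ^ n)%N -> 0 <= grid n i <= T.
  by move=> iN; rewrite grid_ge0 grid_leT// ltnW.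
have mS i : (i < 2 ^ n)%N -> measurable_fun setT (fun w => sigma (grid n i) (euler n i w)).
  move=> iN; have [_ sE] := euler_wrt (ltnW iN).
  apply: (measurableT_comp _ (sqint_measurable sE)).
  by apply: (sigma_measurable RC); exact: gT.
have lS i w : (i < 2 ^ n)%N -> `|sigma (grid n i) (euler n i w)| <= M.
  by move=> iN; apply: (rc_sigma_le RC); exact: gT.
have aS i : (i < 2 ^ n)%N -> sqint P (fun w => sigma (grid n i) (euler n i w)).
  by move=> iN; exact: (sqint_bounded P (mS i iN) (fun w => lS i w iN)).
have md := chain_mdiff F_filtration B_brownian c0 cl cN aw aS.
have [jw js] := mdiff_partial_sum (chain_sigma F_filtration c0 cl cN)
  (chain_mono F_filtration c0 cl cN) md (leqnn _).
rewrite dyadic_chainN// in jw.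
have [_ j2] := chain_isometry_le F_filtration B_brownian c0 cl cN aw aS.
have sumc : \sum_(i < 2 ^ n) (dyadic_chain n t i.+1 - dyadic_chain n t i) = t.
  rewrite -(big_mkord xpredT (fun i => dyadic_chain n t i.+1 - dyadic_chain n t i)).
  by rewrite telescope_sumr// dyadic_chainN// dyadic_chain0// subr0.
have {}j2 : mean P (fun w => sp_int B (euler_sp n) t w ^+ 2) <= 8 * M ^+ 2 * T.
  apply: (le_trans j2).
  apply: (@le_trans _ _ (\sum_(i < 2 ^ n) (dyadic_chain n t i.+1 - dyadic_chain n t i)
    * (8 * M ^+ 2))).
    apply: ler_sum => i _; have iN := ltn_ord i.
    have : mean P (fun w => sigma (grid n i) (euler n i w) ^+ 2) <= M ^+ 2.
      rewrite -[leRHS](mean_cst P); apply: mean_le.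
      - by have [] := aS i iN.
      - exact: intg_cst.
      - move=> w; rewrite -real_normK ?num_real// ler_pXn2r ?nnegrE//.
        exact: lS.
    have D0 : 0 <= dyadic_chain n t i.+1 - dyadic_chain n t i by rewrite subr_ge0 cl.
    move=> h; rewrite -mulrA mulrCA ler_wpM2l// ler_wpM2l//.
  by rewrite -mulr_suml sumc mulrC ler_wpM2l// mulr_ge0// sqr_ge0.
have dw i : (i < 2 ^ n)%N -> measurable_wrt (F t) (fun w =>
    drift b (dyadic_chain n t i) (dyadic_chain n t i.+1) (euler n i) (euler n i w)).
  move=> iN; have [mE sE] := euler_wrt (ltnW iN).
  have := cl i iN; rewrite le_eqVlt => /orP[/eqP E|lt].
    rewrite -E; under [X in measurable_wrt _ X]eq_fun do rewrite drift_self.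
    exact: measurable_wrt_cst.
  have [_ ti] := dyadic_chain_lt lt.
  have FF := filtration_le F_filtration (grid_ge0 n i) (ltW ti) tT.
  apply: (measurable_wrt_comp _ (measurable_wrtS FF mE)).
  have /andP[h1 _] := cT i (ltnW iN); have /andP[_ h2] := cT i.+1 iN.
  exact: (rc_drift_measurable RC h1 (cl i iN) h2 sE).
have Dw : measurable_wrt (F t) (euler_drift n t).
  exact: (@measurable_wrt_sum _ _ _ sF _ (fun i w =>
    drift b (dyadic_chain n t i) (dyadic_chain n t i.+1) (euler n i) (euler n i w))).
have Dle w := euler_drift_le n w t0 tT.
have Ds : sqint P (euler_drift n t).
  exact: (sqint_bounded P (measurable_wrt_fun mF Dw) Dle).
have js' : sqint P (sp_int B (euler_sp n) t) by exact: js.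
split=> //.
- apply: measurable_wrtD => //; apply: measurable_wrtD => //.
  exact: measurable_wrt_cst.
- by apply: sqintD => //; apply: sqintD => //; exact: sqint_cst.
- have i2 : intg P (fun w => sp_int B (euler_sp n) t w ^+ 2) by case: js'.
  apply: (@le_trans _ _ (mean P (fun w => (`|x| + M * T + 1)
      + sp_int B (euler_sp n) t w ^+ 2))).
    apply: mean_le.
    + apply/intg_norm/sqint_intg.
      by apply: sqintD => //; apply: sqintD => //; exact: sqint_cst.
    + by apply: intgD => //; exact: intg_cst.
    + move=> w; rewrite /euler_path; set y := sp_int _ _ _ _.
      apply: (le_trans (ler_normD _ _)).
      apply: (le_trans (lerD (ler_normD _ _) (lexx _))).
      have := Dle w; have : `|y| <= 1 + y ^+ 2.
        rewrite -(@real_normK _ y) ?num_real//.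
        have := sqr_ge0 (`|y| - 1); have := sqr_ge0 `|y|; nra.
      lra.
  by rewrite meanD ?mean_cst ?lerD2l//; exact: intg_cst.
Qed.

Lemma eulerXE n t : 0 <= t -> t <= T -> eulerX n t = euler_path n t :> (Omega -> R).
Proof.
move=> t0 tT; rewrite /eulerX toRVE//.
by have [_ /sqint_measurable] := euler_path_wrt n t0 tT.
Qed.

(** With [q] the square root of the mesh, the drift moves by at most [M q^2 <= M q], and the
    stochastic part by at most [3 M q] in mean because [8 <= 3^2]. *)
Lemma euler_path_osc n i t : (i < 2 ^ n)%N -> grid n i <= t -> t <= grid n i.+1 ->
  T / 2 ^+ n <= 1 ->
  mean P (fun w => `|euler n i w - euler_path n t w|) <=
  4 * M * Num.sqrt (T / 2 ^+ n).
Proof.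
move=> iN it ti h1; have i0 := grid_ge0 n i; have iT := grid_leT iN.
have tT : t <= T := le_trans ti iT; have t0 : 0 <= t := le_trans i0 it.
have [mE sE] := euler_wrt (ltnW iN).
have [_ sX _ _ _] := euler_path_wrt n t0 tT.
set q := Num.sqrt _; have q0 : 0 <= q := sqrtr_ge0 _.
have qq : q ^+ 2 = T / 2 ^+ n by rewrite sqr_sqrtr// divr_ge0// exprn_ge0.
have q1 : q <= 1 by rewrite -(@ler_pXn2r _ 2)// ?nnegrE// qq expr1n.
have ti' : t - grid n i <= q ^+ 2 by rewrite qq; move: ti; rewrite gridS; lra.
have msE : measurable_wrt (F (grid n i)) (fun w => sigma (grid n i) (euler n i w)).
  by apply: (measurable_wrt_comp _ mE); apply: (sigma_measurable RC);
    rewrite i0 (le_trans it).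
have lS w : `|sigma (grid n i) (euler n i w)| <= M.
  by apply: (rc_sigma_le RC); rewrite i0 (le_trans it).
have sS : sqint P (fun w => sigma (grid n i) (euler n i w)).
  apply: (@sqint_bounded _ _ _ P _ M) => //.
  apply: measurable_wrt_fun msE; apply: (filtration_meas F_filtration).
  by rewrite i0 (le_trans it).
have [s1 m1] := incr_mul_sqint B_brownian i0 it tT (fun _ => msE) sS.
have m2 : mean P (fun w => `|sigma (grid n i) (euler n i w) * incr B (grid n i) t w|)
    <= 3 * M * q.
  apply: mean_norm_le_sqrt => //; first by rewrite !mulr_ge0.
  apply: (le_trans m1).
  have : mean P (fun w => sigma (grid n i) (euler n i w) ^+ 2) <= M ^+ 2.
    rewrite -[leRHS](mean_cst P); apply: mean_le.
    - by case: sS.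
    - exact: intg_cst.
    - move=> w; rewrite -real_normK ?num_real// ler_pXn2r ?nnegrE//.
  move=> h; apply: (@le_trans _ _ (8 * q ^+ 2 * M ^+ 2)).
    apply: ler_pM => //; first by rewrite mulr_ge0// subr_ge0.
      by apply: mean_ge0 => w; exact: sqr_ge0.
    by rewrite ler_wpM2l.
  have -> : (3 * M * q) ^+ 2 = 9 * q ^+ 2 * M ^+ 2 by ring.
  by rewrite ler_wpM2r ?sqr_ge0// ler_wpM2r ?sqr_ge0// ler_nat.
apply: (@le_trans _ _ (mean P (fun w => M * q +
    `|sigma (grid n i) (euler n i w) * incr B (grid n i) t w|))).
  apply: mean_le.
  - exact/intg_norm/sqint_intg/sqintB.
  - by apply: intgD; [exact: intg_cst|exact/intg_norm/sqint_intg].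
  move=> w; rewrite (euler_path_step w iN (lexx _) it ti) drift_self subr0.
  rewrite euler_path_grid ?(ltnW iN)//.
  have e3 (y z u : R) : y + z + u - y = z + u by ring.
  rewrite distrC e3; apply: (le_trans (ler_normD _ _)); rewrite lerD2r.
  apply: (le_trans (rc_drift_le RC _ i0 it tT (sqint_intg sE))).
  rewrite ler_wpM2l//; apply: (le_trans ti').
  by rewrite expr2 ler_piMr.
rewrite meanD ?mean_cst; [|exact: intg_cst|exact/intg_norm/sqint_intg].
lra.
Qed.

(** The scheme of level [n] is observed on a finer grid [L]. The remainders come from its
    coefficients being frozen at the start [E i] of the coarse cell and not at the current value
    [X i]. They are controlled by the coarse mesh, whatever [L], so schemes of different levels can
    be compared on a common grid. *)
Lemma eulerX_approx_sol eps : 0 < eps -> exists n0, forall n L t,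
  (n0 <= n)%N -> (n <= L)%N -> 0 <= t -> t <= T ->
  approx_sol x b sigma F B (2 ^ L) (dyadic_chain L t) eps
    (fun i => eulerX n (dyadic_chain L t i))
    (fun i => sp_int B (euler_sp n) (dyadic_chain L t i)).
Proof.
move=> eps0.
pose C0 := `|x| + M * T + 1 + 8 * M ^+ 2 * T.
have C00 : 0 <= C0 by rewrite !addr_ge0 ?mulr_ge0 ?sqr_ge0.
have kap := rc_kappa_small RC.
pose e1 := eps / (4 * (C + 1)).
have C1 : 0 < C + 1 by rewrite ltr_wpDl// (rc_C RC).
have e10 : 0 < e1 by rewrite divr_gt0// mulr_gt0.
have e4 : 0 < eps / 4 by rewrite divr_gt0.
have [v1 v10 kv1] := kap _ e4.
pose e2 := eps ^+ 2 / (16 * (1 + C0)).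
have e20 : 0 < e2.
  by rewrite divr_gt0 ?exprn_gt0// mulr_gt0// ltr_pwDl.
have [dl dl0 sm] := sigma_modulus (rc_sigma_le RC) (rc_sigma_cont RC) (rc_K RC)
  (rc_sigma_half RC) e20.
pose v2 := eps ^+ 2 / (32 * (K + 1)).
have K1 : 0 < K + 1 by rewrite ltr_wpDl// (rc_K RC).
have v20 : 0 < v2 by rewrite divr_gt0 ?exprn_gt0// mulr_gt0.
(* [v] will bound the mean of [|E i - X i|]. Its three caps give [kappa v <= eps / 4],
   [C * v <= eps / 4] and [2 * K * v <= eps ^+ 2 / 16]. *)
pose v := Num.min v1 (Num.min e1 v2).
have v0 : 0 < v by rewrite !lt_min v10 e10 v20.
have vv1 : v <= v1 by rewrite ge_min lexx.
have ve1 : v <= e1 by rewrite !ge_min lexx orbT.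
have vv2 : v <= v2 by rewrite !ge_min lexx !orbT.
have M4 : 0 < 4 * (M + 1) by rewrite mulr_gt0// ltr_wpDl.
pose q := v / (4 * (M + 1)); have q0 : 0 < q by rewrite divr_gt0.
pose mesh := Num.min 1 (Num.min dl (q ^+ 2)).
have mesh0 : 0 < mesh by rewrite !lt_min ltr01 dl0 exprn_gt0.
have [n0 Hn0] := grid_mesh_small T mesh0.
exists n0 => n L t n0n nL t0 tT.
have meshn := Hn0 n n0n.
have mesh1 : T / 2 ^+ n <= 1 by apply: (le_trans meshn); rewrite ge_min lexx.
have meshdl : T / 2 ^+ n <= dl by apply: (le_trans meshn); rewrite !ge_min lexx orbT.
have meshq : Num.sqrt (T / 2 ^+ n) <= q.
  have h : T / 2 ^+ n <= q ^+ 2 by apply: (le_trans meshn); rewrite !ge_min lexx !orbT.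
  by rewrite -(gtr0_norm q0) -sqrtr_sqr ler_wsqrtr.
have osc : 4 * M * Num.sqrt (T / 2 ^+ n) <= v.
  apply: (@le_trans _ _ (4 * (M + 1) * q)).
    apply: ler_pM => //; first by rewrite mulr_ge0.
    by rewrite ler_wpM2l// lerDl.
  by rewrite /q mulrC divfK// gt_eqF.
pose c := dyadic_chain L t.
have [c0 cl cN _] := dyadic_chain_good t0 tT (lexx (T / 2 ^+ L)).
have cT := chain_itv c0 cl cN.
rewrite -/c in c0 cl cN cT.
(* The range condition sits inside the existential so that [choice] yields a total index map [k]. *)
have cell i : exists j, (i < 2 ^ L)%N ->
    [/\ (j < 2 ^ n)%N, grid n j <= grid L i & grid L i.+1 <= grid n j.+1].
  have [iN|iN] := ltnP i (2 ^ L); last by exists 0%N.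
  by have [j h] := grid_cell iN nL; exists j.
have [k kP] := choice cell.
pose X i := eulerX n (c i).
have XE i : (i <= 2 ^ L)%N -> X i = euler_path n (c i) :> (Omega -> R).
  by move=> iN; have /andP[h1 h2] := cT i iN; exact: eulerXE.
have Xw i : (i <= 2 ^ L)%N -> measurable_wrt (F (c i)) (X i) /\ sqint P (X i).
  move=> iN; have /andP[h1 h2] := cT i iN; rewrite XE//.
  by have [] := euler_path_wrt n h1 h2.
have Xm i : (i <= 2 ^ L)%N -> mean P (fun w => `|X i w|) <= C0.
  move=> iN; have /andP[h1 h2] := cT i iN; rewrite XE//.
  by have [] := euler_path_wrt n h1 h2.
pose E i := euler n (k i).
pose a i w := sigma (grid n (k i)) (E i w) - sigma (c i) (X i w).
pose r i w := drift b (c i) (c i.+1) (E i) (E i w) - drift b (c i) (c i.+1) (X i) (X i w).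
(* Only proper steps begin at a grid point and lie in one coarse cell; on the flat ones every
   increment and drift vanishes. *)
have active i : (i < 2 ^ L)%N -> c i < c i.+1 ->
    [/\ (k i < 2 ^ n)%N, grid n (k i) <= c i, c i.+1 <= grid n (k i).+1 &
        c i = grid L i].
  move=> iN lt; have [ci _] := dyadic_chain_lt lt; rewrite -/c in ci.
  have [h1 h2 h3] := kP i iN; rewrite ci; split => //.
  by apply: le_trans h3; rewrite /c /dyadic_chain ge_min lexx.
have EXm i : (i < 2 ^ L)%N -> c i < c i.+1 -> mean P (fun w => `|E i w - X i w|) <= v.
  move=> iN lt; have [h1 h2 h3 h4] := active i iN lt.
  rewrite XE ?(ltnW iN)//; apply: le_trans osc.
  by apply: euler_path_osc => //; apply: (le_trans (ltW lt)).
have Es i : (i < 2 ^ L)%N -> sqint P (E i).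
  by move=> iN; have [h1 _ _] := kP i iN; have [] := euler_wrt (ltnW h1).
have am i : (i < 2 ^ L)%N -> measurable_fun setT (a i).
  move=> iN; have [h1 _ _] := kP i iN.
  have [_ sX] := Xw i (ltnW iN).
  apply: measurable_funB.
    apply: (measurableT_comp _ (sqint_measurable (Es i iN))).
    by apply: (sigma_measurable RC); rewrite grid_ge0 grid_leT// ltnW.
  apply: (measurableT_comp _ (sqint_measurable sX)).
  by apply: (sigma_measurable RC); exact/cT/ltnW.
have aM i w : (i < 2 ^ L)%N -> `|a i w| <= 2 * M.
  move=> iN; have [h1 _ _] := kP i iN; apply: (le_trans (ler_normB _ _)).
  have gT : 0 <= grid n (k i) <= T by rewrite grid_ge0 grid_leT// ltnW.
  have := rc_sigma_le RC (E i w) gT.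
  have := rc_sigma_le RC (X i w) (cT i (ltnW iN)); lra.
have as_ i : (i < 2 ^ L)%N -> sqint P (a i).
  by move=> iN; exact: (sqint_bounded P (am i iN) (fun w => aM i w iN)).
have aw i : (i < 2 ^ L)%N -> c i < c i.+1 -> measurable_wrt (F (c i)) (a i).
  move=> iN lt; have [h1 h2 h3 h4] := active i iN lt.
  have /andP[_ ciT] := cT i (ltnW iN).
  have [mX _] := Xw i (ltnW iN); have [mE _] := euler_wrt (ltnW h1).
  apply: measurable_wrtB.
  - exact/(filtration_sigma F_filtration)/cT/ltnW.
  - apply: (measurable_wrtS (filtration_le F_filtration (grid_ge0 n _) h2 ciT)).
    apply: (measurable_wrt_comp _ mE).
    by apply: (sigma_measurable RC); rewrite grid_ge0 (le_trans h2).
  - apply: (measurable_wrt_comp _ mX); apply: (sigma_measurable RC).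
    exact/cT/ltnW.
rewrite -/c; exists r, (fun i w => a i w * incr B (c i) (c i.+1) w); split.
- split => //.
  rewrite /c dyadic_chain0// (eulerXE n (lexx 0) T0').
  under [X in mean P X]eq_fun do rewrite euler_path0 subrr normr0.
  by rewrite mean_cst ltW.
- move=> i iN; have /andP[h1 _] := cT i (ltnW iN); have /andP[_ h2] := cT i.+1 iN.
  have [_ sX] := Xw i (ltnW iN); have sE := Es i iN.
  have ir : intg P (r i).
    apply: sqint_intg; apply: (@sqint_bounded _ _ _ P _ (2 * (M * (c i.+1 - c i)))).
      apply: measurable_funB.
        apply: (measurableT_comp _ (sqint_measurable sE)).
        exact: (rc_drift_measurable RC h1 (cl i iN) h2 sE).
      apply: (measurableT_comp _ (sqint_measurable sX)).
      exact: (rc_drift_measurable RC h1 (cl i iN) h2 sX).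
    move=> w; apply: (le_trans (ler_normB _ _)).
    have := rc_drift_le RC (E i w) h1 (cl i iN) h2 (sqint_intg sE).
    have := rc_drift_le RC (X i w) h1 (cl i iN) h2 (sqint_intg sX); rewrite -/c; lra.
  split => //.
  have := cl i iN; rewrite le_eqVlt => /orP[/eqP eqc|lt].
    rewrite /r -eqc.
    under [Y in mean P Y]eq_fun do rewrite !drift_self subrr normr0.
    by rewrite mean_cst subrr mulr0.
  have D0 : 0 <= c i.+1 - c i by rewrite subr_ge0 cl.
  have iEX := intg_norm (sqint_intg (sqintB sE sX)).
  have mEX := EXm i iN lt.
  have kv : 0 <= kappa v by apply: (kappa_ge0 (rc_kappa_incr RC) (rc_kappa0 RC)); exact: ltW.
  have kv2 : kappa v <= eps / 4.
    by apply: le_trans kv1; apply: (kappa_le (rc_kappa_incr RC)) => //; exact: ltW.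
  have cv : C * v <= eps / 4.
    apply: (@le_trans _ _ ((C + 1) * e1)).
      by apply: ler_pM => //; rewrite ?(rc_C RC) ?(ltW v0)// lerDl.
    rewrite /e1 le_eqVlt; apply/orP; left; apply/eqP.
    by field; rewrite gt_eqF.
  apply: (@le_trans _ _ (mean P (fun w => (c i.+1 - c i) * (kappa v + C * v) +
      (c i.+1 - c i) * kappa v / v * `|E i w - X i w|))).
    apply: mean_le; first exact: intg_norm.
      by apply: intgD; [exact: intg_cst|exact: intgZ].
    move=> w; apply: (le_trans (rc_driftB_le RC (E i w) (X i w) h1 (cl i iN) h2 sE sX)).
    rewrite mulrC -/c.
    have -> : (c i.+1 - c i) * (kappa v + C * v) +
      (c i.+1 - c i) * kappa v / v * `|E i w - X i w| =
      (c i.+1 - c i) * (kappa v * (1 + `|E i w - X i w| / v) + C * v).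
      by field; rewrite gt_eqF.
    rewrite ler_wpM2l//; apply: lerD; last by rewrite ler_wpM2l// (rc_C RC).
    exact: (kappa_affine (rc_kappa_incr RC) (rc_kappa0 RC) (rc_kappa_concave RC)).
  rewrite meanD ?mean_cst; [|exact: intg_cst|exact: intgZ].
  rewrite meanZ//.
  have : (c i.+1 - c i) * kappa v / v * mean P (fun w => `|E i w - X i w|) <=
     (c i.+1 - c i) * kappa v.
    rewrite [leRHS](_ : _ = (c i.+1 - c i) * kappa v / v * v); last by field; rewrite gt_eqF.
    by rewrite ler_wpM2l// divr_ge0 ?(ltW v0)// mulr_ge0.
  have : (c i.+1 - c i) * (kappa v + C * v + kappa v) <= (c i.+1 - c i) * eps.
    by rewrite ler_wpM2l//; lra.
  rewrite -/c; lra.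
- exact: (chain_mdiff F_filtration B_brownian c0 cl cN aw as_).
- move=> i iN; have /andP[h1 _] := cT i (ltnW iN); have /andP[_ h2] := cT i.+1 iN.
  have [_ m2] := incr_mul_sqint B_brownian h1 (cl i iN) h2 (aw i iN) (as_ i iN).
  apply: (le_trans m2).
  have := cl i iN; rewrite le_eqVlt => /orP[/eqP eqc|lt].
    by rewrite -eqc subrr !mulr0 mul0r.
  have [g1 g2 g3 g4] := active i iN lt.
  have D0 : 0 <= c i.+1 - c i by rewrite subr_ge0 cl.
  have [_ sX] := Xw i (ltnW iN); have sE := Es i iN.
  have iX := intg_norm (sqint_intg sX).
  have iEX := intg_norm (sqint_intg (sqintB sE sX)).
  have gc : `|grid n (k i) - c i| <= dl.
    rewrite distrC ger0_norm ?subr_ge0//; apply: le_trans meshdl.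
    by move: g3; rewrite gridS; have := ltW lt; lra.
  have a2 : mean P (fun w => a i w ^+ 2) <= eps ^+ 2 / 8.
    apply: (@le_trans _ _ (mean P (fun w => 2 * K * `|E i w - X i w| +
        (e2 + e2 * `|X i w|)))).
      apply: mean_le.
      - by have [] := as_ i iN.
      - apply: intgD; first exact: intgZ.
        by apply: intgD; [exact: intg_cst|exact: intgZ].
      move=> w; rewrite -{1}(mulr1 e2) -mulrDr; apply: sm => //.
      + by rewrite grid_ge0 grid_leT// ltnW.
      + exact/cT/ltnW.
    have j1 := intgZ (2 * K) iEX; have j2 := intgZ e2 iX.
    have j3 := intg_cst P e2.
    rewrite (meanD j1 (intgD j3 j2)) (meanD j3 j2) mean_cst !meanZ//.
    have := EXm i iN lt; have := Xm i (ltnW iN); have K0 := rc_K RC => mX mEX.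
    have b1 : 2 * K * mean P (fun w => `|E i w - X i w|) <= eps ^+ 2 / 16.
      apply: (@le_trans _ _ (2 * (K + 1) * v2)).
        apply: ler_pM; rewrite ?mulr_ge0//.
        + by apply: mean_ge0 => w; exact: normr_ge0.
        + by rewrite ler_wpM2l// lerDl.
        + exact: le_trans vv2.
      rewrite /v2 le_eqVlt; apply/orP; left; apply/eqP.
      by field; rewrite gt_eqF.
    have b2 : e2 + e2 * mean P (fun w => `|X i w|) <= eps ^+ 2 / 16.
      apply: (@le_trans _ _ (e2 * (1 + C0))).
        by rewrite mulrDr mulr1 lerD2l ler_wpM2l// ltW.
      rewrite /e2 le_eqVlt; apply/orP; left; apply/eqP.
      by field; rewrite gt_eqF// ltr_pwDl.
    by apply: (le_trans (lerD b1 b2)); lra.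
  apply: (le_trans (ler_wpM2l _ a2)); first by rewrite mulr_ge0.
  by rewrite le_eqVlt; apply/orP; left; apply/eqP; field.
- move=> i w iN.
  rewrite (XE i.+1 iN) (XE i (ltnW iN)).
  have := cl i iN; rewrite le_eqVlt => /orP[/eqP eqc|lt].
    by rewrite /r -eqc !drift_self incr_self; split; ring.
  have [g1 g2 g3 g4] := active i iN lt.
  have /andP[h1 _] := cT i (ltnW iN); have /andP[_ h2] := cT i.+1 iN.
  have [_ sps] := euler_path_step_sp w g1 g2 (ltW lt) g3.
  rewrite sps (euler_path_step w g1 g2 (ltW lt) g3).
  have sE := Es i iN.
  rewrite -(drift_cat (rc_b_le RC) (rc_b_cont RC) (E i w) (grid_ge0 n _) g2 (ltW lt) h2
    (sqint_intg sE)).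
  by rewrite /r /a XE ?(ltnW iN)//; split; ring.
Qed.

End Filtered.
End Euler.

(** * Continuous processes *)

Section Paths.
Context (R : realType) (T : R).
Hypothesis T0 : 0 < T.
Implicit Types (s t e dl : R) (f : R -> R).
Let T0' := ltW T0.

Lemma path_continuousP f : {within `[0, T], continuous f} <->
  forall t, 0 <= t <= T -> forall e, 0 < e -> exists2 dl : R, 0 < dl &
    forall s, 0 <= s <= T -> `|t - s| < dl -> `|f t - f s| < e.
Proof.
split=> [/within_continuousE H t tT e e0|H].
  have tT' : `[0, T]%classic t by rewrite /= in_itv.
  have [dl dl0 K] := H t tT' e e0.
  by exists dl => // s sT ts; apply: K => //; rewrite /= in_itv.
apply/within_continuousE => t /=; rewrite in_itv/= => tT e e0.
have [dl dl0 K] := H t tT e e0.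
by exists dl => // s; rewrite in_itv/= => sT ts; exact: K.
Qed.

Lemma path_uniformly_continuous f e : {within `[0, T], continuous f} -> 0 < e ->
  exists2 dl : R, 0 < dl &
    forall s t, 0 <= s <= T -> 0 <= t <= T -> `|s - t| <= dl -> `|f s - f t| <= e.
Proof.
move=> /path_continuousP fc e0.
pose Q (dl : R) (s : R) := forall t, 0 <= t <= T -> `|s - t| <= dl -> `|f s - f t| <= e.
have : near_covering_within (`[0, T] : set R).
  by apply/near_covering_withinP; apply/compact_near_coveringP; exact: segment_compact.
move=> /(_ R (0^'+) Q _) nc.
have : \forall dl \near 0^'+, `[0, T] `<=` Q dl.
  apply: nc => s0 /=; rewrite in_itv/= => s0T.
  have e2 : 0 < e / 2 by rewrite divr_gt0.
  have [dl dl0 H] := fc s0 s0T _ e2.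
  have dl2 : 0 < dl / 2 by rewrite divr_gt0.
  exists (ball s0 (dl / 2), [set d : R | d < dl / 2]).
    by split=> /=; [exact: nbhsx_ballx|exact: nbhs_right_lt].
  move=> [s d] /= [b1 dd]; rewrite in_itv/= => sT t tT std.
  move: b1; rewrite /ball/= => b1.
  have h1 : `|f s0 - f s| < e / 2 by apply: H => //; lra.
  have h2 : `|f s0 - f t| < e / 2.
    by apply: H => //; have := ler_distD s s0 t; lra.
  by have := ler_distD (f s0) (f s) (f t); rewrite (distrC _ (f s0)); lra.
move=> [dl /= dl0 H]; have dl2 : 0 < dl / 2 by rewrite divr_gt0.
exists (dl / 2) => // s t sT tT st.
have := H (dl / 2); rewrite /= sub0r normrN gtr0_norm// gtr_pMr// invf_lt1//.
by rewrite ltr1n => /(_ erefl dl2 s) /=; rewrite in_itv/=; apply.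
Qed.

Lemma grid_cell_exists n t : 0 < t -> t <= T ->
  exists i, [/\ (i < 2 ^ n)%N, grid T n i < t & t <= grid T n i.+1].
Proof.
move=> t0 tT.
have ex : exists i, t <= grid T n i by exists (2 ^ n)%N; rewrite gridN.
case: (ex_minnP ex) => -[|i] ti mi.
  by move: ti; rewrite grid0 leNgt t0.
exists i; split=> //; first by apply: mi; rewrite gridN.
by rewrite ltNge; apply/negP => /mi; rewrite ltnn.
Qed.

Lemma dyadic_dense_le f e L0 : {within `[0, T], continuous f} ->
  (forall L i, (L0 <= L)%N -> (i <= 2 ^ L)%N -> `|f (grid T L i)| <= e) ->
  forall t, 0 <= t <= T -> `|f t| <= e.
Proof.
move=> fc H t /andP[t0 tT]; apply/ler_addgt0Pr => e' e'0.
have [dl dl0 K] := path_uniformly_continuous fc e'0.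
have [n0 Hn0] := grid_mesh_small T dl0.
have := t0; rewrite le_eqVlt => /orP[/eqP<-|{}t0].
  by rewrite -(grid0 T L0) (le_trans (H L0 0%N _ _))// lerDl ltW.
have [i [iN it ti]] := grid_cell_exists (maxn L0 n0) t0 tT.
have h : `|f t - f (grid T (maxn L0 n0) i)| <= e'.
  apply: K; first by rewrite ltW.
    by rewrite grid_ge0//= grid_leT// ltnW.
  rewrite ger0_norm ?subr_ge0 ?(ltW it)//; apply: le_trans (Hn0 _ (leq_maxr L0 _)).
  by move: ti; rewrite gridS; lra.
have := H _ _ (leq_maxl L0 n0) (ltnW iN).
by have := ler_distD (f (grid T (maxn L0 n0) i)) (f t) 0; rewrite !subr0; lra.
Qed.

Lemma fast_cauchy_lim (D : set R) (u : nat -> R -> R) k0 :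
  (forall k t, (k0 <= k)%N -> D t -> `|u k.+1 t - u k t| <= 2^-1 ^+ k.+1) ->
  forall t, D t -> (u n t @[n --> \oo] --> limn (u^~ t)) /\
    forall k, (k0 <= k)%N -> `|limn (u^~ t) - u k t| <= 2^-1 ^+ k.
Proof.
move=> H t Dt.
(* The exact geometric sum, rather than its limit [2^-k], is what makes the induction on [j] go
   through. *)
have S k j : (k0 <= k)%N -> `|u (k + j)%N t - u k t| <= 2^-1 ^+ k - 2^-1 ^+ (k + j).
  move=> kk; elim: j => [|j IH]; first by rewrite addn0 !subrr normr0.
  rewrite addnS; have h := H (k + j)%N t (leq_trans kk (leq_addr _ _)) Dt.
  have := ler_distD (u (k + j)%N t) (u (k + j).+1 t) (u k t).
  by move: h IH; rewrite exprS; set q := 2^-1 ^+ (k + j); lra.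
have S' k j : (k0 <= k)%N -> (k <= j)%N -> `|u j t - u k t| <= 2^-1 ^+ k.
  move=> kk kj; have := S k (j - k)%N kk; rewrite subnKC// => h.
  by apply: (le_trans h); rewrite gerBl exprn_ge0.
have small e : 0 < e -> exists2 k, (k0 <= k)%N & 2^-1 ^+ k < e.
  move=> e0; have q1 : `|2^-1 : R| < 1 by rewrite ger0_norm; lra.
  have [k1 _ Hk1] := (cvgrPdist_lt _ _).1 (cvg_expr q1) e e0.
  exists (maxn k0 k1); first exact: leq_maxl.
  have := Hk1 (maxn k0 k1) (leq_maxr _ _).
  by rewrite /= sub0r normrN ger0_norm// exprn_ge0.
have cv : u n t @[n --> \oo] --> limn (u^~ t).
  apply: cauchy_cvg; apply: cauchy_exP => e e0.
  have [k kk ke] := small e e0; exists (u k t); exists k => //= n kn.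
  by rewrite /ball/= distrC; apply: le_lt_trans (S' _ _ kk kn) ke.
split=> // k kk; apply/ler_addgt0Pr => e e0.
have [N _ HN] := (cvgrPdist_lt _ _).1 cv e e0.
have := HN (maxn N k) (leq_maxl _ _); have := S' k _ kk (leq_maxr N k).
by have /= := ler_distD (u (maxn N k) t) (limn (u^~ t)) (u k t); lra.
Qed.

End Paths.

(** * Limits and joint measurability of continuous processes *)

Section Processes.
Context (R : realType) (d : measure_display) (Omega : measurableType d).
Variables (P : probability Omega R) (T : R).
Hypothesis T0 : 0 < T.
Implicit Types (s t : R) (k n L i : nat).
Let T0' := ltW T0.

(** Fatou's lemma. The bound is needed from rank [N] on only, so it is applied to the shifted
    sequence. *)
Lemma fatou_mean (f : nat -> Omega -> R) (g : Omega -> R) c (N : nat) :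
  (forall n w, 0 <= f n w) -> (forall n, measurable_fun setT (f n)) ->
  (forall n, (N <= n)%N -> intg P (f n) /\ mean P (f n) <= c) ->
  (forall w, f n w @[n --> \oo] --> g w) ->
  intg P g /\ mean P g <= c.
Proof.
move=> f0 mf fc cv.
have mg : measurable_fun setT g.
  by apply: (measurable_fun_cvg mf) => w _; exact: cv.
have g0 w : 0 <= g w.
  rewrite -(cvg_lim _ (cv w))//; apply: limr_ge; first exact: (cvgP _ (cv w)).
  by apply: nearW => n; exact: f0.
have le : (\int[P]_w (g w)%:E <= c%:E)%E.
  have E w : (g w)%:E = limn_einf (fun n => (f (n + N)%N w)%:E).
    have cvE : (f (n + N)%N w)%:E @[n --> \oo] --> (g w)%:E.
      apply: cvg_EFin; first by apply: nearW.
      by move: (cv w); rewrite -(cvg_shiftn N).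
    by rewrite is_cvg_limn_einfE; [exact/esym/cvg_lim|exact: cvgP cvE].
  under eq_integral do rewrite E.
  apply: le_trans (fatou _ _ _ _) _ => //.
  - by move=> n; apply/measurable_EFinP.
  - by move=> n w _; rewrite lee_fin.
  rewrite limn_einf_lim; apply: lime_le; first exact: is_cvg_einfs.
  apply: nearW => n; apply: ge_ereal_inf; exists (\int[P]_w (f (n + N)%N w)%:E)%E.
    by exists n => //=.
  have [i1 i2] := fc _ (leq_addl n N).
  by rewrite -meanE// lee_fin.
have mgE : measurable_fun setT (EFin \o g) by exact/measurable_EFinP.
have ig : intg P g.
  apply/integrableP; split; first exact/measurable_EFinP.
  apply: le_lt_trans (ltry c); apply: le_trans le.
  apply: ge0_le_integral => //=.
  - by apply/measurable_EFinP; apply: measurableT_comp.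
  - by move=> w _; rewrite lee_fin ger0_norm // g0.
by split=> //; rewrite -lee_fin meanE.
Qed.

(* Borel-Cantelli for the deviations on the dyadic grids; by continuity of the
   paths the grids control the uniform norm. *)
Lemma fast_cauchy_ae (W : nat -> R -> Omega -> R) (N : nat -> nat) :
  (forall k t, 0 <= t <= T -> measurable_fun setT (W k t)) ->
  (forall k, continuous_paths T (W k)) ->
  (forall k L, (N k <= L)%N ->
    (P [set w | exists2 i, (i <= 2 ^ L)%N &
      (2^-1 ^+ k.+1 <= `|W k.+1 (grid T L i) w - W k (grid T L i) w|)%R]
      <= (2^-1 ^+ k.+1)%:E)%E) ->
  exists A : set Omega, [/\ measurable A, P A = 0%E & forall w, ~ A w ->
    exists k0, forall k t, (k0 <= k)%N -> 0 <= t <= T ->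
      `|W k.+1 t w - W k t w| <= 2^-1 ^+ k.+1].
Proof.
move=> mW cW PW.
pose e k i L := [set w | 2^-1 ^+ k.+1 <= `|W k.+1 (grid T L i) w - W k (grid T L i) w|].
pose E k L := [set w | exists2 i, (i <= 2 ^ L)%N & e k i L w].
have EE k L : E k L = \bigcup_(i in [set i | (i <= 2 ^ L)%N]) e k i L by [].
have me k i L : (i <= 2 ^ L)%N -> measurable (e k i L).
  move=> iL; have iT : 0 <= grid T L i <= T by rewrite grid_ge0//= grid_leT.
  have mf : measurable_fun setT
      (fun w => `|W k.+1 (grid T L i) w - W k (grid T L i) w|).
    apply: measurableT_comp => //; apply: measurable_funB; exact: mW.
  have := mf measurableT _ (@measurable_itv R `[2^-1 ^+ k.+1, +oo[).
  rewrite setTI (_ : _ @^-1` _ = e k i L)//.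
  by apply/seteqP; split => w /=; rewrite in_itv/= andbT.
have mE k L : measurable (E k L).
  by rewrite EE; apply: bigcup_measurable => i iL; exact: me.
(* A grid is contained in every finer one, so the events increase with the level and their union has
   probability at most the common bound. *)
have ndE k L j : E k L `<=` E k (L + j)%N.
  move=> w [i iL h]; exists (i * 2 ^ j)%N; first by rewrite expnD leq_mul2r iL orbT.
  by move: h; rewrite /e/= (grid_refine T i (leq_addr j L)) addKn.
pose A k := \bigcup_j E k (N k + j)%N.
have mA k : measurable (A k) by apply: bigcup_measurable => j _; exact: mE.
have PA k : (P (A k) <= (2^-1 ^+ k.+1)%:E)%E.
  have cv : P (E k (N k + j)%N) @[j --> \oo] --> P (A k).
    apply: (@nondecreasing_cvg_mu _ _ _ P (fun j => E k (N k + j)%N)).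
    - by move=> j; exact: mE.
    - exact: mA.
    move=> i j ij; apply/subsetPset; rewrite -(subnKC ij) addnA; exact: ndE.
  rewrite -(cvg_lim _ cv)//; apply: lime_le; first exact: (cvgP _ cv).
  by apply: nearW => j; apply: PW; exact: leq_addr.
exists (lim_sup_set A); split.
- by apply: bigcap_measurable => // n _; apply: bigcup_measurable => k _; exact: mA.
- apply: lim_sup_set_cvg0 => //; apply: (@le_lt_trans _ _ 1%:E); last exact: ltry.
  apply: le_trans (@epsilon_trick0 _ 1 xpredT ler01).
  apply: lee_nneseries => // k _.
  by apply: (le_trans (PA k)); rewrite lee_fin div1r natrX exprVn.
- move=> w /existsNP[n /not_implyP[_ nA]]; exists n => k t nk tT.
  have cf : {within `[0, T], continuous (fun t => W k.+1 t w - W k t w)}.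
    by move=> u; apply: cvgB; [exact: cW|exact: cW].
  apply: (dyadic_dense_le T0 cf (L0 := N k)) tT => L i NL iL.
  rewrite leNgt; apply/negP => h; apply: nA; exists k => //=.
  exists (L - N k)%N => //=; rewrite subnKC//; exists i => //=.
  exact: ltW.
Qed.

Lemma sum_cell (tau g : nat -> R) n i s :
  (forall j, (j < n)%N -> tau j <= tau j.+1) -> (i < n)%N ->
  tau i < s -> s <= tau i.+1 ->
  \sum_(j < n) g j * \1_(`]tau j, tau j.+1]) s = g i.
Proof.
move=> tm iN is_ si.
have mono j k : (j <= k)%N -> (k <= n)%N -> tau j <= tau k.
  move=> jk; rewrite -(subnKC jk); elim: (k - j)%N => [|m IH]; rewrite ?addn0//.
  by rewrite addnS => h; apply: le_trans (IH (ltnW h)) (tm _ h).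
rewrite (bigD1 (Ordinal iN))//= big1 ?addr0.
  by rewrite indicE mem_set ?mulr1//= in_itv/= is_ si.
move=> j; rewrite -val_eqE/= => ji.
rewrite indicE memNset ?mulr0//= in_itv/= => /andP[h1 h2].
move: ji; rewrite neq_ltn => /orP[ji|ij].
  by have := lt_le_trans is_ (le_trans h2 (mono _ _ ji (ltnW iN))); rewrite ltxx.
by have := lt_le_trans h1 (le_trans si (mono _ _ ij (ltnW (ltn_ord j)))); rewrite ltxx.
Qed.

Lemma step_process_measurable (tau : nat -> R) (g : nat -> Omega -> R) n :
  (forall i, (i < n)%N -> measurable_fun setT (g i)) ->
  measurable_fun setT (fun z : R * Omega =>
    \sum_(i < n) g i z.2 * \1_(`]tau i, tau i.+1]) z.1).
Proof.
move=> mg; apply: measurable_sum => i; apply: measurable_funM.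
  exact: (measurableT_comp (mg i (ltn_ord i)) measurable_snd).
apply: (@measurableT_comp _ _ _ _ _ _ (\1_(`]tau i, tau i.+1]) : R -> R)) => //.
Qed.

(** Pointwise limit of the dyadic step processes taking the value at the right end of each cell.
    Time 0 lies in no half-open cell and has its own term. *)
Lemma continuous_process_measurable (H : R -> Omega -> R) :
  (forall t, 0 <= t <= T -> measurable_fun setT (H t)) -> continuous_paths T H ->
  measurable_fun (`[0, T] `*` setT) (fun z : R * Omega => H z.1 z.2).
Proof.
move=> mH cH.
pose h n (z : R * Omega) := H 0 z.2 * \1_([set 0 : R]) z.1 +
  \sum_(i < 2 ^ n) H (grid T n i.+1) z.2 * \1_(`]grid T n i, grid T n i.+1]) z.1.
have mS : measurable (`[0, T] `*` setT : set (R * Omega)).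
  by apply: measurableX => //; exact: measurable_itv.
have mh n : measurable_fun (`[0, T] `*` setT) (h n).
  apply: measurable_funTS; apply: measurable_funD.
    apply: measurable_funM.
      by apply: (measurableT_comp (mH 0 _) measurable_snd); rewrite lexx.
    apply: (@measurableT_comp _ _ _ _ _ _ (\1_([set 0 : R]) : R -> R)) => //.
  apply: (@step_process_measurable (grid T n) (fun i => H (grid T n i.+1))) => i iN.
  by apply: mH; rewrite grid_ge0//= grid_leT.
apply: (measurable_fun_cvg mh) => -[s w] [/= sT _].
move: sT; rewrite in_itv/= => /andP[]; rewrite le_eqVlt => /orP[/eqP<- _|s0 sT].
  have -> : h ^~ (0, w) = fun=> H 0 w; last exact: cvg_cst.
  apply/funext => n; rewrite /h/= indicE mem_set// mulr1 big1 ?addr0// => i _.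
  by rewrite indicE memNset ?mulr0//= in_itv/= ltNge grid_ge0.
apply/cvgrPdist_le => e e0.
have [dl dl0 K] := path_uniformly_continuous (cH w) e0.
have [n0 Hn0] := grid_mesh_small T dl0.
exists n0 => //= n n0n; have [i [iN is_ si]] := grid_cell_exists n s0 sT.
rewrite /h/= indicE memNset ?mulr0 ?add0r; last by move=> /= E; rewrite E ltxx in s0.
rewrite (@sum_cell (grid T n) (fun i => H (grid T n i.+1) w) _ i)//; last first.
  by move=> j _; exact: grid_le.
apply: K; first by rewrite (ltW s0).
  by rewrite grid_ge0//= grid_leT.
rewrite distrC ger0_norm ?subr_ge0//; apply: le_trans (Hn0 n n0n).
by move: is_; rewrite gridS; lra.
Qed.

Lemma section_measurable (f : R * Omega -> R) w :
  measurable_fun (`[0, T] `*` setT) f -> measurable_fun `[0, T] (fun s => f (s, w)).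
Proof.
move=> mf.
have mS : measurable (`[0, T] `*` setT : set (R * Omega)).
  by apply: measurableX => //; exact: measurable_itv.
apply: (measurable_comp mS _ mf); first by move=> _ [s sT <-].
apply: measurable_funTS; exact: measurable_fun_pair.
Qed.

Lemma tonelli_itv (f : R * Omega -> R) s t :
  measurable_fun (`[0, T] `*` setT) f -> (forall z, 0 <= f z) -> 0 <= s -> t <= T ->
  measurable_fun `]s, t] (fun u => \int[P]_w (f (u, w))%:E)%E /\
  (\int[P]_w \int[lebesgue_measure]_(u in `]s, t]) (f (u, w))%:E =
   \int[lebesgue_measure]_(u in `]s, t]) \int[P]_w (f (u, w))%:E)%E.
Proof.
move=> mf f0 s0 tT.
pose S : set (measurableTypeR R * Omega) := `]s, t] `*` setT.
have mS : measurable S by apply: measurableX.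
have sS : S `<=` (`[0, T] `*` setT : set (measurableTypeR R * Omega)).
  move=> z [/=]; rewrite !in_itv/= => /andP[h1 h2] _; split => //.
  by rewrite (le_trans s0 (ltW h1)) (le_trans h2).
have mT : measurable (`[0, T] `*` setT : set (measurableTypeR R * Omega)).
  by apply: measurableX.
(* Measurability of [f] is known on the strip only; extension by 0 allows Tonelli's theorem on the
   whole product. *)
pose g : measurableTypeR R * Omega -> \bar R := (EFin \o f) \_ S.
have mg : measurable_fun setT g.
  apply/(measurable_restrictT _ mS)/measurable_EFinP.
  by apply: (measurable_funS mT sS); exact: mf.
have g0 z : (0 <= g z)%E.
  by rewrite /g patchE; case: ifP => //= _; rewrite lee_fin.
have gE u w : g (u, w) = ((EFin \o (fun u => f (u, w))) \_ (`]s, t])) u.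
  rewrite /g !patchE /=; congr (if _ then _ else _).
  by apply/idP/idP => /set_mem h; apply/mem_set; [case: h|split].
split.
  have mG := @measurable_fun_fubini_tonelli_F _ _ (measurableTypeR R) _ R P g mg g0.
  apply: (@eq_measurable_fun _ _ (measurableTypeR R) _ `]s, t] (fubini_F P g)).
    move=> u us; apply: eq_integral => w _.
    by rewrite gE patchE us.
  exact: (measurable_funTS mG).
have := @fubini_tonelli _ _ _ _ R (lebesgue_measure : {measure set (measurableTypeR R) -> \bar R}) P g mg g0.
move=> E; rewrite (eq_integral (fun w => \int[lebesgue_measure]_u g (u, w))%E); last first.
  by move=> w _; rewrite [LHS]integral_mkcond; apply: eq_integral => u _; rewrite gE.
rewrite -E [RHS]integral_mkcond; apply: eq_integral => u _.
rewrite patchE; case: ifPn => us; last first.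
  rewrite integral0_eq// => w _; by rewrite gE patchE (negbTE us).
by apply: eq_integral => w _; rewrite gE patchE us.
Qed.

Lemma tonelli_le (f : R * Omega -> R) s t c :
  measurable_fun (`[0, T] `*` setT) f -> (forall z, 0 <= f z) -> 0 <= s -> s <= t ->
  t <= T -> (forall u, s < u -> u <= t -> (\int[P]_w (f (u, w))%:E <= c%:E)%E) ->
  (\int[P]_w \int[lebesgue_measure]_(u in `]s, t]) (f (u, w))%:E <= (c * (t - s))%:E)%E.
Proof.
move=> mf f0 s0 st tT H; have [mI ->] := tonelli_itv mf f0 s0 tT.
have c0 u : s < u -> u <= t -> 0 <= c.
  move=> su ut; rewrite -lee_fin; apply: le_trans (H u su ut).
  by apply: integral_ge0 => w _; rewrite lee_fin.
have := st; rewrite le_eqVlt => /orP[/eqP<-|lt].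
  by rewrite set_itv_ge ?integral_set0 ?subrr ?mulr0// bnd_simp ltxx.
apply: (@le_trans _ _ (\int[lebesgue_measure]_(u in `]s, t]) (cst c%:E u))%E).
  apply: ge0_le_integral => //=.
  - by move=> u _; apply: integral_ge0 => w _; rewrite lee_fin.
  - by move=> u; rewrite in_itv/= => /andP[su ut]; exact: H.
rewrite integral_cst//= lebesgue_measure_itv/= lte_fin lt.
by rewrite EFinM EFinB.
Qed.

End Processes.

(** * Convergence of the Euler scheme *)

Lemma measurable_fun_patch (R : realType) d (Omega : measurableType d)
    (A : set Omega) (k : R) (f : Omega -> R) :
  measurable A -> measurable_fun setT f ->
  measurable_fun setT (fun w => if w \in A then k else f w).
Proof.
move=> mA mf.
have -> : (fun w => if w \in A then k else f w) = (fun w => f w + (k - f w) * \1_A w).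
  by apply/funext => w; rewrite indicE; case: (w \in A) => /=; lra.
apply: measurable_funD => //; apply: measurable_funM; last exact: measurable_indic.
exact: measurable_funB.
Qed.

Lemma measurable_wrt_patch (R : realType) (Omega : pointedType) (G : set (set Omega))
    (A : set Omega) (k : R) (f : Omega -> R) :
  sigma_algebra setT G -> G A -> measurable_wrt G f ->
  measurable_wrt G (fun w => if w \in A then k else f w).
Proof.
move=> sG GA mf; apply/(measurable_wrtE sG).
apply: measurable_fun_patch; last exact/(measurable_wrtE sG).
by change (<<s G >> A); exact: sub_sigma_algebra.
Qed.

Lemma within_continuous_sum (R : realType) (D : set R) (g : nat -> R -> R) n :
  (forall i, (i < n)%N -> {within D, continuous (g i)}) ->
  {within D, continuous (fun t => \sum_(i < n) g i t)}.
Proof.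
elim: n => [|n IH] h.
  by under [X in {within _, continuous X}]eq_fun do rewrite big_ord0; move=> t; exact: cvg_cst.
under [X in {within _, continuous X}]eq_fun do rewrite big_ord_recr/=.
by move=> t; apply: cvgD; [apply: IH => i /leqW; exact: h|exact: h].
Qed.

Section Existence.
Context (R : realType) (d : measure_display) (Omega : measurableType d).
Variables (P : probability Omega R) (T M C K x : R).
Variables (b : R -> R -> borel_prob R -> R) (sigma : R -> R -> R) (kappa : R -> R).
Hypothesis RC : regular_coef T M C K b sigma kappa.
Variables (F : R -> set (set Omega)) (B : R -> {RV P >-> R}).
Hypothesis F_filtration : filtration T F.
Hypothesis B_brownian : brownian_motion T F B.
Implicit Types (s t eps eta : R) (n i j k L : nat) (w : Omega).

Let T0 := rc_T RC.
Let T0' : 0 <= T := ltW T0.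
Let M0 := rc_M_ge0 RC.
Local Notation euler := (euler T x b sigma B).
Local Notation euler_sp := (euler_sp T x b sigma B).
Local Notation euler_drift := (euler_drift T x b sigma B).
Local Notation euler_path := (euler_path T x b sigma B).
Local Notation grid := (grid T).

Lemma sp_int_continuous (S : simple_process R Omega) :
  (forall i, (i <= sp_size S)%N -> 0 <= sp_time S i) ->
  continuous_paths T (sp_int B S).
Proof.
move=> S0 w.
have cB j : (j <= sp_size S)%N ->
    {within `[0, T], continuous (fun t => B (Num.min (sp_time S j) t) w)}.
  move=> jS; apply/path_continuousP => t /andP[t0 tT] e e0.
  have [_ cB _ _] := B_brownian.
  have mT s : 0 <= s <= T -> 0 <= Num.min (sp_time S j) s <= T.
    by move=> /andP[s0 sT]; rewrite le_min S0// s0 ge_min sT orbT.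
  have [|dl dl0 H] := (path_continuousP _ _).1 (cB w) (Num.min (sp_time S j) t) _ e e0.
    by apply: mT; rewrite t0.
  exists dl => // s sT ts; apply: H; first exact: mT.
  apply: le_lt_trans ts; set a := sp_time S j.
  by case: (leP a t) => h1; case: (leP a s) => h2; rewrite ?subrr ?normr0//;
    have := ler_norm (t - s); have := ler_norm (s - t); rewrite (distrC s) ler_norml;
    try lra.
apply: (@within_continuous_sum _ _ (fun i t => sp_coef S i w *
  (B (Num.min (sp_time S i.+1) t) w - B (Num.min (sp_time S i) t) w))) => i iS t.
apply: cvgM; first exact: cvg_cst.
by apply: cvgB; [exact: (cB i.+1 iS)|exact: (cB i (ltnW iS))].
Qed.

(** Each of the [2 ^ n] cells is allowed to move by the full [M * |t - s|]. This is crude, but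
    enough for continuity in time at a fixed level. *)
Lemma euler_drift_osc n s t w : 0 <= s <= T -> 0 <= t <= T ->
  `|euler_drift n t w - euler_drift n s w| <= (2 ^ n)%:R * M * `|t - s|.
Proof.
wlog st : s t / s <= t.
  move=> H sT tT; have [/H|/ltW/H] := leP s t; first exact.
  by rewrite distrC (distrC t); exact.
move=> /andP[s0 _] /andP[_ tT].
rewrite -sumrB; apply: (le_trans (ler_norm_sum _ _ _)).
rewrite -mulrA mulr_natl -[X in _ *+ X]card_ord -sumr_const.
apply: ler_sum => i _; have iN := ltn_ord i.
have [_ sE] := euler_wrt x RC F_filtration B_brownian (ltnW iN).
have iE := sqint_intg sE.
have gi : 0 <= grid n i by exact: grid_ge0.
have gii : grid n i <= grid n i.+1 by exact: grid_le.
rewrite (ger0_norm (_ : 0 <= t - s)) ?subr_ge0//.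
(* Clamping [u] to the cell gives a common lower endpoint, so the two drifts differ by the integral
   over a subinterval. *)
pose c u := Num.max (grid n i) (Num.min (grid n i.+1) u).
have cE u : drift b (Num.min (grid n i) u) (Num.min (grid n i.+1) u) (euler n i) (euler n i w)
    = drift b (grid n i) (c u) (euler n i) (euler n i w).
  rewrite /c; case: (leP (grid n i) u) => h.
    by rewrite max_r// le_min gii h.
  rewrite (min_r (ltW (lt_le_trans h gii))) (max_l (ltW h)) !drift_self//.
have giT : grid n i.+1 <= T by exact: grid_leT.
have c1 u : u <= T -> grid n i <= c u /\ c u <= T.
  by move=> uT; rewrite /c le_max lexx ge_max (le_trans gii giT) ge_min giT.
have [a1 a2] := c1 t tT; have [a3 a4] := c1 s (le_trans st tT).
have cst : c s <= c t.
  by rewrite /c ge_max !le_max lexx/= le_min !ge_min lexx st/= !orbT.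
have cts : c t - c s <= t - s.
  have h0 : Num.min (grid n i.+1) s <= c s by rewrite /c le_max lexx orbT.
  rewrite lerBlDr {1}/c ge_max; apply/andP; split; first by lra.
  rewrite ge_min; move: h0; rewrite ge_min => /orP[h|h]; apply/orP; [left|right]; lra.
rewrite !cE -(drift_cat (rc_b_le RC) (rc_b_cont RC) _ gi a3 cst a2 iE) addrC addKr.
apply: (le_trans (rc_drift_le RC _ (le_trans gi a3) cst a2 iE)).
by rewrite ler_wpM2l.
Qed.

Lemma euler_path_continuous n : continuous_paths T (euler_path n).
Proof.
move=> w.
have cD : {within `[0, T], continuous (euler_drift n ^~ w)}.
  apply/path_continuousP => t tT e e0.
  have k0 : 0 < (2 ^ n)%:R * M + 1 by rewrite ltr_wpDl// mulr_ge0.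
  exists (e / ((2 ^ n)%:R * M + 1)); first by rewrite divr_gt0.
  move=> s sT; rewrite ltr_pdivlMr// => h.
  apply: (le_lt_trans (euler_drift_osc n w sT tT)); apply: le_lt_trans h.
  by rewrite mulrC ler_wpM2l// lerDl.
have cS : {within `[0, T], continuous (sp_int B (euler_sp n) ^~ w)}.
  by apply: sp_int_continuous => i _; exact: grid_ge0.
move=> t; apply: cvgD; last exact: cS.
by apply: cvgD; [exact: cvg_cst|exact: cD].
Qed.

(** Stability of two schemes on a common finer grid: stopped at [t] for the first and third claims,
    and run up to [T] for the second. *)
Lemma euler_cauchy eta : 0 < eta -> exists n0, forall m n, (n0 <= m)%N -> (n0 <= n)%N ->
  [/\ forall t, 0 <= t <= T -> mean P (fun w => `|euler_path m t w - euler_path n t w|) <= eta,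
      forall L, (m <= L)%N -> (n <= L)%N ->
        (P [set w | exists2 i, (i <= 2 ^ L)%N &
          (eta <= `|euler_path m (grid L i) w - euler_path n (grid L i) w|)%R] <= eta%:E)%E &
      forall t, 0 <= t <= T ->
        mean P (fun w => (sp_int B (euler_sp m) t w - sp_int B (euler_sp n) t w) ^+ 2) <= eta].
Proof.
move=> eta0.
have [eps eps0 ST] := stability x RC F_filtration B_brownian eta0.
have [n1 H1] := eulerX_approx_sol x RC F_filtration B_brownian eps0.
have [n2 H2] := grid_mesh_small T eps0.
exists (maxn n1 n2) => m n; rewrite !geq_max => /andP[m1 m2] /andP[n1' n2'].
have H L t : (m <= L)%N -> (n <= L)%N -> 0 <= t <= T ->
  [/\ mean P (fun w => `|euler_path m t w - euler_path n t w|) <= eta,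
   (P [set w | exists2 i, (i <= 2 ^ L)%N & (eta <=
     `|euler_path m (dyadic_chain T L t i) w - euler_path n (dyadic_chain T L t i) w|)%R]
     <= eta%:E)%E &
   mean P (fun w => (sp_int B (euler_sp m) t w - sp_int B (euler_sp n) t w) ^+ 2) <= eta].
  move=> mL nL /andP[t0 tT].
  have gc : good_chain T (2 ^ L) (dyadic_chain T L t) eps.
    by apply: dyadic_chain_good => //; apply: H2; apply: leq_trans mL.
  have [h1 h2 [_ h3]] := ST _ _ _ _ _ _ gc (H1 m L t m1 mL t0 tT) (H1 n L t n1' nL t0 tT).
  have [c0 cl cN _] := gc; have cT := chain_itv c0 cl cN.
  have XE k i : (i <= 2 ^ L)%N -> eulerX T x b sigma B k (dyadic_chain T L t i)
      = euler_path k (dyadic_chain T L t i) :> (Omega -> R).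
    by move=> /cT/andP[u0 uT]; exact: (eulerXE x RC F_filtration B_brownian).
  split.
  - by have := h1 _ (leqnn _); rewrite !XE// dyadic_chainN.
  - apply: le_trans h2; rewrite le_eqVlt; apply/orP; left; apply/eqP; congr (P _).
    by apply/seteqP; split => w [i iL h]; exists i => //; move: h; rewrite !XE.
  - move: h3; rewrite dyadic_chainN// dyadic_chain0//.
    have sp0 k w : sp_int B (euler_sp k) 0 w = 0.
      rewrite /sp_int big1// => i _ /=.
      by rewrite !min_r ?grid_ge0// subrr mulr0.
    by under [X in mean P X]eq_fun do rewrite !sp0 !subr0.
split.
- by move=> t tT; have [] := H _ t (leq_maxl m n) (leq_maxr m n) tT.
- move=> L mL nL; have [|_ h _] := H L T mL nL; first by rewrite T0' lexx.
  apply: le_trans h; rewrite le_eqVlt; apply/orP; left; apply/eqP; congr (P _).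
  by apply/seteqP; split => w [i iL h]; exists i => //; move: h;
    rewrite /dyadic_chain min_l// grid_leT.
- by move=> t tT; have [] := H _ t (leq_maxl m n) (leq_maxr m n) tT.
Qed.

End Existence.

Section EulerLimit.
Context (R : realType) (d : measure_display) (Omega : measurableType d).
Variables (P : probability Omega R) (T M C K x : R).
Variables (b : R -> R -> borel_prob R -> R) (sigma : R -> R -> R) (kappa : R -> R).
Hypothesis RC : regular_coef T M C K b sigma kappa.
Variables (F : R -> set (set Omega)) (B : R -> {RV P >-> R}).
Hypothesis F_filtration : filtration T F.
Hypothesis B_brownian : brownian_motion T F B.
Hypothesis F_null : forall t A, 0 <= t <= T -> P.-negligible A -> F t A.
Implicit Types (s t eps eta : R) (n i j k L : nat) (w : Omega).

Let T0 := rc_T RC.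
Let T0' : 0 <= T := ltW T0.
Let M0 := rc_M_ge0 RC.
Local Notation euler := (euler T x b sigma B).
Local Notation euler_sp := (euler_sp T x b sigma B).
Local Notation euler_drift := (euler_drift T x b sigma B).
Local Notation euler_path := (euler_path T x b sigma B).
Local Notation grid := (grid T).
Local Notation path_wrt n t0 tT := (euler_path_wrt x RC F_filtration B_brownian n t0 tT).

(** [N] is a subsequence of levels and [A] the null set off which the convergence is uniform; on [A]
    the limit is set to [x]. The last clause retains the convergence of the stochastic parts, from
    which the Ito integral of the limit is identified. *)
Definition euler_limit (N : nat -> nat) (A : set Omega) (X : R -> {RV P >-> R}) :=
  [/\ measurable A /\ P A = 0%E,
      forall k, (k <= N k)%N,
      forall w, ~ A w -> exists k0, forall k t, (k0 <= k)%N -> 0 <= t <= T ->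
        `|X t w - euler_path (N k) t w| <= 2^-1 ^+ k,
      forall t, 0 <= t <= T ->
        [/\ forall w, A w -> X t w = x, measurable_wrt (F t) (X t), sqint P (X t) &
            forall k, mean P (fun w => `|X t w - euler_path (N k) t w|) <= 2^-1 ^+ k.+1] &
      forall k j t, (k <= j)%N -> 0 <= t <= T ->
        mean P (fun w => (sp_int B (euler_sp (N j)) t w
                          - sp_int B (euler_sp (N k)) t w) ^+ 2) <= 2^-1 ^+ k.+1].

Lemma patch_sqint (A : set Omega) (k : R) (f : Omega -> R) :
  measurable A -> sqint P f -> sqint P (fun w => if w \in A then k else f w).
Proof.
move=> mA sf; apply: (@sqint_le _ _ _ P _ (fun w => `|k| + `|f w|)).
- exact: measurable_fun_patch mA (sqint_measurable sf).
- by apply: sqintD; [exact: sqint_cst|exact: sqint_norm].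
- by move=> w; rewrite [leRHS]ger0_norm ?addr_ge0//; case: ifP => _; rewrite ?lerDl ?lerDr.
Qed.

Lemma patch_mean (A : set Omega) (k : R) (f : Omega -> R) :
  measurable A -> P A = 0%E -> measurable_fun setT f ->
  mean P (fun w => if w \in A then k else f w) = mean P f.
Proof.
move=> mA PA mf; apply: ae_mean_eq => //.
  exact: measurable_fun_patch.
exists A; split=> // w /= h; apply: contrapT => nA; apply: h.
by rewrite memNset.
Qed.

Lemma euler_limit_exists : exists N A X, euler_limit N A X.
Proof.
have q0 k : 0 < 2^-1 ^+ k.+1 :> R by rewrite exprn_gt0.
have [nn Hn] := choice (fun k => euler_cauchy x RC F_filtration B_brownian (q0 k)).
(* The sum dominates every threshold [nn j] with [j <= k], and the successors make it strictly
   increasing, hence at least [k]. *)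
pose N k := (\sum_(j < k.+1) (nn j).+1)%N.
have Nn k j : (k <= j)%N -> (nn k <= N j)%N.
  move=> kj; have kj' : (k < j.+1)%N by [].
  rewrite /N (bigD1 (Ordinal kj'))//=.
  exact: leq_trans (leqnSn _) (leq_addr _ _).
have NS k : N k.+1 = (N k + (nn k.+1).+1)%N by rewrite /N big_ord_recr.
have NN k : (N k <= N k.+1)%N by rewrite NS leq_addr.
have kN k : (k <= N k)%N.
  by elim: k => // k IH; rewrite NS addnS ltnS (leq_trans IH)// leq_addr.
pose W k t w := euler_path (N k) t w.
have Wt k t : 0 <= t <= T -> [/\ measurable_wrt (F t) (W k t), sqint P (W k t)
    & measurable_fun setT (W k t)].
  move=> /andP[t0 tT]; have [h1 h2 _ _ _] := path_wrt (N k) t0 tT.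
  by split => //; exact: sqint_measurable h2.
have [||k L NL|A [mA PA HA]] := @fast_cauchy_ae _ _ _ P T T0 W (fun k => N k.+1).
- by move=> k t /(Wt k)[].
- by move=> k; exact: (euler_path_continuous RC F_filtration B_brownian).
- have [_ h _] := Hn k _ _ (Nn _ _ (leqnSn k)) (Nn _ _ (leqnn k)).
  by apply: h => //; exact: leq_trans NL.
have nA : P.-negligible A by exists A; split.
(* Patched on the null set, the schemes converge at every sample point and stay adapted because
   [F t] contains the null sets. *)
pose V k t w := if w \in A then x else W k t w.
pose Y t w := if w \in A then x else limn (W ^~ t ^~ w).
have lim w : ~ A w -> forall t, 0 <= t <= T -> (W n t w @[n --> \oo] --> Y t w) .
  move=> Aw t tT; have [k0 h] := HA w Aw.
  have [c _] := @fast_cauchy_lim _ [set t | 0 <= t <= T] (fun k t => W k t w) k0 h t tT.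
  by rewrite /Y memNset.
have cV w t : 0 <= t <= T -> V n t w @[n --> \oo] --> Y t w.
  move=> tT; have [Aw|Aw] := pselect (A w).
    by rewrite /V /Y mem_set//; exact: cvg_cst.
  by rewrite /V memNset//; exact: lim.
have sF t : 0 <= t <= T -> sigma_algebra setT (F t).
  exact: (filtration_sigma F_filtration).
have mYw t : 0 <= t <= T -> measurable_wrt (F t) (Y t).
  move=> tT; apply: (measurable_wrt_cvg (sF t tT) (f := fun k => V k t)).
    by move=> k; apply: measurable_wrt_patch; [exact: sF|exact: F_null|have [] := Wt k t tT].
  by move=> w; exact: cV.
have mY t : 0 <= t <= T -> measurable_fun setT (Y t).
  move=> tT; apply: measurable_wrt_fun (mYw t tT); exact: (filtration_meas F_filtration).
have Xe t : 0 <= t <= T -> toRV P (Y t) = Y t :> (Omega -> R).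
  by move=> tT; rewrite toRVE//; exact: mY.
have sV k t : 0 <= t <= T -> sqint P (V k t).
  by move=> tT; apply: patch_sqint => //; have [] := Wt k t tT.
have VW k t : 0 <= t <= T -> mean P (fun w => `|Y t w - V k t w|)
    = mean P (fun w => `|Y t w - W k t w|).
  move=> tT; have [_ _ mW] := Wt k t tT.
  rewrite -(patch_mean 0 mA PA (f := fun w => `|Y t w - W k t w|)); last first.
    apply: measurableT_comp => //; apply: measurable_funB => //; exact: mY.
  congr mean; apply/funext => w; rewrite /V; case: ifPn => // /set_mem Aw.
  by rewrite /Y mem_set// subrr normr0.
have spD k j t : (k <= j)%N -> 0 <= t <= T ->
    mean P (fun w => (sp_int B (euler_sp (N j)) t w
      - sp_int B (euler_sp (N k)) t w) ^+ 2) <= 2^-1 ^+ k.+1.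
  by move=> kj tT; have [_ _ h] := Hn k _ _ (Nn _ _ kj) (Nn _ _ (leqnn k)); exact: h.
exists N, A, (fun t => toRV P (Y t)); split => //.
- move=> w Aw; have [k0 h] := HA w Aw; exists k0 => k t kk tT; rewrite Xe//.
  have [_ c] := @fast_cauchy_lim _ [set t | 0 <= t <= T] (fun k t => W k t w) k0 h t tT.
  by rewrite /Y memNset//; exact: c.
- move=> t tT; rewrite Xe//; have mYt := mY t tT.
  have [t0 tT'] := andP tT.
  split.
  + by move=> w Aw; rewrite /Y mem_set.
  + exact: mYw.
  (* Square integrability of the limit comes from its difference to level 0: the drifts differ by at
     most [2 M T], which gives [2 * (2 M T)^2 = 8 (M T)^2], and the stochastic parts are close in
     L^2. *)
  + have [] := @fatou_mean _ _ _ P (fun j w => (V j t w - V 0%N t w) ^+ 2)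
      (fun w => (Y t w - V 0%N t w) ^+ 2) (2 + 8 * (M * T) ^+ 2) 0.
    * by move=> j w; exact: sqr_ge0.
    * by move=> j; apply: measurable_funX; exact: sqint_measurable (sqintB (sV j t tT) (sV 0%N t tT)).
    * move=> j _; split; first by have [] := sqintB (sV j t tT) (sV 0%N t tT).
      have sS k := let: And5 _ _ _ _ h := path_wrt (N k) t0 tT' in h.
      have sD := sqintB (sS j) (sS 0%N).
      apply: (@le_trans _ _ (mean P (fun w => 2 * (sp_int B (euler_sp (N j)) t w
          - sp_int B (euler_sp (N 0%N)) t w) ^+ 2 + 8 * (M * T) ^+ 2))).
        apply: mean_le.
        - by have [] := sqintB (sV j t tT) (sV 0%N t tT).
        - by apply: intgD; [apply: intgZ; case: sD|exact: intg_cst].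
        move=> w; set u := sp_int _ _ _ _; set v := sp_int _ _ _ _.
        have r0 : 0 <= 2 * (u - v) ^+ 2 + 8 * (M * T) ^+ 2.
          by rewrite addr_ge0// mulr_ge0// sqr_ge0.
        rewrite /V; case: ifP => _; first by rewrite subrr expr0n.
        have h1 := euler_drift_le x RC F_filtration B_brownian (N j) w t0 tT'.
        have h2 := euler_drift_le x RC F_filtration B_brownian (N 0%N) w t0 tT'.
        rewrite /W /euler_path -/u -/v.
        move: h1 h2; set a := euler_drift _ _ _; set a' := euler_drift _ _ _ => h1 h2.
        have h3 : (a - a') ^+ 2 <= (2 * (M * T)) ^+ 2.
          rewrite -real_normK ?num_real// ler_pXn2r ?nnegrE ?mulr_ge0//.
          by have := ler_normB a a'; lra.
        have -> : x + a + u - (x + a' + v) = (a - a') + (u - v) by ring.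
        have := sqr_ge0 ((a - a') - (u - v)); nra.
      have iD := sqint_intg_sqr sD.
      rewrite (meanD (intgZ 2 iD) (intg_cst P _)) (meanZ 2 iD) mean_cst.
      rewrite lerD2r; have h := spD 0%N j t (leq0n j) tT.
      apply: (@le_trans _ _ (2 * 2^-1 ^+ 1)); first by rewrite ler_wpM2l.
      by rewrite expr1; lra.
    * move=> w; apply: cvgM; apply: cvgB; (exact: cV || exact: cvg_cst).
    move=> i1 _; have s1 : sqint P (fun w => Y t w - V 0%N t w).
      by split => //; apply: measurable_funB => //; exact: sqint_measurable (sV 0%N t tT).
    have := sqintD s1 (sV 0%N t tT).
    by under [X in sqint P X]eq_fun do rewrite subrK.
  + move=> k; rewrite -VW//.
    have [] := @fatou_mean _ _ _ P (fun j w => `|V j t w - V k t w|)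
      (fun w => `|Y t w - V k t w|) (2^-1 ^+ k.+1) k => //.
    * by move=> j; apply: measurableT_comp => //; exact: sqint_measurable (sqintB (sV j t tT) (sV k t tT)).
    * move=> j kj; split; first exact: intg_norm (sqint_intg (sqintB (sV j t tT) (sV k t tT))).
      have [h _ _] := Hn k _ _ (Nn _ _ kj) (Nn _ _ (leqnn k)).
      apply: le_trans (h t tT).
      rewrite -(patch_mean 0 mA PA (f := fun w => `|W j t w - W k t w|)); last first.
        have [_ _ h1] := Wt j t tT; have [_ _ h2] := Wt k t tT.
        by apply: measurableT_comp => //; exact: measurable_funB.
      rewrite le_eqVlt; apply/orP; left; apply/eqP; congr mean; apply/funext => w.
      by rewrite /V; case: ifP => //; rewrite subrr normr0.
    * by move=> w; apply: cvg_norm; apply: cvgB; [exact: cV|exact: cvg_cst].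
Qed.

End EulerLimit.

(** * Increments of the Ito integral *)

Lemma chain_cell_exists (R : realType) (c : nat -> R) N s : c 0%N < s -> s <= c N ->
  exists i, [/\ (i < N)%N, c i < s & s <= c i.+1].
Proof.
move=> s0 sN; have ex : exists i, s <= c i by exists N.
case: (ex_minnP ex) => -[|i] si mi; first by move: si; rewrite leNgt s0.
exists i; split=> //; first exact: mi.
by rewrite ltNge; apply/negP => /mi; rewrite ltnn.
Qed.

Lemma step_integral (R : realType) (c a : nat -> R) N :
  (forall i, (i < N)%N -> c i <= c i.+1) -> (forall i, 0 <= a i) ->
  (\int[lebesgue_measure]_(s in `]c 0%N, c N])
     (\sum_(i < N) a i * \1_(`]c i, c i.+1]) s)%:E
   = (\sum_(i < N) a i * (c i.+1 - c i))%:E)%E.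
Proof.
move=> cl a0.
have mono j k : (j <= k)%N -> (k <= N)%N -> c j <= c k.
  move=> jk; rewrite -(subnKC jk); elim: (k - j)%N => [|m IH]; rewrite ?addn0//.
  by rewrite addnS => h; apply: le_trans (IH (ltnW h)) (cl _ h).
have mi i : measurable_fun `]c 0%N, c N]
    (fun s => (\1_(`]c i, c i.+1] : set (measurableTypeR R)) s)%:E : \bar R).
  by apply/measurable_EFinP; apply: measurable_indic; exact: measurable_itv.
under eq_integral do rewrite -sumEFin.
rewrite (@ge0_integral_sum _ (measurableTypeR R) R lebesgue_measure `]c 0%N, c N]
  (measurable_itv _) _ (fun (i : 'I_N) s => (a i * \1_(`]c i, c i.+1]) s)%:E)); last 2 first.
- move=> i; apply/measurable_EFinP; apply: measurable_funM => //.
- by move=> i s _; rewrite lee_fin mulr_ge0.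
rewrite -sumEFin; apply: eq_bigr => i _; have iN := ltn_ord i.
under eq_integral do rewrite EFinM.
rewrite ge0_integralZl//=; last 2 first.
- exact: mi.
- by rewrite lee_fin.
rewrite EFinM integral_indic//= setIidl.
  rewrite lebesgue_measure_itv/= lte_fin.
  have := cl i iN; rewrite le_eqVlt => /orP[/eqP->|->]; last by rewrite EFinB.
  by rewrite ltxx subrr.
move=> s /=; rewrite !in_itv/= => /andP[h1 h2].
by rewrite (le_lt_trans _ h1) ?(le_trans h2)// mono// ltnW.
Qed.

Section SimpleIncrements.
Context (R : realType) (d : measure_display) (Omega : measurableType d).
Variables (P : probability Omega R) (T : R).
Variables (F : R -> set (set Omega)) (B : R -> {RV P >-> R}).
Hypothesis F_filtration : filtration T F.
Hypothesis B_brownian : brownian_motion T F B.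
Variable S : simple_process R Omega.
Hypothesis S_simple : is_simple_process T F S.
Variables (v u : R) (xi : Omega -> R).
Hypotheses (v0 : 0 <= v) (vu : v <= u) (uT : u <= T).
Hypotheses (xi_wrt : measurable_wrt (F v) xi) (xi_sqint : sqint P xi).
Implicit Types (s t : R) (i j : nat) (w : Omega).

Let n := sp_size S.
Let clamp t := Num.max v (Num.min t u).

(* The chain [v <= clamp t_0 <= ... <= clamp t_n <= u]. *)
Let c i := if i is j.+1 then if (j <= n)%N then clamp (sp_time S j) else u else v.
(** Value of [S] on the successive cells of [c]; it is 0 on the first and the last, where [S]
    vanishes. *)
Let alpha i w := if i is j.+1 then if (j < n)%N then sp_coef S j w else 0 else 0.

Let clamp_itv t : v <= clamp t <= u.
Proof. by rewrite le_max lexx ge_max vu ge_min lexx orbT. Qed.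

Let clamp_lt t s : v < s -> s <= u -> (clamp t < s) = (t < s).
Proof. by move=> vs su; rewrite gt_max vs gt_min (ltNge u) su orbF. Qed.

Let clamp_incr t w : B (Num.min t u) w - B (Num.min t v) w = B (clamp t) w - B v w.
Proof.
rewrite /clamp; case: (leP t v) => tv.
  by rewrite (min_l (le_trans tv vu)) max_l // !subrr.
have h : v <= Num.min t u by rewrite le_min (ltW tv) vu.
by rewrite (max_r h).
Qed.

Let c0 : 0 <= c 0. Proof. by []. Qed.

Let cN : c n.+2 = u. Proof. by rewrite /c ltnn. Qed.

Let cl i : (i < n.+2)%N -> c i <= c i.+1.
Proof.
have [_ _ h] := S_simple; case: i => [|j] /=; rewrite ?leq0n.
  by have /andP[] := clamp_itv (sp_time S 0).
rewrite !ltnS => jn; rewrite jn; case: ifP => [jn'|_]; last by have /andP[] := clamp_itv (sp_time S j).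
have [tt _ _] := h j jn'; rewrite /clamp ge_max !le_max lexx/= le_min !ge_min lexx tt/= !orbT//.
Qed.

Let time_itv i : (i <= n)%N -> 0 <= sp_time S i <= T.
Proof.
have [t0 tT h] := S_simple.
apply: (@chain_itv _ T n (sp_time S) t0 _ tT) => j jn; by have [] := h j jn.
Qed.

Let alpha_wrt i : (i < n.+2)%N -> c i < c i.+1 -> measurable_wrt (F (c i)) (alpha i).
Proof.
have cT := chain_itv c0 cl (_ : c n.+2 <= T).
move=> iN; have sF : sigma_algebra setT (F (c i)).
  by apply: (filtration_sigma F_filtration); apply: cT; rewrite ?cN// ltnW.
case: i iN sF => [|j] jn sF; first by move=> _; exact: measurable_wrt_cst.
have -> : alpha j.+1 = if (j < n)%N then sp_coef S j else fun=> 0.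
  by apply/funext => w /=; case: ifP.
case: (ltnP j n) => [jn'|_ _]; last exact: measurable_wrt_cst.
rewrite /= jn' (ltnW jn') => lt.
have [_ _ h] := S_simple; have [_ wj _] := h j jn'.
apply: measurable_wrtS wj; have /andP[t0 tT] := time_itv (ltnW jn').
have /andP[cv cu] := clamp_itv (sp_time S j).
apply: (filtration_le F_filtration) => //; last exact: le_trans uT.
(* A proper cell starts before [u], so [sp_time S j] is at most its clamped value and the
   coefficient is known at the start of the cell. *)
have ju : clamp (sp_time S j) < u.
  by apply: lt_le_trans lt _; have /andP[] := clamp_itv (sp_time S j.+1).
move: ju; rewrite /clamp gt_max => /andP[vu']; rewrite gt_min ltxx orbF => ju.
by rewrite le_max (min_l (ltW ju)) lexx orbT.
Qed.

Let alpha_sqint i : sqint P (alpha i).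
Proof.
case: i => [|j]; first exact: sqint_cst.
have -> : alpha j.+1 = if (j < n)%N then sp_coef S j else fun=> 0.
  by apply/funext => w /=; case: ifP.
case: (ltnP j n) => [jn|_]; last exact: sqint_cst.
have [_ _ h] := S_simple; have [_ wj [k hk]] := h j jn.
apply: (sqint_bounded P _ hk); apply: measurable_wrt_fun wj.
exact/(filtration_meas F_filtration)/time_itv/ltnW.
Qed.

Let a i w := alpha i w - xi w.

Let a_wrt i : (i < n.+2)%N -> c i < c i.+1 -> measurable_wrt (F (c i)) (a i).
Proof.
move=> iN lt; have cT := chain_itv c0 cl (_ : c n.+2 <= T).
have ciT : 0 <= c i <= T by apply: cT; rewrite ?cN// ltnW.
have sF := filtration_sigma F_filtration ciT.
apply: measurable_wrtB => //; first exact: alpha_wrt.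
apply: measurable_wrtS xi_wrt; apply: (filtration_le F_filtration) => //.
  by have := chain_le cl (leq0n i) (ltnW iN).
by case/andP: ciT.
Qed.

Let a_sqint i : (i < n.+2)%N -> sqint P (a i).
Proof. by move=> _; apply: sqintB => //; exact: alpha_sqint. Qed.

Let sum_a w : \sum_(i < n.+2) a i w * incr B (c i) (c i.+1) w =
  sp_int B S u w - sp_int B S v w - xi w * incr B v u w.
Proof.
under eq_bigr do rewrite mulrBl; rewrite sumrB -mulr_sumr; congr (_ - _ * _).
  rewrite big_ord_recl/= mul0r add0r big_ord_recr/= /bump/= add1n ltnn mul0r addr0.
  rewrite /sp_int -sumrB; apply: eq_bigr => i _; rewrite /= /bump/= !add1n.
  rewrite (ltn_ord i) (ltnW (ltn_ord i)) /incr.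
  have := clamp_incr (sp_time S i.+1) w; have := clamp_incr (sp_time S i) w.
  rewrite -mulrBr => h1 h2; congr (_ * _); move: h1 h2; lra.
rewrite /incr -(big_mkord xpredT (fun i => B (c i.+1) w - B (c i) w)).
by rewrite telescope_sumr// cN.
Qed.

Let sp_valE s w : v < s -> s <= u ->
  (sp_val S s w - xi w) ^+ 2 = \sum_(i < n.+2) a i w ^+ 2 * \1_(`]c i, c i.+1]) s.
Proof.
move=> vs su; have [|i [iN ci ci']] := @chain_cell_exists _ c n.+2 s vs; first by rewrite cN.
rewrite (sum_cell (fun i => a i w ^+ 2) cl iN ci ci') /a; congr ((_ - _) ^+ 2).
rewrite -(sum_cell (fun i => alpha i w) cl iN ci ci').
rewrite big_ord_recl/= mul0r add0r big_ord_recr/= /bump/= add1n ltnn mul0r addr0.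
apply: eq_bigr => j _; rewrite /= /bump/= !add1n (ltn_ord j) (ltnW (ltn_ord j)); congr (_ * _).
rewrite !indicE; congr (nat_of_bool _)%:R.
have E t : (s <= clamp t) = (s <= t) by rewrite !leNgt clamp_lt.
by apply/idP/idP => /set_mem/=; rewrite in_itv/= => h; apply/mem_set => /=; move: h;
  rewrite in_itv/= clamp_lt// E.
Qed.

(** On the chain [c] the expression is a sum of Brownian increments with coefficients
    [alpha i - xi], both known at the start of each proper cell; the martingale property and the
    isometry for chains then apply. *)
Lemma simple_increment :
  let I := fun w => sp_int B S u w - sp_int B S v w - xi w * incr B v u w in
  [/\ sqint P I, measurable_wrt (F u) I,
      forall eta, measurable_wrt (F v) eta -> sqint P eta ->
        mean P (fun w => eta w * I w) = 0 &
      ((mean P (fun w => I w ^+ 2))%:E <= 8%:E *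
        \int[P]_w \int[lebesgue_measure]_(s in `]v, u])
          ((sp_val S s w - xi w) ^+ 2)%:E)%E].
Proof.
move=> I; have cT : c n.+2 <= T by rewrite cN.
have IE : I = fun w => \sum_(i < n.+2) a i w * incr B (c i) (c i.+1) w.
  by apply/funext => w; rewrite sum_a.
have md := chain_mdiff F_filtration B_brownian c0 cl cT a_wrt a_sqint.
have [sI I2] := chain_isometry_le F_filtration B_brownian c0 cl cT a_wrt a_sqint.
have [wI _] := mdiff_partial_sum (chain_sigma F_filtration c0 cl cT)
  (chain_mono F_filtration c0 cl cT) md (leqnn _).
rewrite cN in wI.
split; rewrite ?IE//.
- move=> eta weta seta.
  under [X in mean P X]eq_fun do rewrite mulr_sumr.
  rewrite (mean_sum (f := fun i w => eta w * (a i w * incr B (c i) (c i.+1) w))); last first.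
    by move=> i iN; have [si _ _] := md i iN; exact: sqint_intgM.
  apply: big1 => i _; have [_ _ o] := md i (ltn_ord i); apply: o => //.
  apply: measurable_wrtS weta; apply: (filtration_le F_filtration) => //.
    by have := chain_le cl (leq0n i) (ltnW (ltn_ord i)).
  by have /andP[] := chain_itv c0 cl cT (ltnW (ltn_ord i)).
- have E w : (\int[lebesgue_measure]_(s in `]v, u]) ((sp_val S s w - xi w) ^+ 2)%:E
      = (\sum_(i < n.+2) a i w ^+ 2 * (c i.+1 - c i))%:E)%E.
    rewrite -(step_integral (a := fun i => a i w ^+ 2) cl) => [|i]; last exact: sqr_ge0.
    rewrite cN; apply: eq_integral => s /set_mem/=; rewrite in_itv/= => /andP[vs su].
    by rewrite sp_valE.
  under [X in (_ <= _ * X)%E]eq_integral do rewrite E.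
  have i2 i : (i < n.+2)%N -> intg P (fun w => a i w ^+ 2 * (c i.+1 - c i)).
    move=> iN; under [X in intg P X]eq_fun do rewrite mulrC.
    by apply: intgZ; have [] := a_sqint iN.
  rewrite -meanE; last by exact: (intg_sum i2).
  rewrite -EFinM lee_fin (mean_sum i2) mulr_sumr.
  apply: (le_trans I2); apply: ler_sum => i _.
  under [X in _ <= _ * mean P X]eq_fun do rewrite mulrC.
  rewrite meanZ; last by have [] := a_sqint (ltn_ord i).
  by rewrite mulrA.
Qed.

End SimpleIncrements.

(* The library's [ge0_le_integral] asks for measurability; here the drift of an
   arbitrary solution is not yet known to be measurable in time. *)
Lemma nonneg_integral_mono (d : measure_display) (X : measurableType d) (R : realType)
    (mu : {measure set X -> \bar R}) (D : set X) (f g : X -> \bar R) :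
  (forall z, D z -> 0 <= f z)%E -> (forall z, D z -> f z <= g z)%E ->
  (\int[mu]_(z in D) f z <= \int[mu]_(z in D) g z)%E.
Proof.
move=> f0 fg; rewrite [leLHS]integral_mkcond [leRHS]integral_mkcond.
have g0 z : D z -> (0 <= g z)%E by move=> Dz; exact: le_trans (f0 z Dz) (fg z Dz).
rewrite !ge0_integralTE; [|by move=> z; rewrite erestrict_ge0..].
apply: le_ereal_sup => _ [h hf <-]; exists h => // z.
by apply: le_trans (hf z) _; apply: lee_restrict.
Qed.

Lemma nonneg_integral_subset (d : measure_display) (X : measurableType d) (R : realType)
    (mu : {measure set X -> \bar R}) (D E : set X) (f : X -> \bar R) :
  D `<=` E -> (forall z, E z -> 0 <= f z)%E ->
  (\int[mu]_(z in D) f z <= \int[mu]_(z in E) f z)%E.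
Proof.
move=> DE f0; rewrite [leLHS]integral_mkcond [leRHS]integral_mkcond.
apply: nonneg_integral_mono => z _; rewrite !patchE.
  by case: ifPn => // /set_mem/DE; exact: f0.
case: ifPn => [/set_mem/DE Ez|_]; first by rewrite mem_set.
by case: ifPn => // /set_mem; exact: f0.
Qed.

(** Holds for arbitrary [f]: the integrals of its positive and negative parts both lie in
    [[0, k t]], and so does the modulus of their difference. *)
Lemma norm_Rintegral_le_bound (R : realType) (f : R -> R) (t k : R) : 0 <= t ->
  (forall s, 0 <= s <= t -> `|f s| <= k) ->
  `|\int[lebesgue_measure]_(s in `[0, t]) f s| <= k * t.
Proof.
move=> t0 fk.
have k0 : 0 <= k by apply: le_trans (fk 0 _); rewrite ?normr_ge0// lexx.
have kt : (\int[lebesgue_measure]_(s in `[0%R, t]) (cst k%:E s) = (k * t)%:E)%E.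
  rewrite integral_cst//= lebesgue_measure_itv/= lte_fin EFinM.
  move: t0; rewrite le_eqVlt => /orP[/eqP<-|->]; last by rewrite oppr0 adde0.
  by rewrite ltxx.
have P1 (g : R -> \bar R) : (forall s, 0 <= g s)%E ->
    (forall s : R, (0 <= s <= t)%R -> g s <= `|f s|%:E)%E ->
    exists2 r : R, 0 <= r <= k * t & (\int[lebesgue_measure]_(s in `[0%R, t]) g s = r%:E)%E.
  move=> g0 gf.
  have I0 : (0 <= \int[lebesgue_measure]_(s in `[0%R, t]) g s)%E by exact: integral_ge0.
  have Ik : (\int[lebesgue_measure]_(s in `[0%R, t]) g s <= (k * t)%:E)%E.
    rewrite -kt; apply: nonneg_integral_mono => // s /=; rewrite in_itv/= => st.
    by apply: (le_trans (gf s st)); rewrite lee_fin fk.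
  exists (fine (\int[lebesgue_measure]_(s in `[0%R, t]) g s)).
    by rewrite fine_ge0//= -lee_fin fineK// ge0_fin_numE// (le_lt_trans Ik)// ltry.
  by rewrite fineK// ge0_fin_numE// (le_lt_trans Ik)// ltry.
rewrite /Rintegral integralE.
have [//||r1 /andP[r10 r1k] ->] := P1 ((EFin \o f)^\+)%E.
  move=> s st; rewrite funeposE/= -EFin_max lee_fin ge_max ler_norm normr_ge0//.
have [//||r2 /andP[r20 r2k] ->] := P1 ((EFin \o f)^\-)%E.
  by move=> s st; rewrite funenegE/= -EFin_max lee_fin ge_max normr_ge0 -normrN ler_norm.
by rewrite -EFinB /= ler_norml; apply/andP; split; lra.
Qed.

Section ItoIntegral.
Context (R : realType) (d : measure_display) (Omega : measurableType d).
Variables (P : probability Omega R) (T : R).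
Hypothesis T0 : 0 < T.
Variables (F : R -> set (set Omega)) (B : R -> {RV P >-> R}).
Implicit Types (s t u v e : R) (k n i : nat) (w : Omega).
Let T0' := ltW T0.

(** Dominated convergence along a sequence of times violating the claim, in the form of Fatou's
    lemma for [2 k - |g t - g s|]. *)
Lemma bounded_process_mean_continuous (g : R -> Omega -> R) k t :
  (forall s, 0 <= s <= T -> measurable_fun setT (g s)) ->
  (forall s w, 0 <= s <= T -> `|g s w| <= k%:R) -> continuous_paths T g ->
  0 <= t <= T -> forall e, 0 < e -> exists2 dl : R, 0 < dl & forall s, 0 <= s <= T ->
    `|t - s| < dl -> mean P (fun w => `|g t w - g s w|) < e.
Proof.
move=> mg gk cg tT e e0; apply: contrapT => H.
have H1 n : exists s, [/\ 0 <= s <= T, `|t - s| < n.+1%:R^-1 &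
    e <= mean P (fun w => `|g t w - g s w|)].
  apply: contrapT => H2; apply: H; exists n.+1%:R^-1 => // s sT ts.
  by rewrite ltNge; apply/negP => h; apply: H2; exists s.
have [s Hs] := choice H1.
have mD n : measurable_fun setT (fun w => `|g t w - g (s n) w|).
  have [sT _ _] := Hs n; apply: measurableT_comp => //.
  by apply: measurable_funB; exact: mg.
have D2 n w : `|g t w - g (s n) w| <= 2 * k%:R.
  have [sT _ _] := Hs n; have := gk t w tT; have := gk (s n) w sT.
  by have := ler_normB (g t w) (g (s n) w); lra.
have iD n : intg P (fun w => `|g t w - g (s n) w|).
  apply/sqint_intg/(sqint_bounded P (k := 2 * k%:R)) => // w.
  by rewrite ger0_norm.
have [] := @fatou_mean _ _ _ P (fun n w => 2 * k%:R - `|g t w - g (s n) w|)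
  (fun w => 2 * k%:R) (2 * k%:R - e) 0.
- by move=> n w; rewrite subr_ge0.
- by move=> n; apply: measurable_funB.
- move=> n _; split; first by apply: intgB => //; exact: intg_cst.
  rewrite meanB ?mean_cst//; last exact: intg_cst.
  by rewrite lerD2l lerN2; have [] := Hs n.
- move=> w; rewrite -[X in _ --> X]subr0; apply: cvgB; first exact: cvg_cst.
  apply/cvgrPdist_lt => e' e'0.
  have [dl dl0 h] := (path_continuousP _ _).1 (cg w) t tT e' e'0.
  exists (Num.truncn dl^-1).+1 => //= n nd; have [sT ts _] := Hs n.
  rewrite sub0r normrN normr_id; apply: h => //; apply: (lt_trans ts).
  rewrite -[ltRHS]invrK ltf_pV2 ?posrE ?invr_gt0//.
  apply: (lt_le_trans (truncnS_gt _)); rewrite ler_nat.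
  exact: leq_trans nd _.
- by move=> _; rewrite mean_cst; lra.
Qed.

Variables (H : R -> Omega -> R) (J : R -> {RV P >-> R}) (M : R).
Hypothesis F_filtration : filtration T F.
Hypothesis B_brownian : brownian_motion T F B.
Hypothesis H_le : forall s w, 0 <= s <= T -> `|H s w| <= M.
Hypothesis J_ito : is_ito_integral T F B H J.

Lemma small_sqint (f : Omega -> R) c : measurable_fun setT f ->
  (\int[P]_w (f w ^+ 2)%:E <= c%:E)%E -> sqint P f /\ mean P (fun w => f w ^+ 2) <= c.
Proof.
move=> mf h; have i2 : intg P (fun w => f w ^+ 2).
  apply/integrableP; split; first by apply/measurable_EFinP; exact: measurable_funX.
  apply: le_lt_trans (ltry c); apply: le_trans h.
  by under eq_integral do rewrite /= ger0_norm ?sqr_ge0//.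
by split=> //; rewrite -lee_fin meanE.
Qed.

Lemma simple_wrt (S : simple_process R Omega) t : is_simple_process T F S -> 0 <= t <= T ->
  [/\ measurable_wrt (F t) (sp_int B S t), sqint P (sp_int B S t),
      forall w, sp_int B S 0 w = 0 &
      measurable_fun (`[0, T] `*` setT) (fun z : R * Omega => sp_val S z.1 z.2)].
Proof.
move=> S_simple /andP[t0 tT].
have [S0 ST h] := S_simple.
have time_itv i : (i <= sp_size S)%N -> 0 <= sp_time S i <= T.
  apply: (@chain_itv _ T (sp_size S) (sp_time S) S0 _ ST) => j jn.
  by have [] := h j jn.
have sp0 w : sp_int B S 0 w = 0.
  rewrite /sp_int big1// => i _; have iN := ltn_ord i.
  have /andP[h1 _] := time_itv i (ltnW iN); have /andP[h2 _] := time_itv i.+1 iN.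
  by rewrite !min_r// subrr mulr0.
have z0T : 0 <= (0 : R) <= T by rewrite lexx.
have [s1 s2 _ _] := simple_increment F_filtration B_brownian S_simple (lexx 0) t0 tT
  (measurable_wrt_cst (filtration_sigma F_filtration z0T) 0) (sqint_cst P 0).
have E : (fun w => sp_int B S t w - sp_int B S 0 w - 0 * incr B 0 t w) = sp_int B S t.
  by apply/funext => w; rewrite sp0 mul0r !subr0.
rewrite E in s1 s2; split=> //.
apply: measurable_funTS; apply: step_process_measurable => i iN.
have [_ wi _] := h i iN; apply: measurable_wrt_fun wi.
exact/(filtration_meas F_filtration)/time_itv/ltnW.
Qed.

(** Finitely many convergences are involved, so one approximating process serves for the integrand
    and for all the times at once. *)
Lemma ito_approx (c : nat -> R) N e : (forall i, (i <= N)%N -> 0 <= c i <= T) -> 0 < e ->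
  exists S, [/\ is_simple_process T F S,
    (\int[P]_w \int[lebesgue_measure]_(s in `[0%R, T])
       ((H s w - sp_val S s w) ^+ 2)%:E <= e%:E)%E &
    forall i, (i <= N)%N -> sqint P (fun w => J (c i) w - sp_int B S (c i) w) /\
      mean P (fun w => (J (c i) w - sp_int B S (c i) w) ^+ 2) <= e].
Proof.
move=> cT e0; have [_ _ [S [S1 S2 S3]]] := J_ito.
have small (f : nat -> \bar R) : f k @[k --> \oo] --> 0%E ->
    \forall k \near \oo, (f k <= e%:E)%E.
  move=> f0; have e0' : (0 < e%:E)%E by rewrite lte_fin.
  have h : nbhs (0%E : \bar R) [set z | (z < e%:E)%E] := open_ereal_lt' e0'.
  by have [k0 _ hk0] := f0 _ h; exists k0 => // k /hk0; exact: ltW.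
have h2 : \forall k \near \oo, (\int[P]_w \int[lebesgue_measure]_(s in `[0%R, T])
       ((H s w - sp_val (S k) s w) ^+ 2)%:E <= e%:E)%E.
  exact: small S2.
have h3 : forall n, (n <= N.+1)%N -> \forall k \near \oo, forall i, (i < n)%N ->
    (\int[P]_w ((J (c i) w - sp_int B (S k) (c i) w) ^+ 2)%:E <= e%:E)%E.
  elim=> [_|n IH nN]; first by apply: nearW.
  apply: filterS2 (IH (ltnW nN)) (small _ (S3 (c n) (cT n nN))) => k hk hk' i.
  by rewrite ltnS leq_eqVlt => /orP[/eqP->//|]; exact: hk.
have [k [hk1 hk2]] : exists k, (\int[P]_w \int[lebesgue_measure]_(s in `[0%R, T])
       ((H s w - sp_val (S k) s w) ^+ 2)%:E <= e%:E)%E /\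
   forall i, (i < N.+1)%N ->
    (\int[P]_w ((J (c i) w - sp_int B (S k) (c i) w) ^+ 2)%:E <= e%:E)%E.
  have [k hk] := filter_ex (filterI h2 (h3 N.+1 (leqnn _))).
  by exists k.
exists (S k); split => // i iN; apply: small_sqint; last exact: hk2.
have [_ s2 _ _] := simple_wrt (S1 k) (cT i iN).
apply: measurable_funB => //; exact: sqint_measurable s2.
Qed.

Lemma cross_section_measurable (f : R * Omega -> R) s : 0 <= s <= T ->
  measurable_fun (`[0, T] `*` setT) f -> measurable_fun setT (fun w => f (s, w)).
Proof.
move=> sT mf.
have mS : measurable (`[0, T] `*` setT : set (R * Omega)).
  by apply: measurableX => //; exact: measurable_itv.
apply: (measurable_comp mS _ mf); last exact: measurable_fun_pair.
by move=> _ [w _ <-]; split=> //=; rewrite in_itv.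
Qed.

(** The isometry costs 8 and passing from [S] to [xi] through [H] costs 2. By Tonelli's theorem, the
    pointwise bound [k] on the mean square becomes [k (u - v)]. *)
Lemma ito_cell (S : simple_process R Omega) v u (xi : Omega -> R) (k : R) e :
  is_simple_process T F S ->
  (\int[P]_w \int[lebesgue_measure]_(s in `[0%R, T])
     ((H s w - sp_val S s w) ^+ 2)%:E <= e%:E)%E ->
  0 <= v -> v <= u -> u <= T -> measurable_wrt (F v) xi -> sqint P xi ->
  (forall s, v < s -> s <= u -> (\int[P]_w ((H s w - xi w) ^+ 2)%:E <= k%:E)%E) ->
  mean P (fun w => (sp_int B S u w - sp_int B S v w - xi w * incr B v u w) ^+ 2) <=
  16 * (k * (u - v) + e).
Proof.
move=> S_simple He v0 vu uT wxi sxi Hk.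
have [[mH adH _] _ _] := J_ito.
have z0T : 0 <= (0 : R) <= T by rewrite lexx.
have [_ _ _ mS] := simple_wrt S_simple z0T.
have mxi := sqint_measurable sxi.
have [_ _ _] := simple_increment F_filtration B_brownian S_simple v0 vu uT wxi sxi.
rewrite -lee_fin => h; apply: (le_trans h) => {h}.
pose f (z : R * Omega) := (sp_val S z.1 z.2 - xi z.2) ^+ 2.
pose g (z : R * Omega) := (H z.1 z.2 - sp_val S z.1 z.2) ^+ 2.
have mf : measurable_fun (`[0, T] `*` setT) f.
  apply: measurable_funX; apply: measurable_funB; first exact: mS.
  apply: measurable_funTS; exact: (measurableT_comp mxi measurable_snd).
have mg : measurable_fun (`[0, T] `*` setT) g.
  by apply: measurable_funX; apply: measurable_funB.
have f0 z : 0 <= f z by exact: sqr_ge0.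
have g0 z : 0 <= g z by exact: sqr_ge0.
have [_ Ef] := tonelli_itv P mf f0 v0 uT.
have [mI Eg] := tonelli_itv P mg g0 v0 uT.
have ge : (\int[lebesgue_measure]_(s in `]v, u]) \int[P]_w (g (s, w))%:E <= e%:E)%E.
  rewrite -Eg; apply: le_trans He; apply: nonneg_integral_mono => w _.
    by apply: integral_ge0 => s _; rewrite lee_fin.
  apply: nonneg_integral_subset => [s /=|s _]; last by rewrite lee_fin sqr_ge0.
  by rewrite !in_itv/= => /andP[h1 h2]; rewrite (le_trans v0 (ltW h1)) (le_trans h2).
have [vu'|uv] := ltP v u; last first.
  have -> : v = u by apply/eqP; rewrite eq_le vu uv.
  rewrite set_itv_ge ?bnd_simp ?ltxx//.
  under eq_integral do rewrite integral_set0.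
  rewrite integral0 mule0 lee_fin subrr mulr0 add0r mulr_ge0// -lee_fin.
  apply: le_trans He; apply: integral_ge0 => w _; apply: integral_ge0 => s _.
  by rewrite lee_fin sqr_ge0.
have k0 : 0 <= k.
  rewrite -lee_fin; apply: le_trans (Hk u vu' (lexx u)); apply: integral_ge0 => w _.
  by rewrite lee_fin sqr_ge0.
have fle : (\int[P]_w \int[lebesgue_measure]_(s in `]v, u])
    ((sp_val S s w - xi w) ^+ 2)%:E <= (2 * (k * (u - v) + e))%:E)%E.
  rewrite [leLHS]Ef.
  apply: (@le_trans _ _ (\int[lebesgue_measure]_(s in `]v, u])
      ((2 * k)%:E + 2%:E * \int[P]_w (g (s, w))%:E)%E)%E).
    apply: nonneg_integral_mono => s /=.
      by move=> _; apply: integral_ge0 => w _; rewrite lee_fin.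
    rewrite in_itv/= => /andP[vs su].
    have sT : 0 <= s <= T by rewrite (le_trans v0 (ltW vs)) (le_trans su).
    have mHs : measurable_fun setT (H s).
      exact: measurable_wrt_fun (filtration_meas F_filtration sT) (adH s sT).
    have mSs : measurable_fun setT (fun w => sp_val S s w).
      exact: (cross_section_measurable sT mS).
    apply: (@le_trans _ _ (\int[P]_w ((2 * (H s w - xi w) ^+ 2)%:E
        + (2 * g (s, w))%:E))%E).
      apply: nonneg_integral_mono => w _; first by rewrite lee_fin.
      rewrite -EFinD lee_fin /f /g /=.
      have := sqr_ge0 (H s w - xi w + (H s w - sp_val S s w)); nra.
    rewrite ge0_integralD//=.
    - under eq_integral do rewrite EFinM.
      under [X in (_ + X)%E]eq_integral do rewrite EFinM.
      rewrite ge0_integralZl//=; last 2 first.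
      + by apply/measurable_EFinP; apply: measurable_funX; exact: measurable_funB.
      + by move=> w _; rewrite lee_fin sqr_ge0.
      rewrite ge0_integralZl//=; last 2 first.
      + by apply/measurable_EFinP; apply: measurable_funX; exact: measurable_funB.
      + by move=> w _; rewrite lee_fin.
      by apply: leeD => //; rewrite EFinM lee_pmul2l// Hk.
    - by move=> w _; rewrite lee_fin mulr_ge0// sqr_ge0.
    - apply/measurable_EFinP; apply: measurable_funM => //.
      by apply: measurable_funX; exact: measurable_funB.
    - by move=> w _; rewrite lee_fin mulr_ge0.
    - apply/measurable_EFinP; apply: measurable_funM => //.
      by apply: measurable_funX; exact: measurable_funB.
  rewrite ge0_integralD//=; last 3 first.
  - by move=> s _; rewrite lee_fin mulr_ge0.
  - by move=> s _; rewrite mule_ge0// integral_ge0// => w _; rewrite lee_fin.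
  - exact: measurable_funeM.
  rewrite integral_cst//= lebesgue_measure_itv/= lte_fin vu' ge0_integralZl//=; last first.
    by move=> s _; rewrite integral_ge0// => w _; rewrite lee_fin.
  rewrite -EFinD -EFinM.
  have -> : 2 * (k * (u - v) + e) = 2 * k * (u - v) + 2 * e by ring.
  rewrite [leRHS]EFinD; apply: leeD => //.
  by rewrite [leRHS]EFinM lee_pmul2l.
apply: (@le_trans _ _ (8%:E * (2 * (k * (u - v) + e))%:E)%E).
  by rewrite lee_pmul2l.
by rewrite -EFinM lee_fin mulrA; have -> : (8 * 2 = 16 :> R) by lra.
Qed.

Lemma ito_sqint t : 0 <= t <= T -> sqint P (J t).
Proof.
move=> tT; have [S [S_simple _ h]] := @ito_approx (fun=> t) 0 1 (fun _ _ => tT) ltr01.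
have [s1 _] := h 0%N (leqnn _); have [_ s2 _ _] := simple_wrt S_simple tT.
have := sqintD s1 s2.
by under [X in sqint P X]eq_fun do rewrite subrK.
Qed.

Lemma ito_increment v u : 0 <= v -> v <= u -> u <= T ->
  mean P (fun w => (J u w - J v w) ^+ 2) <= 48 * M ^+ 2 * (u - v).
Proof.
move=> v0 vu uT; apply/ler_addgt0Pr => e e0.
have vT : 0 <= v <= T by rewrite v0 (le_trans vu).
have uT' : 0 <= u <= T by rewrite uT (le_trans v0).
(* The square of a sum of three terms costs 3, and the three means carry [1 + 1 + 16] copies of this
   error, with [3 * 18 = 54]. The main term gives [48 = 3 * 16]. *)
have e1 : 0 < e / 54 by rewrite divr_gt0.
pose c i := if i is 0%N then v else u.
have cT i : (i <= 1)%N -> 0 <= c i <= T by case: i.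
have [S [S_simple He h]] := ito_approx cT e1.
have [sv mv] := h 0%N isT; have [su mu] := h 1%N isT.
have [_ spu _ _] := simple_wrt S_simple uT'; have [_ spv _ _] := simple_wrt S_simple vT.
have w0 : measurable_wrt (F v) (fun=> 0 : R).
  by apply: measurable_wrt_cst; exact: (filtration_sigma F_filtration).
have mI : mean P (fun w => (sp_int B S u w - sp_int B S v w) ^+ 2) <=
    16 * (M ^+ 2 * (u - v) + e / 54).
  have -> : (fun w => (sp_int B S u w - sp_int B S v w) ^+ 2) =
      (fun w => (sp_int B S u w - sp_int B S v w - 0 * incr B v u w) ^+ 2).
    by apply/funext => w; rewrite mul0r subr0.
  apply: (ito_cell S_simple He v0 vu uT w0 (sqint_cst P 0)) => s vs su'.
  have sT : 0 <= s <= T by rewrite (le_trans v0 (ltW vs)) (le_trans su').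
  apply: (@le_trans _ _ (\int[P]_w (cst (M ^+ 2)%:E w))%E); last first.
    by rewrite integral_cst//= probability_setT mule1.
  apply: nonneg_integral_mono => w _; rewrite lee_fin ?sqr_ge0// subr0.
  rewrite -real_normK ?num_real//; have hM := H_le w sT.
  by rewrite ler_pXn2r ?nnegrE// (le_trans _ hM).
have sD := sqintB spu spv.
pose f w := (J u w - sp_int B S u w) ^+ 2; pose g w := (J v w - sp_int B S v w) ^+ 2.
pose q w := (sp_int B S u w - sp_int B S v w) ^+ 2.
have i1 : intg P f by case: su.
have i2 : intg P g by case: sv.
have i3 : intg P q by case: sD.
apply: (@le_trans _ _ (mean P (fun w => 3 * (f w + g w + q w)))).
  apply: mean_le.
  - by have [] := sqintB (ito_sqint uT') (ito_sqint vT).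
  - by apply: intgZ; apply: intgD => //; exact: intgD.
  move=> w; rewrite /f /g /q.
  set a := J u w; set a' := J v w; set p := sp_int _ _ _ _; set p' := sp_int _ _ _ _.
  have := sqr_ge0 (a - p + (a' - p')); have := sqr_ge0 (a - p - (p - p')).
  have := sqr_ge0 (a' - p' + (p - p')).
  have -> : a - a' = (a - p) - (a' - p') + (p - p') by ring.
  by nra.
rewrite (meanZ 3 (intgD (intgD i1 i2) i3)) (meanD (intgD i1 i2) i3) (meanD i1 i2).
have {}mu : mean P f <= e / 54 := mu.
have {}mv : mean P g <= e / 54 := mv.
have {}mI : mean P q <= 16 * (M ^+ 2 * (u - v) + e / 54) := mI.
lra.
Qed.

Lemma ito_zero : {ae P, forall w, J 0 w = 0}.
Proof.
have z0T : 0 <= (0 : R) <= T by rewrite lexx.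
have s0 := ito_sqint z0T.
have m0 e : 0 < e -> mean P (fun w => J 0 w ^+ 2) <= e.
  move=> e0; have [S [S_simple _ h]] := @ito_approx (fun=> 0) 0 e (fun _ _ => z0T) e0.
  have [_ _ sp0 _] := simple_wrt S_simple z0T.
  have [_] := h 0%N (leqnn _).
  by under [X in mean P X]eq_fun do rewrite sp0 subr0.
have E : (\int[P]_w `|(J 0 w ^+ 2)%:E| = 0)%E.
  under eq_integral do rewrite /= ger0_norm ?sqr_ge0//.
  rewrite -meanE; last by case: s0.
  congr (_%:E); apply/eqP; rewrite eq_le mean_ge0 ?andbT => [|w]; last exact: sqr_ge0.
  by apply/ler_addgt0Pr => e e0; rewrite add0r m0.
have mJ : measurable_fun setT (fun w => (J 0 w ^+ 2)%:E).
  by apply/measurable_EFinP; apply: measurable_funX.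
have := (@ae_eq_integral_abs _ _ _ P setT measurableT _ mJ).1 E.
by apply: filterS => w /(_ I) /= [/eqP]; rewrite sqrf_eq0 => /eqP.
Qed.

End ItoIntegral.

(** * Existence *)

Lemma ereal_cvg0 (R : realType) (f : nat -> \bar R) : (forall k, 0 <= f k)%E ->
  (forall eta : R, 0 < eta -> exists k0, forall k, (k0 <= k)%N -> (f k <= eta%:E)%E) ->
  f k @[k --> \oo] --> 0%E.
Proof.
move=> f0 H; apply/fine_cvgP; split.
  have [k0 h] := H 1 ltr01; exists k0 => // k /h fk.
  by rewrite ge0_fin_numE// (le_lt_trans fk)// ltry.
apply/cvgrPdist_le => e e0; have [k0 h] := H e e0; exists k0 => // k /h fk.
rewrite /= sub0r normrN ger0_norm ?fine_ge0// -lee_fin fineK//.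
by rewrite ge0_fin_numE// (le_lt_trans fk)// ltry.
Qed.

Section LimitIsSolution.
Context (R : realType) (d : measure_display) (Omega : measurableType d).
Variables (P : probability Omega R) (T M C K x : R).
Variables (b : R -> R -> borel_prob R -> R) (sigma : R -> R -> R) (kappa : R -> R).
Hypothesis RC : regular_coef T M C K b sigma kappa.
Variables (F : R -> set (set Omega)) (B : R -> {RV P >-> R}).
Hypothesis F_filtration : filtration T F.
Hypothesis B_brownian : brownian_motion T F B.
Hypothesis F_null : forall t A, 0 <= t <= T -> P.-negligible A -> F t A.
Implicit Types (s t u v e eps eta : R) (n i j k L : nat) (w : Omega).

Let T0 := rc_T RC.
Let T0' : 0 <= T := ltW T0.
Let M0 := rc_M_ge0 RC.
Local Notation euler := (euler T x b sigma B).
Local Notation euler_sp := (euler_sp T x b sigma B).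
Local Notation euler_drift := (euler_drift T x b sigma B).
Local Notation euler_path := (euler_path T x b sigma B).
Local Notation grid := (grid T).
Local Notation path_wrt n t0 tT := (euler_path_wrt x RC F_filtration B_brownian n t0 tT).

Lemma euler_sp_simple n : is_simple_process T F (euler_sp n).
Proof.
split=> /=; [by rewrite grid0|by rewrite gridN|move=> i iN].
have [wE _] := euler_wrt x RC F_filtration B_brownian (ltnW iN).
have gT : 0 <= grid n i <= T by rewrite grid_ge0//= grid_leT// ltnW.
split; first exact: grid_le.
  exact: (measurable_wrt_comp (sigma_measurable RC gT) wE).
by exists M => w; exact: (rc_sigma_le RC).
Qed.

Lemma euler_sp_val n i s w : (i < 2 ^ n)%N -> grid n i < s -> s <= grid n i.+1 ->
  sp_val (euler_sp n) s w = sigma (grid n i) (euler n i w).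
Proof.
move=> iN is_ si.
apply: (@sum_cell _ (grid n) (fun i => sigma (grid n i) (euler n i w))) => // j _.
exact: grid_le.
Qed.

Lemma euler_sp_increment n v u : 0 <= v -> v <= u -> u <= T ->
  mean P (fun w => (sp_int B (euler_sp n) u w - sp_int B (euler_sp n) v w) ^+ 2)
  <= 8 * M ^+ 2 * (u - v).
Proof.
move=> v0 vu uT; have vT : 0 <= v <= T by rewrite v0 (le_trans vu).
have w0 : measurable_wrt (F v) (fun=> 0 : R).
  by apply: measurable_wrt_cst; exact: (filtration_sigma F_filtration).
have [_ _ _] := simple_increment F_filtration B_brownian (euler_sp_simple n) v0 vu uT
  w0 (sqint_cst P 0).
have -> : (fun w => (sp_int B (euler_sp n) u w - sp_int B (euler_sp n) v w
      - 0 * incr B v u w) ^+ 2) =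
    (fun w => (sp_int B (euler_sp n) u w - sp_int B (euler_sp n) v w) ^+ 2).
  by apply/funext => w; rewrite mul0r subr0.
rewrite -lee_fin => h; apply: (le_trans h); rewrite -mulrA [leRHS]EFinM lee_pmul2l//.
apply: (@le_trans _ _ (\int[P]_w (cst (M ^+ 2 * (u - v))%:E w))%E); last first.
  by rewrite integral_cst//= probability_setT mule1.
apply: nonneg_integral_mono => w _.
  by apply: integral_ge0 => s _; rewrite lee_fin sqr_ge0.
apply: (@le_trans _ _ (\int[lebesgue_measure]_(s in `]v, u]) (cst (M ^+ 2)%:E s))%E).
  apply: nonneg_integral_mono => s /=; first by rewrite lee_fin sqr_ge0.
  rewrite in_itv/= => /andP[vs su]; rewrite lee_fin subr0.
  have [i [iN is_ si]] := grid_cell_exists n (le_lt_trans v0 vs) (le_trans su uT).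
  rewrite (euler_sp_val _ iN is_ si) -real_normK ?num_real// ler_pXn2r ?nnegrE//.
  by apply: (rc_sigma_le RC); rewrite grid_ge0//= grid_leT// ltnW.
rewrite integral_cst//= lebesgue_measure_itv/= lte_fin EFinM.
by move: vu; rewrite le_eqVlt => /orP[/eqP->|->]; rewrite ?ltxx ?subrr ?EFinB.
Qed.

Lemma euler_path_mean_osc n v u : 0 <= v -> v <= u -> u <= T ->
  mean P (fun w => `|euler_path n u w - euler_path n v w|) <=
  (2 ^ n)%:R * M * (u - v) + 3 * M * Num.sqrt (u - v).
Proof.
move=> v0 vu uT; have vT := le_trans vu uT; have u0 := le_trans v0 vu.
have [_ su _ _ spu] := path_wrt n u0 uT.
have [_ sv _ _ spv] := path_wrt n v0 vT.
have sD := sqintB spu spv.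
apply: (@le_trans _ _ (mean P (fun w => (2 ^ n)%:R * M * (u - v)
    + `|sp_int B (euler_sp n) u w - sp_int B (euler_sp n) v w|))).
  apply: mean_le.
  - exact: intg_norm (sqint_intg (sqintB su sv)).
  - by apply: intgD; [exact: intg_cst|exact: intg_norm (sqint_intg sD)].
  move=> w; rewrite /euler_path.
  have vT' : 0 <= v <= T by rewrite v0.
  have uT' : 0 <= u <= T by rewrite u0.
  have := euler_drift_osc (P := P) x RC F_filtration B_brownian n w vT' uT'.
  rewrite (ger0_norm (_ : 0 <= u - v)) ?subr_ge0//.
  set a := euler_drift _ _ _; set a' := euler_drift _ _ _.
  set p := sp_int _ _ _ _; set p' := sp_int _ _ _ _ => h.
  have -> : x + a + p - (x + a' + p') = (a - a') + (p - p') by ring.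
  by apply: (le_trans (ler_normD _ _)); rewrite lerD2r.
rewrite (meanD (intg_cst P _) (intg_norm (sqint_intg sD))) mean_cst lerD2l.
apply: mean_norm_le_sqrt => //; first by rewrite !mulr_ge0.
apply: (le_trans (euler_sp_increment n v0 vu uT)).
rewrite !exprMn sqr_sqrtr ?subr_ge0//.
by rewrite ler_wpM2r ?subr_ge0// ler_wpM2r ?sqr_ge0// expr2 -natrM ler_nat.
Qed.

Variables (N : nat -> nat) (A : set Omega) (X : R -> {RV P >-> R}).
Hypothesis HL : euler_limit T x b sigma F B N A X.

Let mA : measurable A. Proof. by have [[]] := HL. Qed.
Let PA : P A = 0%E. Proof. by have [[]] := HL. Qed.
Let kN k : (k <= N k)%N. Proof. by have [_] := HL; exact. Qed.

Let unif w : ~ A w -> exists k0, forall k t, (k0 <= k)%N -> 0 <= t <= T ->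
  `|X t w - euler_path (N k) t w| <= 2^-1 ^+ k.
Proof. by have [_ _ h _ _] := HL; exact: h. Qed.

Let XA t w : 0 <= t <= T -> A w -> X t w = x.
Proof. by have [_ _ _ h _] := HL => /h[+ _ _ _]; exact. Qed.

Let Xwrt t : 0 <= t <= T -> measurable_wrt (F t) (X t).
Proof. by have [_ _ _ h _] := HL => /h[]. Qed.

Let Xsq t : 0 <= t <= T -> sqint P (X t).
Proof. by have [_ _ _ h _] := HL => /h[]. Qed.

Let XW k t : 0 <= t <= T -> mean P (fun w => `|X t w - euler_path (N k) t w|) <= 2^-1 ^+ k.+1.
Proof. by have [_ _ _ h _] := HL => /h[_ _ _]; exact. Qed.

Let sp_close k j t : (k <= j)%N -> 0 <= t <= T ->
  mean P (fun w => (sp_int B (euler_sp (N j)) t w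
    - sp_int B (euler_sp (N k)) t w) ^+ 2) <= 2^-1 ^+ k.+1.
Proof. by have [_ _ _ _] := HL; exact. Qed.

Lemma half_pow_small e : 0 < e -> exists k0, forall k, (k0 <= k)%N -> (2^-1 : R) ^+ k <= e.
Proof.
move=> e0; have q1 : `|2^-1 : R| < 1 by rewrite ger0_norm; lra.
have [k0 _ h] := (cvgrPdist_lt _ _).1 (cvg_expr q1) e e0.
exists k0 => k kk; have := h k kk.
by rewrite /= sub0r normrN ger0_norm ?exprn_ge0// => /ltW.
Qed.

Lemma limit_continuous : continuous_paths T X.
Proof.
move=> w; apply/path_continuousP => t tT e e0.
have [Aw|Aw] := pselect (A w).
  by exists 1 => // s sT _; rewrite !XA// subrr normr0.
have e3 : 0 < e / 3 by rewrite divr_gt0.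
have [k0 hk0] := unif Aw; have [k1 hk1] := half_pow_small e3.
pose k := maxn k0 k1.
have hk := hk1 k (leq_maxr _ _).
have cW : {within `[0, T], continuous (euler_path (N k) ^~ w)}.
  exact: (euler_path_continuous RC F_filtration B_brownian).
have [dl dl0 h] := (path_continuousP _ _).1 cW t tT _ e3.
exists dl => // s sT ts.
have h1 := hk0 k t (leq_maxl _ _) tT; have h2 := hk0 k s (leq_maxl _ _) sT.
have h3 := h s sT ts; rewrite distrC in h2.
have := ler_distD (euler_path (N k) t w) (X t w) (X s w).
have := ler_distD (euler_path (N k) s w) (euler_path (N k) t w) (X s w).
lra.
Qed.

Lemma limit_mean_continuous u : 0 <= u <= T -> forall e, 0 < e ->
  exists2 dl : R, 0 < dl & forall v, 0 <= v <= T -> `|u - v| < dl ->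
    mean P (fun w => `|X u w - X v w|) < e.
Proof.
move=> uT e e0; have e4 : 0 < e / 4 by rewrite divr_gt0.
have [k1 hk1] := half_pow_small e4.
pose Q := (2 ^ N k1)%:R * M + 1; have Q0 : 0 < Q by rewrite ltr_wpDl// mulr_ge0.
pose q := e / 4 / (3 * M + 1).
have M1 : 0 < 3 * M + 1 by rewrite ltr_wpDl// mulr_ge0.
have q0 : 0 < q by rewrite divr_gt0.
exists (Num.min (e / 4 / Q) (q ^+ 2)); first by rewrite lt_min divr_gt0// exprn_gt0.
move=> v vT; rewrite lt_min => /andP[d1 d2].
have osc s t : 0 <= s <= T -> 0 <= t <= T -> s <= t -> `|t - s| < e / 4 / Q ->
    `|t - s| < q ^+ 2 ->
    mean P (fun w => `|euler_path (N k1) t w - euler_path (N k1) s w|) <= e / 2.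
  move=> /andP[s0 sT] /andP[t0 tT] st; rewrite ger0_norm ?subr_ge0// => h1 h2.
  apply: (le_trans (euler_path_mean_osc (N k1) s0 st tT)).
  have -> : e / 2 = e / 4 + e / 4 by field.
  apply: lerD.
    move: h1; rewrite ltr_pdivlMr// => /ltW; apply: le_trans.
    by rewrite mulrC ler_wpM2l ?subr_ge0// lerDl.
  have h3 : Num.sqrt (t - s) <= q.
    rewrite -(@ler_pXn2r _ 2)// ?nnegrE ?sqrtr_ge0 ?(ltW q0)//.
    by rewrite sqr_sqrtr ?subr_ge0// ltW.
  apply: (@le_trans _ _ ((3 * M + 1) * q)); last by rewrite /q mulrC divfK// gt_eqF.
  by apply: ler_pM => //; rewrite ?sqrtr_ge0 ?mulr_ge0// lerDl.
have h1 : mean P (fun w => `|euler_path (N k1) u w - euler_path (N k1) v w|) <= e / 2.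
  have [vu|/ltW uv] := leP v u; first exact: osc.
  under [X in mean P X]eq_fun do rewrite distrC.
  by apply: osc => //; rewrite distrC.
have sW t : 0 <= t <= T -> sqint P (euler_path (N k1) t).
  by move=> /andP[t0 tT]; have [_ sX _ _ _] := path_wrt (N k1) t0 tT.
have tri (f g h : Omega -> R) : sqint P f -> sqint P g -> sqint P h ->
    mean P (fun w => `|f w - h w|) <= mean P (fun w => `|f w - g w|) + mean P (fun w => `|g w - h w|).
  move=> sf sg sh; rewrite -meanD; last 2 first.
  - exact: intg_norm (sqint_intg (sqintB sf sg)).
  - exact: intg_norm (sqint_intg (sqintB sg sh)).
  apply: mean_le => [||w]; last exact: ler_distD.
  - exact: intg_norm (sqint_intg (sqintB sf sh)).
  - apply: intgD; first exact: intg_norm (sqint_intg (sqintB sf sg)).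
    exact: intg_norm (sqint_intg (sqintB sg sh)).
have h2 := tri _ _ _ (Xsq uT) (sW u uT) (Xsq vT).
have h3 := tri _ _ _ (sW u uT) (sW v vT) (Xsq vT).
have h4 := XW k1 uT.
have h5 : mean P (fun w => `|euler_path (N k1) v w - X v w|) <= 2^-1 ^+ k1.+1.
  by under [X in mean P X]eq_fun do rewrite distrC; exact: XW.
have := hk1 k1 (leqnn k1); rewrite !exprS in h4 h5.
have : 0 < 2^-1 ^+ k1 :> R by rewrite exprn_gt0.
lra.
Qed.

Let Xint t (tT : 0 <= t <= T) : intg P (X t) := sqint_intg (Xsq tT).

Let limit_drift w s := b s (X s w) (law (X s)).

Let limit_drift_measurable w : measurable_fun `[0, T] (limit_drift w).
Proof.
apply: drift_path_measurable.
apply: (drift_path_continuous (rc_b_cont RC)).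
- exact: limit_continuous.
- exact: Xint.
- exact: limit_mean_continuous.
Qed.

Let limit_drift_le w s : 0 <= s <= T -> `|limit_drift w s| <= M.
Proof. by move=> sT; apply: (rc_b_le RC) => //; exact/finite_moment1_law/Xint. Qed.

Lemma euler_cell_close e : 0 < e -> exists k0, forall k i s, (k0 <= k)%N ->
  (i < 2 ^ N k)%N -> grid (N k) i <= s -> s <= grid (N k) i.+1 ->
  mean P (fun w => `|euler (N k) i w - X s w|) <= e.
Proof.
move=> e0; have e2 : 0 < e / 2 by rewrite divr_gt0.
have M1 : 0 < 4 * M + 1 by rewrite ltr_wpDl// mulr_ge0.
pose q := e / 2 / (4 * M + 1); have q0 : 0 < q by rewrite divr_gt0.
have m0 : 0 < Num.min 1 (q ^+ 2) by rewrite lt_min ltr01 exprn_gt0.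
have [n0 hn0] := grid_mesh_small T m0.
have [k1 hk1] := half_pow_small e2.
exists (maxn n0 k1) => k i s; rewrite geq_max => /andP[nk kk] iN is_ si.
have := hn0 (N k) (leq_trans nk (kN k)); rewrite le_min => /andP[h1 h2].
have sT : 0 <= s <= T.
  by rewrite (le_trans (grid_ge0 T0' (N k) i))//= (le_trans si)// grid_leT.
have [s0 sT'] := andP sT.
have [_ sE] := euler_wrt x RC F_filtration B_brownian (ltnW iN).
have [_ sW _ _ _] := path_wrt (N k) s0 sT'.
have osc := euler_path_osc x RC F_filtration B_brownian iN is_ si h1.
have o2 : 4 * M * Num.sqrt (T / 2 ^+ N k) <= e / 2.
  have h3 : Num.sqrt (T / 2 ^+ N k) <= q.
    rewrite -(@ler_pXn2r _ 2)// ?nnegrE ?sqrtr_ge0 ?(ltW q0)//.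
    by rewrite sqr_sqrtr// divr_ge0// exprn_ge0.
  apply: (@le_trans _ _ ((4 * M + 1) * q)); last by rewrite /q mulrC divfK// gt_eqF.
  by apply: ler_pM => //; rewrite ?sqrtr_ge0 ?mulr_ge0// lerDl.
have h4 : mean P (fun w => `|euler_path (N k) s w - X s w|) <= e / 2.
  under [X in mean P X]eq_fun do rewrite distrC.
  by apply: (le_trans (XW k sT)); apply: hk1; exact: leqW.
have i1 := intg_norm (sqint_intg (sqintB sE sW)).
have i2 := intg_norm (sqint_intg (sqintB sW (Xsq sT))).
apply: (@le_trans _ _ (mean P (fun w => `|euler (N k) i w - euler_path (N k) s w|)
    + mean P (fun w => `|euler_path (N k) s w - X s w|))).
  rewrite -meanD//; apply: mean_le => [||w]; last exact: ler_distD.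
  - exact: intg_norm (sqint_intg (sqintB sE (Xsq sT))).
  - exact: intgD.
by lra.
Qed.

Lemma chain_integral (f : R -> R) (c : nat -> R) n :
  measurable_fun `[0, T] f -> (forall s, 0 <= s <= T -> `|f s| <= M) ->
  0 <= c 0%N -> (forall i, (i < n)%N -> c i <= c i.+1) -> c n <= T ->
  \sum_(i < n) \int[lebesgue_measure]_(s in `]c i, c i.+1]) f s
  = \int[lebesgue_measure]_(s in `]c 0%N, c n]) f s.
Proof.
move=> mf fM c0; elim: n => [|n IH] cl cT; first by rewrite big_ord0 integral_itv_self.
have cnn := cl n (ltnSn n).
rewrite big_ord_recr/= IH => [|i iN|]; [|exact/cl/leqW|exact: le_trans cT].
apply: (integral_itv_cat mf fM) => //.
exact: (chain_le (N := n) (fun i h => cl i (leqW h)) (leq0n n) (leqnn n)).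
Qed.

(** On each cell the position is compared along the fixed path, where convergence is uniform, and
    the law through the mean distance. The two integrands then differ by at most [(C + 1) * q]. *)
Lemma limit_drift_cvg w t : ~ A w -> 0 <= t <= T ->
  euler_drift (N k) t w @[k --> \oo] -->
    \int[lebesgue_measure]_(s in `]0, t]) limit_drift w s.
Proof.
move=> Aw tT; have [t0 tT'] := andP tT.
apply/cvgrPdist_le => e e0.
have CT : 0 < (C + 1) * T by rewrite mulr_gt0// ltr_wpDl// (rc_C RC).
pose q := e / ((C + 1) * T); have q0 : 0 < q by rewrite divr_gt0.
have [c c0 kc] := rc_kappa_small RC q0.
have c2 : 0 < c / 2 by rewrite divr_gt0.
have cX : {within `[0, T], continuous (X ^~ w)} by exact: limit_continuous.
have [dl dl0 hdl] := path_uniformly_continuous cX c2.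
have [n0 hn0] := grid_mesh_small T dl0.
have [k1 hk1] := half_pow_small c2.
have [k2 hk2] := unif Aw.
have [k3 hk3] := euler_cell_close q0.
exists (maxn (maxn n0 k1) (maxn k2 k3)) => //= k /=.
rewrite !geq_max => /andP[/andP[nk kk1] /andP[kk2 kk3]].
have [a0 al aN _] := dyadic_chain_good T0' t0 tT' (lexx (T / 2 ^+ N k)).
have aT := chain_itv a0 al aN.
have E := chain_integral (limit_drift_measurable w) (limit_drift_le w) a0 al aN.
rewrite dyadic_chain0// dyadic_chainN// in E.
rewrite -E /euler_drift -sumrB; apply: (le_trans (ler_norm_sum _ _ _)).
apply: (@le_trans _ _ (\sum_(i < 2 ^ N k)
    ((C + 1) * q) * (dyadic_chain T (N k) t i.+1 - dyadic_chain T (N k) t i))).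
  apply: ler_sum => i _; have iN := ltn_ord i.
  have [_ sE] := euler_wrt x RC F_filtration B_brownian (ltnW iN).
  have /andP[h1 _] := aT i (ltnW iN); have /andP[_ h2] := aT i.+1 iN.
  have := al i iN; rewrite le_eqVlt => /orP[/eqP eq|lt].
    rewrite -/(dyadic_chain T (N k) t i) -/(dyadic_chain T (N k) t i.+1) -eq.
    by rewrite drift_self integral_itv_self !subrr normr0 mulr0.
  apply: (norm_integral_itvB_le (limit_drift_measurable w)
    (drift_time_measurable (rc_b_cont RC) _ (sqint_intg sE)) (limit_drift_le w)
    (drift_time_le (rc_b_le RC) _ (sqint_intg sE)) h1 (al i iN) h2) => s /andP[is_ si].
  have [gE gt] := dyadic_chain_lt lt; rewrite gE in is_.
  have si' : s <= grid (N k) i.+1 by apply: (le_trans si); rewrite ge_min lexx.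
  have sT : 0 <= s <= T by rewrite (le_trans (grid_ge0 T0' (N k) i))//= (le_trans si).
  rewrite distrC; apply: (le_trans (drift_diff (rc_C RC) (rc_b_lip RC) (rc_b_kappa RC) _ _ sT sE (Xsq sT))).
  rewrite mulrDl mul1r addrC; apply: lerD.
    by apply: ler_wpM2l; [exact: (rc_C RC)|exact: hk3].
  apply: le_trans kc; apply: (kappa_le (rc_kappa_incr RC)) => //.
  have gT : 0 <= grid (N k) i <= T by rewrite grid_ge0//= grid_leT// ltnW.
  have h3 := hk2 k _ kk2 gT.
  rewrite (euler_path_grid x RC F_filtration B_brownian _ (ltnW iN)) in h3.
  have h4 : `|X (grid (N k) i) w - X s w| <= c / 2.
    apply: hdl => //; rewrite distrC ger0_norm ?subr_ge0//.
    by apply: le_trans (hn0 _ (leq_trans nk (kN k))); move: si'; rewrite gridS; lra.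
  have := ler_distD (X (grid (N k) i) w) (euler (N k) i w) (X s w).
  by rewrite distrC in h3; have := hk1 k kk1; lra.
rewrite -mulr_sumr.
rewrite -(big_mkord xpredT (fun i => dyadic_chain T (N k) t i.+1 - dyadic_chain T (N k) t i)).
rewrite telescope_sumr// dyadic_chainN// dyadic_chain0// subr0.
apply: (@le_trans _ _ (((C + 1) * q) * T)).
  by rewrite ler_wpM2l// mulr_ge0 ?(ltW q0)// addr_ge0// (rc_C RC).
by rewrite mulrAC /q mulrC divfK// gt_eqF.
Qed.

Lemma sigma_path_continuous (y : R -> R) : {within `[0, T], continuous y} ->
  {within `[0, T], continuous (fun t => sigma t (y t))}.
Proof.
move=> /path_continuousP cy; apply/path_continuousP => t tT e e0.
have tT' : (`[0, T] `*` setT : set (R * R)) (t, y t) by split=> //=; rewrite in_itv.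
have [dl dl0 h] := (within_continuousE _ _).1 (rc_sigma_cont RC) _ tT' e e0.
have [dl' dl'0 h'] := cy t tT dl dl0.
exists (Num.min dl dl'); first by rewrite lt_min dl0.
move=> s sT; rewrite lt_min => /andP[h1 h2].
by apply: (h (s, y s)); [split=> //=; rewrite in_itv|split=> //=; exact: h'].
Qed.

Let D w t := \int[lebesgue_measure]_(s in `]0, t]) limit_drift w s.

Let D_continuous w : {within `[0, T], continuous (D w)}.
Proof.
have lip s t : 0 <= s -> s <= t -> t <= T -> `|D w t - D w s| <= M * (t - s).
  move=> s0 st tT.
  rewrite /D -(integral_itv_cat (limit_drift_measurable w) (limit_drift_le w) (lexx 0) s0 st tT).
  rewrite addrC addKr.
  exact: (norm_integral_itv_le (limit_drift_measurable w) (limit_drift_le w) s0 st tT).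
apply/path_continuousP => t /andP[t0 tT] e e0.
have M1 : 0 < M + 1 by rewrite ltr_wpDl.
exists (e / (M + 1)); first by rewrite divr_gt0.
move=> s /andP[s0 sT]; rewrite ltr_pdivlMr// mulrC mulrDl mul1r => h.
apply: le_lt_trans h; apply: (@le_trans _ _ (M * `|t - s|)); last by rewrite lerDl.
have [st|/ltW ts] := leP s t; first by rewrite (ger0_norm (_ : 0 <= t - s)) ?subr_ge0// lip.
by rewrite distrC (distrC t) (ger0_norm (_ : 0 <= s - t)) ?subr_ge0// lip.
Qed.

(** The Ito integral is defined as what the drift leaves of [X], so the equation holds by
    construction. Adaptedness and the L^2 approximation come from its being the limit of the simple
    integrals of the schemes. *)
Let ito_part t w := if w \in A then 0 else X t w - x - D w t.

Let sp_patch k t w := if w \in A then 0 else sp_int B (euler_sp (N k)) t w.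

Let sp_wrt k t : 0 <= t <= T -> measurable_wrt (F t) (sp_int B (euler_sp (N k)) t) /\
  sqint P (sp_int B (euler_sp (N k)) t).
Proof. by move=> /andP[t0 tT]; have [_ _ _] := path_wrt (N k) t0 tT. Qed.

Let sp_patch_cvg t w : 0 <= t <= T -> sp_patch k t w @[k --> \oo] --> ito_part t w.
Proof.
move=> tT; rewrite /sp_patch /ito_part; case: ifPn => [_|Aw]; first exact: cvg_cst.
have {}Aw : ~ A w by move=> h; rewrite mem_set in Aw.
have cW : euler_path (N k) t w @[k --> \oo] --> X t w.
  apply/cvgrPdist_le => e e0; have [k0 hk0] := unif Aw; have [k1 hk1] := half_pow_small e0.
  exists (maxn k0 k1) => //= k /=; rewrite geq_max => /andP[h0 h1].
  by apply: le_trans (hk0 k t h0 tT) (hk1 k h1).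
have -> : (fun k => sp_int B (euler_sp (N k)) t w) =
    (fun k => euler_path (N k) t w - x - euler_drift (N k) t w).
  by apply/funext => k; rewrite /euler_path; ring.
apply: cvgB; last exact: limit_drift_cvg.
by apply: cvgB => //; exact: cvg_cst.
Qed.

Let ito_wrt t : 0 <= t <= T -> measurable_wrt (F t) (ito_part t).
Proof.
move=> tT; have sF := filtration_sigma F_filtration tT.
apply: (measurable_wrt_cvg sF (f := fun k => sp_patch k t)) => [k|w]; last exact: sp_patch_cvg.
apply: measurable_wrt_patch => //; last by have [] := sp_wrt k tT.
by apply: F_null => //; exists A; split.
Qed.

Let J t : {RV P >-> R} := toRV P (ito_part t).

Let JE t : 0 <= t <= T -> J t = ito_part t :> (Omega -> R).
Proof.
move=> tT; rewrite /J toRVE//.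
exact: measurable_wrt_fun (filtration_meas F_filtration tT) (ito_wrt tT).
Qed.

Let J_continuous : continuous_paths T J.
Proof.
move=> w; apply/path_continuousP => t tT e e0.
have [Aw|Aw] := boolP (w \in A).
  by exists 1 => // s sT _; rewrite !JE// /ito_part Aw subrr normr0.
have cg : {within `[0, T], continuous (fun t => X t w - x - D w t)}.
  move=> u; apply: cvgB; last exact: D_continuous.
  by apply: cvgB; [exact: limit_continuous|exact: cvg_cst].
have [dl dl0 h] := (path_continuousP _ _).1 cg t tT e e0.
by exists dl => // s sT ts; rewrite !JE// /ito_part (negbTE Aw); exact: h.
Qed.

(** Fatou's lemma as [j] grows, in the distance between the stochastic parts of levels [N j] and
    [N k]. *)
Let J_close k t : 0 <= t <= T ->
  (\int[P]_w ((J t w - sp_int B (euler_sp (N k)) t w) ^+ 2)%:E <= (2^-1 ^+ k)%:E)%E.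
Proof.
move=> tT; have [_ sk] := sp_wrt k tT; have mk := sqint_measurable sk.
have mp j : sqint P (sp_patch j t) by apply: patch_sqint => //; have [] := sp_wrt j tT.
have sD j := sqintB (mp j) (mp k).
have [||||i1 m1] := @fatou_mean _ _ _ P (fun j w => (sp_patch j t w - sp_patch k t w) ^+ 2)
    (fun w => (ito_part t w - sp_patch k t w) ^+ 2) (2^-1 ^+ k.+1) k.
- by move=> j w; exact: sqr_ge0.
- by move=> j; apply: measurable_funX; exact: sqint_measurable (sD j).
- move=> j kj; split; first by have [] := sD j.
  have [_ sj] := sp_wrt j tT.
  apply: le_trans (sp_close kj tT).
  rewrite -(patch_mean 0 mA PA (f := fun w => (sp_int B (euler_sp (N j)) t w
    - sp_int B (euler_sp (N k)) t w) ^+ 2)); last first.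
    by apply: measurable_funX; exact: sqint_measurable (sqintB sj sk).
  rewrite le_eqVlt; apply/orP; left; apply/eqP; congr mean; apply/funext => w.
  by rewrite /sp_patch; case: ifP => // _; rewrite subrr expr0n.
- by move=> w; apply: cvgM; apply: cvgB; (exact: sp_patch_cvg || exact: cvg_cst).
have mJ : measurable_fun setT (fun w => (J t w - sp_int B (euler_sp (N k)) t w) ^+ 2).
  by apply: measurable_funX; exact: measurable_funB.
have mQ : measurable_fun setT (fun w => (ito_part t w - sp_patch k t w) ^+ 2).
  exact: intg_measurable i1.
rewrite (@ae_eq_integral _ _ _ P setT (fun w => ((ito_part t w - sp_patch k t w) ^+ 2)%:E))//.
- rewrite -meanE// lee_fin; apply: (le_trans m1); rewrite exprS.
  by rewrite ler_piMl ?exprn_ge0//; lra.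
- exact/measurable_EFinP.
- exact/measurable_EFinP.
exists A; split=> // w /= h; apply: contrapT => nA; apply: h => _.
by rewrite JE// /ito_part /sp_patch memNset.
Qed.

Let limit_L2 : L2_integrand P T F (fun t w => sigma t (X t w)).
Proof.
split.
- apply: (continuous_process_measurable (H := fun t w => sigma t (X t w)) T0).
    move=> t tT; apply: (measurableT_comp (sigma_measurable RC tT)).
    exact: sqint_measurable (Xsq tT).
  by move=> w; apply: sigma_path_continuous; exact: limit_continuous.
- move=> t tT; exact: (measurable_wrt_comp (sigma_measurable RC tT) (Xwrt tT)).
- apply: (@le_lt_trans _ _ (\int[P]_w (cst (M ^+ 2 * T)%:E w))%E); last first.
    by rewrite integral_cst//= probability_setT mule1 ltry.
  apply: nonneg_integral_mono => w _.
    by apply: integral_ge0 => s _; rewrite lee_fin sqr_ge0.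
  apply: (@le_trans _ _ (\int[lebesgue_measure]_(s in `[0%R, T]) (cst (M ^+ 2)%:E s))%E).
    apply: nonneg_integral_mono => s /=; first by rewrite lee_fin sqr_ge0.
    rewrite in_itv/= => sT; rewrite lee_fin -real_normK ?num_real// ler_pXn2r ?nnegrE//.
    exact: (rc_sigma_le RC).
  by rewrite integral_cst//= lebesgue_measure_itv/= lte_fin T0 EFinM oppr0 adde0.
Qed.

(** The modulus of [sigma] combines the mean distance of the cell value to [X s] with a time term of
    factor [1 + |v|], whose mean is bounded uniformly in the level by [Q]. *)
Let sp_val_close eta : 0 < eta -> exists k0, forall k, (k0 <= k)%N ->
  (\int[P]_w \int[lebesgue_measure]_(s in `[0%R, T])
     ((sigma s (X s w) - sp_val (euler_sp (N k)) s w) ^+ 2)%:E <= eta%:E)%E.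
Proof.
move=> eta0.
pose q := eta / (2 * T); have q0 : 0 < q by rewrite divr_gt0// mulr_gt0.
pose Q := 1 + (`|x| + M * T + 1 + 8 * M ^+ 2 * T).
have Q0 : 0 < Q.
  by rewrite ltr_wpDr// !addr_ge0// !mulr_ge0// sqr_ge0.
have qQ : 0 < q / Q by rewrite divr_gt0.
have [dl dl0 sm] := sigma_modulus (rc_sigma_le RC) (rc_sigma_cont RC) (rc_K RC)
  (rc_sigma_half RC) qQ.
have K1 : 0 < 2 * K + 1 by rewrite ltr_wpDl// mulr_ge0// (rc_K RC).
have [k1 hk1] := euler_cell_close (divr_gt0 q0 K1).
have [n0 hn0] := grid_mesh_small T dl0.
exists (maxn k1 n0) => k; rewrite geq_max => /andP[kk1 kn0].
have [mS _ _] := limit_L2.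
have z0T : 0 <= (0 : R) <= T by rewrite lexx.
have [_ _ _ mV] := simple_wrt T0 F_filtration B_brownian (euler_sp_simple (N k)) z0T.
have mf : measurable_fun (`[0, T] `*` setT) (fun z : R * Omega =>
    (sigma z.1 (X z.1 z.2) - sp_val (euler_sp (N k)) z.1 z.2) ^+ 2).
  by apply: measurable_funX; apply: measurable_funB.
have -> : (\int[P]_w \int[lebesgue_measure]_(s in `[0%R, T])
     ((sigma s (X s w) - sp_val (euler_sp (N k)) s w) ^+ 2)%:E =
   \int[P]_w \int[lebesgue_measure]_(s in `]0%R, T])
     ((sigma s (X s w) - sp_val (euler_sp (N k)) s w) ^+ 2)%:E)%E.
  apply: eq_integral => w _; rewrite integral_itv_obnd_cbnd//.
  apply/measurable_EFinP; apply: measurable_funS (section_measurable w mf) => //.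
  by apply: subset_itvr; rewrite bnd_simp.
have -> : eta = (2 * q) * (T - 0) by rewrite /q subr0; field; rewrite gt_eqF.
have f0 (z : R * Omega) :
  0 <= (sigma z.1 (X z.1 z.2) - sp_val (euler_sp (N k)) z.1 z.2) ^+ 2 by exact: sqr_ge0.
have tl := tonelli_le mf f0 (lexx 0) T0' (lexx T) (c := 2 * q).
apply: tl => s s0 sT /=.
have [i [iN is_ si]] := grid_cell_exists (N k) s0 sT.
have sT' : 0 <= s <= T by rewrite ltW.
have gT : 0 <= grid (N k) i <= T by rewrite grid_ge0//= grid_leT// ltnW.
have [_ sE] := euler_wrt x RC F_filtration B_brownian (ltnW iN).
have [g0 gT'] := andP gT.
have [_ _ mE _ _] := path_wrt (N k) g0 gT'.
have iE := intg_norm (sqint_intg sE).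
have iD := intg_norm (sqint_intg (sqintB sE (Xsq sT'))).
have i1 := intgZ (2 * K) iD.
have i2 := intgZ (q / Q) (intgD (intg_cst P 1) iE).
apply: (@le_trans _ _ (\int[P]_w (2 * K * `|euler (N k) i w - X s w|
    + q / Q * (1 + `|euler (N k) i w|))%:E)%E).
  apply: nonneg_integral_mono => w _; rewrite lee_fin /= ?sqr_ge0//.
  rewrite (euler_sp_val w iN is_ si) distrC.
  apply: sm => //; rewrite ger0_norm ?subr_ge0 ?(ltW is_)//.
  apply: le_trans (hn0 _ (leq_trans kn0 (kN k))).
  by move: si; rewrite gridS; lra.
rewrite -meanE; last exact: intgD.
rewrite lee_fin (meanD i1 i2) (meanZ _ iD) (meanZ _ (intgD (intg_cst P 1) iE)).
rewrite (meanD (intg_cst P 1) iE) mean_cst.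
have {}mE : mean P (fun w => `|euler (N k) i w|) <= `|x| + M * T + 1 + 8 * M ^+ 2 * T.
  apply: le_trans mE; rewrite le_eqVlt; apply/orP; left; apply/eqP; congr mean.
  by apply/funext => w; rewrite (euler_path_grid x RC F_filtration B_brownian _ (ltnW iN)).
have -> : 2 * q = q + q by ring.
apply: lerD.
  apply: (@le_trans _ _ ((2 * K + 1) * (q / (2 * K + 1)))).
    apply: ler_pM => //; [by rewrite mulr_ge0// (rc_K RC)|by apply: mean_ge0|by rewrite lerDl|].
    exact: (hk1 k i s kk1 iN (ltW is_) si).
  by rewrite mulrC divfK// gt_eqF.
apply: (@le_trans _ _ (q / Q * Q)); last by rewrite divfK// gt_eqF.
by rewrite ler_wpM2l ?(ltW qQ)// lerD2l.
Qed.

Theorem limit_solution : mckean_vlasov_solution T F B x b sigma X.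
Proof.
split; [exact: Xwrt|exact: limit_continuous| |].
  by move=> t tT; exact/finite_moment1_law/Xint.
exists J; split; last first.
  exists A; split=> // w /= h; apply: contrapT => nA; apply: h => t tT.
  have [_ tT'] := andP tT.
  rewrite JE// /ito_part memNset// (integral_itv_closed (limit_drift_measurable w) (limit_drift_le w) tT').
  by rewrite /D; ring.
split; [exact: limit_L2|exact: J_continuous|].
exists (fun k => euler_sp (N k)); split.
- by move=> k; exact: euler_sp_simple.
- apply: ereal_cvg0 => [k|eta eta0]; last exact: sp_val_close.
  by apply: integral_ge0 => w _; apply: integral_ge0 => s _; rewrite lee_fin sqr_ge0.
- move=> t tT; apply: ereal_cvg0 => [k|eta eta0].
    by apply: integral_ge0 => w _; rewrite lee_fin sqr_ge0.
  have [k0 hk0] := half_pow_small eta0; exists k0 => k /hk0 h.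
  by apply: (le_trans (J_close k tT)); rewrite lee_fin.
Qed.

End LimitIsSolution.

(** * Uniqueness *)

Lemma sqint_ae (R : realType) (d : measure_display) (Omega : measurableType d)
    (P : probability Omega R) (A : set Omega) (f g : Omega -> R) :
  measurable A -> P A = 0%E -> sqint P f -> measurable_fun setT g ->
  (forall w, ~ A w -> f w = g w) -> sqint P g.
Proof.
move=> mA PA [mf i2] mg fg.
have [] := @small_sqint _ _ _ P g (mean P (fun w => f w ^+ 2)) mg => //.
rewrite meanE// (@ae_eq_integral _ _ _ P setT (fun w => (g w ^+ 2)%:E)
  (fun w => (f w ^+ 2)%:E))//.
- by apply/measurable_EFinP; exact: measurable_funX.
- by apply/measurable_EFinP; exact: measurable_funX.
exists A; split=> // w /= h; apply: contrapT => nA; apply: h => _.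
by rewrite fg.
Qed.

(** Approximation errors of the Ito integral must be small relative to each step, hence to the
    shortest proper one. *)
Lemma min_gap (R : realType) (c : nat -> R) N : exists2 dm : R, 0 < dm &
  forall i, (i < N)%N -> c i < c i.+1 -> dm <= c i.+1 - c i.
Proof.
elim: N => [|N [dm dm0 h]]; first by exists 1.
exists (if c N < c N.+1 then Num.min dm (c N.+1 - c N) else dm).
  by case: ifP => // ?; rewrite lt_min dm0 subr_gt0.
move=> i; rewrite ltnS leq_eqVlt => /orP[/eqP->|iN] lt.
  by rewrite lt ge_min lexx orbT.
by case: ifP => _; rewrite ?ge_min h.
Qed.

Section SolutionIsApproximate.
Context (R : realType) (d : measure_display) (Omega : measurableType d).
Variables (P : probability Omega R) (T M C K x : R).
Variables (b : R -> R -> borel_prob R -> R) (sigma : R -> R -> R) (kappa : R -> R).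
Hypothesis RC : regular_coef T M C K b sigma kappa.
Variables (F : R -> set (set Omega)) (B : R -> {RV P >-> R}).
Hypothesis F_filtration : filtration T F.
Hypothesis B_brownian : brownian_motion T F B.
Implicit Types (s t u v e eps eta : R) (n i j k L : nat) (w : Omega).

Let T0 := rc_T RC.
Let T0' : 0 <= T := ltW T0.
Let M0 := rc_M_ge0 RC.

Variables (Y J : R -> {RV P >-> R}) (A : set Omega).
Hypothesis Y_wrt : adapted T F Y.
Hypothesis Y_cont : continuous_paths T Y.
Hypothesis Y_moment : forall t, 0 <= t <= T -> finite_moment 1 (distribution P (Y t)).
Hypothesis J_ito : is_ito_integral T F B (fun t w => sigma t (Y t w)) J.
Hypotheses (mA : measurable A) (PA : P A = 0%E).
Hypothesis Y_eq : forall w, ~ A w -> forall t, 0 <= t <= T ->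
  Y t w = x + \int[lebesgue_measure]_(s in `[0, t])
    b s (Y s w) (distribution P (Y s)) + J t w.

Let sigma_le s w : 0 <= s <= T -> `|sigma s (Y s w)| <= M.
Proof. exact: (rc_sigma_le RC). Qed.

Let J_sqint t : 0 <= t <= T -> sqint P (J t).
Proof. exact: (ito_sqint T0 F_filtration B_brownian J_ito). Qed.

Let b_le s w : 0 <= s <= T -> `|b s (Y s w) (law (Y s))| <= M.
Proof. by move=> sT; apply: (rc_b_le RC) => //; exact: Y_moment. Qed.

(** The drift part of the solution, defined without its integral: measurability and path continuity
    are then immediate, before the integrand is known to be measurable in time. *)
Let G t w := if w \in A then 0 else Y t w - x - J t w.

Let G_le t w : 0 <= t <= T -> `|G t w| <= M * T.
Proof.
move=> tT; have [t0 tT'] := andP tT; rewrite /G; case: ifPn => [_|Aw].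
  by rewrite normr0 mulr_ge0.
have {}Aw : ~ A w by move=> h; rewrite mem_set in Aw.
rewrite (Y_eq Aw tT) [X in `|X|](_ : _ =
  \int[lebesgue_measure]_(s in `[0, t]) b s (Y s w) (law (Y s))); last by rewrite /law; ring.
apply: (@le_trans _ _ (M * t)); last by rewrite ler_wpM2l.
apply: norm_Rintegral_le_bound => // s /andP[s0 st].
by apply: b_le; rewrite s0 (le_trans st).
Qed.

Let G_meas t : 0 <= t <= T -> measurable_fun setT (G t).
Proof.
move=> tT; apply: measurable_fun_patch => //; apply: measurable_funB => //.
exact: measurable_funB.
Qed.

Let G_cont : continuous_paths T G.
Proof.
move=> w; have [_ cJ _] := J_ito; have [Aw|Aw] := boolP (w \in A).
  have -> : G ^~ w = fun=> 0 by apply/funext => t; rewrite /G Aw.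
  by move=> t; exact: cvg_cst.
have -> : G ^~ w = fun t => Y t w - x - J t w.
  by apply/funext => t; rewrite /G (negbTE Aw).
move=> t; apply: cvgB; last exact: cJ.
by apply: cvgB; [exact: Y_cont|exact: cvg_cst].
Qed.

Lemma solution_sqint t : 0 <= t <= T -> sqint P (Y t).
Proof.
move=> tT; apply: (sqint_ae mA PA (f := fun w => G t w + x + J t w)).
- apply: sqintD; last exact: J_sqint.
  by apply: sqintD; [exact: (sqint_bounded P (G_meas tT) (fun w => G_le w tT))|exact: sqint_cst].
- exact: measurable_funP.
- by move=> w Aw; rewrite /G memNset//; ring.
Qed.

Let Y_intg t (tT : 0 <= t <= T) : intg P (Y t) := sqint_intg (solution_sqint tT).

(** The constant 7 comes from [48 <= 7^2]. *)
Let J_osc v u : 0 <= v -> v <= u -> u <= T ->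
  mean P (fun w => `|J u w - J v w|) <= 7 * M * Num.sqrt (u - v).
Proof.
move=> v0 vu uT; have uT' : 0 <= u <= T by rewrite uT (le_trans v0).
have vT' : 0 <= v <= T by rewrite v0 (le_trans vu).
apply: mean_norm_le_sqrt; first by rewrite !mulr_ge0.
  by apply: sqintB; exact: J_sqint.
apply: (le_trans (ito_increment T0 F_filtration B_brownian sigma_le J_ito v0 vu uT)).
rewrite !exprMn sqr_sqrtr ?subr_ge0//.
by rewrite ler_wpM2r ?subr_ge0// ler_wpM2r ?sqr_ge0// expr2 -natrM ler_nat.
Qed.

Let Y_split u v : 0 <= u <= T -> 0 <= v <= T ->
  mean P (fun w => `|Y u w - Y v w|) <=
  mean P (fun w => `|G u w - G v w|) + mean P (fun w => `|J u w - J v w|).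
Proof.
move=> uT vT.
have sG t : 0 <= t <= T -> sqint P (G t).
  by move=> tT; exact: (sqint_bounded P (G_meas tT) (fun w => G_le w tT)).
have i1 := intg_norm (sqint_intg (sqintB (sG u uT) (sG v vT))).
have i2 := intg_norm (sqint_intg (sqintB (J_sqint uT) (J_sqint vT))).
have i3 := intg_norm (sqint_intg (sqintB (solution_sqint uT) (solution_sqint vT))).
rewrite -(meanD i1 i2).
rewrite -(patch_mean 0 mA PA (intg_measurable i3)).
apply: mean_le.
- apply: (intg_le _ i3); first exact: measurable_fun_patch mA (intg_measurable i3).
  by move=> w; case: ifP => _; rewrite ?normr0 ?normr_id.
- exact: intgD.
move=> w; rewrite /G; case: ifP => _; first by rewrite addr_ge0.
have -> : Y u w - Y v w = (Y u w - x - J u w - (Y v w - x - J v w)) + (J u w - J v w) by ring.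
exact: ler_normD.
Qed.

(** Breaks a circle: measurability of the drift along [Y] rests on the continuity of its law. Here
    [G] enters only as a bounded process with continuous paths. *)
Lemma solution_mean_continuous u : 0 <= u <= T -> forall e, 0 < e ->
  exists2 dl : R, 0 < dl & forall v, 0 <= v <= T -> `|u - v| < dl ->
    mean P (fun w => `|Y u w - Y v w|) < e.
Proof.
move=> uT e e0; have e2 : 0 < e / 2 by rewrite divr_gt0.
have Gk s w : 0 <= s <= T -> `|G s w| <= (Num.truncn (M * T)).+1%:R.
  by move=> sT; apply: (le_trans (G_le w sT)); exact/ltW/truncnS_gt.
have [dl dl0 h] := bounded_process_mean_continuous P G_meas Gk G_cont uT e2.
have M1 : 0 < 7 * M + 1 by rewrite ltr_wpDl// mulr_ge0.
pose q := e / 2 / (7 * M + 1); have q0 : 0 < q by rewrite divr_gt0.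
exists (Num.min dl (q ^+ 2)); first by rewrite lt_min dl0 exprn_gt0.
move=> v vT; rewrite lt_min => /andP[h1 h2].
apply: (le_lt_trans (Y_split uT vT)).
rewrite (splitr e); apply: ltr_leD; first exact: h.
have osc s t : 0 <= s -> t <= T -> s <= t -> `|t - s| < q ^+ 2 ->
    mean P (fun w => `|J t w - J s w|) <= e / 2.
  move=> s0 tT st; rewrite ger0_norm ?subr_ge0// => h3.
  apply: (le_trans (J_osc s0 st tT)).
  have h4 : Num.sqrt (t - s) <= q.
    rewrite -(@ler_pXn2r _ 2)// ?nnegrE ?sqrtr_ge0 ?(ltW q0)//.
    by rewrite sqr_sqrtr ?subr_ge0// ltW.
  apply: (@le_trans _ _ ((7 * M + 1) * q)); last by rewrite /q mulrC divfK// gt_eqF.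
  by apply: ler_pM => //; rewrite ?sqrtr_ge0 ?mulr_ge0// lerDl.
have [u0 uT'] := andP uT; have [v0 vT'] := andP vT.
have [vu|/ltW uv] := leP v u; first exact: osc.
under [X in mean P X]eq_fun do rewrite distrC.
by apply: osc => //; rewrite distrC.
Qed.

Let path_drift w s := b s (Y s w) (law (Y s)).

Let path_drift_measurable w : measurable_fun `[0, T] (path_drift w).
Proof.
apply: drift_path_measurable; apply: (drift_path_continuous (rc_b_cont RC)).
- exact: Y_cont.
- exact: Y_intg.
- exact: solution_mean_continuous.
Qed.

Let path_drift_le w s : 0 <= s <= T -> `|path_drift w s| <= M.
Proof. exact: b_le. Qed.

Let G_incr v u w : ~ A w -> 0 <= v -> v <= u -> u <= T ->
  G u w - G v w = \int[lebesgue_measure]_(s in `]v, u]) path_drift w s.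
Proof.
move=> Aw v0 vu uT.
have GE t : 0 <= t -> t <= T -> G t w = \int[lebesgue_measure]_(s in `]0, t]) path_drift w s.
  move=> t0 tT; rewrite /G memNset// Y_eq ?t0//.
  rewrite (integral_itv_closed (path_drift_measurable w) (path_drift_le w) tT).
  by rewrite /path_drift /law; ring.
rewrite !GE ?(le_trans v0)// ?(le_trans vu)//.
rewrite -(integral_itv_cat (path_drift_measurable w) (path_drift_le w) (lexx 0) v0 vu uT).
by rewrite addrC addKr.
Qed.

Lemma solution_osc v u : 0 <= v -> v <= u -> u <= T ->
  mean P (fun w => `|Y u w - Y v w|) <= M * (u - v) + 7 * M * Num.sqrt (u - v).
Proof.
move=> v0 vu uT; have uT' : 0 <= u <= T by rewrite uT (le_trans v0).
have vT' : 0 <= v <= T by rewrite v0 (le_trans vu).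
apply: (le_trans (Y_split uT' vT')); apply: lerD; last exact: J_osc.
have sG t : 0 <= t <= T -> sqint P (G t).
  by move=> tT; exact: (sqint_bounded P (G_meas tT) (fun w => G_le w tT)).
rewrite -[leRHS](mean_cst P); apply: mean_le.
- exact: intg_norm (sqint_intg (sqintB (sG u uT') (sG v vT'))).
- exact: intg_cst.
move=> w; have [Aw|Aw] := pselect (A w).
  by rewrite /G mem_set// subrr normr0 mulr_ge0// subr_ge0.
rewrite G_incr//.
exact: (norm_integral_itv_le (path_drift_measurable w) (path_drift_le w) v0 vu uT).
Qed.

Lemma solution_initial : mean P (fun w => `|Y 0 w - x|) = 0.
Proof.
have z0T : 0 <= (0 : R) <= T by rewrite lexx.
rewrite -[RHS](mean_cst P); apply: ae_mean_eq => //.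
  by apply: measurableT_comp => //; exact: measurable_funB.
have aeA : {ae P, forall w, ~ A w}.
  by exists A; split=> // w /= h; apply: contrapT => nA; exact: h.
have aeJ := ito_zero T0 F_filtration B_brownian J_ito.
apply: filterS2 aeA aeJ => w Aw J0.
by rewrite Y_eq// J0 set_itv1 Rintegral_set1 !addr0 subrr normr0.
Qed.

Lemma solution_bound t : 0 <= t <= T ->
  mean P (fun w => `|Y t w|) <= `|x| + M * T + 7 * M * Num.sqrt T.
Proof.
move=> tT; have [t0 tT'] := andP tT; have z0T : 0 <= (0 : R) <= T by rewrite lexx.
have i1 := intg_norm (sqint_intg (sqintB (solution_sqint tT) (solution_sqint z0T))).
have i2 := intg_norm (sqint_intg (sqintB (solution_sqint z0T) (sqint_cst P x))).
have i12 := intgD i1 i2.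
apply: (@le_trans _ _ (mean P (fun w => `|x| + (`|Y t w - Y 0 w| + `|Y 0 w - x|)))).
  apply: mean_le => [||w].
  - exact: intg_norm (Y_intg tT).
  - by apply: intgD => //; exact: intg_cst.
  have := ler_distD (Y 0 w) (Y t w) x; have := ler_distD x (Y t w) 0.
  by rewrite !subr0; lra.
rewrite (meanD (intg_cst P _) i12) mean_cst (meanD i1 i2) solution_initial addr0 -addrA lerD2l.
apply: (le_trans (solution_osc (lexx 0) t0 tT')); rewrite subr0.
by apply: lerD; rewrite ler_wpM2l ?mulr_ge0// ler_wsqrtr.
Qed.

Lemma cell_remainder v u (kc c dlt : R) : 0 <= v -> v <= u -> u <= T -> 0 < c ->
  kappa c <= kc -> (forall s, v < s -> s <= u -> mean P (fun w => `|Y s w - Y v w|) <= dlt) ->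
  mean P (fun w => `|Y u w - Y v w - (J u w - J v w) - drift b v u (Y v) (Y v w)|)
  <= (kc * (1 + dlt / c) + C * dlt) * (u - v).
Proof.
move=> v0 vu uT c0 kk Hd; have uT' : 0 <= u <= T by rewrite uT (le_trans v0).
have vT' : 0 <= v <= T by rewrite v0 (le_trans vu).
have C0 := rc_C RC.
have sYv := solution_sqint vT'.
have [->|nuv] := eqVneq v u.
  rewrite subrr mulr0; under [X in mean P X]eq_fun do rewrite drift_self !subrr normr0.
  by rewrite mean_cst.
have vu' : v < u by rewrite lt_neqAle nuv.
have dlt0 : 0 <= dlt by apply: le_trans (Hd u vu' (lexx u)); apply: mean_ge0.
have kc0 : 0 <= kc by apply: le_trans kk; exact: (kappa_ge0 (rc_kappa_incr RC) (rc_kappa0 RC) (ltW c0)).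
have md := rc_drift_measurable RC v0 vu uT sYv.
pose R1 w := Y u w - Y v w - (J u w - J v w) - drift b v u (Y v) (Y v w).
have sR1 : sqint P R1.
  apply: sqintB.
    by apply: sqintB; apply: sqintB; (exact: solution_sqint || exact: J_sqint).
  apply: (sqint_bounded P (k := M * (u - v))); first exact: measurableT_comp md _.
  by move=> w; exact: (rc_drift_le RC _ v0 vu uT (sqint_intg sYv)).
have iR1 := intg_norm (sqint_intg sR1).
rewrite -(patch_mean 0 mA PA (intg_measurable iR1)) -lee_fin meanE; last first.
  apply: (intg_le _ iR1); first exact: measurable_fun_patch mA (intg_measurable iR1).
  by move=> w; case: ifP => _; rewrite ?normr0 ?normr_id.
pose g (z : R * Omega) := kc * (1 + `|Y z.1 z.2 - Y v z.2| / c) + C * dlt.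
have mYj : measurable_fun (`[0, T] `*` setT) (fun z : R * Omega => Y z.1 z.2).
  apply: (continuous_process_measurable (H := fun s => Y s) T0) => //.
have mg : measurable_fun (`[0, T] `*` setT) g.
  apply: measurable_funD => //; apply: measurable_funM => //; apply: measurable_funD => //.
  apply: measurable_funM => //; apply: measurableT_comp => //.
  apply: measurable_funB => //; apply: measurable_funTS.
  by apply: measurableT_comp measurable_snd.
have g0 z : 0 <= g z.
  by rewrite addr_ge0 ?mulr_ge0// addr_ge0// divr_ge0// ltW.
have gs s : v < s -> s <= u ->
    (\int[P]_w (g (s, w))%:E <= (kc * (1 + dlt / c) + C * dlt)%:E)%E.
  move=> vs su; have sT : 0 <= s <= T by rewrite (le_trans v0 (ltW vs)) (le_trans su).
  have iD := intg_norm (sqint_intg (sqintB (solution_sqint sT) sYv)).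
  have iD' := intgZ (kc / c) iD.
  have -> : (\int[P]_w (g (s, w))%:E = \int[P]_w
      ((kc + C * dlt) + kc / c * `|Y s w - Y v w|)%:E)%E.
    by apply: eq_integral => w _; congr (_%:E); rewrite /g /=; ring.
  rewrite -meanE; last by apply: intgD => //; exact: intg_cst.
  rewrite lee_fin (meanD (intg_cst P _) iD') mean_cst (meanZ _ iD).
  have h : kc / c * mean P (fun w => `|Y s w - Y v w|) <= kc / c * dlt.
    by rewrite ler_wpM2l ?divr_ge0 ?(ltW c0)// Hd.
  apply: (@le_trans _ _ (kc + C * dlt + kc / c * dlt)); first by rewrite lerD2l.
  by rewrite le_eqVlt; apply/orP; left; apply/eqP; ring.
apply: le_trans (tonelli_le mg g0 v0 vu uT gs).
apply: nonneg_integral_mono => w _; first by rewrite lee_fin; case: ifP.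
case: ifPn => [_|Aw]; first by apply: integral_ge0 => s _; rewrite lee_fin.
have {}Aw : ~ A w by move=> h; rewrite mem_set in Aw.
have -> : R1 w = G u w - G v w - drift b v u (Y v) (Y v w).
  by rewrite /R1 /G !memNset//; ring.
rewrite (G_incr Aw v0 vu uT).
have m2 := drift_time_measurable (rc_b_cont RC) (Y v w) (sqint_intg sYv).
have i1 := integrable_itv (path_drift_measurable w) (path_drift_le w) v0 uT.
have i2 := integrable_itv m2 (drift_time_le (rc_b_le RC) (Y v w) (sqint_intg sYv)) v0 uT.
rewrite -RintegralB//.
pose h s := path_drift w s - b s (Y v w) (law (Y v)).
have mh : measurable_fun `[0, T] h by apply: measurable_funB => //; exact: path_drift_measurable.
have hM s : 0 <= s <= T -> `|h s| <= M + M.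
  move=> sT; apply: (le_trans (ler_normB _ _)); apply: lerD; first exact: b_le.
  exact: (drift_time_le (rc_b_le RC) (Y v w) (sqint_intg sYv)).
have iB := integrable_itv mh hM v0 uT.
apply: (@le_trans _ _ (\int[lebesgue_measure]_(s in `]v, u])
    (`|path_drift w s - b s (Y v w) (law (Y v))|)%:E)%E).
  have mhE : measurable_fun `]v, u] (EFin \o h).
    apply/measurable_EFinP; apply: measurable_funS mh => // s /=; rewrite !in_itv/=.
    by move=> /andP[vs su]; rewrite (le_trans v0 (ltW vs)) (le_trans su).
  rewrite -[leRHS]fineK ?lee_fin; last first.
    by have := integrable_norm iB; exact: integrable_fin_num.
  exact: le_normr_Rintegral iB.
apply: nonneg_integral_mono => s /=; first by rewrite lee_fin.
rewrite in_itv/= => /andP[vs su].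
have sT : 0 <= s <= T by rewrite (le_trans v0 (ltW vs)) (le_trans su).
rewrite lee_fin /g /=.
apply: (le_trans (drift_diff (rc_C RC) (rc_b_lip RC) (rc_b_kappa RC) _ _ sT (solution_sqint sT) sYv)).
apply: lerD; last by rewrite ler_wpM2l// Hd.
apply: (le_trans (kappa_affine (rc_kappa_incr RC) (rc_kappa0 RC) (rc_kappa_concave RC) (normr_ge0 _) c0)).
by rewrite ler_wpM2r// addr_ge0// divr_ge0// ltW.
Qed.

Lemma solution_approx_sol eps : 0 < eps -> exists L0, forall L t, (L0 <= L)%N ->
  0 <= t -> t <= T -> exists Q, approx_sol x b sigma F B (2 ^ L) (dyadic_chain T L t) eps
    (fun i => Y (dyadic_chain T L t i)) Q.
Proof.
move=> eps0; have C0 := rc_C RC; have K0 := rc_K RC.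
pose Yb := 1 + (`|x| + M * T + 7 * M * Num.sqrt T).
have Yb0 : 0 < Yb by rewrite ltr_wpDr// !addr_ge0// !mulr_ge0// sqrtr_ge0.
have e16 : 0 < eps / 16 by rewrite divr_gt0.
have [c c0 kc] := rc_kappa_small RC e16.
have C1 : 0 < 16 * (C + 1) by rewrite mulr_gt0// ltr_wpDl.
have K1 : 0 < 128 * (K + 1) by rewrite mulr_gt0// ltr_wpDl.
pose dlt := Num.min c (Num.min (eps / (16 * (C + 1))) (eps ^+ 2 / (128 * (K + 1)))).
have dlt0 : 0 < dlt by rewrite !lt_min c0 !divr_gt0// exprn_gt0.
have d1 : dlt <= c by rewrite ge_min lexx.
have d2 : C * dlt <= eps / 16.
  apply: (@le_trans _ _ ((C + 1) * (eps / (16 * (C + 1))))).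
    by apply: ler_pM => //; [exact: ltW|rewrite lerDl|rewrite !ge_min lexx !orbT].
  by rewrite le_eqVlt; apply/orP; left; apply/eqP; field; rewrite gt_eqF// ltr_wpDl.
have d3 : 2 * K * dlt <= eps ^+ 2 / 64.
  apply: (@le_trans _ _ (2 * (K + 1) * (eps ^+ 2 / (128 * (K + 1))))).
    apply: ler_pM => //; first by rewrite mulr_ge0.
    - exact: ltW.
    - by rewrite ler_wpM2l// lerDl.
    - by rewrite !ge_min lexx !orbT.
  by rewrite le_eqVlt; apply/orP; left; apply/eqP; field; rewrite gt_eqF// ltr_wpDl.
pose eta := eps ^+ 2 / (64 * Yb).
have eta0 : 0 < eta by rewrite divr_gt0 ?exprn_gt0// mulr_gt0.
have [dl dl0 sm] := sigma_modulus (rc_sigma_le RC) (rc_sigma_cont RC) K0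
  (rc_sigma_half RC) eta0.
have M1 : 0 < M + 1 by rewrite ltr_wpDl.
have M7 : 0 < 7 * M + 1 by rewrite ltr_wpDl// mulr_ge0.
pose q := dlt / 2 / (7 * M + 1); have q0 : 0 < q by rewrite !divr_gt0.
pose mesh := Num.min (Num.min eps dl) (Num.min (dlt / 2 / (M + 1)) (q ^+ 2)).
have mesh0 : 0 < mesh by rewrite !lt_min eps0 dl0 !divr_gt0// exprn_gt0.
have [L0 HL0] := grid_mesh_small T mesh0.
exists L0 => L t LL t0 tT.
have meshL := HL0 L LL.
have ml : T / 2 ^+ L <= dl by rewrite (le_trans meshL)// !ge_min lexx !orbT.
have mM : T / 2 ^+ L <= dlt / 2 / (M + 1) by rewrite (le_trans meshL)// !ge_min lexx !orbT.
have mq : T / 2 ^+ L <= q ^+ 2 by rewrite (le_trans meshL)// !ge_min lexx !orbT.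
pose ch := dyadic_chain T L t.
have [a0 al aN astep] := dyadic_chain_good T0' t0 tT (lexx (T / 2 ^+ L)).
have aT := chain_itv a0 al aN.
have ch0 : ch 0%N = 0 by exact: dyadic_chain0.
rewrite -/ch in a0 al aN astep aT *.
have osc i s : (i < 2 ^ L)%N -> ch i <= s -> s <= ch i.+1 ->
    mean P (fun w => `|Y s w - Y (ch i) w|) <= dlt.
  move=> iN is_ si; have /andP[i0 _] := aT i (ltnW iN); have /andP[_ iT] := aT i.+1 iN.
  apply: (le_trans (solution_osc i0 is_ (le_trans si iT))).
  have h : s - ch i <= T / 2 ^+ L by have := astep i iN; rewrite -/ch; lra.
  have h1 : M * (s - ch i) <= dlt / 2.
    apply: (@le_trans _ _ ((M + 1) * (dlt / 2 / (M + 1)))).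
      by apply: ler_pM => //; rewrite ?subr_ge0 ?lerDl// (le_trans h).
    by rewrite mulrC divfK// gt_eqF.
  have h2 : 7 * M * Num.sqrt (s - ch i) <= dlt / 2.
    have h3 : Num.sqrt (s - ch i) <= q.
      rewrite -(@ler_pXn2r _ 2)// ?nnegrE ?sqrtr_ge0 ?(ltW q0)//.
      by rewrite sqr_sqrtr ?subr_ge0// (le_trans h).
    apply: (@le_trans _ _ ((7 * M + 1) * q)); last by rewrite /q mulrC divfK// gt_eqF.
    by apply: ler_pM => //; rewrite ?sqrtr_ge0 ?mulr_ge0// lerDl.
  lra.
have [dm dm0 gap] := min_gap ch (2 ^ L).
(* The first bound gives [16 * e <= eps^2 dm / 2] for the martingale remainder. The second gives
   [eps dm / 4] for the L^1 discrepancy at each end of a cell. *)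
pose e := Num.min (eps ^+ 2 * dm / 32) ((eps * dm / 4) ^+ 2).
have ed : 0 < eps * dm / 4 by rewrite divr_gt0// mulr_gt0.
have e0 : 0 < e by rewrite lt_min divr_gt0 ?mulr_gt0 ?exprn_gt0.
have [S [S_simple He HJ]] := ito_approx T0 F_filtration B_brownian J_ito aT e0.
pose xi i w := sigma (ch i) (Y (ch i) w).
have wY i : (i <= 2 ^ L)%N -> measurable_wrt (F (ch i)) (Y (ch i)) by move=> /aT; exact: Y_wrt.
have sY i : (i <= 2 ^ L)%N -> sqint P (Y (ch i)) by move=> /aT; exact: solution_sqint.
have wxi i : (i <= 2 ^ L)%N -> measurable_wrt (F (ch i)) (xi i).
  by move=> iN; apply: (measurable_wrt_comp _ (wY i iN)); exact: (sigma_measurable RC (aT i iN)).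
have sxi i : (i <= 2 ^ L)%N -> sqint P (xi i).
  move=> iN; apply: (@sqint_bounded _ _ _ P _ M) => [|w]; last exact: (sigma_le w (aT i iN)).
  exact: measurable_wrt_fun (filtration_meas F_filtration (aT i iN)) (wxi i iN).
pose m i w := sp_int B S (ch i.+1) w - sp_int B S (ch i) w
  - xi i w * incr B (ch i) (ch i.+1) w.
pose r i w := (Y (ch i.+1) w - Y (ch i) w - (J (ch i.+1) w - J (ch i) w)
  - drift b (ch i) (ch i.+1) (Y (ch i)) (Y (ch i) w))
  + ((J (ch i.+1) w - sp_int B S (ch i.+1) w) - (J (ch i) w - sp_int B S (ch i) w)).
have itv i : (i < 2 ^ L)%N -> [/\ 0 <= ch i, ch i <= ch i.+1 & ch i.+1 <= T].
  by move=> iN; have /andP[? _] := aT i (ltnW iN); have /andP[_ ?] := aT i.+1 iN; split=> //; exact: al.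
exists (fun i => sp_int B S (ch i)), r, m; split.
- split=> [i iN|]; first by split; [exact: wY|exact: sY].
  by rewrite ch0 solution_initial ltW.
- move=> i iN; have [i0 ii iT] := itv i iN.
  have sD : sqint P (fun w => Y (ch i.+1) w - Y (ch i) w - (J (ch i.+1) w - J (ch i) w)
      - drift b (ch i) (ch i.+1) (Y (ch i)) (Y (ch i) w)).
    apply: sqintB.
      apply: sqintB; apply: sqintB; [exact: sY iN|exact: sY (ltnW iN)|
        exact: J_sqint (aT _ iN)|exact: J_sqint (aT _ (ltnW iN))].
    apply: (@sqint_bounded _ _ _ P _ (M * (ch i.+1 - ch i))).
      exact: measurableT_comp (rc_drift_measurable RC i0 ii iT (sY i (ltnW iN))) _.
    by move=> w; exact: (rc_drift_le RC _ i0 ii iT (sqint_intg (sY i (ltnW iN)))).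
  have [s1 m1] := HJ i.+1 iN; have [s2 m2] := HJ i (ltnW iN).
  have sE := sqintB s1 s2.
  split; first exact: sqint_intg (sqintD sD sE).
  have := ii; rewrite le_eqVlt => /orP[/eqP E|lt].
    rewrite /r -E; under [X in mean P X]eq_fun do rewrite drift_self !subrr addr0 normr0.
    by rewrite mean_cst subrr mulr0.
  have iD := intg_norm (sqint_intg sD).
  have i1 := intg_norm (sqint_intg s1); have i2 := intg_norm (sqint_intg s2).
  apply: (@le_trans _ _ (mean P (fun w => `|Y (ch i.+1) w - Y (ch i) w
        - (J (ch i.+1) w - J (ch i) w) - drift b (ch i) (ch i.+1) (Y (ch i)) (Y (ch i) w)|
      + (`|J (ch i.+1) w - sp_int B S (ch i.+1) w| + `|J (ch i) w - sp_int B S (ch i) w|)))).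
    apply: mean_le => [||w].
    + exact: intg_norm (sqint_intg (sqintD sD sE)).
    + by apply: intgD => //; exact: intgD.
    by apply: (le_trans (ler_normD _ _)); rewrite lerD2l ler_normB.
  rewrite (meanD iD (intgD i1 i2)) (meanD i1 i2).
  have h1 := cell_remainder i0 ii iT c0 kc (fun s vs su => osc i s iN (ltW vs) su).
  have h2 : eps / 16 * (1 + dlt / c) + C * dlt <= eps / 2.
    have : dlt / c <= 1 by rewrite ler_pdivrMr// mul1r.
    by move: d2 e16; nra.
  have D0 : 0 <= ch i.+1 - ch i by rewrite subr_ge0.
  have {}h2 := le_trans h1 (ler_wpM2r D0 h2).
  have e4 : e <= (eps * dm / 4) ^+ 2 by rewrite ge_min lexx orbT.
  have h3 := mean_norm_le_sqrt (ltW ed) s1 (le_trans m1 e4).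
  have h4 := mean_norm_le_sqrt (ltW ed) s2 (le_trans m2 e4).
  have h5 := ler_wpM2l (ltW eps0) (gap i iN lt).
  by move: h2 h3 h4 h5; lra.
- move=> i iN; have [i0 ii iT] := itv i iN.
  have [g1 g2 g3 _] := simple_increment F_filtration B_brownian S_simple i0 ii iT
    (wxi i (ltnW iN)) (sxi i (ltnW iN)).
  by split.
- move=> i iN; have [i0 ii iT] := itv i iN.
  have := ii; rewrite le_eqVlt => /orP[/eqP E|lt].
    rewrite /m -E incr_self; under [X in mean P X]eq_fun do rewrite mulr0 !subrr expr0n.
    by rewrite mean_cst subrr mulr0.
  have sI := sY i (ltnW iN).
  have k1 s : ch i < s -> s <= ch i.+1 ->
      (\int[P]_w ((sigma s (Y s w) - xi i w) ^+ 2)%:E <= (eps ^+ 2 / 32)%:E)%E.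
    move=> is_ si; have sT : 0 <= s <= T by rewrite (le_trans i0 (ltW is_)) (le_trans si).
    have iD := intg_norm (sqint_intg (sqintB (solution_sqint sT) sI)).
    have iE := intg_norm (sqint_intg sI).
    have j1 := intgZ (2 * K) iD; have j2 := intgZ eta (intgD (intg_cst P 1) iE).
    apply: (@le_trans _ _ (\int[P]_w (2 * K * `|Y s w - Y (ch i) w|
        + eta * (1 + `|Y (ch i) w|))%:E)%E).
      apply: nonneg_integral_mono => w _; rewrite lee_fin ?sqr_ge0//.
      apply: sm => //; first exact: aT (ltnW iN).
      rewrite ger0_norm ?subr_ge0 ?(ltW is_)//; apply: le_trans ml.
      by have := astep i iN; rewrite -/ch; lra.
    rewrite -meanE; last exact: intgD.
    rewrite lee_fin (meanD j1 j2) (meanZ _ iD) (meanZ _ (intgD (intg_cst P 1) iE)).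
    rewrite (meanD (intg_cst P 1) iE) mean_cst.
    have h1 : 2 * K * mean P (fun w => `|Y s w - Y (ch i) w|) <= eps ^+ 2 / 64.
      by apply: le_trans d3; rewrite ler_wpM2l ?mulr_ge0// osc// ltW.
    have h2 : eta * (1 + mean P (fun w => `|Y (ch i) w|)) <= eps ^+ 2 / 64.
      apply: (@le_trans _ _ (eta * Yb)).
        by rewrite ler_wpM2l ?(ltW eta0)// lerD2l solution_bound// aT// ltnW.
      by rewrite le_eqVlt; apply/orP; left; apply/eqP; rewrite /eta; field; rewrite gt_eqF.
    lra.
  have h := ito_cell T0 F_filtration B_brownian J_ito S_simple He i0 ii iT
    (wxi i (ltnW iN)) (sxi i (ltnW iN)) k1.
  apply: (le_trans h).
  have e3 : e <= eps ^+ 2 * dm / 32 by rewrite ge_min lexx.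
  have h5 := ler_wpM2l (sqr_ge0 eps) (gap i iN lt).
  by move: h5 e3; set u := ch i.+1 - ch i; lra.
- by move=> i w iN; rewrite /r /m /xi; split; ring.
Qed.

End SolutionIsApproximate.

Lemma mean_norm_eq0 (R : realType) (d : measure_display) (Omega : measurableType d)
    (P : probability Omega R) (f : Omega -> R) :
  intg P f -> (forall e, 0 < e -> mean P (fun w => `|f w|) <= e) ->
  {ae P, forall w, f w = 0}.
Proof.
move=> fi fe; have ifn := intg_norm fi.
have E : (\int[P]_w `|(f w)%:E| = 0)%E.
  rewrite -[LHS](meanE ifn); congr (_%:E); apply/eqP; rewrite eq_le mean_ge0 ?andbT//.
  by apply/ler_addgt0Pr => e e0; rewrite add0r fe.
have mf : measurable_fun setT (fun w => (f w)%:E).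
  by apply/measurable_EFinP; exact: intg_measurable fi.
have := (@ae_eq_integral_abs _ _ _ P setT measurableT _ mf).1 E.
by apply: filterS => w /(_ I) /= [].
Qed.

Section PathwiseUniqueness.
Context (R : realType) (d : measure_display) (Omega : measurableType d).
Variables (P : probability Omega R) (T M C K x : R).
Variables (b : R -> R -> borel_prob R -> R) (sigma : R -> R -> R) (kappa : R -> R).
Hypothesis RC : regular_coef T M C K b sigma kappa.
Variables (F : R -> set (set Omega)) (B : R -> {RV P >-> R}).
Hypothesis F_filtration : filtration T F.
Hypothesis B_brownian : brownian_motion T F B.

Lemma mckean_vlasov_approx_sol (Y : R -> {RV P >-> R}) :
  mckean_vlasov_solution T F B x b sigma Y ->
  (forall t, 0 <= t <= T -> sqint P (Y t)) /\
  forall eps, 0 < eps -> exists L0, forall L t, (L0 <= L)%N -> 0 <= t -> t <= T ->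
    exists Q, approx_sol x b sigma F B (2 ^ L) (dyadic_chain T L t) eps
      (fun i => Y (dyadic_chain T L t i)) Q.
Proof.
move=> [Y_wrt Y_cont Y_moment [J [J_ito [A [mA PA AY]]]]].
have Y_eq w : ~ A w -> forall t, 0 <= t <= T -> Y t w = x +
    \int[lebesgue_measure]_(s in `[0, t]) b s (Y s w) (distribution P (Y s)) + J t w.
  by move=> Aw; apply: contrapT => nE; apply: Aw; exact: AY.
split.
  exact: (solution_sqint RC F_filtration B_brownian Y_moment J_ito mA PA Y_eq).
exact: (solution_approx_sol RC F_filtration B_brownian Y_wrt Y_cont Y_moment J_ito mA PA Y_eq).
Qed.

(** Stability for every [eta] gives equality almost surely at each fixed time. The dyadic times are
    countably many, and continuity of the paths does the rest. *)
Lemma pathwise_uniqueness (X Y : R -> {RV P >-> R}) :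
  mckean_vlasov_solution T F B x b sigma X ->
  mckean_vlasov_solution T F B x b sigma Y ->
  {ae P, forall w, forall t, 0 <= t <= T -> X t w = Y t w}.
Proof.
move=> HX HY; have T0 := rc_T RC; have T0' := ltW T0.
have [sX aX] := mckean_vlasov_approx_sol HX.
have [sY aY] := mckean_vlasov_approx_sol HY.
have eqt t : 0 <= t <= T -> {ae P, forall w, X t w - Y t w = 0}.
  move=> tT; have [t0 tT'] := andP tT.
  apply: mean_norm_eq0 => [|eta eta0].
    exact: sqint_intg (sqintB (sX t tT) (sY t tT)).
  have [eps eps0 ST] := stability x RC F_filtration B_brownian eta0.
  have [L1 h1] := aX eps eps0; have [L2 h2] := aY eps eps0.
  have [L3 h3] := grid_mesh_small T eps0.
  pose L := maxn (maxn L1 L2) L3.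
  have [Q q1] := h1 L t (leq_trans (leq_maxl L1 L2) (leq_maxl _ _)) t0 tT'.
  have [Q' q2] := h2 L t (leq_trans (leq_maxr L1 L2) (leq_maxl _ _)) t0 tT'.
  have gc := dyadic_chain_good T0' t0 tT' (h3 L (leq_maxr _ _)).
  have [h _ _] := ST _ _ _ _ _ _ gc q1 q2.
  by have := h _ (leqnn _); rewrite dyadic_chainN.
have : {ae P, forall w, forall L i, (i <= 2 ^ L)%N ->
    X (grid T L i) w - Y (grid T L i) w = 0}.
  apply: ae_foralln => L; apply: ae_foralln => i.
  have [iL|iL] := leqP i (2 ^ L); last by apply: aeW.
  have gT : 0 <= grid T L i <= T by rewrite grid_ge0//= grid_leT.
  by apply: filterS (eqt _ gT) => w /=.
apply: filterS => w h t tT.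
have [_ cX _ _] := HX; have [_ cY _ _] := HY.
have cD : {within `[0, T], continuous (fun t => X t w - Y t w)}.
  by move=> u; apply: cvgB; [exact: cX|exact: cY].
apply/eqP; rewrite -subr_eq0 -normr_eq0 eq_le normr_ge0 andbT.
apply: (dyadic_dense_le T0 cD (L0 := 0%N)) tT => L i _ iL.
by rewrite h// normr0.
Qed.

End PathwiseUniqueness.

(** * The completed filtration of the Brownian motion *)

Section CompletedFiltration.
Context (R : realType) (d : measure_display) (Omega : measurableType d).
Variables (P : probability Omega R) (T : R).
Variables (F : R -> set (set Omega)) (B : R -> {RV P >-> R}).
Hypothesis F_usual : usual_conditions P T F.
Hypothesis B_brownian : brownian_motion T F B.
Local Notation H := (completed_natural_filtration B).

Let F_filtration : filtration T F. Proof. by case: F_usual. Qed.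

Lemma completed_filtration_sub t : 0 <= t <= T -> H t `<=` F t.
Proof.
move=> tT; have [t0 tT'] := andP tT; have [_ F_null _] := F_usual.
have [adB _ _ _] := B_brownian.
apply: smallest_sub; first exact: (filtration_sigma F_filtration).
move=> A [[s [U [/andP[s0 st] mU ->]]]|/F_null nA].
  apply: (filtration_le F_filtration s0 st tT').
  by apply: adB => //; rewrite s0 (le_trans st).
exact: (filtration_le F_filtration (lexx 0) t0 tT' nA).
Qed.

Lemma completed_filtration_filtration : filtration T H.
Proof.
split=> [t tT|s t s0 st tT].
  split; first exact: smallest_sigma_algebra.
  apply: subset_trans (completed_filtration_sub tT) _.
  exact: (filtration_meas F_filtration).
apply: smallest_sub; first exact: smallest_sigma_algebra.
move=> A hA; apply: sub_sigma_algebra; case: hA => [[r [U [/andP[r0 rs] mU ->]]]|nA].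
  by left; exists r, U; split=> //; rewrite r0 (le_trans rs).
by right.
Qed.

(** Independence of the increments from the past is inherited from the larger [F]. *)
Lemma completed_filtration_brownian : brownian_motion T H B.
Proof.
have [adB cB B0 indB] := B_brownian; split=> //.
  move=> t /andP[t0 tT] U mU; apply: sub_sigma_algebra; left.
  by exists t, U; rewrite t0 lexx.
move=> s t s0 st tT; have [h1 h2] := indB s t s0 st tT.
split=> // A U HA mU; apply: h2 => //.
by apply: completed_filtration_sub HA; rewrite s0 (le_trans (ltW st)).
Qed.

Lemma completed_filtration_null t A : P.-negligible A -> H t A.
Proof. by move=> nA; apply: sub_sigma_algebra; right. Qed.

End CompletedFiltration.

(** Simple processes for the smaller filtration are simple for the larger one, so the same
    approximants witness the Ito integral. *)
Lemma mckean_vlasov_solutionS (R : realType) (d : measure_display)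
    (Omega : measurableType d) (P : probability Omega R) (T : R)
    (H F : R -> set (set Omega)) (B : R -> {RV P >-> R}) (x : R)
    (b : R -> R -> borel_prob R -> R) (sigma : R -> R -> R) (X : R -> {RV P >-> R}) :
  (forall t, 0 <= t <= T -> H t `<=` F t) ->
  mckean_vlasov_solution T H B x b sigma X -> mckean_vlasov_solution T F B x b sigma X.
Proof.
move=> HF [X_wrt X_cont X_moment [J [[[mS S_wrt S2] cJ [S [S_simple S_val S_int]]] X_eq]]].
have wF f : adapted T H f -> adapted T F f.
  by move=> h t tT; apply: measurable_wrtS (h t tT); exact: HF.
split=> //; first exact: wF.
exists J; split=> //; split=> //; first by split=> //; exact: wF.
exists S; split=> // k; have [t0 tT h] := S_simple k; split=> // i iN.
have [h1 h2 h3] := h i iN; split=> //; apply: measurable_wrtS h2; apply: HF.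
apply: (@chain_itv _ T (sp_size (S k)) (sp_time (S k)) t0 _ tT _ (ltnW iN)) => j jn.
by have [] := h j jn.
Qed.

Theorem mainTheorem2 (R : realType) (T x : R)
  (b : R -> R -> borel_prob R -> R) (sigma : R -> R -> R)
  (T_gt0 : 0 < T)
  (b_bounded : exists M : R, forall t y mu,
     0 <= t <= T -> finite_moment 1 mu -> `|b t y mu| <= M)
  (b_continuous : continuous_drift T b)
  (sigma_bounded : exists M : R, forall t y, 0 <= t <= T -> `|sigma t y| <= M)
  (sigma_continuous :
     {within `[0, T] `*` setT, continuous (fun z : R * R => sigma z.1 z.2)})
  (hyp_a : exists2 C : R, 0 < C & forall t y mu nu, 0 <= t <= T ->
     finite_moment 1 mu -> finite_moment 1 nu ->
     (`|b t y mu - b t y nu|%:E <= C%:E * wasserstein 1 mu nu)%E)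
  (hyp_b : exists rho : R -> R,
     [/\ {in `[0, +oo[ &, {homo rho : u v / u < v}},
         rho 0 = 0,
         convex_function (`[0, +oo[%classic : set R) (fun u => rho u ^+ 2),
         diverges_at_0 (fun u => (rho u ^+ 2)^-1) &
         forall t y z, 0 <= t <= T ->
           `|sigma t y - sigma t z| <= rho `|y - z|])
  (hyp_c : exists kappa : R -> R,
     [/\ {in `[0, +oo[ &, {homo kappa : u v / u < v}},
         kappa 0 = 0,
         concave_function `[0, +oo[ kappa,
         diverges_at_0 (fun u => (kappa u)^-1) &
         forall t y z mu, 0 <= t <= T -> finite_moment 2 mu ->
           `|b t y mu - b t z mu| <= kappa `|y - z|])
  (d : measure_display) (Omega : measurableType d) (P : probability Omega R)
  (F : R -> set (set Omega)) (B : R -> {RV P >-> R})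
  (F_usual : usual_conditions P T F)
  (B_brownian : brownian_motion T F B) :
  unique_strong_solution T F B x b sigma.
Proof.
have [Mb b_le] := b_bounded; have [Ms s_le] := sigma_bounded.
have [C C0 b_lip] := hyp_a.
have [rho [rho_incr rho0 rho_cvx _ s_rho]] := hyp_b.
have [kappa [k_incr k0 k_conc k_div b_kappa]] := hyp_c.
have [K K0 s_half] := sigma_half_holder s_le rho_incr rho0 rho_cvx s_rho.
have RC : regular_coef T (Num.max Mb Ms) C K b sigma kappa.
  split=> //; first exact: ltW.
  - by move=> t y mu tT m1; rewrite le_max b_le.
  - by move=> t y tT; rewrite le_max s_le ?orbT.
have [F_filtration F_null _] := F_usual.
(* The Euler limit is constructed in the completed filtration of [B], which makes it strong; it is
   then viewed as a solution for [F], where uniqueness is proved. *)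
have H_filtration := completed_filtration_filtration F_usual B_brownian.
have H_brownian := completed_filtration_brownian F_usual B_brownian.
have H_null t A : 0 <= t <= T -> P.-negligible A -> completed_natural_filtration B t A.
  by move=> _; exact: completed_filtration_null.
have [N [A [X HL]]] := euler_limit_exists x RC H_filtration H_brownian H_null.
have X_sol := limit_solution RC H_filtration H_brownian H_null HL.
have X_solF := mckean_vlasov_solutionS (completed_filtration_sub F_usual B_brownian) X_sol.
exists X; split=> //; first by have [] := X_sol.
by move=> Y; exact: (pathwise_uniqueness RC F_filtration B_brownian).
Qed.
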